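(* Let $m\ge 0$ be an integer, let $g$ be an entire function on $\mathbb{C}$, and let $0<p,q<\infty$. Consider the Volterra-type operator $V_gf(z)=\int_0^z f(w)g'(w)\,dw$. (1) If $0<p\le q<\infty$, then $V_g:\mathcal{F}_{\psi_m}^p\to\mathcal{F}_{\psi_m}^q$ is (a) bounded if and only if $g(z)=az^2+bz+c$ for some $a,b,c\in\mathbb{C}$; (b) compact if and only if $g(z)=az+b$ for some $a,b\in\mathbb{C}$. (2) If $0<q<p<\infty$, then the following statements are equivalent: (a) $V_g:\mathcal{F}_{\psi_m}^p\to\mathcal{F}_{\psi_m}^q$ is bounded; (b) $V_g:\mathcal{F}_{\psi_m}^p\to\mathcal{F}_{\psi_m}^q$ is compact; (c) in the case $\frac{q}{2}>\frac{p-q}{p}$, $g(z)=az+b$ for some $a,b\in\mathbb{C}$; and in the case $\frac{q}{2}\le\frac{p-q}{p}$, $g$ is constant. (3) Let $0<p<\infty$. If $V_g$ is compact on $\mathcal{F}_{\psi_m}^2$, then $V_g$ belongs to the Schatten class $\mathcal{S}_p(\mathcal{F}_{\psi_m}^2)$ for all $p>2$. On the other hand, if $0<p<2$, then $V_g$ belongs to $\mathcal{S}_p(\mathcal{F}_{\psi_m}^2)$ if and only if $g$ is a constant function.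
   Context: For an integer $m\ge 0$ let $\psi_m(z)=\frac12|z|^2-m\log(1+|z|)$, $z\in\mathbb{C}$. For $0<p<\infty$, the Fock--Sobolev space $\mathcal{F}_{\psi_m}^p$ is the space of all entire functions $f$ with $\|f\|_{(p,m)}^p:=\int_{\mathbb{C}}|f(z)|^pe^{-p\psi_m(z)}\,dA(z)<\infty$, where $dA$ is Lebesgue area measure on $\mathbb{C}$. $\mathcal{F}_{\psi_m}^2$ is a Hilbert space, and $\mathcal{S}_p(\mathcal{F}_{\psi_m}^2)$ denotes the Schatten $p$-class of compact operators on it (those whose singular values are $\ell^p$-summable). *)

(* Defs.v *)
From HB Require Import structures.
From mathcomp Require Import all_boot all_order all_algebra.
From mathcomp Require Import all_classical all_reals all_analysis.
From mathcomp Require Import complex.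
Import Order.TTheory GRing.Theory Num.Theory.
Import numFieldNormedType.Exports.

Set Implicit Arguments.
Unset Strict Implicit.
Unset Printing Implicit Defensive.

Local Open Scope ring_scope.
Local Open Scope classical_set_scope.

Section FockSobolev.
Variable R : realType.

(* The complex plane is R[i]; as a normed space over itself ((R[i])^o) its
   topology is the Euclidean one, so derivability over the scalars R[i]
   is complex differentiability. *)

Definition modc (z : R[i]) : R :=
  Num.sqrt (complex.Re z ^+ 2 + complex.Im z ^+ 2).

Definition cplx (xy : R * R) : R[i] := Complex xy.1 xy.2.

Definition entire (f : R[i] -> R[i]) : Prop :=
  forall z : R[i], derivable (f : (R[i])^o -> (R[i])^o) z 1.

Definition cderiv (g : R[i] -> R[i]) : R[i] -> R[i] :=
  fun z => (g : (R[i])^o -> (R[i])^o)^`() z.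

Definition psi (m : nat) (z : R[i]) : R :=
  (modc z) ^+ 2 / 2 - m%:R * ln (1 + modc z).

Definition area := ((@lebesgue_measure R) \x (@lebesgue_measure R))%E.

Definition fock_int (m : nat) (p : R) (f : R[i] -> R[i]) : \bar R :=
  (\int[area]_xy
     ((modc (f (cplx xy)) * expR (- psi m (cplx xy))) `^ p)%:E)%E.

Definition in_fock (m : nat) (p : R) (f : R[i] -> R[i]) : Prop :=
  entire f /\ (fock_int m p f < +oo)%E.

Definition fnorm (m : nat) (p : R) (f : R[i] -> R[i]) : R :=
  (fine (fock_int m p f)) `^ p^-1.

(* complex line integral along the segment [0, z]:
   \int_0^z h(w) dw = z * \int_0^1 h(t z) dt  (real and imaginary parts) *)
Definition segint (h : R[i] -> R[i]) (z : R[i]) : R[i] :=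
  z * Complex
        (Rintegral (@lebesgue_measure R) `[0, 1]
           (fun t : R => complex.Re (h (Complex t 0 * z))))
        (Rintegral (@lebesgue_measure R) `[0, 1]
           (fun t : R => complex.Im (h (Complex t 0 * z)))).

Definition volterra (g : R[i] -> R[i]) (f : R[i] -> R[i]) : R[i] -> R[i] :=
  segint (fun w => f w * cderiv g w).

Definition bounded_op (m : nat) (p q : R)
    (T : (R[i] -> R[i]) -> (R[i] -> R[i])) : Prop :=
  (forall f, in_fock m p f -> in_fock m q (T f)) /\
  exists c : R, forall f, in_fock m p f -> fnorm m q (T f) <= c * fnorm m p f.

Definition compact_op (m : nat) (p q : R)
    (T : (R[i] -> R[i]) -> (R[i] -> R[i])) : Prop :=
  (forall f, in_fock m p f -> in_fock m q (T f)) /\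
  forall u : nat -> (R[i] -> R[i]),
    (forall n, in_fock m p (u n)) ->
    (exists M : R, forall n, fnorm m p (u n) <= M) ->
    exists (phi : nat -> nat) (h : R[i] -> R[i]),
      {homo phi : a b / (a < b)%N} /\ in_fock m q h /\
      (fun n => fnorm m q (fun z => T (u (phi n)) z - h z)) @ \oo --> (0 : R).

Definition lin_functional (m : nat) (phi : (R[i] -> R[i]) -> R[i]) : Prop :=
  forall (f h : R[i] -> R[i]) (a b : R[i]), in_fock m 2 f -> in_fock m 2 h ->
    phi (fun z => a * f z + b * h z) = a * phi f + b * phi h.

Definition rank_le (m : nat) (n : nat)
    (K : (R[i] -> R[i]) -> (R[i] -> R[i])) : Prop :=
  exists (phis : 'I_n -> (R[i] -> R[i]) -> R[i]) (hs : 'I_n -> R[i] -> R[i]),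
    (forall i, lin_functional m (phis i)) /\ (forall i, in_fock m 2 (hs i)) /\
    forall f, in_fock m 2 f -> K f = fun z => \sum_(i < n) phis i f * hs i z.

(* square of the n-th singular value (approximation number) of T on F^2:
   s_n(T)^2 = inf { ||T - K||^2 : rank K <= n } *)
Definition sq_sing_val (m : nat) (T : (R[i] -> R[i]) -> (R[i] -> R[i]))
    (n : nat) : R :=
  fine (ereal_inf
    [set (ereal_sup [set fock_int m 2 (fun z => T f z - K f z) |
                     f in [set f | in_fock m 2 f /\ fnorm m 2 f <= 1]])
    | K in [set K | rank_le m n K]]).

Definition schatten (m : nat) (p : R)
    (T : (R[i] -> R[i]) -> (R[i] -> R[i])) : Prop :=
  compact_op m 2 2 T /\
  (\sum_(0 <= n <oo) ((sq_sing_val m T n) `^ (p / 2))%:E < +oo)%E.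

End FockSobolev.

(* Main.v *)
Require Import Defs.
From HB Require Import structures.
From mathcomp Require Import all_boot all_order all_algebra.
From mathcomp Require Import all_classical all_reals all_analysis.
From mathcomp Require Import measurable_realfun complex.
From mathcomp Require Import ring lra zify.
Import Order.TTheory GRing.Theory Num.Theory.
Import numFieldNormedType.Exports.
Local Open Scope ring_scope.

(* With W = exp (- psi_m), entire functions satisfy a sub-mean value property |f W|^q (z) <= C int |f W|^q k(z, .)
   for an exponentially decaying kernel k (apply it to f(w) exp (- w conj z)), and integration along rays gives the
   converse, so that ||V_g f||_q is comparable to the L^q norm of f g' W / (1 + |w|).
   Testing on the normalized kernels f_z(w) = (1 + |z|)^-m exp (w conj z - |z|^2 / 2) yields |g'| <= C (1 + |z|), hence g
   is quadratic, and compactness kills the leading coefficient. Sufficiency for p <= q uses that F^p functions are bounded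
   against W; for q < p it is Young's inequality together with the integrability of (1 + |w|)^-r for r = pq / (p - q) > 2.
   For the necessity when q < p we test on sum_l c_l f_l over a sparse lattice with c_l = (1 + i + j)^(-2/p): the p-norm
   is controlled by L_N = sum (1 + i + j)^-2, which diverges, and V_g would make a multiple of L_N bounded by L_N^(q/p).
   On F^2 monomials are orthogonal by rotation invariance, with |z^(k+1)|^2 comparable to (k+1) |z^k|^2, so for
   g = a z + b the n-th singular value of V_g is comparable to |a| (n+1)^(-1/2), which is p-summable exactly for p > 2. *)

Set Implicit Arguments.
Unset Strict Implicit.
Unset Printing Implicit Defensive.

(** * Modulus and complex derivative *)

Section Modulus.
Local Open Scope classical_set_scope.
Local Open Scope ring_scope.
Context {R : realType}.
Implicit Types (x y : R) (z w d : R[i]) (f g : R[i] -> R[i]).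

(** Plane integrals are only ever taken of nonnegative functions, in Cartesian coordinates. This
    shapes many choices: contours are squares, kernels decay in the l1 distance so that they split
    into one-variable factors, inner products are replaced by polarization, Cauchy-Schwarz by a mean
    inequality with a free parameter, and the circle group by one rotation of infinite order written
    with shears. The other obstacle is exponents below 1, where convexity and the triangle
    inequality fail: the sub-mean inequality then comes from a weighted supremum, and sums are
    estimated with a factor 2^p. Passing between a function and its derivative costs one factor 1 +
    |w|: differentiating against the Gaussian weight produces the term conj z f(z), and integrating
    the Gaussian along a ray gains 1/|z|. Singular values are approximation numbers, so upper bounds
    come from truncated Taylor series and lower bounds from a dimension count; the norm ratios of
    consecutive monomials follow from the same comparison of functions with derivatives, together
    with log-convexity. *)

Lemma modcE z : `|z| = (modc z)%:C%C.
Proof. by case: z => a b; rewrite normc_def. Qed.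

Lemma modc_ge0 z : 0 <= modc z. Proof. exact: sqrtr_ge0. Qed.

Lemma inj_realc : injective (fun x : R => x%:C%C).
Proof. by move=> x y []. Qed.

Lemma realc_le x y : (x%:C%C <= y%:C%C) = (x <= y).
Proof. exact: lecR. Qed.

Lemma realc_lt x y : (x%:C%C < y%:C%C) = (x < y).
Proof. exact: ltcR. Qed.

Lemma modcM z w : modc (z * w) = modc z * modc w.
Proof. by apply: inj_realc; rewrite -modcE normrM !modcE rmorphM. Qed.

Lemma modcV z : modc z^-1 = (modc z)^-1.
Proof. by apply: inj_realc; rewrite -modcE normfV !modcE fmorphV. Qed.

Lemma modcf_div z w : modc (z / w) = modc z / modc w.
Proof. by rewrite modcM modcV. Qed.

Lemma modcX z n : modc (z ^+ n) = modc z ^+ n.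
Proof. by apply: inj_realc; rewrite -modcE normrX !modcE rmorphXn. Qed.

Lemma modcN z : modc (- z) = modc z.
Proof. by apply: inj_realc; rewrite -modcE normrN !modcE. Qed.

Lemma modc0 : modc (0 : R[i]) = 0.
Proof. by apply: inj_realc; rewrite -modcE normr0. Qed.

Lemma modc1 : modc (1 : R[i]) = 1.
Proof. by apply: inj_realc; rewrite -modcE normr1. Qed.

Lemma modcD z w : modc (z + w) <= modc z + modc w.
Proof. by rewrite -realc_le rmorphD /= -!modcE ler_normD. Qed.

Lemma modcB z w : modc (z - w) <= modc z + modc w.
Proof. by rewrite -[modc w]modcN modcD. Qed.

Lemma modc_distC z w : modc (z - w) = modc (w - z).
Proof. by rewrite -modcN opprB. Qed.

Lemma modc_tri u z w : modc (z - w) <= modc (z - u) + modc (u - w).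
Proof. by apply: le_trans (modcD _ _); rewrite addrA subrK. Qed.

Lemma modc_lip z w : `|modc z - modc w| <= modc (z - w).
Proof.
have h1 := modc_tri 0 z 0; have h2 := modcD (z - w) w; have h3 := modcD (w - z) z.
have e1 : z - w + w = z by ring.
have e2 : w - z + z = w by ring.
rewrite e1 in h2; rewrite e2 -modc_distC in h3.
by rewrite ler_norml; apply/andP; split; lra.
Qed.

Lemma modc_eq0 z : (modc z == 0) = (z == 0).
Proof.
apply/eqP/eqP => [h|->]; last exact: modc0.
by apply/eqP; rewrite -normr_eq0 modcE h.
Qed.

Lemma modc_gt0 z : (0 < modc z) = (z != 0).
Proof. by rewrite lt_def modc_ge0 andbT modc_eq0. Qed.

Lemma modc_real x : modc x%:C%C = `|x|.
Proof. by rewrite /modc /= expr0n addr0 sqrtr_sqr. Qed.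

Lemma modc_i : modc ('i%C : R[i]) = 1.
Proof. by rewrite /modc /= expr0n add0r expr1n sqrtr1. Qed.

Lemma modc_sqr z : modc z ^+ 2 = complex.Re z ^+ 2 + complex.Im z ^+ 2.
Proof. by rewrite sqr_sqrtr // addr_ge0 ?sqr_ge0. Qed.

Lemma Re_le_modc z : `|complex.Re z| <= modc z.
Proof.
rewrite -(ler_pXn2r (n := 2)) ?nnegrE ?modc_ge0 //.
by rewrite modc_sqr real_normK ?num_real // lerDl sqr_ge0.
Qed.

Lemma Im_le_modc z : `|complex.Im z| <= modc z.
Proof.
rewrite -(ler_pXn2r (n := 2)) ?nnegrE ?modc_ge0 //.
by rewrite modc_sqr real_normK ?num_real // lerDr sqr_ge0.
Qed.

Lemma complex_split z : z = (complex.Re z)%:C%C + 'i%C * (complex.Im z)%:C%C.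
Proof. by rewrite -complexE. Qed.

Lemma modc_le_ReIm z : modc z <= `|complex.Re z| + `|complex.Im z|.
Proof.
rewrite {1}[z]complex_split; apply: le_trans (modcD _ _) _.
by rewrite modcM modc_i mul1r !modc_real.
Qed.

Lemma modc_sum (I : Type) (r : seq I) (P : pred I) (F : I -> R[i]) :
  modc (\sum_(i <- r | P i) F i) <= \sum_(i <- r | P i) modc (F i).
Proof.
elim/big_ind2 : _ => [|a b c e h1 h2|//]; first by rewrite modc0.
by apply: le_trans (modcD _ _) _; exact: lerD.
Qed.

Lemma cReD z w : complex.Re (z + w) = complex.Re z + complex.Re w.
Proof. by case: z; case: w. Qed.
Lemma cImD z w : complex.Im (z + w) = complex.Im z + complex.Im w.
Proof. by case: z; case: w. Qed.
Lemma cReB z w : complex.Re (z - w) = complex.Re z - complex.Re w.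
Proof. by case: z; case: w. Qed.
Lemma cImB z w : complex.Im (z - w) = complex.Im z - complex.Im w.
Proof. by case: z; case: w. Qed.
Lemma cReM z w : complex.Re (z * w) =
  complex.Re z * complex.Re w - complex.Im z * complex.Im w.
Proof. by case: z; case: w. Qed.
Lemma cImM z w : complex.Im (z * w) =
  complex.Re z * complex.Im w + complex.Im z * complex.Re w.
Proof. by case: z; case: w. Qed.

Lemma complex_ext z w :
  complex.Re z = complex.Re w -> complex.Im z = complex.Im w -> z = w.
Proof. by case: z => a b; case: w => c e /= -> ->. Qed.

(** Complex differentiability with real tolerances and no quotient: the increment [h = 0] is
    allowed, and all estimates stay in the ordered field [R]. *)
Definition cdiff f z d := forall e, 0 < e -> exists2 r, 0 < r &
  forall h, modc h < r -> modc (f (z + h) - f z - d * h) <= e * modc h.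

Lemma pos_realc z : 0 < z -> z = (complex.Re z)%:C%C.
Proof. by case: z => a b; rewrite ltcE /= => /andP[/eqP h _]; rewrite h. Qed.

(** The radius of a ball in [(R[i])^o] is itself a complex number; positivity in the partial order
    forces it to be real, which is what lets filters be traded for real radii. *)
Lemma nbhs_modc (P : R[i] -> Prop) z : nbhs (z : (R[i])^o) P <->
  exists2 r, 0 < r & forall h, modc h < r -> P (z + h).
Proof.
split=> [/nbhs_ballP [e /= e0 he]|[r r0 hr]].
- have ee := pos_realc e0.
  have re0 : 0 < complex.Re e by rewrite -realc_lt -ee.
  exists (complex.Re e) => // h hh; apply: he; rewrite /ball /=.
  by rewrite opprD addNKr normrN modcE ee realc_lt.
- apply/nbhs_ballP; exists r%:C%C; first by rewrite /= realc_lt.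
  move=> y; rewrite /ball /= modcE realc_lt modc_distC => yr.
  by rewrite -(subrKC z y); apply: hr.
Qed.

Lemma cdiff_is_derive f z d : cdiff f z d ->
  derivable (f : (R[i])^o -> (R[i])^o) z 1 /\ cderiv f z = d.
Proof.
move=> H.
have key : (fun h : (R[i])^o => h^-1 *: (((f : (R[i])^o -> (R[i])^o) \o shift z) (h *: 1) - f z)) @ 0^' --> (d : (R[i])^o).
  apply/cvgrPdist_le => e e0.
  have ee := pos_realc e0.
  have re0 : 0 < complex.Re e by rewrite -realc_lt -ee.
  have [r r0 hr] := H _ re0.
  rewrite near_withinE; apply/nbhs_modc; exists r => // h hr' /=; rewrite add0r.
  move=> h0; rewrite ee modcE realc_le.
  have -> : h *: (1 : (R[i])^o) = h by rewrite /GRing.scale /= mulr1.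
  rewrite /GRing.scale /= [h + z]addrC.
  have -> : d - h^-1 * (f (z + h) - f z) = - (h^-1 * (f (z + h) - f z - d * h)).
    by field.
  rewrite modcN modcM modcV mulrC ler_pdivrMr ?modc_gt0 //; exact: hr.
split; first by apply/cvg_ex; exists d.
by rewrite /cderiv derive1E /derive; apply: cvg_lim key.
Qed.

Lemma derivable_cdiff f z :
  derivable (f : (R[i])^o -> (R[i])^o) z 1 -> cdiff f z (cderiv f z).
Proof.
move=> /cvg_ex [d /= key].
have -> : cderiv f z = d by rewrite /cderiv derive1E /derive; apply: cvg_lim key.
move=> e e0.
have e0' : 0 < e%:C%C :> R[i] by rewrite realc_lt.
move/cvgrPdist_le : key => /(_ _ e0').
rewrite near_withinE => /nbhs_modc [r r0 hr].
exists r => // h hh; have [->|h0] := eqVneq h 0.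
  by rewrite addr0 subrr mulr0 subr0 modc0 mulr0.
have := hr _ hh; rewrite add0r => /(_ h0).
have -> : h *: (1 : (R[i])^o) = h by rewrite /GRing.scale /= mulr1.
rewrite modcE realc_le /GRing.scale /= [h + z]addrC.
have -> : d - h^-1 * (f (z + h) - f z) = - (h^-1 * (f (z + h) - f z - d * h)).
  by field.
by rewrite modcN modcM modcV mulrC ler_pdivrMr ?modc_gt0.
Qed.

Lemma entireP f : entire f <-> forall z, exists d, cdiff f z d.
Proof.
split=> [H z|H z]; first by exists (cderiv f z); exact: derivable_cdiff.
by have [d /cdiff_is_derive[]] := H z.
Qed.

Lemma entire_cdiff f z : entire f -> cdiff f z (cderiv f z).
Proof. by move=> H; exact: derivable_cdiff. Qed.

Lemma cdiff_cderiv f z d : cdiff f z d -> cderiv f z = d.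
Proof. by case/cdiff_is_derive. Qed.

Lemma cdiff_ext f g z d : (forall w, f w = g w) -> cdiff f z d -> cdiff g z d.
Proof. by move=> fg; have -> // : f = g by apply/funext. Qed.

(** Taylor estimates and limits of them deliver quadratic remainders, so nearly every derivative
    below is produced in this form. *)
Lemma cdiff_sqr f z d C r : 0 < r ->
  (forall h, modc h < r -> modc (f (z + h) - f z - d * h) <= C * modc h ^+ 2) ->
  cdiff f z d.
Proof.
move=> r0 H e e0; exists (Num.min r (e / (`|C| + 1))).
  by rewrite lt_min r0 divr_gt0 // ltr_wpDl.
move=> h; rewrite lt_min => /andP[hr]; rewrite ltr_pdivlMr ?ltr_wpDl // => hC.
apply: le_trans (H _ hr) _; rewrite expr2 mulrA ler_wpM2r ?modc_ge0 //.
apply: le_trans (ltW hC); rewrite mulrC ler_wpM2l ?modc_ge0 //.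
by rewrite (le_trans (ler_norm C)) // lerDl.
Qed.

Lemma cdiff_cst (c : R[i]) z : cdiff (fun=> c) z 0.
Proof. by apply: (@cdiff_sqr _ _ _ 0 1) => // h _; rewrite subrr mul0r subr0 modc0 mul0r. Qed.

Lemma cdiff_id z : cdiff id z 1.
Proof.
apply: (@cdiff_sqr _ _ _ 0 1) => // h _.
have -> : id (z + h) - id z - 1 * h = 0 by rewrite /=; ring.
by rewrite modc0 mul0r.
Qed.

Lemma cdiffD f g z d d' : cdiff f z d -> cdiff g z d' ->
  cdiff (fun w => f w + g w) z (d + d').
Proof.
move=> Hf Hg e e0; have e2 : 0 < e / 2 by rewrite divr_gt0.
have [r r0 hr] := Hf _ e2; have [s s0 hs] := Hg _ e2.
exists (Num.min r s); first by rewrite lt_min r0.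
move=> h; rewrite lt_min => /andP[/hr h1 /hs h2].
have -> : f (z + h) + g (z + h) - (f z + g z) - (d + d') * h =
  (f (z + h) - f z - d * h) + (g (z + h) - g z - d' * h) by ring.
by apply: le_trans (modcD _ _) _; lra.
Qed.

Lemma cdiff_lip f z d : cdiff f z d -> exists2 r, 0 < r &
  forall h, modc h < r -> modc (f (z + h) - f z) <= (modc d + 1) * modc h.
Proof.
move=> /(_ _ ltr01) [r r0 hr]; exists r => // h /hr; rewrite mul1r => h1.
have -> : f (z + h) - f z = (f (z + h) - f z - d * h) + d * h by ring.
by apply: le_trans (modcD _ _) _; rewrite modcM; lra.
Qed.

Lemma cdiffM f g z d d' : cdiff f z d -> cdiff g z d' ->
  cdiff (fun w => f w * g w) z (d * g z + f z * d').
Proof.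
move=> Hf Hg e e0.
(* The remainder of the product splits into the two linear remainders and the product of the
   increments. [A] dominates every coefficient that occurs, so each of the three parts is allotted
   [e / 3]. *)
set A := modc (f z) + modc (g z) + modc d + modc d' + 2.
have A0 : 0 < A by rewrite /A; have := modc_ge0; move=> H; have := H (f z); have := H (g z); have := H d; have := H d'; lra.
have e2 : 0 < e / (3 * A) by rewrite divr_gt0 // mulr_gt0.
have [r r0 hr] := Hf _ e2; have [s s0 hs] := Hg _ e2.
have [t t0 ht] := cdiff_lip Hf; have [u u0 hu] := cdiff_lip Hg.
have v0 : 0 < e / (3 * A ^+ 2) by rewrite divr_gt0 // mulr_gt0 // exprn_gt0.
exists (Num.min (Num.min r s) (Num.min (Num.min t u) (e / (3 * A ^+ 2)))).
  by rewrite !lt_min r0 s0 t0 u0 v0.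
move=> h; rewrite !lt_min => /andP[/andP[/hr h1 /hs h2] /andP[/andP[/ht h3 /hu h4] h5]].
have -> : f (z + h) * g (z + h) - f z * g z - (d * g z + f z * d') * h =
  (f (z + h) - f z - d * h) * g z + f z * (g (z + h) - g z - d' * h)
  + (f (z + h) - f z) * (g (z + h) - g z) by ring.
apply: le_trans (modcD _ _) _.
apply: (@le_trans _ _ (e / (3 * A) * modc h * A + A * (e / (3 * A) * modc h) + (A * modc h) * (A * modc h))).
  have Hf0 := modc_ge0 (f z); have Hg0 := modc_ge0 (g z).
  have Hd0 := modc_ge0 d; have Hd'0 := modc_ge0 d'; have Hh0 := modc_ge0 h.
  have lA : modc d + 1 <= A /\ modc d' + 1 <= A by rewrite /A; split; lra.
  apply: lerD; [apply: le_trans (modcD _ _) _; apply: lerD|]; rewrite modcM;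
    apply: ler_pM; rewrite ?modc_ge0 //; try by rewrite /A; lra.
  - by apply: le_trans h3 _; rewrite ler_wpM2r //; case: lA.
  - by apply: le_trans h4 _; rewrite ler_wpM2r //; case: lA.
have -> : e / (3 * A) * modc h * A = e / 3 * modc h by field; rewrite lt0r_neq0.
have -> : A * (e / (3 * A) * modc h) = e / 3 * modc h by field; rewrite lt0r_neq0.
have : A ^+ 2 * modc h <= e / 3.
  have -> : e / 3 = A ^+ 2 * (e / (3 * A ^+ 2)) by field; rewrite lt0r_neq0.
  by rewrite ler_wpM2l ?sqr_ge0 // ltW.
have := modc_ge0 h; move=> hh H.
have : A ^+ 2 * modc h * modc h <= e / 3 * modc h by apply: ler_wpM2r.
nra.
Qed.

Lemma cdiffZ f z d (c : R[i]) : cdiff f z d -> cdiff (fun w => c * f w) z (c * d).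
Proof. by move=> /(cdiffM (cdiff_cst c z)); rewrite mul0r add0r. Qed.

Lemma cdiffB f g z d d' : cdiff f z d -> cdiff g z d' ->
  cdiff (fun w => f w - g w) z (d - d').
Proof.
move=> Hf /(cdiffZ (-1)) Hg; have := cdiffD Hf Hg; rewrite mulN1r.
by apply: cdiff_ext => w; rewrite mulN1r.
Qed.

Lemma cdiff_shift f z d a : cdiff f (a + z) d -> cdiff (fun w => f (a + w)) z d.
Proof. by move=> H e /H [r r0 hr]; exists r => // h /hr; rewrite addrA. Qed.

Lemma cdiffV z : z != 0 -> cdiff (fun w => w^-1) z (- (z ^- 2)).
Proof.
move=> z0; have mz : 0 < modc z by rewrite modc_gt0.
apply: (@cdiff_sqr _ _ _ (2 * (modc z)^-1 ^+ 3) (modc z / 2)); first by rewrite divr_gt0.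
move=> h hh.
have zh : modc z / 2 <= modc (z + h).
  have := modcB (z + h) h; rewrite addrK; lra.
have zh0 : z + h != 0 by rewrite -modc_gt0; lra.
have -> : (z + h)^-1 - z^-1 - - z ^- 2 * h = h ^+ 2 * (z ^- 2 * (z + h)^-1) by field; rewrite zh0 z0.
rewrite (modcM (h ^+ 2)) modcX (modcM (z ^- 2)) !modcV modcX mulrC ler_wpM2r ?sqr_ge0 //.
have : (modc (z + h))^-1 <= 2 / modc z.
  have -> : 2 / modc z = (modc z / 2)^-1 by rewrite invf_div.
  rewrite lef_pV2 ?posrE //; lra.
rewrite -exprVn => H.
have -> : 2 * (modc z)^-1 ^+ 3 = (modc z)^-1 ^+ 2 * (2 / modc z) by ring.
by rewrite ler_wpM2l // sqr_ge0.
Qed.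

Lemma entire_ext f g : (forall w, f w = g w) -> entire f -> entire g.
Proof. by move=> fg; have -> // : f = g by apply/funext. Qed.
Lemma entire_cst (c : R[i]) : entire (fun=> c).
Proof. by apply/entireP => z; exists 0; exact: cdiff_cst. Qed.
Lemma entire_id : entire (@id R[i]).
Proof. by apply/entireP => z; exists 1; exact: cdiff_id. Qed.
Lemma entireD f g : entire f -> entire g -> entire (fun w => f w + g w).
Proof. by move=> Hf Hg; apply/entireP => z; eexists; apply: cdiffD; apply: entire_cdiff. Qed.
Lemma entireB f g : entire f -> entire g -> entire (fun w => f w - g w).
Proof. by move=> Hf Hg; apply/entireP => z; eexists; apply: cdiffB; apply: entire_cdiff. Qed.
Lemma entireM f g : entire f -> entire g -> entire (fun w => f w * g w).
Proof. by move=> Hf Hg; apply/entireP => z; eexists; apply: cdiffM; apply: entire_cdiff. Qed.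
Lemma entireZ f (c : R[i]) : entire f -> entire (fun w => c * f w).
Proof. by move=> Hf; apply: (entireM (@entire_cst c) Hf). Qed.
Lemma entire_shift f a : entire f -> entire (fun w => f (a + w)).
Proof. by move=> Hf; apply/entireP => z; eexists; apply: cdiff_shift; apply: entire_cdiff. Qed.
Lemma entireX n : entire (fun w : R[i] => w ^+ n).
Proof.
elim: n => [|n IH]; first by apply: (entire_ext _ (@entire_cst 1)) => w; rewrite expr0.
by apply: (entire_ext _ (entireM entire_id IH)) => w; rewrite exprS.
Qed.
Lemma entire_sum (I : Type) (r : seq I) (P : pred I) (F : I -> R[i] -> R[i]) :
  (forall i, entire (F i)) -> entire (fun w => \sum_(i <- r | P i) F i w).
Proof.
move=> H; elim: r => [|i r IH].
  by apply: (entire_ext _ (@entire_cst 0)) => w; rewrite big_nil.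
have [Pi|nPi] := boolP (P i).
  by apply: (entire_ext _ (entireD (H i) IH)) => w; rewrite big_cons Pi.
by apply: (entire_ext _ IH) => w; rewrite big_cons (negbTE nPi).
Qed.

End Modulus.

(** * Integrals on segments *)

Section RealIntegral.
Local Open Scope classical_set_scope.
Local Open Scope ring_scope.
Context {R : realType}.
Implicit Types (a b c u : R) (f g : R -> R).
Local Notation mu := (@lebesgue_measure R).

Definition rint a b f := Rintegral mu `[a, b] f.

Definition rcont_on a b f := forall t, a <= t <= b -> forall e, 0 < e ->
  exists2 r, 0 < r & forall s, a <= s <= b -> `|s - t| < r -> `|f s - f t| <= e.

Lemma rcont_on_within a b f : rcont_on a b f -> {within `[a, b], continuous f}.
Proof.
move=> H; apply/subspace_continuousP => x; rewrite set_itvE /= => xab.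
apply/cvgrPdist_le => e e0; have [r r0 hr] := H x xab e e0.
rewrite near_withinE; apply/nbhs_ballP; exists r => // y; rewrite /ball /= => xy yab.
by rewrite distrC; apply: hr => //; rewrite distrC.
Qed.

Lemma rint_integrable a b f : rcont_on a b f -> mu.-integrable `[a, b] (EFin \o f).
Proof.
move=> H; apply: continuous_compact_integrable; first exact: segment_compact.
exact: rcont_on_within.
Qed.

Lemma rintD a b f g : rcont_on a b f -> rcont_on a b g ->
  rint a b (fun t => f t + g t) = rint a b f + rint a b g.
Proof. by move=> Hf Hg; rewrite /rint RintegralD //; exact: rint_integrable. Qed.

Lemma rintB a b f g : rcont_on a b f -> rcont_on a b g ->
  rint a b (fun t => f t - g t) = rint a b f - rint a b g.
Proof. by move=> Hf Hg; rewrite /rint RintegralB //; exact: rint_integrable. Qed.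

Lemma rintZ a b f c : rcont_on a b f ->
  rint a b (fun t => c * f t) = c * rint a b f.
Proof. by move=> Hf; rewrite /rint RintegralZl //; exact: rint_integrable. Qed.

Lemma eq_rint a b f g : (forall t, a <= t <= b -> f t = g t) -> rint a b f = rint a b g.
Proof.
move=> H; apply: eq_Rintegral => t; rewrite inE /= in_itv /=; exact: H.
Qed.

Lemma rint_xx a f : rint a a f = 0.
Proof. by rewrite /rint set_itv1 Rintegral_set1. Qed.

Lemma rint_split a b c f : a <= b -> b <= c -> rcont_on a c f ->
  rint a c f = rint a b f + rint b c f.
Proof.
move=> ab bc H.
have := @Rintegral_itvB R f (BLeft a) (BRight c) b (rint_integrable H).
rewrite !bnd_simp => /(_ ab bc) /eqP; rewrite subr_eq => /eqP.
rewrite /rint => ->; rewrite addrC; congr +%R.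
rewrite Rintegral_itv_obnd_cbnd //.
apply: integrableS (rint_integrable H) => //.
by apply: subset_itv => //; rewrite bnd_simp.
Qed.

Lemma le_rint a b f g : rcont_on a b f -> rcont_on a b g ->
  (forall t, a <= t <= b -> f t <= g t) -> rint a b f <= rint a b g.
Proof.
move=> Hf Hg H; apply: le_Rintegral => //; try exact: rint_integrable.
Qed.

Lemma rcont_on_cst a b c : rcont_on a b (fun=> c).
Proof. by move=> t _ e e0; exists 1 => // s _ _; rewrite subrr normr0 ltW. Qed.

Lemma rcont_on_norm a b f : rcont_on a b f -> rcont_on a b (fun t => `|f t|).
Proof.
move=> H t tab e e0; have [r r0 hr] := H t tab e e0; exists r => // s sab st.
exact: le_trans (ler_dist_dist _ _) (hr s sab st).
Qed.

Lemma rint_cst a b c : a <= b -> rint a b (fun=> c) = c * (b - a).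
Proof.
move=> ab; rewrite /rint Rintegral_cst //= lebesgue_measure_itv /= lte_fin.
by move: ab; rewrite le_eqVlt => /predU1P[->|->]; rewrite ?ltxx /= ?subrr ?mulr0.
Qed.

Lemma rint_abs a b f : rcont_on a b f -> `|rint a b f| <= rint a b (fun t => `|f t|).
Proof. by move=> H; apply: le_normr_Rintegral => //; exact: rint_integrable. Qed.

Definition shiftR u (x : measurableTypeR R) : measurableTypeR R := (x : R) + u.

Lemma measurable_shiftR u : measurable_fun setT (shiftR u).
Proof. by apply: (@measurable_funD _ R R setT (fun x => x) (fun=> u)). Qed.

HB.instance Definition _ u := isMeasurableFun.Build _ _ _ _ _ (measurable_shiftR u).

(** Uniqueness of Lebesgue measure: the pushforward gives half-open intervals their length. *)
Lemma lebesgue_measure_shift u (A : set R) : measurable A ->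
  pushforward mu (shiftR u) A = mu A.
Proof.
move=> mA; apply/esym/lebesgue_measure_unique => //= _ [[a b]] _ <-.
rewrite /pushforward.
have -> : shiftR u @^-1` `]a, b]%classic = `]a - u, b - u]%classic.
  by apply/seteqP; split => x /=; rewrite /shiftR !in_itv /= ltrBlDr lerBrDr.
rewrite !lebesgue_measure_itv /= !lte_fin ltrD2r; case: ifP => // _.
by rewrite -!EFinB; congr EFin; ring.
Qed.

(** Extension by zero turns the segment integral into one over the line, where translation preserves
    the measure. The integrand is signed, so integrability of its translate is checked first,
    through the absolute value. *)
Lemma rint_shift a b u f : rcont_on (a + u) (b + u) f ->
  rint (a + u) (b + u) f = rint a b (fun t => f (t + u)).
Proof.
move=> H; rewrite /rint Rintegral_mkcond [RHS]Rintegral_mkcond /Rintegral; congr fine.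
have eqm (A : set R) : measurable A -> A `<=` setT -> pushforward mu (shiftR u) A = mu A.
  by move=> mA _; exact: lebesgue_measure_shift.
pose g := f \_ `[a + u, b + u].
have gphi x : g (x + u) = ((fun t => f (t + u)) \_ `[a, b]) x.
  by rewrite /g /patch !mem_setE !in_itv /= !lerD2r.
have ig : mu.-integrable setT (EFin \o g).
  have /integrable_mkcond := rint_integrable H.
  by move=> /(_ (measurable_itv _)); rewrite /g restrict_EFin.
have [mg fi] := integrableP _ _ _ ig.
transitivity (\int[mu]_x (EFin \o g) x)%E; first by [].
transitivity (\int[pushforward mu (shiftR u)]_x (EFin \o g) x)%E.
  by apply/esym/eq_measure_integral => A mA AT; exact: eqm.
rewrite integral_pushforward //=.
  by apply: eq_integral => x _ /=; rewrite -gphi.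
rewrite preimage_setT; apply/integrableP; split; first exact: (measurableT_comp mg (measurable_shiftR u)).
have := @ge0_integral_pushforward _ _ _ _ R _ (measurable_shiftR u) mu setT (abse \o (EFin \o g)).
rewrite /= => <- //; last exact: measurableT_comp.
by rewrite (@eq_measure_integral _ _ _ _ mu (pushforward mu (shiftR u))).
Qed.

End RealIntegral.

(** * Complex-valued integrals on segments *)

Section ComplexIntegral.
Local Open Scope classical_set_scope.
Local Open Scope ring_scope.
Context {R : realType}.
Implicit Types (a b c d u s t : R) (z w p : R[i]) (F G : R -> R[i]) (f g : R[i] -> R[i]).

Definition cint a b F : R[i] :=
  Complex (rint a b (fun t => complex.Re (F t))) (rint a b (fun t => complex.Im (F t))).

Definition ccont_on a b F := forall t, a <= t <= b -> forall e, 0 < e ->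
  exists2 r, 0 < r & forall s, a <= s <= b -> `|s - t| < r -> modc (F s - F t) <= e.

Lemma ccont_on_Re a b F : ccont_on a b F -> rcont_on a b (fun t => complex.Re (F t)).
Proof.
move=> H t tab e e0; have [r r0 hr] := H t tab e e0; exists r => // s sab st.
by rewrite -cReB; apply: le_trans (Re_le_modc _) (hr s sab st).
Qed.

Lemma ccont_on_Im a b F : ccont_on a b F -> rcont_on a b (fun t => complex.Im (F t)).
Proof.
move=> H t tab e e0; have [r r0 hr] := H t tab e e0; exists r => // s sab st.
by rewrite -cImB; apply: le_trans (Im_le_modc _) (hr s sab st).
Qed.

Lemma ccont_on_modc a b F : ccont_on a b F -> rcont_on a b (fun t => modc (F t)).
Proof.
move=> H t tab e e0; have [r r0 hr] := H t tab e e0; exists r => // s sab st.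
exact: le_trans (modc_lip _ _) (hr s sab st).
Qed.

Lemma ccont_onW a b c d F : a <= c -> d <= b -> ccont_on a b F -> ccont_on c d F.
Proof.
move=> ac db H t /andP[ct td] e e0.
have [|r r0 hr] := H t _ e e0; first by rewrite (le_trans ac ct) (le_trans td db).
by exists r => // s /andP[cs sd]; apply: hr; rewrite (le_trans ac cs) (le_trans sd db).
Qed.

Lemma ccont_on_cst a b z : ccont_on a b (fun=> z).
Proof. by move=> t _ e e0; exists 1 => // s _ _; rewrite subrr modc0 ltW. Qed.

Lemma ccont_onD a b F G : ccont_on a b F -> ccont_on a b G ->
  ccont_on a b (fun t => F t + G t).
Proof.
move=> HF HG t tab e e0; have e2 : 0 < e / 2 by rewrite divr_gt0.
have [r r0 hr] := HF t tab _ e2; have [s s0 hs] := HG t tab _ e2.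
exists (Num.min r s); first by rewrite lt_min r0.
move=> x xab; rewrite lt_min => /andP[/(hr _ xab) h1 /(hs _ xab) h2].
have -> : F x + G x - (F t + G t) = (F x - F t) + (G x - G t) by ring.
by apply: le_trans (modcD _ _) _; lra.
Qed.

Lemma ccont_onM a b F G : ccont_on a b F -> ccont_on a b G ->
  ccont_on a b (fun t => F t * G t).
Proof.
move=> HF HG t tab e e0.
set A := modc (F t) + modc (G t) + 1.
have A0 : 1 <= A by have := modc_ge0 (F t); have := modc_ge0 (G t); rewrite /A; lra.
have e1 : 0 < Num.min 1 (e / (3 * A)) by rewrite lt_min ltr01 divr_gt0 // mulr_gt0 //; lra.
have [r r0 hr] := HF t tab _ e1; have [s s0 hs] := HG t tab _ e1.
exists (Num.min r s); first by rewrite lt_min r0.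
move=> x xab; rewrite lt_min => /andP[/(hr _ xab) h1 /(hs _ xab) h2].
have -> : F x * G x - F t * G t =
  (F x - F t) * G t + F t * (G x - G t) + (F x - F t) * (G x - G t) by ring.
move: h1 h2; rewrite !le_min => /andP[h1 h1'] /andP[h2 h2'].
have := modcD ((F x - F t) * G t + F t * (G x - G t)) ((F x - F t) * (G x - G t)).
have := modcD ((F x - F t) * G t) (F t * (G x - G t)).
rewrite !modcM.
set X := modc (F x - F t) in h1 h1' *; set Y := modc (G x - G t) in h2 h2' *.
have X0 : 0 <= X := modc_ge0 _; have Y0 : 0 <= Y := modc_ge0 _.
have f0 := modc_ge0 (F t); have g0 := modc_ge0 (G t).
have eA : e / (3 * A) * A = e / 3 by field; lra.
have k1 : X * modc (G t) <= e / 3.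
  by rewrite -eA; apply: ler_pM => //; rewrite /A; lra.
have k2 : modc (F t) * Y <= e / 3.
  by rewrite -eA mulrC; apply: ler_pM => //; rewrite /A; lra.
have k3 : X * Y <= e / 3.
  by rewrite -eA; apply: ler_pM => //; lra.
lra.
Qed.

Lemma ccont_onZ a b F z : ccont_on a b F -> ccont_on a b (fun t => z * F t).
Proof. by move=> H; apply: ccont_onM => //; exact: ccont_on_cst. Qed.

Lemma ccont_onB a b F G : ccont_on a b F -> ccont_on a b G ->
  ccont_on a b (fun t => F t - G t).
Proof.
move=> HF /(ccont_onZ (-1)) HG; have := ccont_onD HF HG.
by have -> : (fun t => F t + -1 * G t) = (fun t => F t - G t) by apply/funext => t; rewrite mulN1r.
Qed.

Lemma ccont_on_id a b : ccont_on a b (fun t => t%:C%C).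
Proof.
move=> t _ e e0; exists e => // s _ st.
by rewrite -rmorphB modc_real ltW.
Qed.

Lemma cintD a b F G : ccont_on a b F -> ccont_on a b G ->
  cint a b (fun t => F t + G t) = cint a b F + cint a b G.
Proof.
move=> HF HG; apply: complex_ext; rewrite ?cReD ?cImD /=.
- rewrite -rintD; [|exact: ccont_on_Re..]; by apply: eq_rint => t _; rewrite cReD.
- rewrite -rintD; [|exact: ccont_on_Im..]; by apply: eq_rint => t _; rewrite cImD.
Qed.

Lemma cintZ a b F z : ccont_on a b F -> cint a b (fun t => z * F t) = z * cint a b F.
Proof.
move=> HF; have hR := ccont_on_Re HF; have hI := ccont_on_Im HF.
have zR c (h : R -> R) : rcont_on a b h -> rcont_on a b (fun t => c * h t).
  move=> Hf t tab e e0; have c0 : 0 < `|c| + 1 by rewrite ltr_wpDl.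
  have [|r r0 hr] := Hf t tab (e / (`|c| + 1)); first by rewrite divr_gt0.
  exists r => // s sab st; rewrite -mulrBr normrM.
  apply: (@le_trans _ _ ((`|c| + 1) * (e / (`|c| + 1)))); last by rewrite mulrC divfK // gt_eqF.
  by apply: ler_pM => //; [rewrite lerDl|exact: hr].
apply: complex_ext; rewrite ?cReM ?cImM /= -!rintZ //.
- by rewrite -rintB; [|exact: zR..]; apply: eq_rint => t _; rewrite cReM.
- by rewrite -rintD; [|exact: zR..]; apply: eq_rint => t _; rewrite cImM.
Qed.

Lemma cintB a b F G : ccont_on a b F -> ccont_on a b G ->
  cint a b (fun t => F t - G t) = cint a b F - cint a b G.
Proof.
move=> HF HG; rewrite -mulN1r -cintZ // -cintD //; last exact: ccont_onZ.
by congr cint; apply/funext => t; rewrite mulN1r.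
Qed.

Lemma cint_split a b c F : a <= b -> b <= c -> ccont_on a c F ->
  cint a c F = cint a b F + cint b c F.
Proof.
move=> ab bc H; apply: complex_ext; rewrite ?cReD ?cImD /=; apply: rint_split => //.
- exact: ccont_on_Re. - exact: ccont_on_Im.
Qed.

Lemma cint_shift a b u F : ccont_on (a + u) (b + u) F ->
  cint (a + u) (b + u) F = cint a b (fun t => F (t + u)).
Proof.
by move=> H; apply: complex_ext; rewrite /= rint_shift //; [exact: ccont_on_Re|exact: ccont_on_Im].
Qed.

Lemma eq_cint a b F G : (forall t, a <= t <= b -> F t = G t) -> cint a b F = cint a b G.
Proof.
by move=> H; apply: complex_ext => /=; apply: eq_rint => t tab; rewrite H.
Qed.

(** The factor 2 comes from bounding the real and imaginary parts separately; it passes into every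
    later contour constant. *)
Lemma cint_le a b F : ccont_on a b F -> modc (cint a b F) <= 2 * rint a b (fun t => modc (F t)).
Proof.
move=> H; apply: le_trans (modc_le_ReIm _) _; rewrite /= mulrDl mul1r.
have hm := ccont_on_modc H; have hR := ccont_on_Re H; have hI := ccont_on_Im H.
apply: lerD; apply: le_trans (rint_abs _) _ => //; apply: le_rint => //.
- exact: rcont_on_norm. - by move=> t _; exact: Re_le_modc.
- exact: rcont_on_norm. - by move=> t _; exact: Im_le_modc.
Qed.

Lemma cint_bound a b F c : a <= b -> ccont_on a b F ->
  (forall t, a <= t <= b -> modc (F t) <= c) -> modc (cint a b F) <= 2 * c * (b - a).
Proof.
move=> ab H hc; apply: le_trans (cint_le H) _; rewrite -mulrA -rint_cst // ler_wpM2l //.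
by apply: le_rint => //; [exact: ccont_on_modc|exact: rcont_on_cst].
Qed.

Lemma cint_cst a b z : a <= b -> cint a b (fun=> z) = z * (b - a)%:C%C.
Proof.
by move=> ab; apply: complex_ext; rewrite ?cReM ?cImM /= !rint_cst //; ring.
Qed.

(* Riemann sums for the linear function are avoided by reflecting the interval. *)
Lemma rint_id a b : a <= b -> rint a b (fun t => t) = (b ^+ 2 - a ^+ 2) / 2.
Proof.
rewrite le_eqVlt => /predU1P[->|ab]; first by rewrite rint_xx subrr mul0r.
rewrite /rint /Rintegral (@continuous_FTC2 _ (fun t => t) (fun t => t ^+ 2 / 2)) //.
- by rewrite -EFinB /= mulrBl.
- by apply: continuous_subspaceT => t; exact: cvg_id.
- split.
  + by move=> x _; apply: derivableM; [exact: exprn_derivable|exact: derivable_cst].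
  + apply: cvg_at_right_filter; apply: cvgM; last exact: cvg_cst.
    exact: exprn_continuous.
  + apply: cvg_at_left_filter; apply: cvgM; last exact: cvg_cst.
    exact: exprn_continuous.
- move=> x _; rewrite derive1E deriveM; [|exact: exprn_derivable|exact: derivable_cst].
  rewrite derive_cst scaler0 add0r exp_derive /GRing.scale /=.
  by rewrite expr1; field.
Qed.

Lemma cint_affine a b z w : a <= b -> cint a b (fun t => z + w * t%:C%C) =
  z * (b - a)%:C%C + w * ((b ^+ 2 - a ^+ 2) / 2)%:C%C.
Proof.
move=> ab; have hid := @ccont_on_id a b.
rewrite cintD ?cintZ ?cint_cst //; [|exact: ccont_on_cst|exact: ccont_onZ].
congr (_ + _ * _); apply: complex_ext => /=; first by rewrite rint_id.
by rewrite rint_cst // mul0r.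
Qed.

End ComplexIntegral.

(** * Goursat's theorem and the Cauchy formula *)

Section Goursat.
Local Open Scope classical_set_scope.
Local Open Scope ring_scope.
Context {R : realType}.
Implicit Types (a b c d u s t x y : R) (z w p : R[i]) (f g : R[i] -> R[i]).

Definition contin f z := forall e, 0 < e -> exists2 r, 0 < r &
  forall h, modc h < r -> modc (f (z + h) - f z) <= e.

Definition hol f z := exists D : R[i], cdiff f z D.

Lemma hol_contin f z : hol f z -> contin f z.
Proof.
move=> [d /cdiff_lip [r r0 hr]] e e0.
have d0 : 0 < modc d + 1 by rewrite ltr_wpDl ?modc_ge0.
exists (Num.min r (e / (modc d + 1))); first by rewrite lt_min r0 divr_gt0.
move=> h; rewrite lt_min => /andP[/hr h1]; rewrite ltr_pdivlMr // mulrC => h2.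
exact: le_trans h1 (ltW h2).
Qed.

Lemma entire_hol f z : entire f -> hol f z.
Proof. by move=> H; exact: ((entireP f).1 H z). Qed.

Lemma entire_contin f z : entire f -> contin f z.
Proof. by move=> /entire_hol H; exact: hol_contin. Qed.

Lemma contin_H f a b y : (forall x, a <= x <= b -> contin f (Complex x y)) ->
  ccont_on a b (fun x => f (Complex x y)).
Proof.
move=> H t tab e e0; have [r r0 hr] := H t tab e e0; exists r => // s _ st.
have -> : Complex s y = Complex t y + (s - t)%:C%C.
  by apply: complex_ext; rewrite ?cReD ?cImD /=; ring.
by apply: hr; rewrite modc_real.
Qed.

Lemma contin_V f x c d : (forall y, c <= y <= d -> contin f (Complex x y)) ->
  ccont_on c d (fun y => f (Complex x y)).
Proof.
move=> H t tab e e0; have [r r0 hr] := H t tab e e0; exists r => // s _ st.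
have -> : Complex x s = Complex x t + 'i%C * (s - t)%:C%C.
  by apply: complex_ext; rewrite ?cReD ?cImD ?cReM ?cImM /=; ring.
by apply: hr; rewrite modcM modc_i mul1r modc_real.
Qed.

(** The counterclockwise contour integral over the boundary of a rectangle, with dz = dx on the
    horizontal sides and dz = i dy on the vertical ones. *)
Definition rectint f a b c d : R[i] :=
  cint a b (fun x => f (Complex x c)) - cint a b (fun x => f (Complex x d)) +
  'i%C * (cint c d (fun y => f (Complex b y)) - cint c d (fun y => f (Complex a y))).

Definition inrect a b c d z := a <= complex.Re z <= b /\ c <= complex.Im z <= d.

(** Continuity is asked on the four sides only, so that integrands with a singularity inside the
    rectangle qualify. *)
Definition crect f a b c d := [/\ ccont_on a b (fun x => f (Complex x c)),
  ccont_on a b (fun x => f (Complex x d)), ccont_on c d (fun y => f (Complex a y)) &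
  ccont_on c d (fun y => f (Complex b y))].

Lemma contin_crect f a b c d : a <= b -> c <= d ->
  (forall z, inrect a b c d z -> contin f z) -> crect f a b c d.
Proof.
move=> ab cd H; split; [apply: contin_H|apply: contin_H|apply: contin_V|apply: contin_V] => t tt;
  by apply: H; split; rewrite /= ?lexx ?ab ?cd ?tt.
Qed.

Lemma rectint_splitv f a b c d e : c <= e -> e <= d ->
  ccont_on c d (fun y => f (Complex a y)) -> ccont_on c d (fun y => f (Complex b y)) ->
  rectint f a b c d = rectint f a b c e + rectint f a b e d.
Proof.
by move=> ce ed Ha Hb; rewrite /rectint (cint_split ce ed Ha) (cint_split ce ed Hb); ring.
Qed.

Lemma rectint_splith f a b c d e : a <= e -> e <= b ->
  ccont_on a b (fun x => f (Complex x c)) -> ccont_on a b (fun x => f (Complex x d)) ->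
  rectint f a b c d = rectint f a e c d + rectint f e b c d.
Proof.
by move=> ae eb Hc Hd; rewrite /rectint (cint_split ae eb Hc) (cint_split ae eb Hd); ring.
Qed.

Lemma rectintB f g a b c d : crect f a b c d -> crect g a b c d ->
  rectint (fun w => f w - g w) a b c d = rectint f a b c d - rectint g a b c d.
Proof. by move=> [? ? ? ?] [? ? ? ?]; rewrite /rectint !cintB //; ring. Qed.

Lemma rectintD f g a b c d : crect f a b c d -> crect g a b c d ->
  rectint (fun w => f w + g w) a b c d = rectint f a b c d + rectint g a b c d.
Proof. by move=> [? ? ? ?] [? ? ? ?]; rewrite /rectint !cintD //; ring. Qed.

Lemma rectintZ f z a b c d : crect f a b c d ->
  rectint (fun w => z * f w) a b c d = z * rectint f a b c d.
Proof. by move=> [? ? ? ?]; rewrite /rectint !cintZ //; ring. Qed.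

Lemma crectB f g a b c d : crect f a b c d -> crect g a b c d ->
  crect (fun w => f w - g w) a b c d.
Proof. by move=> [? ? ? ?] [? ? ? ?]; split; apply: ccont_onB. Qed.

Lemma crectM f g a b c d : crect f a b c d -> crect g a b c d ->
  crect (fun w => f w * g w) a b c d.
Proof. by move=> [? ? ? ?] [? ? ? ?]; split; apply: ccont_onM. Qed.

Lemma crect_cst z a b c d : crect (fun=> z) a b c d.
Proof. by split; exact: ccont_on_cst. Qed.

Lemma crectZ f z a b c d : crect f a b c d -> crect (fun w => z * f w) a b c d.
Proof. by apply: crectM; exact: crect_cst. Qed.

Lemma entire_crect f a b c d : entire f -> crect f a b c d.
Proof. by move=> H; split; [apply: contin_H|apply: contin_H|apply: contin_V|apply: contin_V] => t _; exact: entire_contin. Qed.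

Definition onrect a b c d w :=
  (exists2 x, a <= x <= b & w = Complex x c \/ w = Complex x d) \/
  (exists2 y, c <= y <= d & w = Complex a y \/ w = Complex b y).

Lemma eq_rectint f g a b c d : (forall w, onrect a b c d w -> f w = g w) ->
  rectint f a b c d = rectint g a b c d.
Proof.
move=> H; rewrite /rectint.
have h1 x : a <= x <= b -> f (Complex x c) = g (Complex x c) by move=> xab; apply: H; left; exists x; auto.
have h2 x : a <= x <= b -> f (Complex x d) = g (Complex x d) by move=> xab; apply: H; left; exists x; auto.
have h3 y : c <= y <= d -> f (Complex a y) = g (Complex a y) by move=> xab; apply: H; right; exists y; auto.
have h4 y : c <= y <= d -> f (Complex b y) = g (Complex b y) by move=> xab; apply: H; right; exists y; auto.
by rewrite (eq_cint h1) (eq_cint h2) (eq_cint h3) (eq_cint h4).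
Qed.

(** Each side contributes at most twice its length times [M], and the perimeter is twice the sum of
    the two side lengths. *)
Lemma rectint_bound f a b c d M : a <= b -> c <= d -> crect f a b c d ->
  (forall w, onrect a b c d w -> modc (f w) <= M) ->
  modc (rectint f a b c d) <= 4 * M * ((b - a) + (d - c)).
Proof.
move=> ab cd [hc hd ha hb] H; rewrite /rectint.
have h1 : modc (cint a b (fun x => f (Complex x c))) <= 2 * M * (b - a).
  by apply: cint_bound => // x xab; apply: H; left; exists x; auto.
have h2 : modc (cint a b (fun x => f (Complex x d))) <= 2 * M * (b - a).
  by apply: cint_bound => // x xab; apply: H; left; exists x; auto.
have h3 : modc (cint c d (fun x => f (Complex a x))) <= 2 * M * (d - c).
  by apply: cint_bound => // x xab; apply: H; right; exists x; auto.
have h4 : modc (cint c d (fun x => f (Complex b x))) <= 2 * M * (d - c).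
  by apply: cint_bound => // x xab; apply: H; right; exists x; auto.
apply: le_trans (modcD _ _) _; rewrite modcM modc_i mul1r.
have k1 := modcB (cint a b (fun x => f (Complex x c))) (cint a b (fun x => f (Complex x d))).
have k2 := modcB (cint c d (fun x => f (Complex b x))) (cint c d (fun x => f (Complex a x))).
lra.
Qed.

Lemma rectint_affine z w a b c d : a <= b -> c <= d ->
  rectint (fun v => z + w * v) a b c d = 0.
Proof.
move=> ab cd; rewrite /rectint.
have cH y : (fun x => z + w * Complex x y) = (fun x => (z + w * ('i%C * y%:C%C)) + w * x%:C%C).
  by apply/funext => x; rewrite [Complex x y]complex_split /=; ring.
have cV x : (fun y => z + w * Complex x y) = (fun y => (z + w * x%:C%C) + (w * 'i%C) * y%:C%C).
  by apply/funext => y; rewrite [Complex x y]complex_split /=; ring.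
by rewrite !cH !cV !cint_affine // !rmorphB /=; ring.
Qed.

Section Bisection.
Context (f : R[i] -> R[i]) (a0 b0 c0 d0 : R) (ab0 : a0 <= b0) (cd0 : c0 <= d0)
  (hf : forall z, inrect a0 b0 c0 d0 z -> hol f z).

Let rect := (R * R * R * R)%type.
Let M (r : rect) := let: (a, b, c, d) := r in modc (rectint f a b c d).
Let ok (r : rect) := let: (a, b, c, d) := r in [/\ a0 <= a, a <= b, b <= b0 & [/\ c0 <= c, c <= d & d <= d0]].
Let wid (r : rect) := let: (a, b, c, d) := r in b - a.
Let hei (r : rect) := let: (a, b, c, d) := r in d - c.
Let sub (r r' : rect) := let: (a, b, c, d) := r in let: (a', b', c', d') := r' in
  [/\ a' <= a, b <= b', c' <= c & d <= d'].
(** The rectangle is halved in one direction at a time, so a step loses only a factor 2: the first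
    half is kept if it carries half of the contour integral, and otherwise the second half does.
    [hstep] followed by [vstep] is the classical quartering. *)
Let hstep (r : rect) : rect := let: (a, b, c, d) := r in
  let m := (a + b) / 2 in
  if M r <= 2 * M (a, m, c, d) then (a, m, c, d) else (m, b, c, d).
Let vstep (r : rect) : rect := let: (a, b, c, d) := r in
  let m := (c + d) / 2 in
  if M r <= 2 * M (a, b, c, m) then (a, b, c, m) else (a, b, m, d).

Let okc a b c d : ok (a, b, c, d) -> crect f a b c d.
Proof.
move=> [h1 h2 h3 [h4 h5 h6]]; apply: contin_crect => // z [/andP[z1 z2] /andP[z3 z4]].
apply: hol_contin; apply: hf; split.
- by rewrite (le_trans h1 z1) (le_trans z2 h3).
- by rewrite (le_trans h4 z3) (le_trans z4 h6).
Qed.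

Let hstepP r : ok r -> [/\ ok (hstep r), wid (hstep r) = wid r / 2, hei (hstep r) = hei r,
  sub (hstep r) r & M r <= 2 * M (hstep r)].
Proof.
case: r => [[[a b] c] d] H; rewrite /hstep.
have [h1 h2 h3 [h4 h5 h6]] := H; set m := (a + b) / 2.
have am : a <= m by rewrite /m; lra.
have mb : m <= b by rewrite /m; lra.
case: ifP => [hM|/negbT]; first by split => //=; solve [by split => //; try split => //; lra | by rewrite /m; field | by split => //; lra].
rewrite -ltNge => hM; split => //=; try solve [by split => //; try split => //; lra | by rewrite /m; field | by split => //; lra].
case: (okc H) => hc hd _ _.
move: hM; rewrite /M (rectint_splith am mb hc hd).
have := modcD (rectint f a m c d) (rectint f m b c d); lra.
Qed.

Let vstepP r : ok r -> [/\ ok (vstep r), wid (vstep r) = wid r, hei (vstep r) = hei r / 2,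
  sub (vstep r) r & M r <= 2 * M (vstep r)].
Proof.
case: r => [[[a b] c] d] H; rewrite /vstep.
have [h1 h2 h3 [h4 h5 h6]] := H; set m := (c + d) / 2.
have am : c <= m by rewrite /m; lra.
have mb : m <= d by rewrite /m; lra.
case: ifP => [hM|/negbT]; first by split => //=; solve [by split => //; try split => //; lra | by rewrite /m; field | by split => //; lra].
rewrite -ltNge => hM; split => //=; try solve [by split => //; try split => //; lra | by rewrite /m; field | by split => //; lra].
case: (okc H) => _ _ hc hd.
move: hM; rewrite /M (rectint_splitv am mb hc hd).
have := modcD (rectint f a b c m) (rectint f a b m d); lra.
Qed.

Let r_ n : rect := iter n (fun r => vstep (hstep r)) (a0, b0, c0, d0).

Let sub_refl r : sub r r.
Proof. by case: r => [[[a b] c] d]; split. Qed.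

Let sub_trans r1 r2 r3 : sub r1 r2 -> sub r2 r3 -> sub r1 r3.
Proof.
case: r1 => [[[? ?] ?] ?]; case: r2 => [[[? ?] ?] ?]; case: r3 => [[[? ?] ?] ?] /=.
by move=> [? ? ? ?] [? ? ? ?]; split; lra.
Qed.

Let r_P n : [/\ ok (r_ n), wid (r_ n) = (b0 - a0) / 2 ^+ n, hei (r_ n) = (d0 - c0) / 2 ^+ n
  & M (a0, b0, c0, d0) <= 4 ^+ n * M (r_ n)].
Proof.
elim: n => [|n [IH1 IH2 IH3 IH4]].
  by rewrite /r_ /= !expr0 !divr1 mul1r; split.
have [h1 h2 h3 _ h5] := hstepP IH1; have [v1 v2 v3 _ v5] := vstepP h1.
rewrite /r_ iterS -/(r_ n); split => //.
- by rewrite v2 h2 IH2 exprS; field; rewrite expf_neq0.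
- by rewrite v3 h3 IH3 exprS; field; rewrite expf_neq0.
- apply: le_trans IH4 _; rewrite exprSr -mulrA ler_wpM2l ?exprn_ge0 //; lra.
Qed.

Let r_mono n k : sub (r_ (n + k)) (r_ n).
Proof.
elim: k => [|k IH]; first by rewrite addn0; exact: sub_refl.
rewrite addnS; apply: sub_trans IH.
case: (r_P (n + k)) => h1 _ _ _; case: (hstepP h1) => o1 _ _ s1 _; case: (vstepP o1) => _ _ _ s2 _.
by rewrite /r_ iterS -/(r_ _); apply: sub_trans s2 s1.
Qed.

(** The suprema of the left and of the lower edges give a point common to all rectangles, since
    every left edge lies below every right edge. *)
Let nested : exists z, forall n, let: (a, b, c, d) := r_ n in inrect a b c d z.
Proof.
pose A n := let: (a, b, c, d) := r_ n in a.
pose B n := let: (a, b, c, d) := r_ n in b.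
pose C n := let: (a, b, c, d) := r_ n in c.
pose D n := let: (a, b, c, d) := r_ n in d.
have mono n k : (n <= k)%N -> [/\ A n <= A k, B k <= B n, C n <= C k & D k <= D n].
  move=> nk; have := r_mono n (k - n); rewrite subnKC // /A /B /C /D.
  by case: (r_ n) => [[[? ?] ?] ?]; case: (r_ k) => [[[? ?] ?] ?] [].
have le n : A n <= B n /\ C n <= D n.
  have [] := r_P n; rewrite /A /B /C /D.
  by case: (r_ n) => [[[? ?] ?] ?] [? ? ? []].
have AB n k : A n <= B k.
  have [nk|/ltnW kn] := leqP n k.
  - by apply: le_trans (le k).1; case: (mono _ _ nk).
  - by apply: le_trans (le n).1 _; case: (mono _ _ kn).
have CD n k : C n <= D k.
  have [nk|/ltnW kn] := leqP n k.
  - by apply: le_trans (le k).2; case: (mono _ _ nk).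
  - by apply: le_trans (le n).2 _; case: (mono _ _ kn).
exists (Complex (sup (range A)) (sup (range C))) => n.
have sA : has_sup (range A) by split; [exists (A 0%N), 0%N|exists (B 0%N) => _ [k _ <-]].
have sC : has_sup (range C) by split; [exists (C 0%N), 0%N|exists (D 0%N) => _ [k _ <-]].
suff : A n <= sup (range A) <= B n /\ C n <= sup (range C) <= D n.
  by rewrite /A /B /C /D; case: (r_ n) => [[[? ?] ?] ?].
split; apply/andP; split.
- by apply: ub_le_sup; [case: sA|exists n].
- by apply: ge_sup; [case: sA|move=> _ [k _ <-]].
- by apply: ub_le_sup; [case: sC|exists n].
- by apply: ge_sup; [case: sC|move=> _ [k _ <-]].
Qed.

(** At the common point [z] the affine part of [f] has zero contour integral, so only the remainder,
    at most [e * modc (w - z)], counts. After [n] rounds both this remainder and the perimeter carry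
    a factor 2^-n, which matches the loss 4^n of the bisection. *)
Lemma goursat_aux : rectint f a0 b0 c0 d0 = 0.
Proof.
apply/eqP; rewrite -modc_eq0; apply: contraT => M0.
have {}M0 : 0 < modc (rectint f a0 b0 c0 d0) by rewrite lt_def M0 modc_ge0.
set M00 := modc _ in M0.
have [z hz] := nested.
have zin : inrect a0 b0 c0 d0 z := hz 0%N.
have [D hD] := hf zin.
set L := (b0 - a0) + (d0 - c0).
have L0 : 0 <= L by rewrite addr_ge0 // subr_ge0.
(* Chosen so that [4 * e * L ^+ 2] is at most [M00 / 2]; the summand 1 covers the degenerate
   rectangle with [L = 0]. *)
have e0 : 0 < M00 / (8 * (L ^+ 2 + 1)).
  by rewrite divr_gt0 // mulr_gt0 // ltr_wpDl ?sqr_ge0.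
have [r rpos hr] := hD _ e0.
have [n hn] : exists n, L < r * 2 ^+ n.
  exists (Num.bound (L / r)); rewrite mulrC -ltr_pdivrMr //.
  apply: lt_le_trans (archi_boundP _) _; first by rewrite divr_ge0 // ltW.
  by rewrite -natrX ler_nat ltnW // ltn_expl.
have [] := r_P n; have := hz n; rewrite -/M00.
case: (r_ n) => [[[a b] c] d] [/andP[z1 z2] /andP[z3 z4]] okr /= hw hh hM.
have [h1 h2 h3 [h4 h5 h6]] := okr.
have hwh : (b - a) + (d - c) = L / 2 ^+ n by rewrite hw hh /L -mulrDl.
set e := M00 / _ in e0 hr.
pose rem w := f w - f z - D * (w - z).
have hc := okc okr.
have pow0 : 0 < (2 : R) ^+ n by rewrite exprn_gt0.
have remE : rectint f a b c d = rectint rem a b c d.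
  have caff : crect (fun w => (f z - D * z) + D * w) a b c d.
    by apply: entire_crect; apply: entireD; [exact: entire_cst|apply: entireZ; exact: entire_id].
  rewrite -[LHS]subr0 -(rectint_affine (f z - D * z) D h2 h5) -rectintB //.
  by apply: eq_rectint => w _; rewrite /rem; ring.
have crem : crect rem a b c d.
  have -> : rem = fun w => f w - ((f z - D * z) + D * w).
    by apply/funext => w; rewrite /rem; ring.
  apply: crectB => //; apply: entire_crect; apply: entireD; first exact: entire_cst.
  by apply: entireZ; exact: entire_id.
have bnd w : onrect a b c d w -> modc (rem w) <= e * (L / 2 ^+ n).
  move=> ow; have inw : inrect a b c d w.
    by case: ow => [[x xx [->|->]]|[x xx [->|->]]]; split => //=; rewrite ?lexx ?h2 ?h5.
  have hwz : modc (w - z) <= L / 2 ^+ n.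
    rewrite -hwh; apply: le_trans (modc_le_ReIm _) _; case: inw => /andP[w1 w2] /andP[w3 w4].
    rewrite cReB cImB; apply: lerD; rewrite ler_norml; apply/andP; split; lra.
  have := hr (w - z); rewrite [z + _]addrC subrK -/(rem w) => /(_ _)/le_trans; apply.
    by apply: le_lt_trans hwz _; rewrite ltr_pdivrMr.
  by rewrite ler_wpM2l // ltW.
have := rectint_bound h2 h5 crem bnd; rewrite -remE hwh => hfin.
have : M00 <= 4 * e * L ^+ 2.
  apply: le_trans hM _; apply: le_trans (ler_wpM2l (exprn_ge0 _ _) hfin) _; first by [].
  have -> : (4 : R) ^+ n = 2 ^+ n * 2 ^+ n by rewrite -exprMn; congr (_ ^+ _); ring.
  by rewrite le_eqVlt; apply/orP; left; apply/eqP; field; rewrite gt_eqF.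
have L20 : 0 <= L ^+ 2 := sqr_ge0 L.
have -> : 4 * e * L ^+ 2 = M00 / 2 * (L ^+ 2 / (L ^+ 2 + 1)) by rewrite /e; field; lra.
have : L ^+ 2 / (L ^+ 2 + 1) <= 1 by rewrite ler_pdivrMr ?mul1r; lra.
nra.
Qed.

End Bisection.

Lemma goursat f a b c d : a <= b -> c <= d ->
  (forall z, inrect a b c d z -> hol f z) -> rectint f a b c d = 0.
Proof. exact: goursat_aux. Qed.

(** The region between the rectangles is cut into a lower and an upper strip and the two remaining
    side pieces; Goursat's theorem kills all four, as each avoids the open inner rectangle. *)
Lemma rectint_annulus f a b c d a' b' c' d' :
  a <= a' -> a' <= b' -> b' <= b -> c <= c' -> c' <= d' -> d' <= d ->
  (forall z, inrect a b c d z ->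
     ~ (a' < complex.Re z < b' /\ c' < complex.Im z < d') -> hol f z) ->
  rectint f a b c d = rectint f a' b' c' d'.
Proof.
move=> h1 h2 h3 h4 h5 h6 H.
have cV x : a <= x <= b -> ~ (a' < x < b') -> ccont_on c d (fun y => f (Complex x y)).
  by move=> xab nx; apply: contin_V => y yy; apply: hol_contin; apply: H => // -[].
have cH y : c <= y <= d -> ~ (c' < y < d') -> ccont_on a b (fun x => f (Complex x y)).
  by move=> yy ny; apply: contin_H => x xx; apply: hol_contin; apply: H => // -[].
have Va : ccont_on c d (fun y => f (Complex a y)) by apply: cV => //; [lra|move=> /andP[]; lra].
have Vb : ccont_on c d (fun y => f (Complex b y)) by apply: cV => //; [lra|move=> /andP[]; lra].
have Hc' : ccont_on a b (fun x => f (Complex x c')) by apply: cH => //; [lra|move=> /andP[]; lra].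
have Hd' : ccont_on a b (fun x => f (Complex x d')) by apply: cH => //; [lra|move=> /andP[]; lra].
rewrite (@rectint_splitv _ _ _ _ _ c') //; last lra.
rewrite (@rectint_splitv _ _ _ c' _ d') //; [|apply: ccont_onW Va; lra|apply: ccont_onW Vb; lra].
rewrite (@rectint_splith _ a b c' d' a') //; last lra.
rewrite (@rectint_splith _ a' b c' d' b') //; [|apply: ccont_onW Hc'; lra|apply: ccont_onW Hd'; lra].
rewrite (@goursat f a b c c') //; [|lra|]; last first.
  move=> z [z1 /andP[z3 z4]]; apply: H; first by split => //; lra.
  by move=> [_ /andP[]]; lra.
rewrite (@goursat f a b d' d) //; [|lra|]; last first.
  move=> z [z1 /andP[z3 z4]]; apply: H; first by split => //; lra.
  by move=> [_ /andP[]]; lra.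
rewrite (@goursat f a a' c' d') //; last first.
  move=> z [/andP[z1 z2] /andP[z3 z4]]; apply: H; first by split; lra.
  by move=> [/andP[]]; lra.
rewrite (@goursat f b' b c' d') //; last first.
  move=> z [/andP[z1 z2] /andP[z3 z4]]; apply: H; first by split; lra.
  by move=> [/andP[]]; lra.
by rewrite !add0r !addr0.
Qed.

End Goursat.

(** * Cauchy's formula and Taylor expansion on squares *)

Section Cauchy.
Local Open Scope classical_set_scope.
Local Open Scope ring_scope.
Context {R : realType}.
Implicit Types (a b c d u s t x y : R) (z w p : R[i]) (f g : R[i] -> R[i]).

Definition sqint s f := rectint f (- s) s (- s) s.
Definition onsq s w := onrect (- s) s (- s) s w.

Lemma onsq_modc s w : 0 < s -> onsq s w -> s <= modc w <= 2 * s.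
Proof.
move=> s0 H; have k : (`|complex.Re w| <= s /\ `|complex.Im w| = s) \/ (`|complex.Re w| = s /\ `|complex.Im w| <= s).
  case: H => [[x xs [->|->]]|[x xs [->|->]]]; [left|left|right|right];
    by rewrite /= ?normrN ?(gtr0_norm s0) ler_norml.
have h1 := Re_le_modc w; have h2 := Im_le_modc w; have h3 := modc_le_ReIm w.
by apply/andP; case: k => -[]; lra.
Qed.

Lemma onsq_neq0 s w : 0 < s -> onsq s w -> w != 0.
Proof. by move=> s0 /(onsq_modc s0)/andP[h _]; rewrite -modc_gt0; lra. Qed.

Lemma hol_crect f a b c d : a <= b -> c <= d ->
  (forall w, onrect a b c d w -> hol f w) -> crect f a b c d.
Proof.
move=> ab cd H; split; [apply: contin_H|apply: contin_H|apply: contin_V|apply: contin_V] => t tt;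
  apply: hol_contin; apply: H; by [left; exists t; auto|right; exists t; auto].
Qed.

Lemma contin_crect' f a b c d : (forall w, onrect a b c d w -> contin f w) -> crect f a b c d.
Proof.
move=> H; split; [apply: contin_H|apply: contin_H|apply: contin_V|apply: contin_V] => t tt;
  apply: H; by [left; exists t; auto|right; exists t; auto].
Qed.

Lemma holM f g z : hol f z -> hol g z -> hol (fun w => f w * g w) z.
Proof. by move=> [d1 h1] [d2 h2]; eexists; exact: cdiffM h1 h2. Qed.

Lemma hol_cst z w : hol (fun=> z) w.
Proof. by eexists; exact: cdiff_cst. Qed.

Lemma hol_shift f z p : hol f (p + z) -> hol (fun w => f (p + w)) z.
Proof. by move=> [d h]; exists d; exact: cdiff_shift. Qed.

Lemma holV z : z != 0 -> hol (fun w : R[i] => w^-1) z.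
Proof. by move=> z0; eexists; exact: cdiffV. Qed.

Lemma hol_invB z p : z != p -> hol (fun w => (w - p)^-1) z.
Proof.
move=> zp; have H : hol (fun w : R[i] => w^-1) (- p + z).
  by apply: holV; rewrite addrC subr_eq0.
have := hol_shift H; have -> // : (fun w => (- p + w)^-1) = (fun w => (w - p)^-1).
by apply/funext => w; rewrite addrC.
Qed.

Lemma holVX n z : z != 0 -> hol (fun w : R[i] => (w ^+ n)^-1) z.
Proof.
move=> z0; elim: n => [|n IH].
  by have := hol_cst (1 ^-1) z; have -> // : (fun _ : R[i] => (1 : R[i])^-1) = (fun w : R[i] => (w ^+ 0)^-1).
have := holM (holV z0) IH; have -> // : (fun w : R[i] => w^-1 * (w ^+ n)^-1) = (fun w : R[i] => (w ^+ n.+1)^-1).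
by apply/funext => w; rewrite exprS invfM.
Qed.

Lemma sqint_indep f s t : 0 < s -> 0 < t -> (forall z, z != 0 -> hol f z) ->
  sqint s f = sqint t f.
Proof.
wlog st : s t / s <= t => [hw|] s0 t0 H.
  by have [/hw|/ltW/hw] := leP s t; [exact|move=> h; apply/esym; exact: h].
apply/esym; apply: rectint_annulus; try lra.
move=> z _ nz; apply: H; apply: contra_notN nz => /eqP -> /=; lra.
Qed.

(** Classically 2 pi i. The value is never computed; independence of the square and nonvanishing
    carry the theory. *)
Definition cauchy_cst : R[i] := sqint 1 (fun w => w^-1).

Lemma cauchy_cstE s : 0 < s -> sqint s (fun w => w^-1) = cauchy_cst.
Proof. by move=> s0; apply: sqint_indep => // z; exact: holV. Qed.

(** Each of the four sides contributes the integral of 1/(1 + x^2) over [-1, 1] to the imaginary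
    part, and this integrand is at least 1/2 there. *)
Lemma cauchy_cst_neq0 : cauchy_cst != 0.
Proof.
have one : (0 : R) < 1 := ltr01.
have [cc cd ca cb] : crect (fun w : R[i] => w^-1) (- 1) 1 (- 1) 1.
  apply: hol_crect; try lra; move=> w /(onsq_neq0 one); exact: holV.
suff : 2 <= complex.Im cauchy_cst.
  by apply: contraTneq => ->; rewrite -ltNge.
have CV x y : complex.Re (Complex x y)^-1 = x / (x ^+ 2 + y ^+ 2) /\
              complex.Im (Complex x y)^-1 = - y / (x ^+ 2 + y ^+ 2).
  by split; rewrite /= ?mulNr.
have rA : rcont_on (- 1) 1 (fun x : R => 1 / (1 + x ^+ 2)).
  have h := ccont_on_Re cb; move=> t tt e e0; have [r r0 hr] := h t tt e e0.
  exists r => // s ss st; have := hr s ss st.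
  by rewrite !(CV _ _).1 expr1n.
have A1 : 1 <= rint (- 1) 1 (fun x : R => 1 / (1 + x ^+ 2)).
  apply: (@le_trans _ _ (rint (- 1) 1 (fun=> 1 / 2))); first by rewrite rint_cst; lra.
  apply: le_rint => //; first exact: rcont_on_cst.
  move=> t tt; rewrite ler_pdivrMr // mulrAC mul1r ler_pdivlMr ?mul1r; nra.
rewrite /cauchy_cst /sqint /rectint /cint cImD cImB cImM /= mul0r add0r mul1r.
rewrite (@eq_rint _ _ _ _ (fun x : R => 1 / (1 + x ^+ 2))); last first.
  by move=> t _; rewrite sqrrN expr1n mulNr opprK addrC.
rewrite (@eq_rint _ _ _ (fun t => - (1 / (t ^+ 2 + 1 ^+ 2))) (fun x : R => -1 * (1 / (1 + x ^+ 2)))); last first.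
  by move=> t _; rewrite expr1n addrC mulN1r.
rewrite (@eq_rint _ _ _ (fun t => 1 / (1 ^+ 2 + t ^+ 2)) (fun x : R => 1 / (1 + x ^+ 2))); last first.
  by move=> t _; rewrite expr1n.
rewrite (@eq_rint _ _ _ (fun t => -1 / ((-1) ^+ 2 + t ^+ 2)) (fun x : R => -1 * (1 / (1 + x ^+ 2)))); last first.
  by move=> t _; rewrite sqrrN expr1n mulrA mulr1.
rewrite !(rintZ (-1) rA); move: A1; set A := rint _ _ _ => A1; lra.
Qed.

Lemma rectint_shift f a b c d u v :
  crect f (a + u) (b + u) (c + v) (d + v) ->
  rectint f (a + u) (b + u) (c + v) (d + v) = rectint (fun w => f (Complex u v + w)) a b c d.
Proof.
move=> [h1 h2 h3 h4]; rewrite /rectint !cint_shift //.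
have E x y : Complex (x + u) (y + v) = Complex u v + Complex x y.
  by apply: complex_ext; rewrite ?cReD ?cImD /= addrC.
by under [in RHS]eq_cint => t _ do rewrite -E; congr (_ - _ + _ * (_ - _)); apply: eq_cint => t _; rewrite E.
Qed.

Lemma small_modc_eq0 z C r : 0 < r -> (forall e, 0 < e -> e < r -> modc z <= C * e) -> z = 0.
Proof.
move=> r0 H; apply/eqP; rewrite -modc_eq0; apply: contraT => z0.
have {}z0 : 0 < modc z by rewrite lt_def z0 modc_ge0.
have C0 : 0 < `|C| + 1 by rewrite ltr_wpDl.
pose e := Num.min (r / 2) (modc z / 2 / (`|C| + 1)).
have e0 : 0 < e by rewrite lt_min !divr_gt0.
have er : e < r by rewrite gt_min; apply/orP; left; lra.
have h := H e e0 er.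
have e2 : e * (`|C| + 1) <= modc z / 2 by rewrite -ler_pdivlMr // ge_min lexx orbT.
have h2 : C * e <= (`|C| + 1) * e by rewrite ler_wpM2r ?(ltW e0) // (le_trans (ler_norm C)) // lerDl.
lra.
Qed.

(** The contour shrinks to a small square of half-side [e] around [p]. There f(p + w)/w differs from
    f(p)/w by a bounded quotient, while the length of the contour is proportional to [e], so the
    discrepancy is O(e) and hence zero. *)
Lemma cauchy_formula f p s : 0 < s -> `|complex.Re p| < s -> `|complex.Im p| < s ->
  (forall z, inrect (- s) s (- s) s z -> hol f z) ->
  sqint s (fun w => f w / (w - p)) = cauchy_cst * f p.
Proof.
move=> s0 ps1 ps2 hf.
move: (ps1) (ps2); rewrite !ltr_norml => /andP[p1 p2] /andP[p3 p4].
have hp : hol f p by apply: hf; split; rewrite !ltW.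
have [D /cdiff_lip [r r0 hr]] := hp.
(* Points of the small square have modulus at most [2 * e], so [r / 3] keeps them in the range of
   the Lipschitz bound; the other two terms keep the square inside the large one. *)
pose r1 := Num.min (Num.min (r / 3) (s - `|complex.Re p|)) (s - `|complex.Im p|).
have r10 : 0 < r1 by rewrite !lt_min !subr_gt0 ps1 ps2 divr_gt0.
apply/eqP; rewrite -subr_eq0; apply/eqP.
apply: (@small_modc_eq0 _ (16 * (modc D + 1)) r1) => // e e0.
rewrite !lt_min => /andP[/andP[e1 e2] e3].
have e4 := ler_norm (complex.Re p); have e5 := ler_norm (complex.Im p).
have e6 := lerNnormlW (lexx `|complex.Re p|); have e7 := lerNnormlW (lexx `|complex.Im p|).
have pE : Complex (complex.Re p) (complex.Im p) = p by case: (p).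
pose F w := f (p + w) / w.
have hF w : onsq e w -> hol F w.
  move=> ow; have /andP[w1 w2] := onsq_modc e0 ow; have w0 := onsq_neq0 e0 ow.
  apply: holM; last exact: holV.
  apply: hol_shift; apply: hf.
  have h1 := Re_le_modc w; have h2 := Im_le_modc w.
  have : `|complex.Re w| <= e /\ `|complex.Im w| <= e.
    by case: ow => [[x xs [->|->]]|[x xs [->|->]]]; rewrite /= ?normrN ?(gtr0_norm e0) ler_norml.
  rewrite !ler_norml => -[/andP[k1 k2] /andP[k3 k4]].
  by split; rewrite ?cReD ?cImD; lra.
have -> : sqint s (fun w => f w / (w - p)) = sqint e F.
  have hq : forall z, inrect (- s) s (- s) s z -> z != p -> hol (fun w => f w / (w - p)) z.
    by move=> z hz zp; apply: holM; [exact: hf|exact: hol_invB].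
  rewrite /sqint (@rectint_annulus R _ (- s) s (- s) s (- e + complex.Re p) (e + complex.Re p) (- e + complex.Im p) (e + complex.Im p)); [|lra|lra|lra|lra|lra|lra|]; last first.
    by move=> z hz nz; apply: hq => //; apply: contra_notN nz => /eqP ->; lra.
  rewrite rectint_shift; last first.
    apply: hol_crect; try lra.
    move=> w ow; apply: hq.
      by case: ow => [[x xs [->|->]]|[x xs [->|->]]]; split => /=; lra.
    by case: ow => [[x xs [->|->]]|[x xs [->|->]]]; apply/eqP; rewrite -pE => -[]; lra.
  by rewrite pE; apply: eq_rectint => w _; rewrite /F [p + w]addrC addrK.
have cF : crect F (- e) e (- e) e by apply: hol_crect => //; lra.
have cI : crect (fun w : R[i] => f p * w^-1) (- e) e (- e) e.
  by apply: hol_crect; try lra; move=> w ow; apply: holM; [exact: hol_cst|apply: holV; exact: onsq_neq0 ow].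
have cV : crect (fun w : R[i] => w^-1) (- e) e (- e) e.
  by apply: hol_crect; try lra; move=> w ow; apply: holV; exact: onsq_neq0 ow.
rewrite -(cauchy_cstE e0) mulrC /sqint -rectintZ // -rectintB //.
have -> : 16 * (modc D + 1) * e = 4 * (modc D + 1) * ((e - - e) + (e - - e)) by ring.
apply: rectint_bound; try lra; first exact: crectB.
move=> w ow; have /andP[w1 w2] := onsq_modc e0 ow.
rewrite /F -mulrBl modcM modcV ler_pdivrMr; last lra.
by apply: hr; lra.
Qed.

(** Defined by a contour integral over one fixed square, which makes it linear in [f] on entire
    functions; [tcoefE] moves it to squares of any size. *)
Definition tcoef f k : R[i] := cauchy_cst^-1 * sqint 1 (fun w => f w / w ^+ k.+1).

Lemma hol_tcoef f k z : entire f -> z != 0 -> hol (fun w => f w / w ^+ k) z.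
Proof. by move=> hf z0; apply: holM; [exact: entire_hol|exact: holVX]. Qed.

Lemma tcoefE f k s : entire f -> 0 < s ->
  tcoef f k = cauchy_cst^-1 * sqint s (fun w => f w / w ^+ k.+1).
Proof.
by move=> hf s0; rewrite /tcoef (sqint_indep ltr01 s0) // => z; exact: hol_tcoef.
Qed.

Lemma sqint_bound f s M : 0 < s -> crect f (- s) s (- s) s ->
  (forall w, onsq s w -> modc (f w) <= M) -> modc (sqint s f) <= 16 * s * M.
Proof.
move=> s0 cf H; have -> : 16 * s * M = 4 * M * ((s - - s) + (s - - s)) by ring.
by apply: rectint_bound => //; lra.
Qed.

(** Here 32 = 16 * 2: [16 * s] bounds the contour integral of a function of modulus at most 1 over
    the square of half-side [s], and [2 / s] bounds 1/|w - z| when |z| is at most [s / 2]. *)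
Definition cauchy_bd : R := 32 / modc cauchy_cst.

Lemma cauchy_bd_gt0 : 0 < cauchy_bd.
Proof. by rewrite divr_gt0 // modc_gt0 cauchy_cst_neq0. Qed.

(** By induction on [K], using 1/(w - z) = 1/w + z/(w (w - z)), the remainder is z^K times the
    contour integral of f(w)/(w^K (w - z)), divided by the Cauchy constant. *)
Lemma taylor f K s M z : entire f -> 0 < s -> modc z <= s / 2 ->
  (forall w, onsq s w -> modc (f w) <= M) ->
  modc (f z - \sum_(k < K) tcoef f k * z ^+ k) <= cauchy_bd * M * (modc z / s) ^+ K.
Proof.
move=> hf s0 zs hM.
have c0 := cauchy_cst_neq0; have mc0 : 0 < modc cauchy_cst by rewrite modc_gt0.
have M0 : 0 <= M.
  have : onsq s (Complex s 0) by right; exists 0; [lra|auto].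
  by move=> /hM; apply: le_trans; exact: modc_ge0.
have zw w : onsq s w -> w - z != 0.
  move=> /(onsq_modc s0)/andP[h1 h2]; rewrite -modc_gt0.
  have := modcD (w - z) z; have -> : w - z + z = w by ring.
  lra.
have cf k : crect (fun w => f w / w ^+ k) (- s) s (- s) s.
  apply: hol_crect; try lra; move=> w ow; apply: hol_tcoef => //; exact: onsq_neq0 ow.
have cfz : crect (fun w => f w / (w - z)) (- s) s (- s) s.
  apply: hol_crect; try lra; move=> w ow; apply: holM; first exact: entire_hol.
  by apply: hol_invB; rewrite -subr_eq0 zw.
have key : cauchy_cst * (f z - \sum_(k < K) tcoef f k * z ^+ k) =
    sqint s (fun w => z ^+ K * (f w / (w ^+ K * (w - z)))) /\
    crect (fun w => z ^+ K * (f w / (w ^+ K * (w - z)))) (- s) s (- s) s.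
  elim: K => [|K [IH1 IH2]].
    rewrite big_ord0 subr0 -(@cauchy_formula f z s) //; last 1 first.
    - by move=> w _; exact: entire_hol.
    - have E : (fun w => f w / (w - z)) = (fun w => z ^+ 0 * (f w / (w ^+ 0 * (w - z)))).
        by apply/funext => w; rewrite !expr0 !mul1r.
      by rewrite -E.
    - by apply: le_lt_trans (Re_le_modc _) _; lra.
    - by apply: le_lt_trans (Im_le_modc _) _; lra.
  have cK := crectZ (z ^+ K) (cf K.+1).
  have E w : onsq s w -> z ^+ K.+1 * (f w / (w ^+ K.+1 * (w - z))) =
      z ^+ K * (f w / (w ^+ K * (w - z))) - z ^+ K * (f w / w ^+ K.+1).
    move=> ow; have w0 := onsq_neq0 s0 ow; have wz := zw w ow.
    rewrite !exprS; field; rewrite wz w0 expf_neq0 //.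
  split.
    rewrite /sqint in IH1 *; rewrite (eq_rectint E) rectintB // [rectint (fun w => _ * (f w / w ^+ K.+1)) _ _ _ _]rectintZ // -IH1 big_ord_recr /=.
    rewrite (tcoefE K hf s0) /sqint opprD addrA mulrBr; congr (_ - _).
    by rewrite mulrA mulrA mulfV // mul1r mulrC.
  apply: hol_crect; try lra; move=> w ow; apply: holM; first exact: hol_cst.
  apply: holM; first exact: entire_hol.
  have -> : (fun w : R[i] => (w ^+ K.+1 * (w - z))^-1) = (fun w => (w ^+ K.+1)^-1 * (w - z)^-1).
    by apply/funext => v; rewrite invfM.
  apply: holM; [apply: holVX; exact: onsq_neq0 ow|].
  by apply: hol_invB; rewrite -subr_eq0 zw.
have [k1 k2] := key.
have bd : modc (sqint s (fun w => z ^+ K * (f w / (w ^+ K * (w - z))))) <= 16 * s * ((modc z / s) ^+ K * M * (2 / s)).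
  apply: sqint_bound => // w ow; have /andP[w1 w2] := onsq_modc s0 ow.
  rewrite !(modcM, modcV, modcX).
  have wz : s / 2 <= modc (w - z).
    have := modcD (w - z) z; have -> : w - z + z = w by ring.
    lra.
  have -> : modc z ^+ K * (modc (f w) * (modc w ^+ K * modc (w - z))^-1) =
     (modc z / modc w) ^+ K * modc (f w) * (modc (w - z))^-1.
    by rewrite expr_div_n; field; rewrite expf_neq0 ?gt_eqF //; lra.
  apply: ler_pM; rewrite ?mulr_ge0 ?exprn_ge0 ?divr_ge0 ?invr_ge0 ?modc_ge0 //.
  - apply: ler_pM; rewrite ?exprn_ge0 ?divr_ge0 ?modc_ge0 //; last exact: hM.
    rewrite lerXn2r ?nnegrE ?divr_ge0 ?modc_ge0 ?(ltW s0) //.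
    by rewrite ler_wpM2l ?modc_ge0 // lef_pV2 ?posrE //; lra.
  - by rewrite -[2 / s]invf_div lef_pV2 ?posrE ?divr_gt0 //; lra.
rewrite -k1 modcM in bd.
rewrite -(ler_pM2l mc0); apply: le_trans bd _; rewrite /cauchy_bd le_eqVlt; apply/orP; left.
by apply/eqP; field; rewrite !gt_eqF.
Qed.

Lemma tcoef_bound f k s M : entire f -> 0 < s ->
  (forall w, onsq s w -> modc (f w) <= M) -> modc (tcoef f k) <= cauchy_bd * M / s ^+ k.
Proof.
move=> hf s0 hM; rewrite (tcoefE k hf s0) modcM modcV.
have mc0 : 0 < modc cauchy_cst by rewrite modc_gt0 cauchy_cst_neq0.
have M0 : 0 <= M.
  have : onsq s (Complex s 0) by right; exists 0; [lra|auto].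
  by move=> /hM; apply: le_trans; exact: modc_ge0.
have : modc (sqint s (fun w => f w / w ^+ k.+1)) <= 16 * s * (M * (s ^+ k.+1)^-1).
  apply: sqint_bound => //.
    apply: hol_crect; try lra; move=> w ow; apply: hol_tcoef => //; exact: onsq_neq0 ow.
  move=> w ow; have /andP[w1 w2] := onsq_modc s0 ow.
  rewrite modcM modcV modcX; apply: ler_pM; rewrite ?invr_ge0 ?exprn_ge0 ?modc_ge0 ?hM //.
  by rewrite lef_pV2 ?posrE ?exprn_gt0 ?lerXn2r ?nnegrE //; lra.
move=> h; apply: (@le_trans _ _ ((modc cauchy_cst)^-1 * (16 * s * (M * (s ^+ k.+1)^-1)))).
  by rewrite ler_wpM2l // invr_ge0 ltW.
rewrite /cauchy_bd exprS.
have -> : (modc cauchy_cst)^-1 * (16 * s * (M * (s * s ^+ k)^-1)) = (16 / modc cauchy_cst) * (M / s ^+ k).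
  by field; rewrite expf_neq0 ?gt_eqF.
rewrite -[X in _ <= X]mulrA ler_wpM2r ?divr_ge0 ?exprn_ge0 ?(ltW s0) //.
by rewrite ler_wpM2r ?invr_ge0 ?(ltW mc0) //; lra.
Qed.

End Cauchy.

(** * Integrals over the plane *)

Section Plane.
Local Open Scope classical_set_scope.
Local Open Scope ring_scope.
Context {R : realType}.
Implicit Types (a b c d u s t x y : R) (z w p : R[i]) (f g : R[i] -> R[i]) (phi chi : R[i] -> R).

(** An open set is the countable union of the rational boxes that it contains; boxes not contained
    in it are replaced by the empty set so that the union runs over a fixed countable type. *)
Lemma box_open_measurable (U : set (R * R)) :
  (forall p : R * R, U p -> exists2 r, 0 < r & forall q : R * R, `|q.1 - p.1| < r -> `|q.2 - p.2| < r -> U q) ->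
  measurable U.
Proof.
move=> H.
pose box (i : rat * rat * nat) : set (R * R) :=
  ball (ratr i.1.1 : R) (i.2.+1%:R^-1) `*` ball (ratr i.1.2 : R) (i.2.+1%:R^-1).
pose V i := if pselect (box i `<=` U) then box i else set0.
have -> : U = \bigcup_i V i.
  apply/seteqP; split => [p Up|p [i _]]; last by rewrite /V; case: pselect => // h /h.
  have [r r0 hr] := H p Up.
  have [n hn] : exists n : nat, n.+1%:R^-1 < r / 2.
    exists (Num.bound (2 / r)); rewrite -[r / 2]invf_div ltf_pV2 ?posrE ?divr_gt0 //.
    apply: lt_le_trans (archi_boundP _) _; first by rewrite divr_ge0 // ltW.
    by rewrite ler_nat.
  have n0 : 0 < n.+1%:R^-1 :> R by rewrite invr_gt0.
  pose e : R := n.+1%:R^-1; rewrite -/e in hn n0.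
  have [q1 hq1] : exists q : rat, ratr q \in `]p.1 - e, p.1 + e[.
    by apply: rat_in_itvoo; lra.
  have [q2 hq2] : exists q : rat, ratr q \in `]p.2 - e, p.2 + e[.
    by apply: rat_in_itvoo; lra.
  move: hq1 hq2; rewrite !in_itv /= => /andP[h1 h2] /andP[h3 h4].
  have hsub : box (q1, q2, n) `<=` U.
    move=> q; rewrite /box /ball /= -/e => -[]; rewrite !ltr_norml => /andP[k1 k2] /andP[k3 k4].
    by apply: hr; rewrite ltr_norml; apply/andP; split; lra.
  exists (q1, q2, n) => //; rewrite /V; case: pselect => [hb|//] /=.
  by rewrite /box /ball /= -/e; split; rewrite ltr_norml; apply/andP; split; lra.
apply: countable_bigcupT_measurable; first exact: countableP.
move=> i; rewrite /V; case: pselect => [hb|_] /=; last exact: measurable0.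
by apply: measurableX; exact: measurable_ball.
Qed.

Definition rcontin phi := forall z e, 0 < e -> exists2 r, 0 < r &
  forall h, modc h < r -> `|phi (z + h) - phi z| <= e.

Definition pmeas phi := measurable_fun [set: R * R] (fun xy => phi (cplx xy)).

Lemma cplx_modc_lt (p q : R * R) r : `|q.1 - p.1| < r / 2 -> `|q.2 - p.2| < r / 2 ->
  modc (cplx q - cplx p) < r.
Proof.
move=> h1 h2; apply: le_lt_trans (modc_le_ReIm _) _; rewrite cReB cImB /=; lra.
Qed.

Lemma rcontin_pmeas phi : rcontin phi -> pmeas phi.
Proof.
move=> H; apply: (measurability (RGenOInfty.G (R := R))); first exact: RGenOInfty.measurableE.
move=> _ [_ [a ->] <-]; rewrite setTI; apply: box_open_measurable => p.
rewrite /= in_itv /= andbT => ap.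
have e0 : 0 < (phi (cplx p) - a) / 2 by lra.
have [r r0 hr] := H (cplx p) _ e0; exists (r / 2); first by rewrite divr_gt0.
move=> q h1 h2; rewrite /= in_itv /= andbT.
have := hr _ (cplx_modc_lt h1 h2); rewrite [cplx p + _]addrC subrK ler_norml => /andP[]; lra.
Qed.

Lemma rcontin_continuous phi : rcontin phi -> continuous (fun xy : R * R => phi (cplx xy)).
Proof.
move=> H p; apply/cvgrPdist_le => e e0; have [r r0 hr] := H (cplx p) _ e0.
exists (ball p.1 (r / 2), ball p.2 (r / 2)) => /=.
  by split; apply: nbhsx_ballx; rewrite divr_gt0.
move=> q [h1 h2] /=; rewrite distrC.
have := hr (cplx q - cplx p); rewrite [cplx p + _]addrC subrK; apply.
by apply: cplx_modc_lt; rewrite distrC.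
Qed.

Lemma rcontin_bounded phi r : rcontin phi -> exists M, forall z,
  `|complex.Re z| <= r -> `|complex.Im z| <= r -> phi z <= M.
Proof.
move=> H; have [r0|r0] := ltP r 0.
  by exists 0 => z h _; have := le_lt_trans h r0; rewrite normr_lt0.
have cK : compact (`[- r, r] `*` `[- r, r] : set (R * R)) by apply: compact_setX; exact: segment_compact.
have [|[x y] _ hM] := compact_EVT_max _ cK (continuous_subspaceT (rcontin_continuous H)).
  by exists (0, 0); split; rewrite /= in_itv /= oppr_le0 r0.
exists (phi (cplx (x, y))) => z; rewrite !ler_norml => h1 h2.
have := hM (complex.Re z, complex.Im z); rewrite /cplx /=.
have -> : Complex (complex.Re z) (complex.Im z) = z by case: z {h1 h2}.
by apply; rewrite inE /=; split; rewrite /= in_itv.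
Qed.

Lemma rcontin_modc f : (forall z, contin f z) -> rcontin (fun z => modc (f z)).
Proof.
move=> H z e e0; have [r r0 hr] := H z e e0; exists r => // h hh.
exact: le_trans (modc_lip _ _) (hr h hh).
Qed.

Lemma contin_bounded f r : (forall z, contin f z) -> exists2 M, 0 < M & forall z, modc z <= r -> modc (f z) <= M.
Proof.
move=> /rcontin_modc /(@rcontin_bounded _ r) [M hM]; exists (`|M| + 1); first by rewrite ltr_wpDl.
move=> z zr; apply: (@le_trans _ _ M).
  by apply: hM; [exact: le_trans (Re_le_modc _) zr|exact: le_trans (Im_le_modc _) zr].
by rewrite (le_trans (ler_norm M)) // lerDl.
Qed.

Lemma entire_bounded f r : entire f -> exists2 M, 0 < M & forall z, modc z <= r -> modc (f z) <= M.
Proof. by move=> H; apply: contin_bounded => z; exact: entire_contin. Qed.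

Lemma pmeas_entire f : entire f -> pmeas (fun z => modc (f z)).
Proof. by move=> H; apply: rcontin_pmeas; apply: rcontin_modc => z; exact: entire_contin. Qed.

Lemma pmeas_cst a : pmeas (fun=> a).
Proof. exact: measurable_cst. Qed.

Lemma pmeasD phi chi : pmeas phi -> pmeas chi -> pmeas (fun z => phi z + chi z).
Proof. exact: measurable_funD. Qed.

Lemma pmeasB phi chi : pmeas phi -> pmeas chi -> pmeas (fun z => phi z - chi z).
Proof. exact: measurable_funB. Qed.

Lemma pmeasM phi chi : pmeas phi -> pmeas chi -> pmeas (fun z => phi z * chi z).
Proof. exact: measurable_funM. Qed.

Lemma pmeasX phi n : pmeas phi -> pmeas (fun z => phi z ^+ n).
Proof. exact: measurable_funX. Qed.

Lemma pmeas_powR phi a : pmeas phi -> pmeas (fun z => phi z `^ a).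
Proof. by move=> H; apply: (measurableT_comp (measurable_powR a) H). Qed.

Lemma pmeas_expR phi : pmeas phi -> pmeas (fun z => expR (phi z)).
Proof. by move=> H; apply: (measurableT_comp (@measurable_expR R) H). Qed.

Lemma pmeas_min phi chi : pmeas phi -> pmeas chi -> pmeas (fun z => Num.min (phi z) (chi z)).
Proof. exact: measurable_minr. Qed.

Lemma pmeas_Re : pmeas (@complex.Re R). Proof. exact: measurable_fst. Qed.
Lemma pmeas_Im : pmeas (@complex.Im R). Proof. exact: measurable_snd. Qed.

Lemma pmeas_norm phi : pmeas phi -> pmeas (fun z => `|phi z|).
Proof. by move=> H; apply: (measurableT_comp (@normr_measurable R setT) H). Qed.

Lemma pmeas_modc : pmeas (@modc R).
Proof. exact: (pmeas_entire (@entire_id R)). Qed.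

Lemma pmeas_sum (I : Type) (r : seq I) (F : I -> R[i] -> R) : (forall i, pmeas (F i)) ->
  pmeas (fun z => \sum_(i <- r) F i z).
Proof.
move=> H; elim: r => [|i r IH].
  have -> : (fun z => \sum_(i <- [::]) F i z) = (fun=> 0) by apply/funext => z; rewrite big_nil.
  exact: pmeas_cst.
have -> : (fun z => \sum_(i <- i :: r) F i z) = (fun z => F i z + \sum_(i <- r) F i z).
  by apply/funext => z; rewrite big_cons.
exact: pmeasD.
Qed.

Local Notation mu := (@lebesgue_measure R).

(** Applied to nonnegative functions throughout, so that Tonelli's theorem and monotonicity hold
    without integrability conditions and divergence is recorded as [+oo]. *)
Definition pint phi : \bar R := (\int[@area R]_xy (phi (cplx xy))%:E)%E.

Lemma pint_ge0 phi : (forall z, 0 <= phi z) -> (0 <= pint phi)%E.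
Proof. by move=> H; apply: integral_ge0 => xy _; rewrite lee_fin. Qed.

Lemma le_pint phi chi : pmeas phi -> pmeas chi -> (forall z, 0 <= phi z) ->
  (forall z, phi z <= chi z) -> (pint phi <= pint chi)%E.
Proof.
move=> m1 m2 p0 pc; apply: ge0_le_integral => //.
- by move=> xy _; rewrite lee_fin.
- exact/measurable_EFinP.
- exact/measurable_EFinP.
- by move=> xy _; rewrite lee_fin.
Qed.

Lemma eq_pint phi chi : (forall z, phi z = chi z) -> pint phi = pint chi.
Proof. by move=> H; congr pint; apply/funext. Qed.

Lemma pintZ phi a : pmeas phi -> (forall z, 0 <= phi z) -> 0 <= a ->
  pint (fun z => a * phi z) = (a%:E * pint phi)%E.
Proof.
move=> m1 p0 a0; rewrite /pint -ge0_integralZl_EFin //.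
- by move=> xy _; rewrite lee_fin.
- exact/measurable_EFinP.
Qed.

Lemma pintD phi chi : pmeas phi -> pmeas chi -> (forall z, 0 <= phi z) -> (forall z, 0 <= chi z) ->
  pint (fun z => phi z + chi z) = (pint phi + pint chi)%E.
Proof.
move=> m1 m2 p0 c0; rewrite /pint -ge0_integralD //.
- by move=> xy _; rewrite lee_fin.
- exact/measurable_EFinP.
- by move=> xy _; rewrite lee_fin.
- exact/measurable_EFinP.
Qed.

Lemma pint_sum (I : Type) (r : seq I) (F : I -> R[i] -> R) : (forall i, pmeas (F i)) ->
  (forall i z, 0 <= F i z) -> pint (fun z => \sum_(i <- r) F i z) = (\sum_(i <- r) pint (F i))%E.
Proof.
move=> mF F0; elim: r => [|i r IH].
  rewrite big_nil; transitivity (pint (fun=> 0)); first by apply: eq_pint => z; rewrite big_nil.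
  by rewrite /pint integral0.
rewrite big_cons -IH -pintD //; first by apply: eq_pint => z; rewrite big_cons.
- exact: pmeas_sum.
- by move=> z; apply: sumr_ge0.
Qed.

Lemma pint_yx phi : pmeas phi -> (forall z, 0 <= phi z) ->
  pint phi = (\int[mu]_y \int[mu]_x (phi (Complex x y))%:E)%E.
Proof.
by move=> m p0; rewrite /pint /area fubini_tonelli2 //; [exact/measurable_EFinP|move=> xy; rewrite lee_fin].
Qed.

Lemma pint_xy phi : pmeas phi -> (forall z, 0 <= phi z) ->
  pint phi = (\int[mu]_x \int[mu]_y (phi (Complex x y))%:E)%E.
Proof.
by move=> m p0; rewrite /pint /area fubini_tonelli1 //; [exact/measurable_EFinP|move=> xy; rewrite lee_fin].
Qed.

Lemma ge0_integral_shift u (F : R -> \bar R) : measurable_fun setT F -> (forall x, (0 <= F x)%E) ->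
  (\int[mu]_x F (x + u)%R = \int[mu]_x F x)%E.
Proof.
move=> mF F0; transitivity (\int[pushforward mu (shiftR u)]_x F x)%E; last first.
  by apply: eq_measure_integral => A mA _; exact: lebesgue_measure_shift.
by rewrite ge0_integral_pushforward //; exact: measurable_shiftR.
Qed.

Lemma ge0_integral_opp (F : R -> \bar R) : measurable_fun setT F -> (forall x, (0 <= F x)%E) ->
  (\int[mu]_x F (- x)%R = \int[mu]_x F x)%E.
Proof.
move=> mF F0; transitivity (\int[pushforward mu (-%R : _ -> measurableTypeR R)]_x F x)%E; last first.
  by apply: eq_measure_integral => A mA _; exact: lebesgue_measureN.
by rewrite ge0_integral_pushforward.
Qed.

Lemma pmeas_shift phi p : pmeas phi -> pmeas (fun z => phi (p + z)).
Proof.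
move=> m; have mm : measurable_fun setT (fun xy : R * R => (complex.Re p + xy.1, complex.Im p + xy.2) : R * R).
  by apply/measurable_fun_pairP; split; apply: measurable_funD.
have := measurableT_comp m mm; apply: eq_measurable_fun => xy _ /=.
by congr phi; apply: complex_ext; rewrite ?cReD ?cImD.
Qed.

Lemma pmeas_H phi y : pmeas phi -> measurable_fun setT (fun x : R => phi (Complex x y)).
Proof. by move=> m; apply: (measurable_fun_pair1 y m). Qed.

Lemma pmeas_V phi x : pmeas phi -> measurable_fun setT (fun y : R => phi (Complex x y)).
Proof. by move=> m; apply: (measurable_fun_pair2 x m). Qed.

Lemma pint_shift phi p : pmeas phi -> (forall z, 0 <= phi z) ->
  pint (fun z => phi (p + z)) = pint phi.
Proof.
move=> m p0; rewrite pint_xy //; last exact: pmeas_shift.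
have E x : (\int[mu]_y (phi (p + Complex x y))%:E)%E = (\int[mu]_y (phi (Complex (x + complex.Re p) y))%:E)%E.
  rewrite -(@ge0_integral_shift (complex.Im p) (fun y => (phi (Complex (x + complex.Re p) y))%:E)) //.
  - by apply: eq_integral => y _; congr (phi _)%:E; apply: complex_ext; rewrite ?cReD ?cImD /= addrC.
  - by apply/measurable_EFinP; exact: pmeas_V.
  - by move=> y; rewrite lee_fin.
under eq_integral => x _ do rewrite E.
rewrite (@ge0_integral_shift (complex.Re p) (fun x => (\int[mu]_y (phi (Complex x y))%:E)%E)).
- by rewrite -pint_xy.
- have mF : measurable_fun [set: R * R] (fun xy => (phi (cplx xy))%:E) by exact/measurable_EFinP.
  by apply: (measurable_fun_fubini_tonelli_F (m2 := mu) _ mF) => xy; rewrite lee_fin.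
- by move=> x; apply: integral_ge0 => y _; rewrite lee_fin.
Qed.

End Plane.

(** * Derivatives of entire functions, Liouville's theorem and primitives along rays *)

Section Derivative.
Local Open Scope classical_set_scope.
Local Open Scope ring_scope.
Context {R : realType}.
Implicit Types (a b c d u s t x y M : R) (z w p h : R[i]) (f g : R[i] -> R[i]).
Local Notation mu := (@lebesgue_measure R).
Local Notation cbd := (@cauchy_bd R).

Lemma onsq_modc_le s w : 0 < s -> onsq s w -> modc w <= 2 * s.
Proof. by move=> s0 /(onsq_modc s0)/andP[]. Qed.

(** The Taylor estimate with one term has remainder zero at the origin. *)
Lemma tcoef0 f : entire f -> tcoef f 0 = f 0.
Proof.
move=> hf; have [M M0 hM] := entire_bounded 2 hf.
have /= := @taylor _ f 1 1 M 0 hf ltr01.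
rewrite modc0 mul0r expr1 mulr0 big_ord_recl big_ord0 /= expr0 mulr1 addr0.
move=> /(_ _ _) hh; have : modc (f 0 - tcoef f 0) <= 0.
  by apply: hh; [lra|move=> w /(onsq_modc_le ltr01); rewrite mulr1; exact: hM].
rewrite le_eqVlt ltNge modc_ge0 orbF modc_eq0 subr_eq0 => /eqP ->; by [].
Qed.

Lemma tcoef_shift_bound f z s M k : entire f -> 0 < s ->
  (forall w, modc w <= 2 * s -> modc (f (z + w)) <= M) ->
  modc (tcoef (fun w => f (z + w)) k) <= cbd * M / s ^+ k.
Proof.
move=> hf s0 hM; apply: (@tcoef_bound R (fun w => f (z + w)) k s M (@entire_shift R f z hf) s0).
by move=> w /(onsq_modc_le s0); exact: hM.
Qed.

Lemma taylor2_aux f z h s M : entire f -> 0 < s -> modc h <= s / 2 ->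
  (forall w, modc w <= 2 * s -> modc (f (z + w)) <= M) ->
  modc (f (z + h) - f z - tcoef (fun w => f (z + w)) 1 * h) <= cbd * M * (modc h / s) ^+ 2.
Proof.
move=> hf s0 hs hM; have hfz := @entire_shift R f z hf.
have := @taylor _ _ 2 s M h hfz s0 hs; rewrite !big_ord_recl big_ord0 /= tcoef0 // addr0.
rewrite expr0 mulr1 expr1 addr0 /bump /= opprD addrA; apply => w /(onsq_modc_le s0); exact: hM.
Qed.

Lemma cderiv_tcoef f z : entire f -> cderiv f z = tcoef (fun w => f (z + w)) 1.
Proof.
move=> hf; have [M M0 hM] := entire_bounded 2 (@entire_shift R f z hf).
apply: cdiff_cderiv; apply: (@cdiff_sqr _ _ _ _ (cbd * M) (1 / 2)); first by lra.
move=> h hh; have := @taylor2_aux f z h 1 M hf ltr01; rewrite mulr1 divr1; apply; [lra|exact: hM].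
Qed.

Lemma taylor2 f z h s M : entire f -> 0 < s -> modc h <= s / 2 ->
  (forall w, modc w <= 2 * s -> modc (f (z + w)) <= M) ->
  modc (f (z + h) - f z - cderiv f z * h) <= cbd * M * (modc h / s) ^+ 2.
Proof. by move=> hf; rewrite cderiv_tcoef //; exact: taylor2_aux. Qed.

Lemma cderiv_bound f z s M : entire f -> 0 < s ->
  (forall w, modc w <= 2 * s -> modc (f (z + w)) <= M) ->
  modc (cderiv f z) <= cbd * M / s.
Proof.
by move=> hf s0 hM; rewrite cderiv_tcoef //; have := tcoef_shift_bound 1 hf s0 hM; rewrite expr1.
Qed.

Lemma taylor1 f z h s M : entire f -> 0 < s -> modc h <= s / 2 ->
  (forall w, modc w <= 2 * s -> modc (f (z + w)) <= M) ->
  modc (f (z + h) - f z) <= cbd * M * (modc h / s).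
Proof.
move=> hf s0 hs hM; have hfz := @entire_shift R f z hf.
have := @taylor _ _ 1 s M h hfz s0 hs; rewrite !big_ord_recl big_ord0 /= tcoef0 // addr0.
rewrite expr0 mulr1 expr1 addr0; apply => w /(onsq_modc_le s0); exact: hM.
Qed.

Lemma contin_shift f z p : contin f (p + z) -> contin (fun w => f (p + w)) z.
Proof. by move=> H e /H [r r0 hr]; exists r => // h /hr; rewrite addrA. Qed.

Lemma crect_sq2 f : (forall w, contin f w) -> crect (fun w : R[i] => f w / w ^+ 2) (- 1) 1 (- 1) 1.
Proof.
move=> H; apply: crectM; first exact: contin_crect'.
apply: hol_crect; try lra; move=> w ow; apply: holVX; exact: onsq_neq0 ow.
Qed.

(** Cauchy's estimate is applied to f(w + h) - f(w), which is O(h) uniformly near [z] by the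
    first-order Taylor bound. *)
Lemma cderiv_contin f z : entire f -> contin (cderiv f) z.
Proof.
move=> hf e e0; have [M M0 hM] := entire_bounded 10 (@entire_shift R f z hf).
set C := cbd * (16 * (cbd * M)) + 1.
have C0 : 0 < C.
  have cbM := mulr_gt0 (cauchy_bd_gt0 (R := R)) M0.
  have := mulr_gt0 (cauchy_bd_gt0 (R := R)) (mulr_gt0 (ltr0n R 16) cbM); rewrite /C; lra.
exists (Num.min (1 / 2) (e / C)); first by rewrite lt_min !divr_gt0.
move=> h; rewrite lt_min => /andP[h1]; rewrite ltr_pdivlMr // => h2.
have hg : entire (fun w => f (w + h) - f w).
  have hfh : entire (fun w => f (w + h)) by apply: (entire_ext _ (@entire_shift R f h hf)) => w; rewrite addrC.
  exact: (entireB hfh hf).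
have dg : cderiv (fun w => f (w + h) - f w) z = cderiv f (z + h) - cderiv f z.
  apply: cdiff_cderiv; apply: cdiffB; last exact: entire_cdiff.
  have E : (fun w => f (w + h)) = (fun w => f (h + w)) by apply/funext => w; rewrite addrC.
  by rewrite E; apply: cdiff_shift; rewrite [h + z]addrC; exact: entire_cdiff.
have bd w : modc w <= 2 * 1 -> modc (f (z + w + h) - f (z + w)) <= cbd * M * modc h.
  rewrite mulr1 => w2; have := @taylor1 f (z + w) h 1 M hf ltr01; rewrite divr1; apply; first lra.
  by move=> v hv; rewrite -addrA; apply: hM; have := modcD w v; lra.
have := cderiv_bound hg ltr01 bd; rewrite dg divr1 => k; apply: le_trans k _.
have := modc_ge0 h; have := cauchy_bd_gt0 (R := R) => cb hh.
have : cbd * (cbd * M * modc h) <= modc h * C.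
  rewrite /C; have -> : cbd * (cbd * M * modc h) = modc h * (cbd * (cbd * M)) by ring.
  rewrite ler_wpM2l //; have cbM := mulr_gt0 cb (mulr_gt0 cb M0).
  have -> : cbd * (16 * (cbd * M)) = 16 * (cbd * (cbd * M)) by ring.
  lra.
lra.
Qed.

(** Each derivative is a contour integral of f(z + w)/w^2 over a fixed square. The second-order
    Taylor bound for [f] is uniform on that square, so differentiation passes under the integral. *)
Lemma entire_cderiv f : entire f -> entire (cderiv f).
Proof.
move=> hf; apply/entireP => z; have [M M0 hM] := entire_bounded 10 (@entire_shift R f z hf).
have c0 := cauchy_cst_neq0 (R := R); have mc0 : 0 < modc (@cauchy_cst R) by rewrite modc_gt0.
have cS p : forall w, contin (fun w => f (p + w)) w by move=> w; apply: contin_shift; exact: entire_contin.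
have cS' p : forall w, contin (fun w => cderiv f (p + w)) w by move=> w; apply: contin_shift; exact: cderiv_contin.
exists (cauchy_cst^-1 * sqint 1 (fun w => cderiv f (z + w) / w ^+ 2)).
apply: (@cdiff_sqr _ _ _ _ ((modc (@cauchy_cst R))^-1 * (16 * (cbd * M))) (1 / 2)); first lra.
move=> h hh.
rewrite !cderiv_tcoef // /tcoef.
set A := sqint _ _; set B := sqint _ _; set D := sqint _ _.
have -> : cauchy_cst^-1 * A - cauchy_cst^-1 * B - cauchy_cst^-1 * D * h = cauchy_cst^-1 * (A - B - h * D) by ring.
have cA := crect_sq2 (cS (z + h)); have cB := crect_sq2 (cS z); have cD := crect_sq2 (cS' z).
rewrite /A /B /D /sqint -rectintZ // -rectintB // -rectintB //; last 2 first.
- exact: crectB.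
- exact: crectZ.
rewrite modcM modcV -mulrA; apply: ler_wpM2l; first by rewrite invr_ge0 ltW.
have -> : 16 * (cbd * M) * modc h ^+ 2 = 16 * 1 * (cbd * M * modc h ^+ 2) by ring.
rewrite -/(sqint 1 _); apply: sqint_bound => //; first by apply: crectB; [exact: crectB|exact: crectZ].
move=> w ow; have /andP[w1 w2] := onsq_modc ltr01 ow; have w0 := onsq_neq0 ltr01 ow.
have -> : f (z + h + w) / w ^+ 2 - f (z + w) / w ^+ 2 - h * (cderiv f (z + w) / w ^+ 2) =
  (f (z + w + h) - f (z + w) - cderiv f (z + w) * h) / w ^+ 2.
  by rewrite [z + h + w]addrAC; ring.
rewrite modcf_div modcX ler_pdivrMr ?exprn_gt0 //; last lra.
apply: (@le_trans _ _ (cbd * M * modc h ^+ 2)).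
  have := @taylor2 f (z + w) h 1 M hf ltr01; rewrite divr1; apply; first lra.
  by move=> v hv; rewrite -addrA; apply: hM; have := modcD w v; lra.
have cbM : 0 <= cbd * M * modc h ^+ 2 by rewrite mulr_ge0 ?sqr_ge0 // ltW // mulr_gt0 // cauchy_bd_gt0.
rewrite ler_peMr //.
by rewrite exprn_ege1 //; lra.
Qed.

(** Two Taylor terms on a square of half-side 1/e leave a remainder of order (1/e) (|z| e)^2 = O(e),
    since linear growth gives the bound [3 * C / e] on that square. *)
Lemma liouville_linear f : entire f ->
  (exists C, forall z, modc (f z) <= C * (1 + modc z)) ->
  exists a b : R[i], forall z, f z = a * z + b.
Proof.
move=> hf [C hC]; exists (tcoef f 1), (f 0) => z.
have C0 : 0 <= C by have := hC 0; rewrite modc0 addr0 mulr1; apply: le_trans; exact: modc_ge0.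
apply/eqP; rewrite -subr_eq0; apply/eqP.
have r0 : 0 < (2 * modc z + 1)^-1 by rewrite invr_gt0; have := modc_ge0 z; lra.
apply: (@small_modc_eq0 _ _ (cbd * (3 * C) * modc z ^+ 2) _ r0) => e e0 er.
have zz := modc_ge0 z.
have s0 : 0 < e^-1 by rewrite invr_gt0.
have s1 : 2 * modc z + 1 < e^-1 by rewrite -[2 * _ + 1]invrK ltf_pV2.
have := @taylor _ f 2 e^-1 (C * (3 * e^-1)) z hf s0.
rewrite !big_ord_recl big_ord0 /= tcoef0 // expr0 mulr1 expr1 addr0 /bump /= => H.
have -> : f z - (tcoef f 1 * z + f 0) = f z - (f 0 + tcoef f 1 * z) by ring.
apply: (le_trans (H _ _)).
- lra.
- move=> w /(onsq_modc_le s0) hw; apply: le_trans (hC w) _; rewrite ler_wpM2l //; lra.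
- rewrite invrK le_eqVlt; apply/orP; left; apply/eqP; field; exact: lt0r_neq0.
Qed.

Lemma is_derive_path f z t : entire f ->
  is_derive t 1 (fun t : R => complex.Re (f (t%:C%C * z))) (complex.Re (cderiv f (t%:C%C * z) * z)) /\
  is_derive t 1 (fun t : R => complex.Im (f (t%:C%C * z))) (complex.Im (cderiv f (t%:C%C * z) * z)).
Proof.
move=> hf; set d := cderiv f _.
have H e : 0 < e -> exists2 r, 0 < r & forall h : R, `|h| < r ->
    modc (f ((h + t)%:C%C * z) - f (t%:C%C * z) - h%:C%C * (d * z)) <= e * `|h|.
  move=> e0; have z1 : 0 < modc z + 1 by have := modc_ge0 z; lra.
  have [|r r0 hr] := entire_cdiff (t%:C%C * z) hf (e := e / (modc z + 1)); first by rewrite divr_gt0.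
  exists (r / (modc z + 1)); first by rewrite divr_gt0.
  move=> h; rewrite ltr_pdivlMr // => hh.
  have mhz : modc (h%:C%C * z) <= `|h| * (modc z + 1).
    by rewrite modcM modc_real ler_wpM2l // lerDl.
  have := hr (h%:C%C * z) (le_lt_trans mhz hh); rewrite -/d.
  have -> : t%:C%C * z + h%:C%C * z = (h + t)%:C%C * z by rewrite rmorphD /=; ring.
  have -> : d * (h%:C%C * z) = h%:C%C * (d * z) by ring.
  move=> k; apply: le_trans k _; apply: le_trans (ler_wpM2l _ mhz) _.
    by rewrite divr_ge0 // ltW.
  by rewrite le_eqVlt; apply/orP; left; apply/eqP; field; exact: lt0r_neq0.
have key (u : R -> R) (d' : R) : (forall e, 0 < e -> exists2 r, 0 < r & forall h : R, `|h| < r ->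
    `|u (h + t) - u t - h * d'| <= e * `|h|) -> is_derive t 1 u d'.
  move=> K; have lim : (fun h : R => h^-1 *: ((u \o shift t) (h *: 1) - u t)) @ 0^' --> d'.
    apply/cvgrPdist_le => e e0; have [r r0 hr] := K e e0.
    rewrite near_withinE; apply/nbhs_ballP; exists r => // h; rewrite /ball /= sub0r normrN => hh h0.
    have -> : h *: (1 : R) = h by rewrite /GRing.scale /= mulr1.
    have -> : d' - h^-1 *: (u (h + t) - u t) = - (h^-1 * (u (h + t) - u t - h * d')).
      by rewrite /GRing.scale /=; field.
    rewrite normrN normrM normfV mulrC ler_pdivrMr ?normr_gt0 //; exact: hr.
  apply: DeriveDef; first by apply/cvg_ex; exists d'.
  by rewrite /derive; apply: cvg_lim lim.
split; apply: key => e e0; have [r r0 hr] := H e e0; exists r => // h /hr k; apply: le_trans _ k.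
- by apply: le_trans _ (Re_le_modc _); rewrite !cReB [complex.Re (h%:C%C * _)]cReM /= mul0r subr0.
- by apply: le_trans _ (Im_le_modc _); rewrite !cImB [complex.Im (h%:C%C * _)]cImM /= mul0r addr0.
Qed.

Lemma ccont_path f z a b : (forall w, contin f w) -> ccont_on a b (fun t => f (t%:C%C * z)).
Proof.
move=> hf t _ e e0; have [r r0 hr] := hf (t%:C%C * z) e e0.
have z1 : 0 < modc z + 1 by have := modc_ge0 z; lra.
exists (r / (modc z + 1)); first by rewrite divr_gt0.
move=> s _; rewrite ltr_pdivlMr // => st.
have -> : s%:C%C * z = t%:C%C * z + (s - t)%:C%C * z by rewrite rmorphB /=; ring.
apply: hr; rewrite modcM modc_real; apply: le_lt_trans _ st; rewrite ler_wpM2l // lerDl; lra.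
Qed.

Lemma rint_FTC (u v : R -> R) : (forall t : R, is_derive t 1 u (v t)) -> rcont_on 0 1 v ->
  rint 0 1 v = u 1 - u 0.
Proof.
move=> H cv; have cu (t : R) : {for t, continuous u}.
  by apply: differentiable_continuous; apply/derivable1_diffP; have [] := H t.
rewrite /rint /Rintegral (@continuous_FTC2 _ v u 0 1) //.
- exact: rcont_on_within.
- split.
  + by move=> x _; have [] := H x.
  + apply: cvg_at_right_filter; exact: cu.
  + apply: cvg_at_left_filter; exact: cu.
- by move=> x _; rewrite derive1E; have [] := H x.
Qed.

Lemma entire_FTC f z : entire f -> f z - f 0 = z * cint 0 1 (fun t => cderiv f (t%:C%C * z)).
Proof.
move=> hf; have hc := @ccont_path (cderiv f) z 0 1 (fun w => @cderiv_contin f w hf).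
rewrite -cintZ //; have hcz := ccont_onZ z hc.
have E : (fun t : R => cderiv f (t%:C%C * z) * z) = (fun t : R => z * cderiv f (t%:C%C * z)).
  by apply/funext => t; rewrite mulrC.
apply: complex_ext => /=.
- have Hd t : is_derive t 1 (fun t : R => complex.Re (f (t%:C%C * z))) (complex.Re (z * cderiv f (t%:C%C * z))).
    by rewrite mulrC; case: (is_derive_path z t hf).
  by have := rint_FTC Hd (ccont_on_Re hcz); rewrite mul1r mul0r cReB.
- have Hd t : is_derive t 1 (fun t : R => complex.Im (f (t%:C%C * z))) (complex.Im (z * cderiv f (t%:C%C * z))).
    by rewrite mulrC; case: (is_derive_path z t hf).
  by have := rint_FTC Hd (ccont_on_Im hcz); rewrite mul1r mul0r cImB.
Qed.

Lemma segintE f z : segint f z = z * cint 0 1 (fun t => f (t%:C%C * z)).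
Proof. by []. Qed.

(** [segint f] is z times [Phi z], the mean of [f] over the ray from 0 to z. The product rule gives
    Phi z + z Psi z, and the fundamental theorem along the ray, applied to w f(w), identifies this
    with f(z). *)
Lemma cdiff_segint f z : entire f -> cdiff (segint f) z (f z).
Proof.
move=> hf; have [M M0 hM] := entire_bounded (modc z + 10) hf.
pose Phi z := cint 0 1 (fun t => f (t%:C%C * z)).
pose Psi z := cint 0 1 (fun t => t%:C%C * cderiv f (t%:C%C * z)).
have cf v : ccont_on 0 1 (fun t : R => f (t%:C%C * v)) by apply: ccont_path => w; exact: entire_contin.
have cf' v : ccont_on 0 1 (fun t : R => t%:C%C * cderiv f (t%:C%C * v)).
  by apply: ccont_onM; [exact: ccont_on_id|apply: ccont_path => w; exact: cderiv_contin].
have dPhi : cdiff Phi z (Psi z).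
  apply: (@cdiff_sqr _ _ _ _ (2 * (cbd * M)) (1 / 2)); first lra.
  move=> h hh; rewrite /Phi /Psi mulrC -cintZ // -!cintB //; last 2 first.
  - exact: ccont_onB.
  - exact: ccont_onZ.
  have -> : 2 * (cbd * M) * modc h ^+ 2 = 2 * (cbd * M * modc h ^+ 2) * (1 - 0) by ring.
  apply: cint_bound => //; first by apply: ccont_onB; [exact: ccont_onB|exact: ccont_onZ].
  move=> t /andP[t0 t1].
  have mt : modc (t%:C%C * h) <= modc h by rewrite modcM modc_real ger0_norm // ler_piMl // modc_ge0.
  have := @taylor2 f (t%:C%C * z) (t%:C%C * h) 1 M hf ltr01; rewrite divr1 mulrDr => k.
  have -> : h * (t%:C%C * cderiv f (t%:C%C * z)) = cderiv f (t%:C%C * z) * (t%:C%C * h) by ring.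
  apply: le_trans (k _ _) _; first lra.
    move=> w w2; apply: hM; apply: le_trans (modcD _ _) _.
    rewrite modcM modc_real ger0_norm //; have : t * modc z <= modc z by rewrite ler_piMl // modc_ge0.
    lra.
  have cbM : 0 <= cbd * M by rewrite ltW // mulr_gt0 // cauchy_bd_gt0.
  by rewrite (ler_wpM2l cbM) // lerXn2r ?nnegrE ?modc_ge0.
have := cdiffM (cdiff_id z) dPhi; rewrite mul1r.
suff -> : Phi z + id z * Psi z = f z by [].
(* The identification divides by [z]; at the origin the mean is that of a constant. *)
have [->|z0] := eqVneq z 0.
  rewrite mul0r addr0 /Phi; under eq_cint => t _ do rewrite mulr0.
  by rewrite cint_cst // subr0 mulr1.
apply: (mulfI z0).
have hk : entire (fun w => w * f w) := entireM (@entire_id R) hf.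
have := entire_FTC z hk; rewrite mul0r subr0 => ->; congr (_ * _).
rewrite /Phi /Psi -cintZ // -cintD //; last exact: ccont_onZ.
apply: eq_cint => t _.
rewrite (cdiff_cderiv (cdiffM (cdiff_id _) (entire_cdiff _ hf))) /=; ring.
Qed.

Lemma entire_segint f : entire f -> entire (segint f).
Proof. by move=> hf; apply/entireP => z; exists (f z); exact: cdiff_segint. Qed.

Lemma cderiv_segint f z : entire f -> cderiv (segint f) z = f z.
Proof. by move=> hf; apply: cdiff_cderiv; exact: cdiff_segint. Qed.

Lemma cderiv0_cst f : entire f -> (forall z, cderiv f z = 0) -> forall z, f z = f 0.
Proof.
move=> hf H z; apply/eqP; rewrite -subr_eq0 entire_FTC //.
by under eq_cint => t _ do rewrite H; rewrite cint_cst // mul0r mulr0.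
Qed.

End Derivative.

(** * Sub-mean value inequality for powers *)

Section SubMean.
Local Open Scope classical_set_scope.
Local Open Scope ring_scope.
Context {R : realType}.
Implicit Types (a b c d u s t x y M q : R) (z w p h v : R[i]) (f g : R[i] -> R[i]).
Local Notation mu := (@lebesgue_measure R).
Local Notation cbd := (@cauchy_bd R).

Definition indsq s z : R := ((`|complex.Re z| <= s) && (`|complex.Im z| <= s))%:R.

Lemma indsq_ge0 s z : 0 <= indsq s z. Proof. exact: ler0n. Qed.
Lemma pmeas_indsq s : pmeas (indsq s).
Proof.
have mB : measurable (`[- s, s] `*` `[- s, s] : set (R * R)) by apply: measurableX.
have := @measurable_indic _ _ R setT _ mB; apply: eq_measurable_fun => xy _.
rewrite /indsq indicE; congr (nat_of_bool _)%:R; rewrite !ler_norml.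
apply/idP/idP => [|/andP[h1 h2]].
  by rewrite inE => -[]; rewrite /= !in_itv /= => -> ->.
by rewrite inE; split; rewrite /= in_itv.
Qed.

Lemma pint_indsq s : 0 <= s -> pint (indsq s) = (4 * s ^+ 2)%:E.
Proof.
move=> s0; rewrite pint_xy; [|exact: pmeas_indsq|exact: indsq_ge0].
pose i1 (y : R) : R := (nat_of_bool (`|y| <= s)%R)%:R.
have E (c : R) : 0 <= c -> (\int[mu]_y (c * i1 y)%:E = (c * (2 * s))%:E)%E.
  move=> c0; have -> : (fun y : R => (c * i1 y)%:E) = (cst c%:E) \_ `[- s, s].
    apply/funext => y; rewrite patchE mem_setE in_itv /= /i1 ler_norml.
    by case: ifP => _; rewrite ?mulr1 ?mulr0.
  rewrite -integral_mkcond integral_cst //= lebesgue_measure_itv /= lte_fin.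
  have -> : (- s < s) = (0 < s) by rewrite -subr_gt0 opprK; apply/idP/idP; lra.
  case: ltgtP s0 => // [s0 _|<- _]; last by rewrite mule0 !mulr0.
  by rewrite -EFinB -EFinM; congr (_%:E); ring.
have -> : (fun x : R => \int[mu]_y (indsq s (Complex x y))%:E)%E = (fun x : R => (2 * s * i1 x)%:E).
  apply/funext => x; transitivity (\int[mu]_y (i1 x * i1 y)%:E)%E.
    by apply: eq_integral => y _; rewrite /indsq /= -mulnb natrM.
  by rewrite E ?ler0n // mulrC.
by rewrite E ?mulr_ge0 //; congr (_%:E); ring.
Qed.

Lemma rint_EFin a b (F : R -> R) : rcont_on a b F ->
  (rint a b F)%:E = (\int[mu]_(x in `[a, b]) (F x)%:E)%E.
Proof. by move=> H; rewrite /rint /Rintegral fineK // integrable_fin_num //; exact: rint_integrable. Qed.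

Lemma rint_le_integral a b (F : R -> R) (G : R -> R) : rcont_on a b F ->
  (forall x, a <= x <= b -> 0 <= F x <= G x) -> measurable_fun setT G -> (forall x, 0 <= G x) ->
  ((rint a b F)%:E <= \int[mu]_x (G x)%:E)%E.
Proof.
move=> H FG mG G0; rewrite rint_EFin //.
have mF : measurable_fun `[a, b] (EFin \o F) by have /integrableP[] := rint_integrable H.
apply: (@le_trans _ _ (\int[mu]_(x in `[a, b]) (G x)%:E)%E).
  apply: ge0_le_integral => //.
  - by move=> x; rewrite /= in_itv /= => /FG/andP[]; rewrite lee_fin.
  - by apply/measurable_EFinP; apply: measurable_funTS.
  - by move=> x; rewrite /= in_itv /= => /FG/andP[]; rewrite lee_fin.
apply: ge0_subset_integral => //; first exact/measurable_EFinP.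
by move=> x _; rewrite lee_fin.
Qed.

(** Cauchy's formula over the square of half-side [t] is integrated over [t] between [s / 2] and
    [s]: the line integrals over the four sides become slices of the area integral. *)
Lemma area_mean f s : entire f -> 0 < s ->
  ((modc (f 0))%:E <= (cbd / s ^+ 2)%:E * pint (fun z => modc (f z) * indsq s z)%R)%E.
Proof.
move=> hf s0; set Phi := (fun z : R[i] => modc (f z) * indsq s z).
have mPhi : pmeas Phi by apply: pmeasM; [exact: pmeas_entire|exact: pmeas_indsq].
have Phi0 z : 0 <= Phi z by rewrite mulr_ge0 ?modc_ge0 ?indsq_ge0.
(* [B] and [A] are the slices along horizontal and vertical lines; the reflected [B'] and [A'] below
   account for the two opposite sides. *)
pose B t := (\int[mu]_x (Phi (Complex x t))%:E)%E.
pose A t := (\int[mu]_y (Phi (Complex t y))%:E)%E.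
have B0 t : (0 <= B t)%E by apply: integral_ge0 => x _; rewrite lee_fin.
have A0 t : (0 <= A t)%E by apply: integral_ge0 => x _; rewrite lee_fin.
have mPhiE : measurable_fun [set: R * R] (fun xy => (Phi (cplx xy))%:E) by exact/measurable_EFinP.
have mA : measurable_fun setT A.
  by apply: (measurable_fun_fubini_tonelli_F (m2 := mu) _ mPhiE) => xy; rewrite lee_fin.
have mB : measurable_fun setT B.
  by apply: (measurable_fun_fubini_tonelli_G (m1 := mu) _ mPhiE) => xy; rewrite lee_fin.
have mopp : measurable_fun setT (fun t : R => - t) by apply: oppr_measurable.
pose A' t := A (- t)%R; pose B' t := B (- t)%R; pose K4 : R := 4 / s.
have K40 : 0 <= K4 by rewrite divr_ge0 // ltW.
have A'0 t : (0 <= A' t)%E by exact: A0.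
have B'0 t : (0 <= B' t)%E by exact: B0.
have mA' : measurable_fun setT A' := measurableT_comp mA mopp.
have mB' : measurable_fun setT B' := measurableT_comp mB mopp.
set c1 := modc (@cauchy_cst R) * modc (f 0).
have mc0 : 0 < modc (@cauchy_cst R) by rewrite modc_gt0 cauchy_cst_neq0.
have c10 : 0 <= c1 by rewrite mulr_ge0 ?modc_ge0.
have key t : s / 2 <= t <= s -> (c1%:E <= K4%:E * ((B' t + B t) + (A t + A' t)))%E.
  move=> /andP[ts st]; have t0 : 0 < t by lra.
  have cw : crect (fun w => f w / (w - 0)) (- t) t (- t) t.
    apply: hol_crect; try lra; move=> w ow; apply: holM; first exact: entire_hol.
    by apply: hol_invB; exact: onsq_neq0 ow.
  have := @cauchy_formula _ f 0 t t0; rewrite /= normr0 => /(_ t0 t0 (fun z _ => entire_hol z hf)) E.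
  have : c1 <= modc (sqint t (fun w => f w / (w - 0))) by rewrite E modcM.
  have cc : crect f (- t) t (- t) t by exact: entire_crect.
  have side (F : R -> R[i]) (G : R -> R[i]) : ccont_on (- t) t F -> ccont_on (- t) t G ->
      (forall x, - t <= x <= t -> modc (F x) <= 2 / s * modc (G x)) ->
      modc (cint (- t) t F) <= 4 / s * rint (- t) t (fun x => modc (G x)).
    move=> cF cG FG; apply: le_trans (cint_le cF) _.
    have hG := ccont_on_modc cG.
    have -> : 4 / s * rint (- t) t (fun x => modc (G x)) = 2 * (2 / s * rint (- t) t (fun x => modc (G x))) by field; lra.
    rewrite ler_wpM2l // -rintZ //; apply: le_rint => //; first exact: ccont_on_modc.
    have s20 : 0 <= 2 / s by rewrite divr_ge0 // ltW.
    move=> y yab e e0; have [r r0 hr] := ccont_on_modc (ccont_onZ (2 / s)%:C%C cG) yab e0.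
    exists r => // x xab xy.
    by have := hr x xab xy; rewrite !modcM modc_real (ger0_norm s20).
  have fw w : onsq t w -> modc (f w / (w - 0)) <= 2 / s * modc (f w).
    move=> ow; have /andP[w1 w2] := onsq_modc t0 ow.
    rewrite subr0 modcf_div mulrC ler_wpM2r ?modc_ge0 // -[2 / s]invf_div lef_pV2 ?posrE ?divr_gt0 //; lra.
  case: cw => w1 w2 w3 w4; case: cc => h1 h2 h3 h4 k0.
  have k1 := side _ _ w1 h1 (fun x xab => fw _ (or_introl (ex_intro2 _ _ x xab (or_introl erefl)))).
  have k2 := side _ _ w2 h2 (fun x xab => fw _ (or_introl (ex_intro2 _ _ x xab (or_intror erefl)))).
  have k3 := side _ _ w3 h3 (fun x xab => fw _ (or_intror (ex_intro2 _ _ x xab (or_introl erefl)))).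
  have k4 := side _ _ w4 h4 (fun x xab => fw _ (or_intror (ex_intro2 _ _ x xab (or_intror erefl)))).
  set R1 := rint _ _ _ in k1; set R2 := rint _ _ _ in k2; set R3 := rint _ _ _ in k3; set R4 := rint _ _ _ in k4.
  have k5 : c1 <= 4 / s * ((R1 + R2) + (R4 + R3)).
    apply: le_trans k0 _; rewrite /sqint /rectint; apply: le_trans (modcD _ _) _; rewrite modcM modc_i mul1r.
    apply: (le_trans (lerD (modcB _ _) (modcB _ _))).
    by rewrite !mulrDr; exact: lerD (lerD k1 k2) (lerD k4 k3).
  have s40 : 0 <= 4 / s by rewrite divr_ge0 // ltW.
  apply: (@le_trans _ _ (K4%:E * ((R1%:E + R2%:E) + (R4%:E + R3%:E)))%E).
    by rewrite -!EFinD -EFinM lee_fin.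
  apply: lee_wpmul2l; first by rewrite lee_fin.
  have bd z : `|complex.Re z| <= s -> `|complex.Im z| <= s -> 0 <= modc (f z) <= Phi z.
    by move=> z1 z2; rewrite modc_ge0 /Phi /indsq z1 z2 mulr1 lexx.
  have nt : `|- t| <= s by rewrite normrN gtr0_norm.
  have nt' : `|t| <= s by rewrite gtr0_norm.
  have xs x : - t <= x <= t -> `|x| <= s by rewrite -ler_norml => xt; exact: le_trans xt st.
  apply: leeD; apply: leeD; apply: rint_le_integral => //.
  - exact: ccont_on_modc.
  - by move=> x /xs xx; apply: bd.
  - exact: pmeas_H.
  - exact: ccont_on_modc.
  - by move=> x /xs xx; apply: bd.
  - exact: pmeas_H.
  - exact: ccont_on_modc.
  - by move=> x /xs xx; apply: bd.
  - exact: pmeas_V.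
  - exact: ccont_on_modc.
  - by move=> x /xs xx; apply: bd.
  - exact: pmeas_V.
have mS : measurable_fun setT (fun t => K4%:E * ((B' t + B t) + (A t + A' t)))%E.
  by apply: emeasurable_funM => //; apply: emeasurable_funD; apply: emeasurable_funD.
have S0 t : (0 <= K4%:E * ((B' t + B t) + (A t + A' t)))%E.
  apply: mule_ge0; first by rewrite lee_fin.
  by apply: adde_ge0; apply: adde_ge0; [exact: B'0|exact: B0|exact: A0|exact: A'0].
have step1 : ((c1 * (s / 2))%:E <= \int[mu]_t (K4%:E * ((B' t + B t) + (A t + A' t))))%E.
  have -> : ((c1 * (s / 2))%:E = \int[mu]_(t in `[(s / 2)%R, s]) (cst c1%:E) t)%E.
    rewrite integral_cst //= lebesgue_measure_itv /= lte_fin.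
    have -> : s / 2 < s by lra.
    by rewrite -EFinB -EFinM; congr (_%:E); field.
  apply: (@le_trans _ _ (\int[mu]_(t in `[(s / 2)%R, s]) (K4%:E * ((B' t + B t) + (A t + A' t))))%E).
    apply: ge0_le_integral => //.
    - by apply: measurable_funTS.
  exact: ge0_subset_integral.
have tot : (\int[mu]_t (K4%:E * ((B' t + B t) + (A t + A' t))) = (16 / s)%:E * pint Phi)%E.
  have S1 t : (0 <= B' t + B t)%E by rewrite adde_ge0 ?B0 ?B'0.
  have S2 t : (0 <= A t + A' t)%E by rewrite adde_ge0 ?A0 ?A'0.
  have S3 t : (0 <= (B' t + B t) + (A t + A' t))%E := adde_ge0 (S1 t) (S2 t).
  have EB : (\int[mu]_t B' t = \int[mu]_t B t)%E := ge0_integral_opp mB B0.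
  have EA : (\int[mu]_t A' t = \int[mu]_t A t)%E := ge0_integral_opp mA A0.
  have m1 : measurable_fun setT (fun t => (B' t + B t)%E) by apply: emeasurable_funD.
  have m2 : measurable_fun setT (fun t => (A t + A' t)%E) by apply: emeasurable_funD.
  have m3 : measurable_fun setT (fun t => ((B' t + B t) + (A t + A' t))%E) by apply: emeasurable_funD.
  have I0 := @ge0_integralZl_EFin _ _ _ mu setT measurableT _ (fun t _ => S3 t) m3 _ K40.
  have I1 := @ge0_integralD _ _ _ mu setT measurableT _ _ (fun t _ => B'0 t) mB' (fun t _ => B0 t) mB.
  have I2 := @ge0_integralD _ _ _ mu setT measurableT _ _ (fun t _ => A0 t) mA (fun t _ => A'0 t) mA'.
  have I3 := @ge0_integralD _ _ _ mu setT measurableT _ _ (fun t _ => S1 t) m1 (fun t _ => S2 t) m2.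
  rewrite I0 I3 I1 I2 EA EB /K4.
  rewrite -[(\int[mu]_x B x)%E](pint_yx mPhi Phi0) -[(\int[mu]_x A x)%E](pint_xy mPhi Phi0).
  have P0 := pint_ge0 Phi0.
  clear -s0 P0; move: (pint Phi) P0 => [r||] //= r0.
  - by rewrite -!EFinD -!EFinM; congr (_%:E); field; lra.
  - by rewrite !addye // !gt0_muley ?lte_fin ?divr_gt0.
move: step1; rewrite tot; have := pint_ge0 Phi0; case: (pint Phi) => [r||] //= r0.
- rewrite -!EFinM !lee_fin => k; rewrite /c1 in k.
  rewrite /cauchy_bd; have -> : 32 / modc (@cauchy_cst R) / s ^+ 2 * r = (16 / s * r) * (2 / (modc (@cauchy_cst R) * s)) by field; lra.
  have -> : modc (f 0) = modc (@cauchy_cst R) * modc (f 0) * (s / 2) * (2 / (modc (@cauchy_cst R) * s)) by field; lra.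
  by rewrite ler_wpM2r // divr_ge0 // mulr_ge0 // ltW.
- by move=> _; rewrite gt0_muley ?leey // lte_fin divr_gt0 ?exprn_gt0 ?cauchy_bd_gt0.
Qed.

End SubMean.

(** * Sub-mean value inequality for all positive powers; the complex exponential *)

Section SubMeanPower.
Local Open Scope classical_set_scope.
Local Open Scope ring_scope.
Context {R : realType}.
Implicit Types (a b c d u s t x y M q : R) (z w p h v : R[i]) (f g : R[i] -> R[i]).
Local Notation cbd := (@cauchy_bd R).

Lemma ler_pow a x y : 0 <= a -> 0 <= x -> x <= y -> x `^ a <= y `^ a.
Proof. by move=> a0 x0 xy; apply: ge0_ler_powR => //; rewrite nnegrE // (le_trans x0). Qed.

Lemma powDp x a b : 0 < x -> x `^ (a + b) = x `^ a * x `^ b.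
Proof. by move=> x0; rewrite powRD //; apply/implyP => _; rewrite gt_eqF. Qed.

Lemma powKV x a : 0 <= x -> a != 0 -> (x `^ a) `^ a^-1 = x.
Proof. by move=> x0 a0; rewrite -powRrM mulfV // powRr1. Qed.

Lemma powVK x a : 0 <= x -> a != 0 -> (x `^ a^-1) `^ a = x.
Proof. by move=> x0 a0; rewrite -powRrM mulVf // powRr1. Qed.

(** In place of Jensen's inequality, the pointwise bound x <= a + a^(1-q) x^q, valid for q >= 1 and
    any a > 0, is inserted into the area mean. *)
Lemma submean_ge1 q f : 1 <= q -> entire f ->
  ((modc (f 0) `^ q)%:E <= ((8 * cbd) `^ q)%:E * pint (fun z => (modc (f z) `^ q * indsq 1 z)%R))%E.
Proof.
move=> q1 hf; have cb := cauchy_bd_gt0 (R := R).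
set J := (fun z => (modc (f z) `^ q * indsq 1 z)%R).
have mJ : pmeas J by apply: pmeasM; [apply: pmeas_powR; exact: pmeas_entire|exact: pmeas_indsq].
have J0 z : 0 <= J z by rewrite mulr_ge0 ?powR_ge0 ?indsq_ge0.
have q0 : q != 0 by rewrite gt_eqF //; lra.
have [->|h0] := eqVneq (modc (f 0)) 0.
  by rewrite powR0 // mule_ge0 ?pint_ge0 // lee_fin powR_ge0.
have {}h0 : 0 < modc (f 0) by rewrite lt_def h0 modc_ge0.
have K0 : 0 < (8 * cbd) `^ q by rewrite powR_gt0 // mulr_gt0.
case E : (pint J) (pint_ge0 J0) => [r||] //= r0; last by rewrite gt0_muley ?leey // lte_fin.
rewrite -EFinM lee_fin; rewrite lee_fin in r0.
(* The unit square has area 4, so the constant term contributes [cbd * a * 4], half of |f(0)|, and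
   is absorbed on the left. *)
pose a := modc (f 0) / (8 * cbd).
have a0 : 0 < a by rewrite divr_gt0 // mulr_gt0.
have key : modc (f 0) <= cbd * (a * 4 + a `^ (1 - q) * r).
  have := area_mean hf ltr01; rewrite expr1n divr1 => k.
  rewrite -lee_fin; apply: le_trans k _; rewrite (EFinM cbd); apply: lee_wpmul2l; first by rewrite lee_fin ltW.
  have -> : ((a * 4 + a `^ (1 - q) * r)%:E = pint (fun z => (a * indsq 1 z + a `^ (1 - q) * J z)%R))%E.
    rewrite pintD; first last.
    - by move=> z; rewrite mulr_ge0 ?powR_ge0.
    - by move=> z; rewrite mulr_ge0 ?indsq_ge0 // ltW.
    - by apply: pmeasM => //; exact: pmeas_cst.
    - by apply: pmeasM; [exact: pmeas_cst|exact: pmeas_indsq].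
    rewrite (pintZ (@pmeas_indsq R 1) (@indsq_ge0 R 1) (ltW a0)) (pintZ mJ J0 (powR_ge0 a (1 - q))).
    by rewrite E pint_indsq // -!EFinM -EFinD expr1n mulr1.
  apply: le_pint.
  - by apply: pmeasM; [exact: pmeas_entire|exact: pmeas_indsq].
  - apply: pmeasD; apply: pmeasM => //; try exact: pmeas_cst; exact: pmeas_indsq.
  - by move=> z; rewrite mulr_ge0 ?modc_ge0 ?indsq_ge0.
  - move=> z; rewrite /J mulrA -mulrDl ler_wpM2r ?indsq_ge0 //.
    have [xa|ax] := leP (modc (f z)) a.
      by apply: (le_trans xa); rewrite lerDl mulr_ge0 ?powR_ge0.
    apply: (@le_trans _ _ (a `^ (1 - q) * modc (f z) `^ q)); last by rewrite lerDr ltW.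
    have xp : 0 < modc (f z) by lra.
    have -> : modc (f z) `^ q = modc (f z) * modc (f z) `^ (q - 1).
      by rewrite mulr_powRB1 ?modc_ge0 //; lra.
    have k1 : a `^ (q - 1) <= modc (f z) `^ (q - 1) by apply: ler_pow; lra.
    have k2 : a `^ (1 - q) * a `^ (q - 1) = 1.
      by rewrite -powDp //; rewrite (_ : 1 - q + (q - 1) = 0) ?powRr0 //; ring.
    have k3 : 1 <= a `^ (1 - q) * modc (f z) `^ (q - 1).
      by rewrite -[leLHS]k2 ler_wpM2l ?powR_ge0.
    by rewrite mulrCA ler_peMr // ltW.
have k1 : modc (f 0) = a * (8 * cbd) by rewrite /a; field; rewrite gt_eqF.
have k2 : a `^ q * a `^ (1 - q) = a.
  by rewrite -powDp //; rewrite (_ : q + (1 - q) = 1) ?powRr1 ?ltW //; ring.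
have aq0 : 0 < a `^ q by rewrite powR_gt0.
have aq : a `^ q * 4 <= r.
  have := ler_wpM2l (ltW aq0) key.
  have -> : a `^ q * (cbd * (a * 4 + a `^ (1 - q) * r)) = cbd * a * (4 * a `^ q) + cbd * (a `^ q * a `^ (1 - q)) * r by ring.
  rewrite k2 k1.
  have -> : a `^ q * (a * (8 * cbd)) = cbd * a * (8 * a `^ q) by ring.
  by rewrite -mulrDr (ler_pM2l (mulr_gt0 cb a0)) => hh; lra.
have c8 : 0 < 8 * cbd := mulr_gt0 (ltr0n R 8) cb.
rewrite k1 (powRM _ (ltW a0) (ltW c8)) [leLHS]mulrC ler_wpM2l ?(ltW K0) //; lra.
Qed.

(** Below exponent 1 one writes |f| = |f|^(1-q) |f|^q in the area mean and bounds the first factor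
    by a supremum. A supremum over a larger square would not close up; the supremum [S] of |f| times
    a power of the distance to the boundary reproduces itself as S^(1-q) and can be divided out. *)
Lemma submean_lt1 q f : 0 < q -> q < 1 -> entire f ->
  ((modc (f 0) `^ q)%:E <= (2 `^ (2 / q) * cbd)%:E * pint (fun z => (modc (f z) `^ q * indsq 1 z)%R))%E.
Proof.
move=> q0 q1 hf; have cb := cauchy_bd_gt0 (R := R).
set J := (fun z => (modc (f z) `^ q * indsq 1 z)%R).
have mJ : pmeas J by apply: pmeasM; [apply: pmeas_powR; exact: pmeas_entire|exact: pmeas_indsq].
have J0 z : 0 <= J z by rewrite mulr_ge0 ?powR_ge0 ?indsq_ge0.
have qn0 : q != 0 by rewrite gt_eqF.
have K0 : 0 < 2 `^ (2 / q) * cbd by rewrite mulr_gt0 ?powR_gt0.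
case E : (pint J) (pint_ge0 J0) => [r||] //= r0; last by rewrite gt0_muley ?leey // lte_fin.
rewrite -EFinM lee_fin; rewrite lee_fin in r0.
(* The distance from [z] to the boundary of the unit square in the maximum norm, positive exactly in
   the interior. *)
pose dl z := 1 - Num.max `|complex.Re z| `|complex.Im z|.
pose Z := [set x : R | exists2 z, 0 < dl z & x = modc (f z) * dl z `^ (2 / q)].
have dl1 z : dl z <= 1 by rewrite /dl lerBlDr lerDl le_max normr_ge0.
have Zne : Z (modc (f 0)).
  have d0 : dl 0 = 1 by rewrite /dl /= normr0 maxxx subr0.
  by exists 0; rewrite d0 ?ltr01 // powR1 mulr1.
have e2q : 0 <= 2 / q by rewrite divr_ge0 // ltW.
have [M M0 hM] := entire_bounded 2 hf.
have hZ : has_sup Z.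
  split; first by exists (modc (f 0)).
  exists M => _ [z zd ->]; have zz : modc z <= 2.
    apply: le_trans (modc_le_ReIm z) _.
    by move: zd; rewrite /dl subr_gt0 gt_max => /andP[]; lra.
  rewrite -[M]mulr1; apply: ler_pM; rewrite ?modc_ge0 ?powR_ge0 ?hM //.
  apply: (@le_trans _ _ (1 `^ (2 / q))); last by rewrite powR1.
  by apply: ler_pow => //; exact: ltW.
set S := sup Z.
have Sub x : Z x -> x <= S by move=> Zx; apply: ub_le_sup => //; case: hZ.
have hS : modc (f 0) <= S by exact: Sub.
have [S0|S0] := leP S 0.
  have -> : modc (f 0) = 0 by apply/eqP; rewrite eq_le modc_ge0 andbT; lra.
  by rewrite powR0 // mulr_ge0 ?(ltW K0).
have Sq0 : 0 < S `^ q by rewrite powR_gt0.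
suff kS : S <= 2 `^ (2 / q) * cbd * (S / S `^ q) * r.
  have k : S `^ q <= 2 `^ (2 / q) * cbd * r.
    rewrite -(ler_pM2l S0) -ler_pdivlMr //.
    by have -> : S * (2 `^ (2 / q) * cbd * r) / S `^ q = 2 `^ (2 / q) * cbd * (S / S `^ q) * r by ring.
  by apply: le_trans k; apply: ler_pow; rewrite ?modc_ge0 // ltW.
apply: ge_sup; first by case: hZ.
move=> _ [w wd ->].
pose rho := dl w / 2; have rho0 : 0 < rho by rewrite divr_gt0.
pose P := rho `^ (2 / q); have P0 : 0 < P by rewrite powR_gt0.
(* The exponent [2 / q] of the weight is chosen for this identity: its q-th power cancels the area
   factor of the mean over a square of half-side [rho]. *)
have Pq : P `^ q = rho ^+ 2 by rewrite /P -powRrM divfK // powR_mulrn // ltW.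
have -> : dl w `^ (2 / q) = 2 `^ (2 / q) * P.
  by rewrite -powRM ?(ltW rho0) //; congr (_ `^ _); rewrite /rho; field.
suff kw : modc (f w) * P <= cbd * (S / S `^ q) * r.
  have -> : modc (f w) * (2 `^ (2 / q) * P) = 2 `^ (2 / q) * (modc (f w) * P) by ring.
  by rewrite -!mulrA ler_wpM2l ?powR_ge0 // !mulrA; move: kw; rewrite !mulrA.
have hfw := @entire_shift R f w hf.
have := area_mean hfw rho0; rewrite addr0 => k.
have {}k : modc (f w) <= cbd / rho ^+ 2 * ((S / P) / (S / P) `^ q * r).
  rewrite -lee_fin; apply: le_trans k _; rewrite (EFinM (cbd / rho ^+ 2)); apply: lee_wpmul2l.
    by rewrite lee_fin divr_ge0 ?exprn_ge0 ?(ltW cb) // ltW.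
  have mJw : pmeas (fun v => J (w + v)) by exact: pmeas_shift.
  rewrite EFinM -E -(pint_shift w mJ J0) -pintZ //; last by rewrite divr_ge0 ?powR_ge0 // divr_ge0 // ltW.
  apply: le_pint.
  - by apply: pmeasM; [apply: pmeas_entire; exact: hfw|exact: pmeas_indsq].
  - by apply: pmeasM => //; exact: pmeas_cst.
  - by move=> z; rewrite mulr_ge0 ?modc_ge0 ?indsq_ge0.
  - move=> v; have T0 : 0 <= S / P / (S / P) `^ q by rewrite divr_ge0 ?powR_ge0 // divr_ge0 // ltW.
    rewrite {1}/indsq; case: (boolP (_ && _)) => [/andP[v1 v2]|_]; last by rewrite mulr0 mulr_ge0.
    have dwv : rho <= dl (w + v).
      rewrite /dl cReD cImD lerBrDr addrC -lerBrDr ge_max.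
      have m1 : `|complex.Re w| <= 1 - 2 * rho.
        have : `|complex.Re w| <= Num.max `|complex.Re w| `|complex.Im w| by rewrite le_max lexx.
        by rewrite /rho /dl; lra.
      have m2 : `|complex.Im w| <= 1 - 2 * rho.
        have : `|complex.Im w| <= Num.max `|complex.Re w| `|complex.Im w| by rewrite le_max lexx orbT.
        by rewrite /rho /dl; lra.
      by rewrite (le_trans (ler_normD _ _)) ?(le_trans (ler_normD _ _)) //; lra.
    have wv1 : indsq 1 (w + v) = 1.
      have : 0 < dl (w + v) by lra.
      rewrite /dl subr_gt0 gt_max => /andP[h1 h2].
      by rewrite /indsq (ltW h1) (ltW h2).
    rewrite mulr1 /J wv1 mulr1.
    have fT : modc (f (w + v)) <= S / P.
      rewrite ler_pdivlMr //; apply: le_trans (_ : _ <= modc (f (w + v)) * dl (w + v) `^ (2 / q)) _.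
        by rewrite ler_wpM2l ?modc_ge0 //; apply: ler_pow => //; exact: ltW.
      by apply: Sub; exists (w + v) => //; lra.
    have [->|fn0] := eqVneq (modc (f (w + v))) 0; first by rewrite mulr_ge0 ?powR_ge0.
    have fp : 0 < modc (f (w + v)) by rewrite lt_def fn0 modc_ge0.
    have Tp : 0 < S / P by rewrite divr_gt0.
    have Tpow x : 0 < x -> x / x `^ q = x `^ (1 - q).
      by move=> x0; rewrite powDp // powRr1 ?(ltW x0) // powRN.
    apply: (@le_trans _ _ (modc (f (w + v)) `^ (1 - q) * modc (f (w + v)) `^ q)).
      by rewrite -powDp // subrK powRr1 // ltW.
    rewrite Tpow // ler_wpM2r ?powR_ge0 //; apply: ler_pow; rewrite ?modc_ge0 //; lra.
apply: le_trans (ler_wpM2r (ltW P0) k) _.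
have e1 : P^-1 `^ q = (rho ^+ 2)^-1.
  by rewrite -powR_inv1 ?(ltW P0) // powRAC Pq powR_inv1 ?sqr_ge0.
rewrite powRM ?(ltW S0) ?invr_ge0 ?(ltW P0) // e1.
rewrite le_eqVlt; apply/orP; left; apply/eqP; field.
by rewrite !gt_eqF.
Qed.

Lemma submean q : 0 < q -> exists2 C, 0 < C & forall f, entire f ->
  ((modc (f 0) `^ q)%:E <= C%:E * pint (fun z => (modc (f z) `^ q * indsq 1 z)%R))%E.
Proof.
move=> q0; have cb := cauchy_bd_gt0 (R := R); have [q1|q1] := leP 1 q.
- by exists ((8 * cbd) `^ q); [rewrite powR_gt0 // mulr_gt0|move=> f; exact: submean_ge1].
- by exists (2 `^ (2 / q) * cbd); [rewrite mulr_gt0 // powR_gt0|move=> f; exact: submean_lt1].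
Qed.

Definition cexp z : R[i] := Complex (expR (complex.Re z) * cos (complex.Im z)) (expR (complex.Re z) * sin (complex.Im z)).

Lemma cexpD z w : cexp (z + w) = cexp z * cexp w.
Proof.
by apply: complex_ext; rewrite ?cReM ?cImM /= cReD cImD expRD ?cosD ?sinD; ring.
Qed.

Lemma modc_cexp z : modc (cexp z) = expR (complex.Re z).
Proof.
rewrite /modc /= !exprMn -mulrDr cos2Dsin2 mulr1 sqrtr_sqr ger0_norm //; exact: expR_ge0.
Qed.

Lemma cexp0 : cexp 0 = 1.
Proof. by apply: complex_ext; rewrite /= expR0 ?cos0 ?sin0 mul1r. Qed.

Lemma is_derive_o (u : R -> R) (d : R) : is_derive (0 : R) 1 u d -> forall e, 0 < e ->
  exists2 r, 0 < r & forall x, `|x| < r -> `|u x - u 0 - d * x| <= e * `|x|.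
Proof.
move=> [/cvg_ex [l hl] dl] e e0; have ld : l = d by rewrite -dl /derive; apply/esym; apply: cvg_lim hl.
move: hl; rewrite ld => /cvgrPdist_le /(_ e e0); rewrite near_withinE => /nbhs_ballP [r r0 hr].
exists r => // x xr; have [->|x0] := eqVneq x 0; first by rewrite subrr mulr0 subr0 normr0 mulr0.
have := hr x; rewrite /ball /= sub0r normrN => /(_ xr x0).
have -> : x *: (1 : R) = x by rewrite /GRing.scale /= mulr1.
rewrite /GRing.scale /= addr0.
have -> : d - x^-1 * (u x - u 0) = - (x^-1 * (u x - u 0 - d * x)) by field.
by rewrite normrN normrM normfV mulrC ler_pdivrMr ?normr_gt0.
Qed.

Lemma cdiff_cexp0 : cdiff cexp 0 1.
Proof.
move=> e e0; have e1 : 0 < Num.min 1 (e / 10) by rewrite lt_min ltr01 divr_gt0.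
have [r1 r10 h1] := is_derive_o (is_derive_expR 0) e1.
have [r2 r20 h2] := is_derive_o (is_derive_cos 0) e1.
have [r3 r30 h3] := is_derive_o (is_derive_sin 0) e1.
set e' := Num.min 1 (e / 10) in e1 h1 h2 h3.
have e'1 : e' <= 1 by rewrite ge_min lexx.
have e'2 : e' <= e / 10 by rewrite ge_min lexx orbT.
exists (Num.min (Num.min r1 r2) (Num.min r3 (Num.min 1 (e / 10)))).
  by rewrite !lt_min r10 r20 r30 ltr01 divr_gt0.
move=> h; rewrite !lt_min => /andP[/andP[hr1 hr2] /andP[hr3 /andP[hr4 hr5]]].
have hx := Re_le_modc h; have hy := Im_le_modc h.
have k1 := h1 _ (le_lt_trans hx hr1); have k2 := h2 _ (le_lt_trans hy hr2); have k3 := h3 _ (le_lt_trans hy hr3).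
move: k1 k2 k3; rewrite expR0 cos0 sin0 !mul1r !subr0 oppr0 mul0r subr0 cexp0 add0r => k1 k2 k3.
apply: le_trans (modc_le_ReIm _) _; rewrite !cReB !cImB /= subr0.
set x := complex.Re h in hx k1 *; set y := complex.Im h in hy k2 k3 *.
set H := modc h in hx hy hr4 hr5 *; have H0 : 0 <= H by exact: modc_ge0.
set E := expR x in k1 *; set c := cos y in k2 *; set s := sin y in k3 *.
have -> : E * c - 1 - x = E * (c - 1) + (E - 1 - x) by ring.
have -> : E * s - y = E * (s - y) + (E - 1) * y by ring.
have E0 : 0 <= E by exact: expR_ge0.
have a1 : `|E - 1 - x| <= e' * H by apply: le_trans k1 _; rewrite ler_wpM2l // ltW.
have a2 : `|c - 1| <= e' * H by apply: le_trans k2 _; rewrite ler_wpM2l // ltW.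
have a3 : `|s - y| <= e' * H by apply: le_trans k3 _; rewrite ler_wpM2l // ltW.
have a4 : `|E - 1| <= 2 * H.
  have -> : E - 1 = (E - 1 - x) + x by ring.
  apply: le_trans (ler_normD _ _) _; have : e' * H <= 1 * H by rewrite ler_wpM2r.
  lra.
have a5 : E <= 3 by have := ler_norm (E - 1); lra.
have b1 : `|E * (c - 1) + (E - 1 - x)| <= 4 * (e' * H).
  apply: le_trans (ler_normD _ _) _; rewrite normrM (ger0_norm E0).
  have : E * `|c - 1| <= 3 * (e' * H) by apply: ler_pM.
  lra.
have b2 : `|E * (s - y) + (E - 1) * y| <= 3 * (e' * H) + 2 * H * H.
  apply: le_trans (ler_normD _ _) _; rewrite !normrM (ger0_norm E0).
  by apply: lerD; apply: ler_pM.
have b3 : e' * H <= e / 10 * H by rewrite ler_wpM2r.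
have b4 : H * H <= e / 10 * H by rewrite ler_wpM2r // ltW.
have b5 : 0 <= e * H by rewrite mulr_ge0 // ltW.
lra.
Qed.

Lemma cdiff_cexp z : cdiff cexp z (cexp z).
Proof.
move=> e e0; have m0 : 0 < modc (cexp z) by rewrite modc_cexp expR_gt0.
have [|r r0 hr] := cdiff_cexp0 (e := e / modc (cexp z)); first by rewrite divr_gt0.
exists r => // h /hr; rewrite add0r cexp0 mul1r => k.
have -> : cexp (z + h) - cexp z - cexp z * h = cexp z * (cexp h - 1 - h) by rewrite cexpD; ring.
by rewrite modcM mulrC -ler_pdivlMr // mulrAC.
Qed.

Lemma cdiff_cexpZ p z : cdiff (fun w => cexp (p * w)) z (p * cexp (p * z)).
Proof.
move=> e e0; have m1 : 0 < modc p + 1 by have := modc_ge0 p; lra.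
have [|r r0 hr] := cdiff_cexp (p * z) (e := e / (modc p + 1)); first by rewrite divr_gt0.
exists (r / (modc p + 1)); first by rewrite divr_gt0.
move=> h; rewrite ltr_pdivlMr // => hh.
have k : modc (p * h) <= modc h * (modc p + 1) by rewrite modcM mulrC ler_wpM2l ?modc_ge0 // lerDl.
have := hr _ (le_lt_trans k hh); rewrite -mulrDr.
have -> : cexp (p * z) * (p * h) = p * cexp (p * z) * h by ring.
move=> H; apply: le_trans H _; apply: le_trans (ler_wpM2l _ k) _; first by rewrite divr_ge0 // ltW.
by rewrite le_eqVlt; apply/orP; left; apply/eqP; field; rewrite gt_eqF.
Qed.

Lemma entire_cexpZ p : entire (fun w => cexp (p * w)).
Proof. by apply/entireP => z; eexists; exact: cdiff_cexpZ. Qed.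

End SubMeanPower.

(** * Local estimates in the weighted spaces *)

Section LocalEstimates.
Local Open Scope classical_set_scope.
Local Open Scope ring_scope.
Context {R : realType}.
Implicit Types (a b c d u s t x y M p q A : R) (z w v : R[i]) (f g : R[i] -> R[i]) (m : nat).
Local Notation cbd := (@cauchy_bd R).
Opaque expR powR ln cauchy_bd.

Definition wgt m z : R := expR (- psi m z).

Lemma modc1_gt0 z : 0 < 1 + modc z.
Proof. by rewrite ltr_pwDl // modc_ge0. Qed.

Lemma wgtE m z : wgt m z = (1 + modc z) ^+ m * expR (- (modc z ^+ 2 / 2)).
Proof.
rewrite /wgt /psi opprB expRD expRM_natl lnK // posrE; exact: modc1_gt0.
Qed.

Lemma wgt_gt0 m z : 0 < wgt m z. Proof. exact: expR_gt0. Qed.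
Lemma wgt_ge0 m z : 0 <= wgt m z. Proof. exact: expR_ge0. Qed.

Lemma pmeas_wgt m : pmeas (wgt m).
Proof.
have -> : wgt m = fun z => (1 + modc z) ^+ m * expR (-1 * (modc z ^+ 2 * 2^-1)).
  by apply/funext => z; rewrite wgtE mulN1r.
apply: pmeasM; first by apply: pmeasX; apply: pmeasD; [exact: pmeas_cst|exact: pmeas_modc].
apply: pmeas_expR; apply: pmeasM; first exact: pmeas_cst.
by apply: pmeasM; [apply: pmeasX; exact: pmeas_modc|exact: pmeas_cst].
Qed.

Definition fw m p f z : R := (modc (f z) * wgt m z) `^ p.

Lemma fwE m p f z : fw m p f z = (modc (f z) * wgt m z) `^ p. Proof. by []. Qed.

Lemma fw_ge0 m p f z : 0 <= fw m p f z. Proof. exact: powR_ge0. Qed.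

Lemma pmeas_fw m p f : entire f -> pmeas (fw m p f).
Proof.
by move=> hf; apply: pmeas_powR; apply: pmeasM; [exact: pmeas_entire|exact: pmeas_wgt].
Qed.

Lemma fock_intE m p f : fock_int m p f = pint (fw m p f).
Proof. by []. Qed.

Definition l1 z : R := `|complex.Re z| + `|complex.Im z|.
(** The l1 distance is used instead of the modulus because the kernel then factors into exponentials
    of the two coordinates, for integration as well as for lattice sums. *)
Definition ker A z w : R := expR (- (A * l1 (z - w))).

Lemma kerE A z w : ker A z w = expR (- (A * l1 (z - w))). Proof. by []. Qed.

Lemma l1_ge0 z : 0 <= l1 z. Proof. exact: addr_ge0. Qed.
Lemma modc_le_l1 z : modc z <= l1 z. Proof. exact: modc_le_ReIm. Qed.
Lemma l1_le_modc z : l1 z <= 2 * modc z.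
Proof. by rewrite mulrDl mul1r lerD // ?Re_le_modc ?Im_le_modc. Qed.
Lemma l1D z w : l1 (z + w) <= l1 z + l1 w.
Proof.
rewrite /l1 cReD cImD; have := ler_normD (complex.Re z) (complex.Re w).
have := ler_normD (complex.Im z) (complex.Im w); lra.
Qed.
Lemma l1N z : l1 (- z) = l1 z.
Proof. by case: z => a b; rewrite /l1 /= !normrN. Qed.
Lemma l1_distC z w : l1 (z - w) = l1 (w - z).
Proof. by rewrite -l1N opprB. Qed.

Lemma ker_ge0 A z w : 0 <= ker A z w. Proof. exact: expR_ge0. Qed.
Lemma ker_gt0 A z w : 0 < ker A z w. Proof. exact: expR_gt0. Qed.
Lemma kerC A z w : ker A z w = ker A w z.
Proof. by rewrite /ker l1_distC. Qed.

Lemma pmeas_l1 z0 : pmeas (fun w => l1 (z0 - w)).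
Proof.
have E z : l1 (z0 - z) = `|complex.Re z0 + -1 * complex.Re z| + `|complex.Im z0 + -1 * complex.Im z|.
  by rewrite /l1 cReB cImB !mulN1r.
have -> : (fun w => l1 (z0 - w)) = fun z => `|complex.Re z0 + -1 * complex.Re z| + `|complex.Im z0 + -1 * complex.Im z| by apply/funext.
apply: pmeasD; apply: pmeas_norm; apply: pmeasD; try exact: pmeas_cst; apply: pmeasM; try exact: pmeas_cst.
- exact: pmeas_Re. - exact: pmeas_Im.
Qed.

Lemma pmeas_ker A z : pmeas (ker A z).
Proof.
have -> : ker A z = fun w => expR (- A * l1 (z - w)) by apply/funext => w; rewrite /ker mulNr.
by apply: pmeas_expR; apply: pmeasM; [exact: pmeas_cst|exact: pmeas_l1].
Qed.

Lemma ker_shift A z z' w : 0 <= A -> ker A z' w <= expR (A * l1 (z - z')) * ker A z w.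
Proof.
move=> A0; rewrite /ker -expRD ler_expR.
have h : l1 (z - w) <= l1 (z - z') + l1 (z' - w).
  have E : z - w = (z - z') + (z' - w) by ring.
  rewrite E; exact: l1D.
have := ler_wpM2l A0 h; lra.
Qed.

Lemma indsq_ker A z w : 0 <= A -> indsq 1 (w - z) <= expR (2 * A) * ker A z w.
Proof.
move=> A0; rewrite /indsq; case: (boolP (_ && _)) => [/andP[h1 h2]|_]; last by rewrite mulr_ge0 ?expR_ge0.
rewrite /ker -expRD l1_distC; apply: le_trans (expR_ge1Dx _); rewrite lerDl.
have : A * l1 (w - z) <= A * 2 by rewrite ler_wpM2l // /l1; lra.
lra.
Qed.

Lemma indsq_modc v : indsq 1 v != 0 -> modc v <= 2 /\ modc v ^+ 2 <= 2.
Proof.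
rewrite /indsq; case: (boolP (_ && _)) => [/andP[h1 h2] _|_]; last by rewrite eqxx.
split; first by have := modc_le_ReIm v; lra.
rewrite modc_sqr -[X in X + _]real_normK ?num_real // -[X in _ + X]real_normK ?num_real //.
have a1 : `|complex.Re v| ^+ 2 <= 1 by rewrite expr_le1.
have a2 : `|complex.Im v| ^+ 2 <= 1 by rewrite expr_le1.
lra.
Qed.

Definition cj z : R[i] := Complex (complex.Re z) (- complex.Im z).

Lemma modc_cj z : modc (cj z) = modc z.
Proof. by rewrite /modc /= sqrrN. Qed.

(* Multiplication by [exp (- conj z * v)] turns the weight at [z] into the weight at [z + v]. *)
Lemma wgt_translate m z v : modc v <= 2 -> modc v ^+ 2 <= 2 ->
  wgt m z * expR (complex.Re (- cj z * v)) <= 3 ^+ m * expR 1 * wgt m (z + v).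
Proof.
move=> v2 vv; rewrite !wgtE.
have -> : (1 + modc z) ^+ m * expR (- (modc z ^+ 2 / 2)) * expR (complex.Re (- cj z * v)) =
  (1 + modc z) ^+ m * (expR (modc v ^+ 2 / 2) * expR (- (modc (z + v) ^+ 2 / 2))).
  rewrite -mulrA -!expRD; congr (_ * expR _); rewrite !modc_sqr cReD cImD cReM.
  by rewrite /cj /=; field.
have -> : 3 ^+ m * expR 1 * ((1 + modc (z + v)) ^+ m * expR (- (modc (z + v) ^+ 2 / 2))) =
  (3 ^+ m * (1 + modc (z + v)) ^+ m) * (expR 1 * expR (- (modc (z + v) ^+ 2 / 2))) by ring.
rewrite -exprMn; apply: ler_pM; rewrite ?exprn_ge0 ?mulr_ge0 ?expR_ge0 //.
- by rewrite ltW // modc1_gt0.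
- rewrite lerXn2r ?nnegrE ?mulr_ge0 ?(ltW (modc1_gt0 _)) //.
  have := modcB (z + v) v; rewrite addrK; have := modc_ge0 (z + v); lra.
- by rewrite ler_wpM2r ?expR_ge0 // ler_expR; lra.
Qed.

Lemma wgt_const_gt0 m : 0 < (3 : R) ^+ m * expR 1.
Proof. by rewrite mulr_gt0 ?exprn_gt0 ?expR_gt0. Qed.

Lemma entire_translate f z : entire f -> entire (fun v => f (z + v) * cexp (- cj z * v)).
Proof.
move=> hf; exact: (entireM (@entire_shift R f z hf) (@entire_cexpZ R (- cj z))).
Qed.

Opaque wgt fw ker l1.

(** The sub-mean inequality for the translated function lives on a unit square, where the l1
    distance is at most 2; there the indicator is below [expR (2 * A) * ker], so every decay rate is
    available. *)
Lemma local_bound m q A : 0 < q -> 0 <= A -> exists2 C, 0 < C & forall f z, entire f ->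
  ((fw m q f z)%:E <= C%:E * pint (fun w => fw m q f w * ker A z w)%R)%E.
Proof.
move=> q0 A0; have [C C0 hC] := @submean R q q0; have c30 := wgt_const_gt0 m.
set c3 := 3 ^+ m * expR 1 in c30.
exists (C * (c3 `^ q * expR (2 * A))).
  by rewrite mulr_gt0 // mulr_gt0 ?powR_gt0 ?expR_gt0.
move=> f z hf; have hh := @entire_translate f z hf.
have := hC _ hh; rewrite /= addr0 modcM modc_cexp mulr0 expR0 mulr1 => k.
have mfw := pmeas_fw m q hf.
have mG : pmeas (fun v => modc (f (z + v) * cexp (- cj z * v)) `^ q * indsq 1 v).
  by apply: pmeasM; [apply: pmeas_powR; exact: pmeas_entire|exact: pmeas_indsq].
have wq : 0 <= wgt m z `^ q by exact: powR_ge0.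
have cE0 : 0 <= c3 `^ q * expR (2 * A) := mulr_ge0 (powR_ge0 _ _) (expR_ge0 _).
have fk0 w : 0 <= c3 `^ q * expR (2 * A) * (fw m q f w * ker A z w) :=
  mulr_ge0 cE0 (mulr_ge0 (fw_ge0 _ _ _ _) (ker_ge0 _ _ _)).
have wt0 v : modc v <= 2 -> modc v ^+ 2 <= 2 ->
  wgt m z * expR (complex.Re (- cj z * v)) <= c3 * wgt m (z + v) by exact: wgt_translate.
have [c3' c3E] : exists c, c = c3 by exists c3.
rewrite -c3E in c30 cE0 fk0 wt0 *; clear c3E c3.
rewrite fwE powRM ?modc_ge0 ?wgt_ge0 // mulrC EFinM.
apply: le_trans (lee_wpmul2l _ k) _; first by rewrite lee_fin.
rewrite muleCA (EFinM C) -muleA; apply: lee_wpmul2l; first by rewrite lee_fin ltW.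
rewrite -pintZ //; last by move=> v; rewrite mulr_ge0 ?powR_ge0 ?indsq_ge0.
have mK : pmeas (fun w => fw m q f w * ker A z w) by apply: pmeasM => //; exact: pmeas_ker.
rewrite -pintZ //; first last.
- by move=> w; rewrite mulr_ge0 ?fw_ge0 ?ker_ge0.
have mI : pmeas (fun w => c3' `^ q * expR (2 * A) * (fw m q f w * ker A z w)).
  by apply: pmeasM => //; exact: pmeas_cst.
rewrite -(pint_shift z mI); last exact: fk0.
apply: le_pint.
- by apply: pmeasM => //; exact: pmeas_cst.
- exact: (pmeas_shift z mI).
- by move=> v; rewrite !mulr_ge0 ?powR_ge0 ?indsq_ge0.
move=> v; have [->|iv] := eqVneq (indsq 1 v) 0.
  by rewrite !mulr0; exact: fk0.
have [v2 vv] := indsq_modc iv; have wt := wt0 v v2 vv.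
have ik : indsq 1 v <= expR (2 * A) * ker A z (z + v).
  by have := @indsq_ker A z (z + v) A0; rewrite [z + v]addrC addrK.
have -> : c3' `^ q * expR (2 * A) * (fw m q f (z + v) * ker A z (z + v)) =
  (c3' `^ q * fw m q f (z + v)) * (expR (2 * A) * ker A z (z + v)) by ring.
rewrite mulrA; apply: ler_pM; rewrite ?indsq_ge0 ?mulr_ge0 ?powR_ge0 //.
have mw w : 0 <= modc (f w) * wgt m w := mulr_ge0 (modc_ge0 _) (wgt_ge0 _ _).
rewrite !fwE -(powRM _ (ltW c30) (mw _)) -(powRM _ (wgt_ge0 _ _) (modc_ge0 _)).
apply: ler_pow; rewrite ?(ltW q0) ?mulr_ge0 ?modc_ge0 ?wgt_ge0 //.
rewrite modcM modc_cexp.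
have -> : wgt m z * (modc (f (z + v)) * expR (complex.Re (- cj z * v))) = modc (f (z + v)) * (wgt m z * expR (complex.Re (- cj z * v))) by ring.
have -> : c3' * (modc (f (z + v)) * wgt m (z + v)) = modc (f (z + v)) * (c3' * wgt m (z + v)) by ring.
by rewrite ler_wpM2l ?modc_ge0.
Qed.

Lemma pint_ker_shift m q A f z z' : 0 <= A -> entire f ->
  (pint (fun w => fw m q f w * ker A z' w)%R <= (expR (A * l1 (z - z')))%:E * pint (fun w => fw m q f w * ker A z w)%R)%E.
Proof.
move=> A0 hf; have mfw := pmeas_fw m q hf.
have mK (y : R[i]) : pmeas (fun w => fw m q f w * ker A y w) by apply: pmeasM => //; exact: pmeas_ker.
rewrite -pintZ ?expR_ge0 //; last by move=> w; rewrite mulr_ge0 ?fw_ge0 ?ker_ge0.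
apply: le_pint => //.
- by apply: pmeasM => //; exact: pmeas_cst.
- by move=> w; rewrite mulr_ge0 ?fw_ge0 ?ker_ge0.
- by move=> w; rewrite mulrCA ler_wpM2l ?fw_ge0 //; exact: ker_shift.
Qed.

(** Moving the centre of the kernel costs a factor [expR (A * l1 _)], so the integral at the single
    centre [z] controls [f] at every other point. This is the form needed along a ray, where the
    centre must stay fixed. *)
Lemma local_sup m q A : 0 < q -> 0 <= A -> exists2 C, 0 < C & forall f z r, entire f ->
  pint (fun w => fw m q f w * ker A z w)%R = r%:E ->
  forall z', modc (f z') * wgt m z' <= (C * r) `^ q^-1 * expR (A / q * l1 (z - z')).
Proof.
move=> q0 A0; have [C C0 hC] := @local_bound m q A q0 A0; exists C => // f z r hf E z'.
have r0 : 0 <= r by rewrite -lee_fin -E pint_ge0 // => w; rewrite mulr_ge0 ?fw_ge0 ?ker_ge0.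
have k1 := hC f z' hf; have k2 := @pint_ker_shift m q A f z z' A0 hf.
have qn0 : q != 0 by rewrite gt_eqF.
have k3 : fw m q f z' <= C * (expR (A * l1 (z - z')) * r).
  rewrite -lee_fin; apply: le_trans k1 _; rewrite (EFinM C) EFinM -E.
  by apply: lee_wpmul2l => //; rewrite lee_fin ltW.
have -> : modc (f z') * wgt m z' = fw m q f z' `^ q^-1.
  by rewrite fwE powKV // mulr_ge0 ?modc_ge0 ?wgt_ge0.
apply: le_trans (ler_pow _ (fw_ge0 _ _ _ _) k3) _; first by rewrite invr_ge0 ltW.
have -> : C * (expR (A * l1 (z - z')) * r) = C * r * expR (A * l1 (z - z')) by ring.
rewrite powRM ?expR_ge0 ?mulr_ge0 ?(ltW C0) //.
by rewrite -expRM; have -> : A / q * l1 (z - z') = A * l1 (z - z') / q by ring.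
Qed.

(** Cauchy's estimate is applied to [k v = f (z + v) * cexp (- cj z * v)]. Its derivative at 0 is
    f'(z) - conj z f(z), and the second term is the source of the factor 1 + |z|. *)
Lemma local_deriv_bound m q A : 0 < q -> 0 <= A -> exists2 C, 0 < C & forall f z, entire f ->
  (((modc (cderiv f z) * wgt m z / (1 + modc z)) `^ q)%:E <= C%:E * pint (fun w => fw m q f w * ker A z w)%R)%E.
Proof.
move=> q0 A0; have [C C0 hC] := @local_sup m q A q0 A0; have cb := cauchy_bd_gt0 (R := R).
have c30 := wgt_const_gt0 m; set c3 := 3 ^+ m * expR 1 in c30.
pose E2 := expR (A / q * 2); have E20 : 0 < E2 by exact: expR_gt0.
have qn0 : q != 0 by rewrite gt_eqF.
pose K := (2 * (cbd * c3) + 1) * E2.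
have bc0 : 0 < cbd * c3 := mulr_gt0 cb c30.
have K0 : 0 < K by rewrite mulr_gt0 //; lra.
exists (K `^ q * C); first by rewrite mulr_gt0 // powR_gt0.
move=> f z hf.
have P0 : (0 <= pint (fun w => fw m q f w * ker A z w)%R)%E.
  by apply: pint_ge0 => w; rewrite mulr_ge0 ?fw_ge0 ?ker_ge0.
case E : (pint _) P0 => [r||] //= r0; last first.
  by rewrite gt0_muley ?leey // lte_fin mulr_gt0 // powR_gt0.
rewrite lee_fin in r0; have hB := hC f z r hf E.
set B := (C * r) `^ q^-1 in hB; have B0 : 0 <= B by exact: powR_ge0.
have hB2 v : modc v <= 1 -> modc (f (z + v)) * wgt m (z + v) <= B * E2.
  move=> v1; apply: le_trans (hB (z + v)) _; rewrite ler_wpM2l // ler_expR.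
  rewrite ler_wpM2l ?divr_ge0 ?(ltW q0) //.
  have -> : z - (z + v) = - v by ring.
  by rewrite l1N; have := l1_le_modc v; lra.
pose k := fun v => f (z + v) * cexp (- cj z * v).
have hk : entire k := @entire_translate f z hf.
have wz : 0 < wgt m z := wgt_gt0 m z.
have dk : cderiv k 0 = cderiv f z - cj z * f z.
  apply: cdiff_cderiv; rewrite /k.
  have d1 : cdiff (fun v => f (z + v)) 0 (cderiv f z).
    by apply: cdiff_shift; rewrite addr0; exact: entire_cdiff.
  have := cdiffM d1 (@cdiff_cexpZ R (- cj z) 0); rewrite /= addr0 mulr0 cexp0 !mulr1.
  by have -> : cderiv f z + f z * - cj z = cderiv f z - cj z * f z by ring.
have half : (0 : R) < 1 / 2 by lra.
have bk : modc (cderiv k 0) * wgt m z <= 2 * (cbd * c3) * (B * E2).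
  have := @cderiv_bound R k 0 (1 / 2) (c3 * (B * E2) / wgt m z) hk half.
  have -> : 2 * (1 / 2) = 1 :> R by field.
  move=> H; rewrite -ler_pdivlMr //.
  have -> : 2 * (cbd * c3) * (B * E2) / wgt m z = cbd * (c3 * (B * E2) / wgt m z) / (1 / 2).
    by field; rewrite gt_eqF.
  apply: H => v v1; rewrite add0r /k modcM modc_cexp ler_pdivlMr // -mulrA.
  have vv : modc v ^+ 2 <= 2 by have : modc v ^+ 2 <= 1 by [rewrite expr_le1 ?modc_ge0]; lra.
  have wt := @wgt_translate m z v (le_trans v1 (ler1n R 2)) vv.
  rewrite [expR _ * _]mulrC; apply: le_trans (ler_wpM2l (modc_ge0 _) wt) _.
  rewrite mulrCA -/c3 ler_wpM2l ?(ltW c30) //; exact: hB2.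
have fz : modc (f z) * wgt m z <= B * E2.
  by have := hB2 0; rewrite addr0 modc0; apply.
have zz := modc_ge0 z.
have fin : modc (cderiv f z) * wgt m z / (1 + modc z) <= K * B.
  rewrite ler_pdivrMr ?modc1_gt0 //.
  have -> : cderiv f z = cderiv k 0 + cj z * f z by rewrite dk; ring.
  apply: le_trans (ler_wpM2r (ltW wz) (modcD _ _)) _; rewrite mulrDl modcM modc_cj -mulrA.
  have BE : 0 <= B * E2 by rewrite mulr_ge0 // ltW.
  have := ler_wpM2l zz fz => h3.
  set D := cbd * c3 in bc0 bk *.
  have h4 : 0 <= D * (B * E2) := mulr_ge0 (ltW bc0) BE.
  have h5 : 0 <= modc z * (D * (B * E2)) := mulr_ge0 zz h4.
  have -> : K * B * (1 + modc z) = 2 * D * (B * E2) + B * E2 + 2 * (modc z * (D * (B * E2))) + modc z * (B * E2) by rewrite /K -/D; ring.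
  lra.
rewrite -EFinM lee_fin.
apply: le_trans (ler_pow (ltW q0) _ fin) _.
  by rewrite !mulr_ge0 ?modc_ge0 ?wgt_ge0 // invr_ge0 ltW // modc1_gt0.
by rewrite powRM ?(ltW K0) // /B powVK // ?mulr_ge0 ?(ltW C0) // mulrA.
Qed.

End LocalEstimates.

(** * Primitives along rays against the Gaussian weight *)

Section LittlewoodPaley.
Local Open Scope classical_set_scope.
Local Open Scope ring_scope.
Context {R : realType}.
Implicit Types (a b c d u s t x y M p q A : R) (z w v : R[i]) (f g h : R[i] -> R[i]) (m : nat).
Local Notation mu := (@lebesgue_measure R).
Opaque expR powR ln cauchy_bd wgt fw ker l1.

Lemma continuous_rcont_on a b (F : R -> R) : continuous F -> rcont_on a b F.
Proof.
move=> cF t _ e e0; have /cvgrPdist_le/(_ e e0) := cF t.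
move=> /nbhs_ballP[r /= r0 hr]; exists r => // s _ st.
by rewrite distrC; apply: hr; rewrite /ball /= distrC.
Qed.

Lemma is_derive_expRlin L t : L != 0 ->
  is_derive t 1 (fun t : R => expR ((t - 1) * L) / L) (expR ((t - 1) * L)).
Proof.
move=> L0; apply: is_derive_eq.
by rewrite /GRing.scale /=; field.
Qed.

Lemma rcont_expRlin L : rcont_on 0 1 (fun t => expR ((t - 1) * L)).
Proof.
apply: continuous_rcont_on => t.
apply: (@continuous_comp _ _ _ (fun t : R => (t - 1) * L) expR); last exact: continuous_expR.
apply: cvgM; last exact: cvg_cst.
apply: cvgB; [exact: cvg_id|exact: cvg_cst].
Qed.

Lemma rint_expRlin L : 0 < L -> rint 0 1 (fun t => expR ((t - 1) * L)) <= L^-1.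
Proof.
move=> L0; have d t : is_derive t 1 (fun t : R => expR ((t - 1) * L) / L) (expR ((t - 1) * L)).
  by apply: is_derive_expRlin; rewrite gt_eqF.
rewrite (rint_FTC d); last exact: rcont_expRlin.
by rewrite subrr mul0r expR0 mul1r lerBlDr lerDl divr_ge0 ?expR_ge0 ?ltW.
Qed.

(* The derivative of a function of the space grows by a factor [1 + `|w|], so [dw] is to
   derivatives what [fw] is to functions. *)
Definition dw m q h w : R := (modc (h w) * wgt m w / (1 + modc w)) `^ q.

Lemma dw_ge0 m q h w : 0 <= dw m q h w. Proof. exact: powR_ge0. Qed.

Lemma pmeas_dw m q h : entire h -> pmeas (dw m q h).
Proof.
move=> hh; have -> : dw m q h = fun w => (modc (h w) * wgt m w * (1 + modc w) `^ (-1)) `^ q.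
  by apply/funext => w; rewrite /dw powR_inv1 // ltW // modc1_gt0.
apply: pmeas_powR; apply: pmeasM.
  by apply: pmeasM; [exact: pmeas_entire|exact: pmeas_wgt].
by apply: pmeas_powR; apply: pmeasD; [exact: pmeas_cst|exact: pmeas_modc].
Qed.

Lemma fw_dw m q h w : fw m q h w = dw m q h w * (1 + modc w) `^ q.
Proof.
have w0 := modc1_gt0 w; rewrite fwE /dw -powRM ?divr_ge0 ?mulr_ge0 ?modc_ge0 ?wgt_ge0 ?(ltW w0) //.
by rewrite divfK // gt_eqF.
Qed.

Lemma modc1_expR z w : 1 + modc w <= (1 + modc z) * expR (l1 (z - w)).
Proof.
have e := expR_ge1Dx (l1 (z - w)).
have w1 : modc w <= modc z + l1 (z - w).
  have -> : modc w = modc (z - (z - w)) by congr modc; ring.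
  apply: le_trans (modcB _ _) _; rewrite lerD2l; exact: modc_le_l1.
have z0 := modc_ge0 z; have l0 := l1_ge0 (z - w).
apply: le_trans (ler_wpM2l (ltW (modc1_gt0 z)) e).
have : 0 <= modc z * l1 (z - w) := mulr_ge0 z0 l0.
lra.
Qed.

(** The factor (1 + |w|)^q separating [fw] from [dw] is exchanged for (1 + |z|)^q at the cost of [q]
    units of the decay rate. *)
Lemma fw_ker_dw m q h z w : 0 < q ->
  fw m q h w * ker (1 + q) z w <= (1 + modc z) `^ q * (dw m q h w * ker 1 z w).
Proof.
move=> q0; rewrite fw_dw -(mulrA (dw m q h w)) [leRHS]mulrCA ler_wpM2l ?dw_ge0 //.
have k0 := ltW (ker_gt0 (1 + q) z w).
apply: le_trans (ler_wpM2r k0 (ler_pow (ltW q0) (ltW (modc1_gt0 w)) (modc1_expR z w))) _.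
rewrite powRM ?(ltW (modc1_gt0 z)) ?expR_ge0 // -mulrA ler_wpM2l ?powR_ge0 //.
rewrite -expRM !kerE -expRD ler_expR.
lra.
Qed.

(* The constant [4 * b ^+ 2] absorbs [b * u] when [rho <= 4 * b]. *)
Lemma ray_exponent b u rho : 0 <= b -> 0 <= u -> u <= rho ->
  b * u - u * rho / 2 <= 4 * b ^+ 2 - u * rho / 4.
Proof.
move=> b0 u0 ur; have [rb|rb] := leP rho (4 * b).
  have h1 : b * u <= b * (4 * b) by rewrite ler_wpM2l //; lra.
  have h2 : 0 <= u * rho by rewrite mulr_ge0 //; lra.
  rewrite expr2; lra.
have h1 : 0 <= u * (rho - 4 * b) by rewrite mulr_ge0 //; lra.
have h2 := sqr_ge0 b; lra.
Qed.

(** From tz out to z the Gaussian decreases by (1 - t)(1 + t)|z|^2/2 in the exponent, of which (1 -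
    t)|z|^2/2 is kept, and the polynomial factor grows by at most exp(m (1 - t)|z|). *)
Lemma wgt_ray m z t : 0 <= t <= 1 ->
  wgt m z <= wgt m (t%:C%C * z) * expR (m%:R * ((1 - t) * modc z) - (1 - t) * modc z * modc z / 2).
Proof.
move=> /andP[t0 t1]; rewrite !wgtE modcM modc_real (ger0_norm t0).
set r := modc z; have r0 : 0 <= r := modc_ge0 z.
have tr0 : 0 <= t * r := mulr_ge0 t0 r0.
have trr : 0 <= t * r ^+ 2 by rewrite mulr_ge0 // sqr_ge0.
rewrite expRD expRM_natl [_ ^+ m * _ * _](_ : _ = ((1 + t * r) * expR ((1 - t) * r)) ^+ m *
  (expR (- ((t * r) ^+ 2 / 2)) * expR (- ((1 - t) * r * r / 2)))); last by rewrite (exprMn m); ring.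
apply: ler_pM; rewrite ?exprn_ge0 ?expR_ge0 //; first by lra.
  rewrite lerXn2r ?nnegrE ?mulr_ge0 ?expR_ge0 //; try lra.
  have u0 : 0 <= (1 - t) * r by rewrite mulr_ge0 //; lra.
  have e := expR_ge1Dx ((1 - t) * r); apply: le_trans (ler_wpM2l _ e); last by lra.
  have : 0 <= t * r * ((1 - t) * r) := mulr_ge0 tr0 u0.
  lra.
rewrite -expRD ler_expR.
have : 0 <= t * r ^+ 2 * (1 - t) by rewrite mulr_ge0 //; lra.
rewrite exprMn !expr2; lra.
Qed.

(** Half of the Gaussian gain absorbs the exponential losses and leaves exp((t - 1) r^2/4) with r =
    |z|, whose integral over [0, 1] is at most 4/r^2. With the length r of the ray this gives (1 +
    r)/r, bounded for r > 1; for r <= 1 the integrand is bounded outright. *)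
Lemma ray_bound m a z h D : 0 <= a -> 0 <= D -> entire h ->
  (forall z', modc (h z') * wgt m z' <= D * (1 + modc z) * expR (a * l1 (z - z'))) ->
  modc (segint h z) * wgt m z <= 16 * expR (4 * (2 * a + m%:R) ^+ 2) * D.
Proof.
move=> a0 D0 hh H; set b := 2 * a + m%:R; set r := modc z; have r0 : 0 <= r := modc_ge0 z.
have b0 : 0 <= b by rewrite addr_ge0 ?mulr_ge0.
pose E := expR (4 * b ^+ 2); have E0 : 0 < E := expR_gt0 _.
have ptw t : 0 <= t <= 1 -> modc (h (t%:C%C * z)) * wgt m z <= D * (1 + r) * E * expR ((t - 1) * (r ^+ 2 / 4)).
  move=> t01; have /andP[t0 t1] := t01.
  apply: le_trans (ler_wpM2l (modc_ge0 _) (wgt_ray m z t01)) _; rewrite (mulrA (modc (h _))) -/r.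
  apply: le_trans (ler_wpM2r (expR_ge0 _) (H (t%:C%C * z))) _; rewrite -/r.
  rewrite -!(mulrA (D * (1 + r))) -!expRD ler_wpM2l ?mulr_ge0 ?addr_ge0 // ler_expR.
  have l : l1 (z - t%:C%C * z) <= 2 * ((1 - t) * r).
    apply: le_trans (l1_le_modc _) _.
    have -> : z - t%:C%C * z = (1 - t)%:C%C * z by rewrite rmorphB rmorph1; ring.
    by rewrite modcM modc_real ger0_norm //; lra.
  have u0 : 0 <= (1 - t) * r by rewrite mulr_ge0 //; lra.
  have ur : (1 - t) * r <= r by rewrite mulrBl mul1r lerBlDr lerDl mulr_ge0.
  have := ray_exponent b0 u0 ur; have := ler_wpM2l a0 l; rewrite /b !expr2; lra.
have ct : ccont_on 0 1 (fun t => h (t%:C%C * z)).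
  apply: ccont_path => w; apply: hol_contin; exists (cderiv h w); exact: entire_cdiff.
have cm := ccont_on_modc ct.
have k1 : modc (segint h z) * wgt m z <= r * (2 * rint 0 1 (fun t => wgt m z * modc (h (t%:C%C * z)))).
  rewrite segintE modcM -mulrA ler_wpM2l // rintZ // [leRHS]mulrCA [leLHS]mulrC.
  by rewrite ler_wpM2l ?wgt_ge0 //; exact: cint_le.
have cE : rcont_on 0 1 (fun t => wgt m z * modc (h (t%:C%C * z))).
  have c1 := @ccont_on_cst R 0 1 (wgt m z)%:C%C.
  have := ccont_on_modc (ccont_onM c1 ct).
  congr (rcont_on _ _ _); apply/funext => t; rewrite modcM modc_real ger0_norm //; exact: wgt_ge0.
apply: le_trans k1 _.
have K0 : 0 <= D * (1 + r) * E by rewrite !mulr_ge0 ?addr_ge0 // ltW.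
rewrite -/E; have DE0 : 0 <= D * E by rewrite mulr_ge0 // ltW.
have [r1|r1] := leP r 1.
  have k2 : rint 0 1 (fun t => wgt m z * modc (h (t%:C%C * z))) <= D * (1 + r) * E.
    have := le_rint cE (@rcont_on_cst R 0 1 (D * (1 + r) * E)).
    rewrite rint_cst // subr0 mulr1; apply => t t01; rewrite mulrC.
    apply: le_trans (ptw t t01) _; rewrite -[leRHS]mulr1 ler_wpM2l // -[leRHS]expR0 ler_expR.
    have /andP[t0 t1] := t01; rewrite mulr_le0_ge0 ?divr_ge0 ?sqr_ge0 //; lra.
  have k3 : r * (2 * rint 0 1 (fun t => wgt m z * modc (h (t%:C%C * z)))) <= 1 * (2 * (D * 2 * E)).
    apply: ler_pM => //; last 1 first.
    - rewrite ler_wpM2l //; apply: le_trans k2 _; rewrite ler_wpM2r ?(ltW E0) // ler_wpM2l //; lra.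
    - rewrite mulr_ge0 //; have := le_rint (@rcont_on_cst R 0 1 0) cE.
      rewrite rint_cst // mul0r; apply => t _; exact: mulr_ge0 (wgt_ge0 _ _) (modc_ge0 _).
  lra.
have r00 : 0 < r by lra.
have L0 : 0 < r ^+ 2 / 4 by rewrite divr_gt0 ?exprn_gt0.
have k2 : rint 0 1 (fun t => wgt m z * modc (h (t%:C%C * z))) <= D * (1 + r) * E * (4 / r ^+ 2).
  have cX := @rcont_expRlin (r ^+ 2 / 4).
  have c2 : rcont_on 0 1 (fun t => D * (1 + r) * E * expR ((t - 1) * (r ^+ 2 / 4))).
    apply: continuous_rcont_on => t; apply: cvgM; first exact: cvg_cst.
    apply: (@continuous_comp _ _ _ (fun t : R => (t - 1) * (r ^+ 2 / 4)) expR); last exact: continuous_expR.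
    by apply: cvgM; last exact: cvg_cst; apply: cvgB; [exact: cvg_id|exact: cvg_cst].
  apply: le_trans (le_rint cE c2 _) _; first by move=> t t01; rewrite mulrC; exact: ptw.
  by rewrite rintZ // ler_wpM2l // (le_trans (rint_expRlin L0)) // invf_div.
have k3 : r * (2 * rint 0 1 (fun t => wgt m z * modc (h (t%:C%C * z)))) <= r * (2 * (D * (1 + r) * E * (4 / r ^+ 2))).
  by rewrite ler_wpM2l // ler_wpM2l.
apply: le_trans k3 _.
have -> : r * (2 * (D * (1 + r) * E * (4 / r ^+ 2))) = 8 * (D * E) * ((1 + r) / r) by field; rewrite gt_eqF.
have : (1 + r) / r <= 2 by rewrite ler_pdivrMr //; lra.
move=> k4; apply: le_trans (ler_wpM2l _ k4) _; first by rewrite mulr_ge0.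
lra.
Qed.

(** The local bound is taken at rate [1 + q]: [q] units pay for replacing [fw] by [dw], and one unit
    remains as the kernel of the conclusion. *)
Lemma segint_bound m q : 0 < q -> exists2 C, 0 < C & forall h z, entire h ->
  ((fw m q (segint h) z)%:E <= C%:E * pint (fun w => dw m q h w * ker 1 z w)%R)%E.
Proof.
move=> q0; have A0 : 0 <= 1 + q by lra.
have [C C0 hC] := @local_sup R m q (1 + q) q0 A0.
pose a := (1 + q) / q; have a0 : 0 <= a by rewrite divr_ge0 // ltW.
pose K := 16 * expR (4 * (2 * a + m%:R) ^+ 2); have K0 : 0 < K by rewrite mulr_gt0 // expR_gt0.
have qn0 : q != 0 by rewrite gt_eqF.
exists (K `^ q * C); first by rewrite mulr_gt0 // powR_gt0.
move=> h z hh.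
have mD : pmeas (fun w => dw m q h w * ker 1 z w) by apply: pmeasM; [exact: pmeas_dw|exact: pmeas_ker].
have d0 w : 0 <= dw m q h w * ker 1 z w := mulr_ge0 (dw_ge0 _ _ _ _) (ker_ge0 _ _ _).
have f0 w : 0 <= fw m q h w * ker (1 + q) z w := mulr_ge0 (fw_ge0 _ _ _ _) (ker_ge0 _ _ _).
have P0 := pint_ge0 d0.
have le : (pint (fun w => fw m q h w * ker (1 + q) z w)%R <=
  ((1 + modc z) `^ q)%:E * pint (fun w => dw m q h w * ker 1 z w)%R)%E.
  rewrite -pintZ //; last exact: powR_ge0.
  apply: le_pint => //.
  - by apply: pmeasM; [exact: pmeas_fw|exact: pmeas_ker].
  - by apply: pmeasM => //; exact: pmeas_cst.
  - by move=> w; exact: fw_ker_dw.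
case E : (pint (fun w => dw m q h w * ker 1 z w)) P0 le => [r||] //= r0 le; last first.
  by rewrite gt0_muley ?leey // lte_fin mulr_gt0 // powR_gt0.
have P1 := pint_ge0 f0; rewrite lee_fin in r0.
case E1 : (pint (fun w => fw m q h w * ker (1 + q) z w)) P1 le => [r'||] //= r'0 le.
rewrite lee_fin in r'0; rewrite -EFinM lee_fin in le.
have hB := hC h z r' hh E1; have z0 := modc1_gt0 z.
pose D := (C * r) `^ q^-1; have D0 : 0 <= D := powR_ge0 _ _.
have B z' : modc (h z') * wgt m z' <= D * (1 + modc z) * expR (a * l1 (z - z')).
  apply: le_trans (hB z') _; rewrite ler_wpM2r ?expR_ge0 //.
  have -> : D * (1 + modc z) = (C * ((1 + modc z) `^ q * r)) `^ q^-1.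
    rewrite [C * _](_ : _ = (C * r) * (1 + modc z) `^ q); last by ring.
    by rewrite powRM ?powR_ge0 ?powKV ?(ltW z0) // mulr_ge0 // ltW.
  apply: ler_pow; first by rewrite invr_ge0 ltW.
    by rewrite mulr_ge0 // ltW.
  by rewrite ler_wpM2l // ltW.
have F := ray_bound a0 D0 hh B; rewrite -/K in F.
rewrite -EFinM lee_fin fwE.
apply: le_trans (ler_pow (ltW q0) _ F) _; first by rewrite mulr_ge0 ?modc_ge0 ?wgt_ge0.
by rewrite powRM ?(ltW K0) // /D powVK // ?mulr_ge0 ?(ltW C0) // mulrA.
Qed.

End LittlewoodPaley.

(** * Schur's test and the norm comparison *)

Section KernelIntegral.
Local Open Scope classical_set_scope.
Local Open Scope ring_scope.
Context {R : realType}.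
Implicit Types (a b c d u s t x y M p q A : R) (z w v : R[i]) (f g h : R[i] -> R[i]) (m : nat).
Local Notation mu := (@lebesgue_measure R).
Opaque expR powR ln cauchy_bd wgt fw dw.

Lemma measurable_expR_abs A : measurable_fun setT (fun x : R => expR (- (A * `|x|))).
Proof.
apply: measurableT_comp; first exact: measurable_expR.
apply: measurableT_comp; first exact: oppr_measurable.
apply: measurable_funM; first exact: measurable_cst.
exact: normr_measurable.
Qed.

(** The integrand lies below 1/A times the sum of the exponential density and its reflection, both
    of mass 1. *)
Lemma integral_expR_abs A : 0 < A -> exists2 K, 0 <= K &
  (\int[mu]_x (expR (- (A * `|x|)))%:E <= K%:E)%E.
Proof.
move=> A0; exists (2 / A); first by rewrite divr_ge0 // ltW.
pose e := exponential_pdf A.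
have e0 x : 0 <= e x by apply: exponential_pdf_ge0; exact: ltW.
have me : measurable_fun setT e := measurable_exponential_pdf A.
have meN : measurable_fun setT (fun x => e (- x)) by apply: measurableT_comp.
have I1 : (\int[mu]_x (e x)%:E = 1)%E := integral_exponential_pdf A0.
have I2 : (\int[mu]_x (e (- x))%:E = 1)%E.
  rewrite (@ge0_integral_opp R (fun x => (e x)%:E)) //; exact/measurable_EFinP.
have An : A != 0 by rewrite gt_eqF.
have le x : expR (- (A * `|x|)) <= A^-1 * e x + A^-1 * e (- x).
  have i0 y : 0 <= A^-1 * e y by rewrite mulr_ge0 // invr_ge0 ltW.
  have [x0|x0] := leP 0 x.
    rewrite ger0_norm // -[leLHS]addr0 lerD //.
    by rewrite /e exponential_pdfE // mulrA mulVf // mul1r mulNr.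
  rewrite ltr0_norm // -[leLHS]add0r lerD //.
  have x0' : 0 <= - x by rewrite oppr_ge0 ltW.
  by rewrite /e exponential_pdfE // mulrA mulVf // mul1r mulNr.
apply: (@le_trans _ _ (\int[mu]_x ((A^-1)%:E * (e x)%:E + (A^-1)%:E * (e (- x))%:E))%E).
  apply: ge0_le_integral => //.
  - by apply/measurable_EFinP; exact: measurable_expR_abs.
  - by apply: emeasurable_funD; apply: measurable_funeM; exact/measurable_EFinP.
  - by move=> x _; rewrite -!EFinM -EFinD lee_fin.
have iA : 0 <= A^-1 by rewrite invr_ge0 ltW.
rewrite ge0_integralD //; first last.
- by apply: measurable_funeM; exact/measurable_EFinP.
- by move=> x _; rewrite -EFinM lee_fin mulr_ge0.
- by apply: measurable_funeM; exact/measurable_EFinP.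
- by move=> x _; rewrite -EFinM lee_fin mulr_ge0.
rewrite !ge0_integralZl_EFin //; first last.
- by apply/measurable_EFinP.
- by move=> x _; rewrite lee_fin.
- by apply/measurable_EFinP.
- by move=> x _; rewrite lee_fin.
by rewrite I1 I2 !mule1 -EFinD lee_fin; lra.
Qed.

Lemma pint_prod (F G : R -> R) : measurable_fun setT F -> measurable_fun setT G ->
  (forall x, 0 <= F x) -> (forall x, 0 <= G x) ->
  pint (fun z => F (complex.Re z) * G (complex.Im z)) =
  ((\int[mu]_x (F x)%:E) * \int[mu]_y (G y)%:E)%E.
Proof.
move=> mF mG F0 G0; rewrite pint_xy; first last.
- by move=> z; rewrite mulr_ge0.
- apply: pmeasM.
    exact: (measurableT_comp mF (@pmeas_Re R)).
  exact: (measurableT_comp mG (@pmeas_Im R)).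
have I0 : (0 <= \int[mu]_y (G y)%:E)%E by apply: integral_ge0 => y _; rewrite lee_fin.
transitivity (\int[mu]_x ((F x)%:E * \int[mu]_y (G y)%:E))%E.
  apply: eq_integral => x _; rewrite -ge0_integralZl_EFin //.
  - by move=> y _; rewrite lee_fin.
  - exact/measurable_EFinP.
rewrite ge0_integralZr //; first exact/measurable_EFinP.
by move=> x _; rewrite lee_fin.
Qed.

Lemma kerE2 A z w : ker A z w =
  expR (- (A * `|complex.Re (z - w)|)) * expR (- (A * `|complex.Im (z - w)|)).
Proof. by rewrite kerE -expRD /l1 mulrDr opprD. Qed.
Opaque l1.

Lemma pint_ker A : 0 < A -> exists2 K, 0 <= K & forall z, (pint (ker A z) <= K%:E)%E.
Proof.
move=> A0; have [K K0 hK] := integral_expR_abs A0.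
exists (K * K); first by rewrite mulr_ge0.
move=> z.
pose E (x : R) := expR (- (A * `|x|)); have mE : measurable_fun setT E := measurable_expR_abs A.
have mp : pmeas (fun w : R[i] => E (complex.Re w) * E (complex.Im w)).
  apply: pmeasM; [exact: (measurableT_comp mE (@pmeas_Re R))|exact: (measurableT_comp mE (@pmeas_Im R))].
have p0 w : 0 <= E (complex.Re w) * E (complex.Im w) by rewrite mulr_ge0 ?expR_ge0.
have -> : pint (ker A z) = pint (fun w => E (complex.Re w) * E (complex.Im w)).
  rewrite -(pint_shift (- z) mp p0); apply: eq_pint => w.
  by rewrite kerC kerE2 /E addrC.
rewrite pint_prod ?EFinM //; try (by move=> x; exact: expR_ge0).
have I0 : (0 <= \int[mu]_x (E x)%:E)%E by apply: integral_ge0 => y _; rewrite lee_fin expR_ge0.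
by apply: lee_pmul.
Qed.

Lemma area_sigma_finite : sigma_finite setT (mu \x mu)%E.
Proof.
have /sigma_finiteP[F [F_T F_nd F_oo]] := @sigma_finiteT _ _ _ mu.
exists (fun n => F n `*` F n).
  apply/esym; rewrite -subTset => -[x y] _.
  have [n _ xn] : (\bigcup_n F n) x by rewrite -F_T.
  have [k _ yk] : (\bigcup_n F n) y by rewrite -F_T.
  exists (maxn n k) => //; split => /=.
    by have /subsetPset h := F_nd _ _ (leq_maxl n k); exact: h.
  by have /subsetPset h := F_nd _ _ (leq_maxr n k); exact: h.
move=> n; have [mF F1] := F_oo n; split; first exact: measurableX.
by rewrite product_measure1E // lte_mul_pinfty // ge0_fin_numE.
Qed.

(* A copy of [mu \x mu]: HB wrongly believes the product already carries a sigma-finite structure. *)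
Definition area_sfm : set (measurableTypeR R * measurableTypeR R)%type -> \bar R := (mu \x mu)%E.

HB.instance Definition _ := isMeasure.Build _ _ _ area_sfm
  (measure0 (mu \x mu)%E) (measure_ge0 (mu \x mu)%E) (@measure_semi_sigma_additive _ _ _ (mu \x mu)%E).
HB.instance Definition _ := Measure_isSigmaFinite.Build _ _ _ area_sfm area_sigma_finite.

(** The pointwise kernel bounds are integrated in [z] and the order of integration is exchanged; the
    symmetry of the kernel bounds its mass in the other variable by the same [K]. *)
Lemma schur_ker A : 0 < A -> exists2 K, 0 <= K & forall (phi G : R[i] -> R) C, 0 <= C ->
  pmeas phi -> pmeas G -> (forall z, 0 <= phi z) -> (forall z, 0 <= G z) ->
  (forall z, (phi z)%:E <= C%:E * pint (fun w => G w * ker A z w)%R)%E ->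
  (pint phi <= (C * K)%:E * pint G)%E.
Proof.
move=> A0; have [K K0 hK] := pint_ker A0; exists K => // phi G C C0 mphi mG phi0 G0 H.
pose F (zw : (R * R) * (R * R)) : \bar R := (G (cplx zw.2) * ker A (cplx zw.1) (cplx zw.2))%:E.
have F0 zw : (0 <= F zw)%E by rewrite lee_fin mulr_ge0 ?ker_ge0.
have mker : measurable_fun setT (fun zw : (R * R) * (R * R) => ker A (cplx zw.1) (cplx zw.2)).
  have mE := measurable_expR_abs A.
  have -> : (fun zw : (R * R) * (R * R) => ker A (cplx zw.1) (cplx zw.2)) =
    (fun zw => expR (- (A * `|zw.1.1 - zw.2.1|)) * expR (- (A * `|zw.1.2 - zw.2.2|))).
    by apply/funext => -[[x y] [x' y']]; rewrite kerE2 cReB cImB.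
  apply: measurable_funM; apply: (measurableT_comp mE); apply: measurable_funB.
  - exact: (measurableT_comp measurable_fst measurable_fst).
  - exact: (measurableT_comp measurable_fst measurable_snd).
  - exact: (measurableT_comp measurable_snd measurable_fst).
  - exact: (measurableT_comp measurable_snd measurable_snd).
have mF : measurable_fun setT F.
  apply/measurable_EFinP; apply: measurable_funM => //.
  exact: (measurableT_comp mG measurable_snd).
have T1 := @fubini_tonelli _ _ _ _ R area_sfm area_sfm F mF F0.
have mFF := measurable_fun_fubini_tonelli_F (m2 := area_sfm) F mF F0.
change (pint phi) with (\int[area_sfm]_x (phi (cplx x))%:E)%E.
change (pint G) with (\int[area_sfm]_x (G (cplx x))%:E)%E.
apply: (@le_trans _ _ (\int[area_sfm]_x (C%:E * \int[area_sfm]_y F (x, y)))%E).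
  apply: ge0_le_integral.
  - exact: measurableT.
  - by move=> x _; rewrite lee_fin.
  - exact/measurable_EFinP.
  - exact: measurable_funeM.
  - by move=> x _; exact: H.
have G0' (x : R * R) : (0 <= (G (cplx x))%:E)%E by rewrite lee_fin.
have I0 (x : R * R) : (0 <= \int[area_sfm]_y F (x, y))%E by apply: integral_ge0 => y _; exact: F0.
have J0 (y : R * R) : (0 <= \int[area_sfm]_x F (x, y))%E by apply: integral_ge0 => x _; exact: F0.
have mFG := measurable_fun_fubini_tonelli_G (m1 := area_sfm) F mF F0.
have mGE : measurable_fun setT (fun y : R * R => (G (cplx y))%:E) by exact/measurable_EFinP.
rewrite (ge0_integralZl_EFin area_sfm measurableT (fun (x : R * R) _ => I0 x) mFF C0).
rewrite T1 EFinM -muleA; apply: lee_wpmul2l; first by rewrite lee_fin.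
rewrite -(ge0_integralZl_EFin area_sfm measurableT (fun (x : R * R) _ => G0' x) mGE K0).
apply: ge0_le_integral.
- exact: measurableT.
- by move=> x _; exact: J0.
- exact: mFG.
- exact: measurable_funeM.
move=> y _; rewrite /F.
have -> : (\int[area_sfm]_x (G (cplx y) * ker A (cplx x) (cplx y))%:E)%E = pint (fun z => G (cplx y) * ker A (cplx y) z)%R.
  by apply: eq_integral => x _; rewrite kerC.
rewrite (pintZ (pmeas_ker A (cplx y)) (fun z => ker_ge0 A (cplx y) z) (G0 (cplx y))).
rewrite muleC; apply: lee_wpmul2r; first exact: G0'.
exact: hK.
Qed.

(** Used with h = f g': the norm of V_g f is then controlled by a weighted norm without any integral
    operator left. *)
Lemma fock_segint m q : 0 < q -> exists2 C, 0 < C & forall h, entire h ->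
  (fock_int m q (segint h) <= C%:E * pint (dw m q h))%E.
Proof.
move=> q0; have [C C0 hC] := @segint_bound R m q q0.
have [K K0 hK] := schur_ker (@ltr01 R).
exists (C * (K + 1)); first by rewrite mulr_gt0 // ltr_wpDl.
move=> h hh; rewrite fock_intE.
have md := pmeas_dw m q hh.
apply: (@le_trans _ _ ((C * K)%:E * pint (dw m q h))%E).
  apply: (hK _ (dw m q h)) => //.
  - exact: ltW.
  - apply: pmeas_fw; exact: entire_segint.
  - by move=> z; exact: fw_ge0.
  - by move=> z; exact: dw_ge0.
  - by move=> z; exact: hC.
apply: lee_wpmul2r; first by apply: pint_ge0 => z; exact: dw_ge0.
by rewrite lee_fin ler_wpM2l ?(ltW C0) // lerDl.
Qed.

(** The converse comparison. Applied to monomials it yields the lower bound for the ratios of their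
    norms. *)
Lemma dw_cderiv m q : 0 < q -> exists2 C, 0 < C & forall f, entire f ->
  (pint (dw m q (cderiv f)) <= C%:E * fock_int m q f)%E.
Proof.
move=> q0; have [C C0 hC] := @local_deriv_bound R m q 1 q0 ler01.
have [K K0 hK] := schur_ker (@ltr01 R).
exists (C * (K + 1)); first by rewrite mulr_gt0 // ltr_wpDl.
move=> f hf; rewrite fock_intE.
have mf := pmeas_fw m q hf.
apply: (@le_trans _ _ ((C * K)%:E * pint (fw m q f))%E).
  apply: (hK _ (fw m q f)) => //.
  - exact: ltW.
  - apply: pmeas_dw; exact: entire_cderiv.
  - by move=> z; exact: dw_ge0.
  - by move=> z; exact: fw_ge0.
  - by move=> z; exact: hC.
apply: lee_wpmul2r; first by apply: pint_ge0 => z; exact: fw_ge0.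
by rewrite lee_fin ler_wpM2l ?(ltW C0) // lerDl.
Qed.

End KernelIntegral.

(** * Fock-Sobolev norms and test functions *)

Section FockAlgebra.
Local Open Scope classical_set_scope.
Local Open Scope ring_scope.
Context {R : realType}.
Implicit Types (a b d s t x y M p q A : R) (z w v c : R[i]) (f g h : R[i] -> R[i]) (m : nat).
Local Notation mu := (@lebesgue_measure R).
Lemma l1_sqr z : l1 z ^+ 2 <= 2 * modc z ^+ 2.
Proof.
rewrite modc_sqr /l1.
rewrite -[complex.Re z ^+ 2]real_normK ?num_real // -[complex.Im z ^+ 2]real_normK ?num_real //.
have := sqr_ge0 (`|complex.Re z| - `|complex.Im z|); rewrite !expr2; lra.
Qed.

Opaque expR powR ln cauchy_bd wgt fw l1 dw ker.

Lemma fock_ge0 m p f : (0 <= fock_int m p f)%E.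
Proof. by rewrite fock_intE; apply: pint_ge0 => z; exact: fw_ge0. Qed.

Lemma fock_fin m p f : in_fock m p f -> fock_int m p f \is a fin_num.
Proof. by move=> [_ h]; rewrite ge0_fin_numE // fock_ge0. Qed.

Lemma fock_fineK m p f : in_fock m p f -> fock_int m p f = (fine (fock_int m p f))%:E.
Proof. by move=> h; rewrite fineK // fock_fin. Qed.

Lemma fnorm_ge0 m p f : 0 <= fnorm m p f. Proof. exact: powR_ge0. Qed.

Lemma fnormX m p f : 0 < p -> in_fock m p f -> fock_int m p f = ((fnorm m p f) `^ p)%:E.
Proof.
move=> p0 hf; rewrite fock_fineK // /fnorm powVK ?gt_eqF //.
by rewrite fine_ge0 // fock_ge0.
Qed.

Lemma fnorm_leP m p f M : 0 < p -> in_fock m p f -> 0 <= M ->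
  (fnorm m p f <= M) = (fock_int m p f <= (M `^ p)%:E)%E.
Proof.
move=> p0 hf M0; rewrite fnormX // lee_fin; apply/idP/idP => h.
  by apply: ler_pow => //; [exact: ltW|exact: fnorm_ge0].
rewrite leNgt; apply/negP => k; move: h; rewrite leNgt => /negP; apply.
by apply: gt0_ltr_powR => //; rewrite nnegrE fnorm_ge0.
Qed.

Lemma fock_fnorm m p f N : 0 < p -> 0 <= N -> (fock_int m p f <= N%:E)%E -> fnorm m p f <= N `^ p^-1.
Proof.
move=> p0 N0 h; apply: ler_pow; first by rewrite invr_ge0 ltW.
  by rewrite fine_ge0 // fock_ge0.
rewrite -lee_fin fineK // ge0_fin_numE ?fock_ge0 //.
by apply: le_lt_trans h _; rewrite ltry.
Qed.

Lemma fw_bound m p f g a : 0 <= p -> 0 <= a -> forall z, modc (f z) <= a * modc (g z) ->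
  fw m p f z <= a `^ p * fw m p g z.
Proof.
move=> p0 a0 z h; rewrite !fwE -powRM //; last exact: mulr_ge0 (modc_ge0 _) (wgt_ge0 _ _).
apply: ler_pow => //; first exact: mulr_ge0 (modc_ge0 _) (wgt_ge0 _ _).
by rewrite mulrA ler_wpM2r // wgt_ge0.
Qed.

Lemma fwZ m p c f z : 0 <= p -> fw m p (fun w => c * f w) z = modc c `^ p * fw m p f z.
Proof.
move=> p0; rewrite !fwE modcM -mulrA powRM // ?modc_ge0 //.
exact: mulr_ge0 (modc_ge0 _) (wgt_ge0 _ _).
Qed.

(** Comparing the sum with twice the larger modulus gives the constant 2^p for all exponents,
    including those below 1. *)
Lemma fwD m p f g z : 0 <= p ->
  fw m p (fun w => f w + g w) z <= 2 `^ p * (fw m p f z + fw m p g z).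
Proof.
move=> p0; have f0 := fw_ge0 m p f z; have g0 := fw_ge0 m p g z.
have t := powR_ge0 2 p; have dd := modcD (f z) (g z).
have [h|h] := leP (modc (f z)) (modc (g z)).
  have k : modc (f z + g z) <= 2 * modc (g z) by lra.
  apply: le_trans (@fw_bound m p (fun w => f w + g w) g 2 p0 (ler0n _ 2) z k) _.
  by rewrite ler_wpM2l // lerDr.
have k : modc (f z + g z) <= 2 * modc (f z) by lra.
apply: le_trans (@fw_bound m p (fun w => f w + g w) f 2 p0 (ler0n _ 2) z k) _.
by rewrite ler_wpM2l // lerDl.
Qed.

Lemma fock_intZ m p c f : 0 <= p -> entire f ->
  fock_int m p (fun w => c * f w) = ((modc c `^ p)%:E * fock_int m p f)%E.
Proof.
move=> p0 hf; rewrite !fock_intE -pintZ ?powR_ge0 //; last by move=> z; exact: fw_ge0.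
  by apply: eq_pint => z; rewrite fwZ.
exact: pmeas_fw.
Qed.

Lemma fock_intD m p f g : 0 <= p -> entire f -> entire g ->
  (fock_int m p (fun w => f w + g w)%R <= (2 `^ p)%:E * (fock_int m p f + fock_int m p g))%E.
Proof.
move=> p0 hf hg; have mf := pmeas_fw m p hf; have mg := pmeas_fw m p hg.
have f0 z := fw_ge0 m p f z; have g0 z := fw_ge0 m p g z.
rewrite !fock_intE -pintD // -pintZ ?powR_ge0 //; first last.
- by move=> z; rewrite addr_ge0.
- exact: pmeasD.
apply: le_pint.
- exact: (pmeas_fw m p (entireD hf hg)).
- by apply: pmeasM; [exact: pmeas_cst|exact: pmeasD].
- by move=> z; exact: fw_ge0.
- by move=> z; exact: fwD.
Qed.

Lemma fock_intN m p f : fock_int m p (fun w => - f w) = fock_int m p f.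
Proof. by rewrite !fock_intE; apply: eq_pint => z; rewrite !fwE modcN. Qed.

Lemma fock_intB m p f g : 0 <= p -> entire f -> entire g ->
  (fock_int m p (fun w => f w - g w)%R <= (2 `^ p)%:E * (fock_int m p f + fock_int m p g))%E.
Proof.
move=> p0 hf hg; rewrite -(fock_intN m p g).
apply: (@fock_intD m p f (fun w => - g w) p0 hf).
by have := @entireB R _ g (@entire_cst R 0) hg; apply: entire_ext => w; rewrite sub0r.
Qed.

Lemma eq_fock_int m p f g : (forall z, f z = g z) -> fock_int m p f = fock_int m p g.
Proof. by move=> h; congr fock_int; apply/funext. Qed.

Lemma in_fockZ m p c f : 0 <= p -> in_fock m p f -> in_fock m p (fun w => c * f w).
Proof.
move=> p0 hf; have [ef _] := hf; split; first exact: entireZ.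
rewrite fock_intZ // (fock_fineK hf) -EFinM; exact: ltry.
Qed.

Lemma in_fockB m p f g : 0 <= p -> in_fock m p f -> in_fock m p g -> in_fock m p (fun w => f w - g w).
Proof.
move=> p0 hf hg; have [ef _] := hf; have [eg _] := hg; split; first exact: entireB.
apply: le_lt_trans (fock_intB m p0 ef eg) _.
by rewrite (fock_fineK hf) (fock_fineK hg) -EFinD -EFinM ltry.
Qed.

Lemma fock_int0 m p : 0 < p -> fock_int m p (fun=> 0) = 0%E.
Proof.
move=> p0; rewrite fock_intE; transitivity (pint (fun _ : R[i] => 0 : R)).
  by apply: eq_pint => z; rewrite fwE modc0 mul0r powR0 // gt_eqF.
by rewrite /pint integral0.
Qed.

Lemma in_fock0 m p : 0 < p -> in_fock m p (fun=> 0).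
Proof. by move=> p0; split; [exact: (@entire_cst R 0)|rewrite fock_int0 // ltry]. Qed.

Lemma ker_le1 A z w : 0 <= A -> ker A z w <= 1.
Proof.
move=> A0; rewrite kerE -[leRHS]expR0 ler_expR oppr_le0 mulr_ge0 //; exact: l1_ge0.
Qed.

(** The local bound at rate zero, where the kernel is constant, is a global pointwise estimate. *)
Lemma fock_ptw m p : 0 < p -> exists2 C, 0 < C & forall f z, entire f ->
  ((fw m p f z)%:E <= C%:E * fock_int m p f)%E.
Proof.
move=> p0; have [C C0 hC] := @local_bound R m p 0 p0 (lexx 0); exists C => // f z hf.
apply: le_trans (hC f z hf) _; apply: lee_wpmul2l; first by rewrite lee_fin ltW.
rewrite fock_intE; apply: le_pint.
- by apply: pmeasM; [exact: pmeas_fw|exact: pmeas_ker].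
- exact: pmeas_fw.
- by move=> w; exact: mulr_ge0 (fw_ge0 _ _ _ _) (ker_ge0 _ _ _).
- by move=> w; rewrite -[leRHS]mulr1 ler_wpM2l ?fw_ge0 // ker_le1.
Qed.

Lemma fock_ptw_segint m q : 0 < q -> exists2 C, 0 < C & forall h z, entire h ->
  ((dw m q h z)%:E <= C%:E * fock_int m q (segint h))%E.
Proof.
move=> p0; have [C C0 hC] := @local_deriv_bound R m q 0 p0 (lexx 0); exists C => // h z hh.
have hs := entire_segint hh; have := hC _ z hs; rewrite cderiv_segint // => k.
apply: le_trans k _; apply: lee_wpmul2l; first by rewrite lee_fin ltW.
rewrite fock_intE; apply: le_pint.
- by apply: pmeasM; [exact: pmeas_fw|exact: pmeas_ker].
- exact: pmeas_fw.
- by move=> w; exact: mulr_ge0 (fw_ge0 _ _ _ _) (ker_ge0 _ _ _).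
- by move=> w; rewrite -[leRHS]mulr1 ler_wpM2l ?fw_ge0 // ker_le1.
Qed.

Lemma segintZ c f z : entire f -> segint (fun w => c * f w) z = c * segint f z.
Proof.
move=> hf; rewrite !segintE mulrCA; congr (_ * _).
by rewrite cintZ //; apply: ccont_path => w; exact: entire_contin.
Qed.

Lemma segintD f h z : entire f -> entire h -> segint (fun w => f w + h w) z = segint f z + segint h z.
Proof.
move=> hf hh; rewrite !segintE -mulrDr; congr (_ * _).
by rewrite cintD //; apply: ccont_path => w; exact: entire_contin.
Qed.

Lemma segint_ext f h : (forall w, f w = h w) -> segint f = segint h.
Proof. by move=> E; congr segint; apply/funext. Qed.

Lemma entire_vol_arg g f : entire g -> entire f -> entire (fun w => f w * cderiv g w).
Proof. by move=> hg hf; exact: (entireM hf (entire_cderiv hg)). Qed.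

Lemma entire_volterra g f : entire g -> entire f -> entire (volterra g f).
Proof. by move=> hg hf; exact: entire_segint (entire_vol_arg hg hf). Qed.

Lemma volterraZ g c f : entire g -> entire f ->
  volterra g (fun w => c * f w) = fun z => c * volterra g f z.
Proof.
move=> hg hf; apply/funext => z; rewrite /volterra -segintZ; last exact: entire_vol_arg.
by congr (segint _ z); apply/funext => w; rewrite mulrA.
Qed.

Lemma volterraD g f h : entire g -> entire f -> entire h ->
  volterra g (fun w => f w + h w) = fun z => volterra g f z + volterra g h z.
Proof.
move=> hg hf hh; apply/funext => z; rewrite /volterra -segintD; try exact: entire_vol_arg.
by congr (segint _ z); apply/funext => w; rewrite mulrDl.
Qed.

Lemma volterraB g f h : entire g -> entire f -> entire h ->
  volterra g (fun w => f w - h w) = fun z => volterra g f z - volterra g h z.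
Proof.
move=> hg hf hh; have E w : f w - h w = f w + -1 * h w by ring.
rewrite (_ : (fun w => f w - h w) = fun w => f w + -1 * h w); last exact/funext.
have hz : entire (fun w => -1 * h w) := @entireZ R h (-1) hh.
rewrite (volterraD hg hf hz) (volterraZ (-1) hg hh).
by apply/funext => z; rewrite mulN1r.
Qed.

Definition tfun m z w : R[i] := ((1 + modc z) ^- m)%:C%C * cexp (cj z * w + (- (modc z ^+ 2 / 2))%:C%C).

Lemma entire_tfun m z : entire (tfun m z).
Proof.
have -> : tfun m z = fun w => ((1 + modc z) ^- m)%:C%C * cexp ((- (modc z ^+ 2 / 2))%:C%C) * cexp (cj z * w).
  by apply/funext => w; rewrite /tfun (addrC (cj z * w)) cexpD mulrA.
exact: (@entireZ R _ _ (@entire_cexpZ R (cj z))).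
Qed.

(** Completing the square: against the weight, the test function is a Gaussian centred at [z], up to
    a ratio of polynomial factors that equals 1 at the centre. *)
Lemma modc_tfun m z w : modc (tfun m z w) * wgt m w =
  ((1 + modc w) / (1 + modc z)) ^+ m * expR (- (modc (z - w) ^+ 2 / 2)).
Proof.
rewrite /tfun modcM modc_cexp modc_real ger0_norm; last first.
  by rewrite invr_ge0 exprn_ge0 // ltW // modc1_gt0.
rewrite wgtE expr_div_n.
have -> : expR (- (modc (z - w) ^+ 2 / 2)) =
  expR (complex.Re (cj z * w + (- (modc z ^+ 2 / 2))%:C%C)) * expR (- (modc w ^+ 2 / 2)).
  rewrite -expRD; congr expR; rewrite cReD cReM /cj /= !modc_sqr cReB cImB; lra.
ring.
Qed.

Lemma tfun_diag m z : modc (tfun m z z) * wgt m z = 1.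
Proof.
rewrite modc_tfun subrr modc0 divff; last by rewrite gt_eqF // modc1_gt0.
by rewrite expr1n mul1r expr0n mul0r oppr0 expR0.
Qed.

(** With l the l1 distance, the Gaussian is at most exp(-l^2/4) and the polynomial ratio at most
    exp(m l); the constant is the maximum of (m + A) l - l^2/4 in the exponent. *)
Lemma tfun_bound m A : 0 <= A -> exists2 C, 0 < C & forall z w,
  modc (tfun m z w) * wgt m w <= C * ker A z w.
Proof.
move=> A0; exists (expR ((m%:R + A) ^+ 2)); first exact: expR_gt0.
move=> z w; rewrite modc_tfun.
have z1 := modc1_gt0 z; have w1 := modc1_gt0 w.
have k : ((1 + modc w) / (1 + modc z)) ^+ m <= expR (m%:R * l1 (z - w)).
  rewrite expRM_natl lerXn2r ?nnegrE ?expR_ge0 //.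
    by rewrite divr_ge0 // ltW.
  rewrite ler_pdivrMr // mulrC; exact: modc1_expR.
apply: le_trans (ler_wpM2r (expR_ge0 _) k) _.
rewrite kerE -!expRD ler_expR.
have h := l1_sqr (z - w); have := sqr_ge0 (l1 (z - w) / 2 - (m%:R + A)).
move: h; set l := l1 _; rewrite !expr2; lra.
Qed.

Lemma in_fock_tfun m p : 0 < p -> exists2 K, 0 < K & forall z, entire (tfun m z) /\
  (fock_int m p (tfun m z) <= K%:E)%E.
Proof.
move=> p0; have ip0 : 0 <= p^-1 by rewrite invr_ge0 ltW.
have [C C0 hC] := tfun_bound m ip0.
have [K K0 hK] := pint_ker (@ltr01 R).
exists (C `^ p * (K + 1)); first by rewrite mulr_gt0 ?powR_gt0 // ltr_wpDl.
move=> z; split; first exact: entire_tfun.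
rewrite fock_intE.
apply: (@le_trans _ _ ((C `^ p)%:E * pint (ker 1 z))%E); last first.
  rewrite EFinM; apply: lee_wpmul2l; first by rewrite lee_fin powR_ge0.
  by apply: le_trans (hK z) _; rewrite lee_fin lerDl.
have mk := pmeas_ker 1 z; have k0 w := ker_ge0 1 z w.
rewrite -pintZ ?powR_ge0 //; apply: le_pint.
- by apply: pmeas_fw; exact: entire_tfun.
- by apply: pmeasM => //; exact: pmeas_cst.
- by move=> w; exact: fw_ge0.
- move=> w; rewrite fwE.
  have -> : ker 1 z w = ker p^-1 z w `^ p.
    by rewrite !kerE -expRM; congr expR; rewrite mulNr mulrAC mulVf ?gt_eqF.
  rewrite -(powRM _ (ltW C0) (ker_ge0 _ _ _)); apply: ler_pow; first exact: ltW.
    exact: mulr_ge0 (modc_ge0 _) (wgt_ge0 _ _).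
  exact: hC.
Qed.

End FockAlgebra.

(** * Boundedness and quadratic symbols *)

Section Boundedness.
Local Open Scope classical_set_scope.
Local Open Scope ring_scope.
Context {R : realType}.
Implicit Types (d s t x y M p q A : R) (a b c z w v : R[i]) (f g h : R[i] -> R[i]) (m n : nat).
Local Notation mu := (@lebesgue_measure R).
Opaque expR powR ln cauchy_bd wgt fw l1 ker tfun.

Lemma dwE m q h w : dw m q h w = (modc (h w) * wgt m w / (1 + modc w)) `^ q.
Proof. by []. Qed.

Lemma dw_tfun m q z g : dw m q (fun w => tfun m z w * cderiv g w) z =
  (modc (cderiv g z) / (1 + modc z)) `^ q.
Proof.
rewrite dwE modcM; congr (_ `^ q).
have -> : modc (tfun m z z) * modc (cderiv g z) * wgt m z / (1 + modc z) =
  (modc (tfun m z z) * wgt m z) * (modc (cderiv g z) / (1 + modc z)) by ring.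
by rewrite tfun_diag mul1r.
Qed.

Lemma dw_growth m q f g C w : 0 <= q -> 0 <= C -> modc (cderiv g w) <= C * (1 + modc w) ->
  dw m q (fun w => f w * cderiv g w) w <= C `^ q * fw m q f w.
Proof.
move=> q0 C0 h; have w1 := modc1_gt0 w.
have mw : 0 <= modc (f w) * wgt m w := mulr_ge0 (modc_ge0 _) (wgt_ge0 _ _).
rewrite dwE fwE -(powRM _ C0 mw); apply: ler_pow => //.
  by rewrite divr_ge0 ?(ltW w1) //; exact: mulr_ge0 (modc_ge0 _) (wgt_ge0 _ _).
rewrite ler_pdivrMr // modcM mulrAC [leRHS]mulrAC [leRHS]mulrC.
by rewrite ler_wpM2l.
Qed.
Opaque dw.

(** The derivative of V_g f_z is tested at the centre of f_z itself, where the weighted modulus of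
    f_z is exactly 1, so that the pointwise bound isolates |g'(z)|/(1 + |z|). No relation between
    [p] and [q] enters. *)
Lemma bounded_growth m p q g : 0 < p -> 0 < q -> entire g -> bounded_op m p q (volterra g) ->
  exists2 C, 0 < C & forall z, modc (cderiv g z) <= C * (1 + modc z).
Proof.
move=> p0 q0 hg [hin [c hc]].
have [K K0 hK] := @in_fock_tfun R m p p0.
have [C1 C10 hC1] := @fock_ptw_segint R m q q0.
pose B := `|c| * K `^ p^-1; have B0 : 0 <= B by rewrite mulr_ge0 // powR_ge0.
exists ((C1 * B `^ q) `^ q^-1 + 1); first by rewrite ltr_wpDl // powR_ge0.
move=> z; have [ef fK] := hK z; set f := tfun m z in ef fK.
have inf : in_fock m p f by split=> //; apply: le_lt_trans fK _; exact: ltry.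
have nf : fnorm m p f <= K `^ p^-1 by apply: fock_fnorm => //; exact: ltW.
have nV : fnorm m q (volterra g f) <= B.
  apply: le_trans (hc f inf) _.
  apply: le_trans (ler_wpM2r (fnorm_ge0 _ _ _) (ler_norm c)) _.
  by rewrite ler_wpM2l.
rewrite (fnorm_leP q0 (hin f inf) B0) in nV.
have h := hC1 _ z (entire_vol_arg hg ef).
have := le_trans h (lee_wpmul2l _ nV); rewrite lee_fin => /(_ (ltW C10)).
rewrite -EFinM lee_fin dw_tfun => k; have z1 := modc1_gt0 z.
rewrite -ler_pdivrMr //; apply: le_trans (_ : (C1 * B `^ q) `^ q^-1 <= _); last by rewrite lerDl.
have r0 : 0 <= modc (cderiv g z) / (1 + modc z) by rewrite divr_ge0 ?modc_ge0 // ltW.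
rewrite -[leLHS](@powKV R _ q) ?gt_eqF //; apply: ler_pow => //; last exact: powR_ge0.
by rewrite invr_ge0 ltW.
Qed.

Lemma cderiv_quadratic g a b c : (forall z, g z = a * z ^+ 2 + b * z + c) ->
  forall z, cderiv g z = 2 * a * z + b.
Proof.
move=> E z; apply: cdiff_cderiv.
have d1 := cdiffD (cdiffD (cdiffZ a (cdiffM (@cdiff_id R z) (@cdiff_id R z))) (cdiffZ b (@cdiff_id R z))) (@cdiff_cst R c z).
have -> : 2 * a * z + b = a * (1 * id z + id z * 1) + b * 1 + 0 by rewrite /=; ring.
by apply: cdiff_ext d1 => w /=; rewrite E expr2.
Qed.

Lemma cderiv_linear g a b : (forall z, g z = a * z + b) -> forall z, cderiv g z = a.
Proof.
move=> E z; rewrite (@cderiv_quadratic g 0 a b); first by ring.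
by move=> w; rewrite E; ring.
Qed.

Lemma eq_of_cderiv f g : entire f -> entire g -> (forall z, cderiv f z = cderiv g z) ->
  forall z, f z = g z + (f 0 - g 0).
Proof.
move=> hf hg E z; have := @cderiv0_cst R _ (@entireB R _ _ hf hg).
have dz w : cderiv (fun w => f w - g w) w = 0.
  apply: cdiff_cderiv; have := cdiffB (entire_cdiff w hf) (entire_cdiff w hg).
  by rewrite E subrr.
move=> /(_ dz z) h; have -> : f z = (f z - g z) + g z by ring.
by rewrite h; ring.
Qed.

Lemma entire_poly2 a b : entire (fun z => a * z ^+ 2 + b * z).
Proof. exact: (@entireD R _ _ (@entireZ R _ a (@entireX R 2)) (@entireZ R _ b (@entire_id R))). Qed.

Lemma quadratic_of_cderiv g a b : entire g -> (forall z, cderiv g z = 2 * a * z + b) ->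
  forall z, g z = a * z ^+ 2 + b * z + g 0.
Proof.
move=> hg E z; have k := @cderiv_quadratic (fun z => a * z ^+ 2 + b * z) a b 0.
rewrite (@eq_of_cderiv _ _ hg (@entire_poly2 a b)); first by rewrite expr0n /= !mulr0 addr0 subr0.
by move=> w; rewrite E k // => v; rewrite addr0.
Qed.

Lemma growth_quadratic g C : entire g -> (forall z, modc (cderiv g z) <= C * (1 + modc z)) ->
  exists a b c, forall z, g z = a * z ^+ 2 + b * z + c.
Proof.
move=> hg hC; have [|a [b E]] := liouville_linear (entire_cderiv hg); first by exists C.
exists (a / 2), b, (g 0); apply: quadratic_of_cderiv => // z.
by rewrite E; congr (_ * _ + _); field.
Qed.

Lemma quadratic_growth g a b c : (forall z, g z = a * z ^+ 2 + b * z + c) ->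
  exists2 C, 0 < C & forall z, modc (cderiv g z) <= C * (1 + modc z).
Proof.
move=> E; have k := cderiv_quadratic E; have a0 := modc_ge0 (2 * a); have b0 := modc_ge0 b.
exists (modc (2 * a) + modc b + 1); first by lra.
move=> z; rewrite k; apply: le_trans (modcD _ _) _; rewrite modcM.
have z0 := modc_ge0 z; have h := mulr_ge0 b0 z0; lra.
Qed.

Lemma fock_volterra_growth m q g C : 0 < q -> entire g -> 0 <= C ->
  (forall z, modc (cderiv g z) <= C * (1 + modc z)) ->
  exists2 K, 0 < K & forall f, entire f -> (fock_int m q (volterra g f) <= K%:E * fock_int m q f)%E.
Proof.
move=> q0 hg C0 hC; have [K K0 hK] := @fock_segint R m q q0.
exists (K * (C `^ q + 1)); first by rewrite mulr_gt0 // ltr_wpDl // powR_ge0.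
move=> f hf; apply: le_trans (hK _ (entire_vol_arg hg hf)) _.
rewrite EFinM -muleA; apply: lee_wpmul2l; first by rewrite lee_fin ltW.
have f0 z := fw_ge0 m q f z; have mf := pmeas_fw m q hf.
have c0 : 0 <= C `^ q + 1 by rewrite addr_ge0 // powR_ge0.
rewrite fock_intE -pintZ //; apply: le_pint.
- exact: pmeas_dw (entire_vol_arg hg hf).
- by apply: pmeasM => //; exact: pmeas_cst.
- by move=> z; exact: dw_ge0.
- move=> z; apply: le_trans (dw_growth m f (ltW q0) C0 (hC z)) _.
  by rewrite ler_wpM2r // lerDl.
Qed.

(* Functions of [F^p] are bounded against the weight, so [F^p] embeds in [F^q] for [p <= q]. *)
Lemma fock_embed m p q : 0 < p -> p <= q -> exists2 K, 0 < K & forall f, in_fock m p f ->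
  (fock_int m q f <= (K * fnorm m p f `^ q)%:E)%E.
Proof.
move=> p0 pq; have [C C0 hC] := @fock_ptw R m p p0.
have e0 : 0 <= (q - p) / p by rewrite divr_ge0 // ?subr_ge0 // ltW.
exists (C `^ ((q - p) / p) + 1); first by rewrite ltr_wpDl // powR_ge0.
move=> f hf; have [ef _] := hf; set N := fnorm m p f; have N0 : 0 <= N := fnorm_ge0 _ _ _.
have pn : p != 0 by rewrite gt_eqF.
have k z : fw m q f z <= (C * N `^ p) `^ ((q - p) / p) * fw m p f z.
  have := hC f z ef; rewrite (fnormX p0 hf) -EFinM lee_fin -/N => h.
  have [f0|f0] := eqVneq (modc (f z) * wgt m z) 0.
    by rewrite !fwE f0 !powR0 ?mulr0 // gt_eqF // (lt_le_trans p0).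
  have fp : 0 < modc (f z) * wgt m z.
    by rewrite lt0r f0; exact: mulr_ge0 (modc_ge0 _) (wgt_ge0 _ _).
  have -> : fw m q f z = (fw m p f z) `^ ((q - p) / p) * fw m p f z.
    rewrite !fwE -powRrM -powDp //; congr (_ `^ _); field; exact: pn.
  by rewrite ler_wpM2r ?fw_ge0 //; apply: ler_pow => //; exact: fw_ge0.
have f0 z := fw_ge0 m p f z; have mf := pmeas_fw m p ef.
rewrite fock_intE; apply: (@le_trans _ _ (((C * N `^ p) `^ ((q - p) / p))%:E * fock_int m p f)%E).
  rewrite fock_intE -pintZ ?powR_ge0 //; apply: le_pint.
  - exact: pmeas_fw.
  - by apply: pmeasM => //; exact: pmeas_cst.
  - by move=> z; exact: fw_ge0.
  - by move=> z; exact: k.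
rewrite (fnormX p0 hf) -EFinM lee_fin -/N (powRM _ (ltW C0) (powR_ge0 _ _)) -mulrA.
have -> : (N `^ p) `^ ((q - p) / p) * N `^ p = N `^ q.
  have [->|n0] := eqVneq N 0.
    by rewrite (powR0 pn) mulr0 powR0 // gt_eqF // (lt_le_trans p0).
  have NP : 0 < N by rewrite lt0r n0.
  rewrite -powRrM -powDp //; congr (_ `^ _); field; exact: pn.
by rewrite ler_wpM2r ?powR_ge0 // lerDl.
Qed.

Lemma growth_bounded m p q g C : 0 < p -> p <= q -> entire g -> 0 <= C ->
  (forall z, modc (cderiv g z) <= C * (1 + modc z)) -> bounded_op m p q (volterra g).
Proof.
move=> p0 pq hg C0 hC; have q0 : 0 < q := lt_le_trans p0 pq.
have [K K0 hK] := @fock_volterra_growth m q g C q0 hg C0 hC.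
have [L L0 hL] := @fock_embed m p q p0 pq.
have k f : in_fock m p f -> (fock_int m q (volterra g f) <= (K * (L * fnorm m p f `^ q))%:E)%E.
  move=> hf; have [ef _] := hf; apply: le_trans (hK f ef) _.
  by rewrite EFinM; apply: lee_wpmul2l; [rewrite lee_fin ltW|exact: hL].
split.
  move=> f hf; have [ef _] := hf; split; first exact: (entire_volterra hg ef).
  by apply: le_lt_trans (k f hf) _; exact: ltry.
exists ((K * L) `^ q^-1) => f hf; have N0 := fnorm_ge0 m p f.
have KL : 0 <= K * L by rewrite mulr_ge0 // ltW.
have -> : (K * L) `^ q^-1 * fnorm m p f = (K * (L * fnorm m p f `^ q)) `^ q^-1.
  by rewrite (mulrA K L) (powRM _ KL (powR_ge0 _ _)) powKV // gt_eqF.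
apply: fock_fnorm => //; last exact: k.
by rewrite mulr_ge0 ?(ltW K0) // mulr_ge0 ?(ltW L0) // powR_ge0.
Qed.

End Boundedness.

(** * Compactness forces linear symbols *)

Section CompactNecessity.
Local Open Scope classical_set_scope.
Local Open Scope ring_scope.
Context {R : realType}.
Implicit Types (d s t x y M p q A : R) (a b c z w v : R[i]) (f g h : R[i] -> R[i]) (m n k : nat).
Lemma l1_real x : l1 (x%:C%C : R[i]) = `|x|.
Proof. by rewrite /l1 /= normr0 addr0. Qed.

Opaque expR powR ln cauchy_bd wgt fw l1 ker tfun dw volterra.

Lemma fnormZ m p c f : 0 < p -> in_fock m p f -> fnorm m p (fun w => c * f w) = modc c * fnorm m p f.
Proof.
move=> p0 hf; have [ef _] := hf; rewrite /fnorm fock_intZ ?(ltW p0) // (fock_fineK hf) /=.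
by rewrite powRM ?powR_ge0 ?fine_ge0 ?fock_ge0 // powKV ?modc_ge0 // gt_eqF.
Qed.

Lemma homo_ltn_ge (phi : nat -> nat) : {homo phi : a b / (a < b)%N} -> forall n, (n <= phi n)%N.
Proof. by move=> h; elim=> [//|n IH]; exact: leq_ltn_trans IH (h _ _ (ltnSn n)). Qed.

Lemma fnorm_cvg0 m q (F : nat -> R[i] -> R[i]) : 0 < q -> (forall n, in_fock m q (F n)) ->
  (fun n => fnorm m q (F n)) @ \oo --> (0 : R) ->
  forall e, 0 < e -> exists N : nat, forall n, (N <= n)%N -> (fock_int m q (F n) <= e%:E)%E.
Proof.
move=> q0 hF cv e e0; have d0 : 0 < e `^ q^-1 by exact: powR_gt0.
have /cvgrPdist_le/(_ _ d0)[N _ hN] := cv.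
exists N => n Nn; have := hN n Nn; rewrite /= sub0r normrN ger0_norm ?fnorm_ge0 //.
by rewrite (fnorm_leP q0 (hF n) (ltW d0)) powVK ?(ltW e0) // gt_eqF.
Qed.

Lemma compact_seq m p q g (u : nat -> R[i] -> R[i]) M : 0 < q -> entire g ->
  compact_op m p q (volterra g) -> (forall n, in_fock m p (u n)) -> (forall n, fnorm m p (u n) <= M) ->
  exists (phi : nat -> nat) h, [/\ {homo phi : a b / (a < b)%N}, in_fock m q h &
  forall e, 0 < e -> exists N : nat, forall n, (N <= n)%N ->
    (fock_int m q (fun z => volterra g (u (phi n)) z - h z)%R <= e%:E)%E].
Proof.
move=> q0 hg [hin hc] hu hM; have [|phi [h [hphi [hh cv]]]] := hc u hu; first by exists M.
have iB n := @in_fockB R m q _ _ (ltW q0) (hin _ (hu (phi n))) hh.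
exists phi, h; split; [exact: hphi|exact: hh|exact: (fnorm_cvg0 q0 iB cv)].
Qed.

(** Compactness is sequential and contains no norm inequality. If none held, rescaling would give
    functions of norm at most 1 with images of norm exactly [n], and no subsequence of those images
    can converge. *)
Lemma compact_op_bounded m p q g : 0 < p -> 0 < q -> entire g ->
  compact_op m p q (volterra g) -> bounded_op m p q (volterra g).
Proof.
move=> p0 q0 hg hcomp; have [hin _] := hcomp; split=> //; apply: contrapT => no.
have ex n : exists f, in_fock m p f /\ n%:R * fnorm m p f < fnorm m q (volterra g f).
  apply: contrapT => H; apply: no; exists n%:R => f hf.
  by rewrite leNgt; apply/negP => lt; apply: H; exists f.
have [u hu] := choice ex.
have V0 n : 0 < fnorm m q (volterra g (u n)).
  by have [_] := hu n; apply: le_lt_trans; rewrite mulr_ge0 // fnorm_ge0.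
(* The image of [u n] has positive norm by the strict inequality, and this factor brings the norm to
   [n]. *)
pose lam n : R := n%:R / fnorm m q (volterra g (u n)).
have lam0 n : 0 <= lam n by rewrite divr_ge0 // ltW.
pose v n := fun w : R[i] => (lam n)%:C%C * u n w.
have mlam n : modc (lam n)%:C%C = lam n by rewrite modc_real ger0_norm.
have iv n : in_fock m p (v n) by apply: (in_fockZ _ (ltW p0)); case: (hu n).
have nv n : fnorm m p (v n) <= 1.
  have [inu lt] := hu n; have E := fnormZ (lam n)%:C%C p0 inu.
  rewrite -/(v n) mlam in E; rewrite E /lam mulrAC (ler_pdivrMr _ _ (V0 n)) mul1r; exact: ltW lt.
have nV n : fnorm m q (volterra g (v n)) = n%:R.
  have [inu lt] := hu n; have [eu _] := inu.
  by rewrite (volterraZ _ hg eu) (fnormZ _ q0 (hin _ inu)) mlam /lam divfK // gt_eqF.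
have [phi [h [hphi hh cv]]] := compact_seq q0 hg hcomp iv nv.
have [N hN] := cv 1 ltr01; have [eh _] := hh.
pose B := 2 `^ q * (1 + fine (fock_int m q h)).
have key n : (N <= n)%N -> n%:R <= B `^ q^-1.
  move=> Nn; have e1 : entire (volterra g (v (phi n))) by case: (hin _ (iv (phi n))).
  have := fock_intD m (ltW q0) (@entireB R _ _ e1 eh) eh.
  rewrite (@eq_fock_int R m q _ (volterra g (v (phi n)))); last by move=> z; rewrite subrK.
  have k1 : (fock_int m q (fun w => volterra g (v (phi n)) w - h w)%R + fock_int m q h <= (1 + fine (fock_int m q h))%:E)%E.
    by rewrite EFinD -fock_fineK //; apply: leeD => //; exact: hN.
  move=> k2; have := le_trans k2 (lee_wpmul2l _ k1); rewrite lee_fin powR_ge0 -EFinM => /(_ isT) k3.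
  apply: le_trans (_ : (phi n)%:R <= _); first by rewrite ler_nat; exact: homo_ltn_ge.
  rewrite -(nV (phi n)); apply: fock_fnorm => //.
  by rewrite mulr_ge0 ?powR_ge0 // addr_ge0 // fine_ge0 // fock_ge0.
have := key (maxn N (Num.bound (B `^ q^-1))) (leq_maxl _ _).
rewrite leNgt => /negP; apply.
apply: lt_le_trans (archi_boundP (powR_ge0 _ _)) _.
by rewrite ler_nat leq_maxr.
Qed.

(** Test functions centred at the integers stay separated after V_g when [a] is nonzero: at the
    centre of a far one its weighted modulus is 1, that of a fixed earlier one is at most 1/2, and
    |g'|/(1 + |z|) is at least |a|. The pointwise bound for the derivative contradicts convergence
    of a subsequence. *)
Lemma compact_linear m p q g : 0 < p -> 0 < q -> entire g ->
  compact_op m p q (volterra g) -> exists a b, forall z, g z = a * z + b.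
Proof.
move=> p0 q0 hg hcomp; have [C0 C00 hC0] := bounded_growth p0 q0 hg (compact_op_bounded p0 q0 hg hcomp).
have [a [b [c E]]] := growth_quadratic hg hC0.
suff a0 : a = 0 by exists b, c => z; rewrite E a0 mul0r add0r.
apply/eqP; rewrite -modc_eq0; apply: contrapT => /negP am.
have aP : 0 < modc a by rewrite lt0r am modc_ge0.
have dE := cderiv_quadratic E.
have [K K0 hK] := @in_fock_tfun R m p p0.
pose zn n : R[i] := (n%:R : R)%:C%C; pose u n := tfun m (zn n).
have iu n : in_fock m p (u n).
  by have [e k] := hK (zn n); split=> //; apply: le_lt_trans k _; exact: ltry.
have nu n : fnorm m p (u n) <= K `^ p^-1.
  by have [e k] := hK (zn n); apply: fock_fnorm => //; exact: ltW.
have [phi [h [hphi hh cv]]] := compact_seq q0 hg hcomp iu nu.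
have [C C10 hC] := @fock_ptw_segint R m q q0.
have [D D0 hD] := @tfun_bound R m 1 ler01.
pose A := (modc a / 2) `^ q; have A0 : 0 < A by rewrite powR_gt0 // divr_gt0.
pose e := A / (C * 2 `^ q * 4); have e0 : 0 < e by rewrite divr_gt0 // !mulr_gt0 // powR_gt0.
have [N hN] := cv e e0.
(* [phi N] and the bound of [2 * D] separate the two centres enough to make the earlier function at
   most 1/2; the last summand makes |2az + b| at least |a| (1 + |z|). *)
pose n := (N + phi N + Num.bound (2 * D) + Num.bound ((modc b + modc a) / modc a))%N.
have Nn : (N <= n)%N by rewrite /n -!addnA leq_addr.
have pn : (n <= phi n)%N := homo_ltn_ge hphi n.
have [hin _] := hcomp; have [eh _] := hh.
have eu k : entire (u k) by case: (iu k).
have eV k : entire (volterra g (u k)) := entire_volterra hg (eu k).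
have T (x y w : R[i]) : x - y = (x - w) - (y - w) by ring.
have small : (fock_int m q (volterra g (fun w => u (phi n) w - u (phi N) w)%R) <= (2 `^ q * (e + e))%:E)%E.
  rewrite (volterraB hg (eu _) (eu _)).
  rewrite (@eq_fock_int R m q _ (fun z => (volterra g (u (phi n)) z - h z) - (volterra g (u (phi N)) z - h z))); last by move=> z; exact: T.
  apply: le_trans (fock_intB m (ltW q0) (@entireB R _ _ (eV _) eh) (@entireB R _ _ (eV _) eh)) _.
  rewrite EFinM; apply: lee_wpmul2l; first by rewrite lee_fin powR_ge0.
  by rewrite EFinD; apply: leeD; apply: hN.
set z := zn (phi n).
have ez : entire (fun w => u (phi n) w - u (phi N) w) := @entireB R _ _ (eu _) (eu _).
have := le_trans (hC _ z (entire_vol_arg hg ez)) (lee_wpmul2l _ small).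
rewrite lee_fin (ltW C10) -EFinM lee_fin => /(_ isT).
apply/negP; rewrite -ltNge.
have -> : C * (2 `^ q * (e + e)) = A / 2.
  by rewrite /e; field; rewrite !gt_eqF // powR_gt0.
apply: lt_le_trans (_ : A <= _); first by lra.
rewrite dwE.
apply: ler_pow; [exact: ltW|by rewrite divr_ge0 // ltW|].
have np : (n%:R : R) <= (phi n)%:R by rewrite ler_nat.
have n1 : (phi N)%:R + 2 * D <= n%:R :> R.
  have b1 : 2 * D < (Num.bound (2 * D))%:R by apply: archi_boundP; rewrite mulr_ge0 // ltW.
  have : (phi N)%:R + (Num.bound (2 * D))%:R <= n%:R :> R.
    by rewrite -natrD ler_nat /n; apply: leq_trans (leq_addr _ _); rewrite leq_add2r leq_addl.
  lra.
have n2 : modc b + modc a <= modc a * n%:R.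
  have b1 : (modc b + modc a) / modc a < (Num.bound ((modc b + modc a) / modc a))%:R.
    by apply: archi_boundP; rewrite divr_ge0 ?addr_ge0 // modc_ge0.
  have b2 : (Num.bound ((modc b + modc a) / modc a))%:R <= n%:R :> R by rewrite ler_nat /n leq_addl.
  by rewrite mulrC -ler_pdivrMr //; lra.
have mz : modc z = (phi n)%:R by rewrite /z /zn modc_real ger0_norm.
have half : modc (u (phi N) z) * wgt m z <= 1 / 2.
  apply: le_trans (hD (zn (phi N)) z) _; rewrite kerE mul1r expRN.
  have -> : l1 (zn (phi N) - z) = (phi n)%:R - (phi N)%:R.
    by rewrite l1_distC /z /zn -rmorphB l1_real ger0_norm // subr_ge0; lra.
  rewrite ler_pdivrMr ?expR_gt0 //.
  have := expR_ge1Dx ((phi n)%:R - (phi N)%:R : R); lra.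
have big : 1 / 2 <= modc (u (phi n) z - u (phi N) z) * wgt m z.
  have := tfun_diag m z; rewrite -[tfun m z z]/(u (phi n) z) => d1.
  have h1 : modc (u (phi n) z) <= modc (u (phi n) z - u (phi N) z) + modc (u (phi N) z).
    by have := modcD (u (phi n) z - u (phi N) z) (u (phi N) z); rewrite subrK.
  have := ler_wpM2r (wgt_ge0 m z) h1; rewrite d1 mulrDl; lra.
have gz : modc a * (1 + modc z) <= modc (cderiv g z).
  rewrite dE.
  have h1 : modc (2 * a * z) <= modc (2 * a * z + b) + modc b.
    by have := modcB (2 * a * z + b) b; rewrite addrK.
  move: h1; rewrite !modcM mz.
  have -> : modc (2 : R[i]) = 2.
    by rewrite -[2 : R[i]](rmorph_nat (real_complex R) 2) modc_real ger0_norm.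
  have := ler_wpM2l (ltW aP) np; lra.
rewrite ler_pdivlMr ?modc1_gt0 // modcM mulrAC.
have z1 := modc1_gt0 z.
have -> : modc a * (1 + modc z) / 2 = 1 / 2 * (modc a * (1 + modc z)) by field.
rewrite [leRHS]mulrAC; apply: ler_pM => //; by rewrite mulr_ge0 ?modc_ge0 // ltW.
Qed.

End CompactNecessity.

(** * Normal families and compactness *)

Section Montel.
Local Open Scope classical_set_scope.
Local Open Scope ring_scope.
Context {R : realType}.
Implicit Types (d e s t x y M p q A : R) (a b c z w : R[i]) (f g h v : R[i] -> R[i]) (m n k : nat).
Local Notation cbd := (@cauchy_bd R).
Opaque expR powR ln cauchy_bd wgt fw l1 ker tfun dw volterra.

Definition rlim0 (x : nat -> R) := forall e, 0 < e -> exists N : nat, forall n, (N <= n)%N -> `|x n| <= e.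

Lemma rlim0P (x : nat -> R) : rlim0 x -> x @ \oo --> (0 : R).
Proof.
move=> H; apply/cvgrPdist_le => e e0; have [N hN] := H e e0.
by exists N => // n /= Nn; rewrite sub0r normrN; exact: hN.
Qed.

Section UltraLimits.
Context (U : set_system nat) (UF : UltraFilter U).

Let UP : ProperFilter U. Proof. by case: UF. Qed.

(** The limit is the supremum of the numbers lying below [x n] for almost every [n]. One fixed
    ultrafilter serves all bounded sequences at once, which replaces diagonal extraction. *)
Lemma ultra_lim (x : nat -> R) M : (forall n, `|x n| <= M) ->
  exists L, forall e, 0 < e -> U [set n | `|x n - L| <= e].
Proof.
move=> hM; pose S := [set y : R | U [set n | y <= x n]].
have S0 : S (- M).
  apply: filterS filterT => n _ /=; have := hM n; rewrite ler_norml => /andP[]//.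
have Sb y : S y -> y <= M.
  move=> /filter_ex[n /= h]; apply: le_trans h _; exact: le_trans (ler_norm _) (hM n).
have hs : has_sup S by split; [exists (- M)|exists M => y; exact: Sb].
exists (sup S) => e e0.
have [y Sy ly] := sup_adherent e0 hs.
have nS : ~ S (sup S + e).
  by move=> h; have := ub_le_sup hs.2 h; rewrite gerDl leNgt e0.
have [//|cU] := @in_ultra_setVsetC _ U [set n | sup S + e <= x n] UF.
apply: filterS2 Sy cU => n /= h1 /negP; rewrite -ltNge => h2.
rewrite ler_distl; apply/andP; split; lra.
Qed.

Lemma ultra_climit (x : nat -> R[i]) M : (forall n, modc (x n) <= M) ->
  exists c, forall e, 0 < e -> U [set n | modc (x n - c) <= e].
Proof.
move=> hM.
have [|a ha] := @ultra_lim (fun n => complex.Re (x n)) M; first by move=> n; exact: le_trans (Re_le_modc _) (hM n).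
have [|b hb] := @ultra_lim (fun n => complex.Im (x n)) M; first by move=> n; exact: le_trans (Im_le_modc _) (hM n).
exists (Complex a b) => e e0; have e2 : 0 < e / 2 by rewrite divr_gt0.
apply: filterS2 (ha _ e2) (hb _ e2) => n /= h1 h2.
apply: le_trans (modc_le_ReIm _) _; rewrite cReB cImB /=; lra.
Qed.

End UltraLimits.

(** A dense sequence in the plane: codes of pairs of rationals, with the default 0 at numbers that
    code no pair. *)
Definition qpt k : R[i] := if unpickle k is Some ab then Complex (ratr (ab : rat * rat).1) (ratr ab.2) else 0.

Lemma qpt_dense z e : 0 < e -> exists k, modc (qpt k - z) <= e.
Proof.
move=> e0; have e2 : 0 < e / 2 by rewrite divr_gt0.
have [a /=] : exists a : rat, ratr a \in `]complex.Re z, complex.Re z + e / 2[ by apply: rat_in_itvoo; lra.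
rewrite in_itv /= => /andP[a1 a2].
have [b /=] : exists b : rat, ratr b \in `]complex.Im z, complex.Im z + e / 2[ by apply: rat_in_itvoo; lra.
rewrite in_itv /= => /andP[b1 b2].
exists (pickle (a, b)); rewrite /qpt pickleK /=.
apply: le_trans (modc_le_ReIm _) _; rewrite cReB cImB /= !ger0_norm; lra.
Qed.

(** Along an ultrafilter the values and the derivatives converge at every point, and the uniform
    second-order Taylor bound survives in the limit, so the limit is entire. A genuine subsequence
    is then extracted on a dense sequence, and the uniform Lipschitz bound extends its convergence
    to all points. *)
Lemma montel (u : nat -> R[i] -> R[i]) (B : R -> R) : (forall n, entire (u n)) ->
  (forall n z r, modc z <= r -> modc (u n z) <= B r) ->
  exists (phi : nat -> nat) v, [/\ {homo phi : a b / (a < b)%N}, entire v,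
    (forall z r, modc z <= r -> modc (v z) <= B r) &
    forall z e, 0 < e -> exists N : nat, forall n, (N <= n)%N -> modc (u (phi n) z - v z) <= e].
Proof.
move=> hu hB.
have [U [UF sU]] := @ultraFilterLemma nat \oo _.
have UP : ProperFilter U by case: UF.
have exv z : exists c, forall e, 0 < e -> U [set n | modc (u n z - c) <= e].
  by apply: (@ultra_climit U UF (fun n => u n z) (B (modc z))) => n; exact: hB.
have [v hv] := choice exv.
have vB z r : modc z <= r -> modc (v z) <= B r.
  move=> zr; apply/ler_addgt0Pr => e e0; have [n /= hn] := filter_ex (hv z e e0).
  have := modcB (u n z) (u n z - v z); rewrite subKr; have := hB n z r zr; lra.
pose M z := B (modc z + 2).
have uM n z w : modc w <= 2 -> modc (u n (z + w)) <= M z.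
  by move=> w2; apply: hB; apply: le_trans (modcD _ _) _; rewrite lerD2l.
have exd z : exists c, forall e, 0 < e -> U [set n | modc (cderiv (u n) z - c) <= e].
  apply: (@ultra_climit U UF (fun n => cderiv (u n) z) (cbd * M z / 1)) => n.
  by apply: (cderiv_bound (hu n) ltr01) => w; rewrite mulr1; exact: uM.
have [dv hdv] := choice exd.
have ev : entire v.
  apply/entireP => z; exists (dv z); apply: (@cdiff_sqr R v z (dv z) (cbd * M z) (1 / 2)); first by lra.
  move=> h h2; apply/ler_addgt0Pr => e e0.
  have h0 := modc_ge0 h; pose e' := e / (2 + modc h).
  have e'0 : 0 < e' by rewrite divr_gt0 //; lra.
  have [n /= [[n1 n2] n3]] := filter_ex (filterI (filterI (hv (z + h) _ e'0) (hv z _ e'0)) (hdv z _ e'0)).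
  have t2 := @taylor2 R (u n) z h 1 (M z) (hu n) ltr01 (ltW h2).
  rewrite divr1 in t2.
  have /t2{t2}t2 : forall w : R[i], modc w <= 2 * 1 -> modc (u n (z + w)) <= M z.
    by move=> w; rewrite mulr1; exact: uM.
  have -> : v (z + h) - v z - dv z * h =
    (u n (z + h) - u n z - cderiv (u n) z * h) - (u n (z + h) - v (z + h)) + (u n z - v z) + (cderiv (u n) z - dv z) * h by ring.
  apply: le_trans (modcD _ _) _; rewrite modcM.
  have k3 := ler_wpM2r h0 n3.
  apply: le_trans (lerD (le_trans (modcD _ _) (lerD (modcB _ _) (lexx _))) k3) _.
  have -> : e = 2 * e' + e' * modc h by rewrite /e'; field; rewrite gt_eqF //; lra.
  lra.
have vM z w : modc w <= 2 -> modc (v (z + w)) <= M z.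
  by move=> w2; apply: vB; apply: le_trans (modcD _ _) _; rewrite lerD2l.
(* Finitely many conditions hold simultaneously on a set of the ultrafilter, which also meets every
   tail; [k] rational points are controlled at the k-th stage. *)
have exn k N : exists n, (N < n)%N /\ forall j, (j < k)%N -> modc (u n (qpt j) - v (qpt j)) <= k.+1%:R^-1.
  have UA : U [set n | forall j, (j < k)%N -> modc (u n (qpt j) - v (qpt j)) <= k.+1%:R^-1].
    have d0 : 0 < k.+1%:R^-1 :> R by rewrite invr_gt0.
    elim: {1}k => [|l IH]; first by apply: filterS filterT => n _ j.
    apply: filterS2 IH (hv (qpt l) _ d0) => n /= h1 h2 j; rewrite ltnS leq_eqVlt => /orP[/eqP->//|]; exact: h1.
  have UN : U [set n | (N < n)%N] by apply: sU; exists N.+1.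
  by have [n /= [h1 h2]] := filter_ex (filterI UN UA); exists n.
have [F hF] := choice (fun kN : nat * nat => exn kN.1 kN.2).
pose phi := fix phi k := if k is k'.+1 then F (k, phi k') else F (0, 0)%N.
have phiS k : (phi k < phi k.+1)%N by have [] := hF (k.+1, phi k).
have phiq k j : (j < k)%N -> modc (u (phi k) (qpt j) - v (qpt j)) <= k.+1%:R^-1.
  by case: k => [//|k]; have [_] := hF (k.+1, phi k); exact.
exists phi, v; split=> //.
  by apply: homo_ltn => //; exact: ltn_trans.
move=> z e e0.
have Mz0 : 0 <= M z by apply: le_trans (modc_ge0 (v (z + 0))) (vM z 0 _); rewrite modc0.
have cM0 : 0 <= cbd * M z by rewrite mulr_ge0 // ltW // cauchy_bd_gt0.
pose d := Num.min (1 / 2) (e / (4 * (cbd * M z + 1))).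
have d0 : 0 < d by rewrite lt_min divr_gt0 //= divr_gt0 // mulr_gt0 // ltr_wpDl.
have [j hj] := qpt_dense z d0; set h := qpt j - z in hj.
have h2 : modc h <= 1 / 2 by apply: le_trans hj _; rewrite ge_min lexx.
have h3 : cbd * M z * modc h <= e / 4.
  have : modc h <= e / (4 * (cbd * M z + 1)) by apply: le_trans hj _; rewrite ge_min lexx orbT.
  rewrite ler_pdivlMr; last by rewrite mulr_gt0 // ltr_wpDl.
  have := modc_ge0 h; lra.
have lip f : entire f -> (forall w, modc w <= 2 -> modc (f (z + w)) <= M z) -> modc (f (qpt j) - f z) <= e / 4.
  move=> ef fM; have := @taylor1 R f z h 1 (M z) ef ltr01 h2; rewrite divr1 /h (addrC z) subrK -/h => k.
  by apply: le_trans h3; apply: k => w; rewrite mulr1; exact: fM.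
exists (maxn j.+1 (Num.bound (2 / e))) => n; rewrite geq_max => /andP[jn bn].
have k1 := phiq n j jn.
have k2 : n.+1%:R^-1 <= e / 2.
  have e20 : 0 < 2 / e by rewrite divr_gt0.
  rewrite -[leRHS]invf_div lef_pV2 ?posrE //.
  apply: le_trans (ltW (archi_boundP (ltW e20))) _; rewrite ler_nat; exact: leq_trans bn (leqnSn n).
have k3 := lip _ (hu (phi n)) (uM (phi n) z); have k4 := lip _ ev (vM z).
have -> : u (phi n) z - v z = (u (phi n) (qpt j) - v (qpt j)) - (u (phi n) (qpt j) - u (phi n) z) + (v (qpt j) - v z) by ring.
have t1 := modcD (u (phi n) (qpt j) - v (qpt j) - (u (phi n) (qpt j) - u (phi n) z)) (v (qpt j) - v z).
have t2 := modcB (u (phi n) (qpt j) - v (qpt j)) (u (phi n) (qpt j) - u (phi n) z).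
apply: le_trans t1 _; apply: le_trans (lerD (le_trans t2 (lerD (le_trans k1 k2) k3)) k4) _.
lra.
Qed.

Lemma pint_fatou (F : nat -> R[i] -> R) (G : R[i] -> R) (M : \bar R) : (forall n, pmeas (F n)) ->
  (forall n z, 0 <= F n z) -> (forall z, rlim0 (fun n => F n z - G z)) ->
  (forall n, pint (F n) <= M)%E -> (pint G <= M)%E.
Proof.
move=> mF F0 cv hM.
have mE n : measurable_fun setT (fun xy : R * R => (F n (cplx xy))%:E) by apply/measurable_EFinP; exact: (mF n).
have E0 n (xy : R * R) : setT xy -> (0 <= (F n (cplx xy))%:E)%E by rewrite lee_fin.
have H := fatou (@area_sfm R) measurableT mE E0.
have -> : pint G = (\int[@area_sfm R]_(xy in setT) limn_einf (fun n => (F n (cplx xy))%:E))%E.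
  apply: eq_integral => xy _; apply/esym.
  have c : (F n (cplx xy))%:E @[n --> \oo] --> (G (cplx xy))%:E.
    apply: cvg_EFin; first exact: nearW.
    have := rlim0P (cv (cplx xy)) => /cvgD/(_ (cvg_cst (G (cplx xy)))).
    rewrite add0r (_ : _ + _ = fun n => F n (cplx xy)) //.
    by apply/funext => n; rewrite /GRing.add /= subrK.
  by have [-> _] := cvg_limn_einf_sup c.
apply: le_trans H _; rewrite limn_einf_lim.
apply: lime_le; first exact: is_cvg_einfs.
apply: nearW => n; apply: le_trans (hM n); apply: ereal_inf_lbound.
by exists n => //=.
Qed.

Lemma pint_dct0 (F : nat -> R[i] -> R) (H : R[i] -> R) : (forall n, pmeas (F n)) -> pmeas H ->
  (forall n z, 0 <= F n z) -> (forall n z, F n z <= H z) -> (pint H < +oo)%E ->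
  (forall z, rlim0 (fun n => F n z)) ->
  forall e, 0 < e -> exists N : nat, forall n, (N <= n)%N -> (pint (F n) <= e%:E)%E.
Proof.
move=> mF mH F0 FH iH cv e e0.
have mE n : measurable_fun setT (fun xy : R * R => (F n (cplx xy))%:E) by apply/measurable_EFinP; exact: (mF n).
have H0 z : 0 <= H z := le_trans (F0 0%N z) (FH 0%N z).
have mHE : measurable_fun setT (fun xy : R * R => (H (cplx xy))%:E) by exact/measurable_EFinP.
have iHE : (@area_sfm R).-integrable setT (fun xy : R * R => (H (cplx xy))%:E).
  apply/integrableP; split=> //; apply: le_lt_trans iH; rewrite le_eqVlt; apply/orP; left; apply/eqP.
  by apply: eq_integral => xy _; rewrite gee0_abs // lee_fin.
have c (xy : R * R) : setT xy -> (F n (cplx xy))%:E @[n --> \oo] --> (0 : \bar R).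
  move=> _; apply: cvg_EFin; first exact: nearW.
  exact: (rlim0P (cv (cplx xy))).
have absF n (xy : R * R) : setT xy -> (`|(F n (cplx xy))%:E| <= (H (cplx xy))%:E)%E.
  by move=> _; rewrite gee0_abs ?lee_fin.
have aec : {ae @area_sfm R, forall xy : R * R, setT xy -> (F n (cplx xy))%:E @[n --> \oo] --> (0 : \bar R)}.
  by apply: aeW => xy; exact: c.
have aeF : {ae @area_sfm R, forall (xy : R * R) n, setT xy -> (`|(F n (cplx xy))%:E| <= (H (cplx xy))%:E)%E}.
  by apply: aeW => xy n; exact: absF.
have [_ _] := @dominated_convergence _ _ R (@area_sfm R) setT measurableT (fun n (xy : R * R) => (F n (cplx xy))%:E)
  (fun _ => 0%E) (fun xy : R * R => (H (cplx xy))%:E) mE (measurable_cst _) aec iHE aeF.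
rewrite integral0 => cvI.
have finF n : (\int[@area_sfm R]_(x in setT) (F n (cplx x))%:E)%E \is a fin_num.
  rewrite ge0_fin_numE; last by apply: integral_ge0 => xy _; rewrite lee_fin.
  by apply: le_lt_trans iH; apply: (le_pint (mF n) mH) => z; [exact: F0|exact: FH].
have /fine_cvgP[_] := cvI.
move=> /cvgrPdist_le/(_ e e0)[N _ hN]; exists N => n Nn.
have := hN n Nn; rewrite /= sub0r normrN => /(le_trans (ler_norm _)).
by rewrite -lee_fin fineK.
Qed.

End Montel.

(** * A criterion for compactness; linear and constant symbols *)

Section CompactSufficiency.
Local Open Scope classical_set_scope.
Local Open Scope ring_scope.
Context {R : realType}.
Implicit Types (d e s t x y M p q r A : R) (a b c z w : R[i]) (f g h v : R[i] -> R[i]) (m n k : nat).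
Local Notation mu := (@lebesgue_measure R).
Opaque expR powR ln cauchy_bd wgt fw l1 ker tfun volterra.

Lemma rlim0_powR (x : nat -> R) y p : 0 < p -> 0 <= y -> (forall n, 0 <= x n) ->
  rlim0 (fun n => x n - y) -> rlim0 (fun n => x n `^ p - y `^ p).
Proof.
move=> p0 y0 x0 H e e0; have pn : p != 0 by rewrite gt_eqF.
have ip : 0 < p^-1 by rewrite invr_gt0.
have yp := powR_ge0 y p.
have [b [b0 bE]] : exists b : R, 0 <= b /\ b `^ p = y `^ p + e.
  exists ((y `^ p + e) `^ p^-1); split; first exact: powR_ge0.
  by rewrite powVK //; lra.
have yb : y < b.
  by rewrite ltNge; apply/negP => h; have := ler_pow (ltW p0) b0 h; rewrite bE; lra.
have [N1 hN1] : exists N : nat, forall n, (N <= n)%N -> x n <= b.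
  have [|N hN] := H (b - y); first by rewrite subr_gt0.
  by exists N => n /hN; rewrite ler_norml => /andP[_]; lra.
have [N2 hN2] : exists N : nat, forall n, (N <= n)%N -> y `^ p - e <= x n `^ p.
  have [h|h] := leP (y `^ p - e) 0; first by exists 0%N => n _; apply: le_trans h _; exact: powR_ge0.
  have [a [a0 aE]] : exists a : R, 0 <= a /\ a `^ p = y `^ p - e.
    exists ((y `^ p - e) `^ p^-1); split; first exact: powR_ge0.
    by rewrite powVK // ltW.
  have ya : a < y.
    by rewrite ltNge; apply/negP => k; have := ler_pow (ltW p0) y0 k; rewrite aE; lra.
  have [|N hN] := H (y - a); first by rewrite subr_gt0.
  exists N => n /hN; rewrite ler_norml => /andP[k _]; rewrite -aE; apply: ler_pow => //; [exact: ltW|lra].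
exists (maxn N1 N2) => n; rewrite geq_max => /andP[n1 n2].
have k1 := ler_pow (ltW p0) (x0 n) (hN1 n n1); have k2 := hN2 n n2; rewrite bE in k1.
rewrite ler_norml; apply/andP; split; lra.
Qed.

Lemma rlim0M (x : nat -> R) y : rlim0 x -> rlim0 (fun n => x n * y).
Proof.
move=> H e e0; have y1 : 0 < `|y| + 1 by rewrite ltr_wpDl.
have [|N hN] := H (e / (`|y| + 1)); first by rewrite divr_gt0.
exists N => n /hN; rewrite ler_pdivlMr // => h; rewrite normrM.
by apply: le_trans h; rewrite ler_wpM2l // lerDl.
Qed.

Lemma rlim0_le (x y : nat -> R) : (forall n, `|x n| <= `|y n|) -> rlim0 y -> rlim0 x.
Proof.
by move=> h H e e0; have [N hN] := H e e0; exists N => n /hN; exact: le_trans.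
Qed.

Lemma wgt_inv m z r : modc z <= r -> (wgt m z)^-1 <= expR (r ^+ 2 / 2).
Proof.
move=> zr; have z0 := modc_ge0 z; rewrite wgtE invfM -expRN opprK.
rewrite -[leRHS]mul1r; apply: ler_pM.
- by rewrite invr_ge0 exprn_ge0 // ltW // modc1_gt0.
- exact: expR_ge0.
- by rewrite invf_le1 ?exprn_gt0 ?modc1_gt0 // exprn_ege1 // lerDl.
- rewrite ler_expR ler_wpM2r // lerXn2r // nnegrE; exact: le_trans zr.
Qed.

Lemma fock_local_bound m p : 0 < p -> forall M, 0 <= M -> exists B : R -> R, forall f, entire f ->
  (fock_int m p f <= M%:E)%E -> forall z r, modc z <= r -> modc (f z) <= B r.
Proof.
move=> p0 M M0; have [C C0 hC] := @fock_ptw R m p p0.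
exists (fun r => (C * M) `^ p^-1 * expR (r ^+ 2 / 2)) => f hf hM z r zr.
have := le_trans (hC f z hf) (lee_wpmul2l _ hM); rewrite lee_fin => /(_ (ltW C0)).
rewrite -EFinM lee_fin => k.
have wz := wgt_gt0 m z.
have k2 : modc (f z) * wgt m z <= (C * M) `^ p^-1.
  rewrite -[leLHS](@powKV R _ p) ?gt_eqF //; last exact: mulr_ge0 (modc_ge0 _) (wgt_ge0 _ _).
  by apply: ler_pow; [rewrite invr_ge0 ltW|rewrite powR_ge0|rewrite -fwE].
rewrite -ler_pdivlMr // in k2; apply: le_trans k2 _.
by rewrite ler_wpM2l ?powR_ge0 //; exact: wgt_inv.
Qed.

(* The decomposition [delta * Y + H] plays the role of uniform integrability. *)
Definition dominated_volterra m p q g := forall M, 0 <= M -> exists2 K, 0 <= K &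
  forall d, 0 < d -> exists H : R[i] -> R, [/\ pmeas H, (forall z, 0 <= H z), (pint H < +oo)%E &
    forall f, in_fock m p f -> (fock_int m p f <= M%:E)%E ->
    exists Y : R[i] -> R, [/\ pmeas Y, (forall z, 0 <= Y z), (pint Y <= K%:E)%E &
      forall w, dw m q (fun w => f w * cderiv g w) w <= d * Y w + H w]].

Lemma dominated_in_fock m p q g : 0 < q -> entire g -> dominated_volterra m p q g ->
  forall f, in_fock m p f -> in_fock m q (volterra g f).
Proof.
move=> q0 hg dom f hf; have [ef _] := hf; split; first exact: (entire_volterra hg ef).
have F0 : 0 <= fine (fock_int m p f) by rewrite fine_ge0 // fock_ge0.
have [K K0 hK] := dom _ F0.
have [H [mH H0 iH hH]] := hK 1 ltr01.
have [|Y [mY Y0 iY hY]] := hH f hf; first by rewrite -(fock_fineK hf).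
have [C C0 hC] := @fock_segint R m q q0.
apply: le_lt_trans (hC _ (entire_vol_arg hg ef)) _.
have : (pint (dw m q (fun w => f w * cderiv g w)%R) <= pint Y + pint H)%E.
  rewrite -pintD //; apply: le_pint.
  - exact: pmeas_dw (entire_vol_arg hg ef).
  - exact: pmeasD.
  - by move=> z; exact: dw_ge0.
  - by move=> z; have := hY z; rewrite mul1r.
move=> k; apply: le_lt_trans (lee_wpmul2l _ k) _; first by rewrite lee_fin ltW.
have finY : (pint Y < +oo)%E by apply: le_lt_trans iY _; exact: ltry.
by rewrite lte_mul_pinfty ?lee_fin ?(ltW C0) // lte_add_pinfty.
Qed.

(** The locally uniform bounds give a pointwise convergent subsequence, whose limit lies in F^p by
    Fatou. For the differences the integrand is at most d Y plus its minimum with [H]: the first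
    part is small in norm, the second tends to 0 by dominated convergence. *)
Lemma compact_criterion m p q g : 0 < p -> 0 < q -> entire g -> dominated_volterra m p q g ->
  compact_op m p q (volterra g).
Proof.
move=> p0 q0 hg dom; have hin := dominated_in_fock q0 hg dom; split=> // u hu [M0 hM0].
have M00 : 0 <= M0 := le_trans (fnorm_ge0 m p (u 0%N)) (hM0 0%N).
pose M1 := M0 `^ p; have M10 : 0 <= M1 := powR_ge0 _ _.
have hM1 n : (fock_int m p (u n) <= M1%:E)%E by rewrite -(fnorm_leP p0 (hu n) M00).
have eu n : entire (u n) by case: (hu n).
have [B hB] := @fock_local_bound m p p0 M1 M10.
have [phi [v [hphi ev vB cv]]] := montel eu (fun n z r => hB (u n) (eu n) (hM1 n) z r).
have cvm z : rlim0 (fun n => modc (u (phi n) z - v z)).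
  by move=> e e0; have [N hN] := cv z e e0; exists N => n /hN; rewrite ger0_norm ?modc_ge0.
have fv : (fock_int m p v <= M1%:E)%E.
  rewrite fock_intE; apply: (@pint_fatou R (fun n => fw m p (u (phi n)))).
  - by move=> n; apply: pmeas_fw; exact: eu.
  - by move=> n z; exact: fw_ge0.
  - move=> z.
    have k : rlim0 (fun n => (modc (u (phi n) z) * wgt m z) `^ p - (modc (v z) * wgt m z) `^ p).
      apply: rlim0_powR => //.
      + exact: mulr_ge0 (modc_ge0 _) (wgt_ge0 _ _).
      + by move=> n; exact: mulr_ge0 (modc_ge0 _) (wgt_ge0 _ _).
      + apply: rlim0_le (rlim0M (wgt m z) (cvm z)) => n.
        rewrite -mulrBl !normrM (ger0_norm (modc_ge0 (u (phi n) z - v z))).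
        by rewrite ler_wpM2r //; exact: modc_lip.
    by apply: rlim0_le k => n; rewrite !fwE.
  - by move=> n; rewrite -fock_intE.
have iv : in_fock m p v by split=> //; apply: le_lt_trans fv _; exact: ltry.
pose x n := fun w => u (phi n) w - v w.
have ix n : in_fock m p (x n) := @in_fockB R m p _ _ (ltW p0) (hu (phi n)) iv.
have ex n : entire (x n) by case: (ix n).
pose M2 := 2 `^ p * (M1 + M1); have M20 : 0 <= M2 by rewrite mulr_ge0 ?powR_ge0 // addr_ge0.
have hM2 n : (fock_int m p (x n) <= M2%:E)%E.
  apply: le_trans (fock_intB m (ltW p0) (eu (phi n)) ev) _; rewrite EFinM.
  apply: lee_wpmul2l; first by rewrite lee_fin powR_ge0.
  by rewrite EFinD; exact: (leeD (hM1 _) fv).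
exists phi, (volterra g v); split; first exact: hphi.
split; first exact: (hin v iv).
have [K K0 hK] := dom M2 M20.
have [C C0 hC] := @fock_segint R m q q0.
have main e : 0 < e -> exists N : nat, forall n, (N <= n)%N -> (fock_int m q (volterra g (x n)) <= e%:E)%E.
  (* Makes [C * (e1 * K + e1)] equal to [e]. *)
  move=> e0; pose e1 := e / (C * (K + 1)); have e10 : 0 < e1 by rewrite divr_gt0 // mulr_gt0 // ltr_wpDl.
  have [H [mH H0 iH hH]] := hK e1 e10.
  pose X n := dw m q (fun w => x n w * cderiv g w).
  have mX n : pmeas (X n) := @pmeas_dw R m q _ (entire_vol_arg hg (ex n)).
  have X0 n z : 0 <= X n z := dw_ge0 _ _ _ _.
  have [N hN] : exists N : nat, forall n, (N <= n)%N -> (pint (fun z => Num.min (X n z) (H z)) <= e1%:E)%E.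
    apply: (@pint_dct0 R (fun n z => Num.min (X n z) (H z)) H) => //.
    - by move=> n; exact: pmeas_min.
    - by move=> n z; rewrite le_min X0 H0.
    - by move=> n z; rewrite ge_min lexx orbT.
    - move=> z.
      have k : rlim0 (fun n => (modc (x n z) * (modc (cderiv g z) * wgt m z / (1 + modc z))) `^ q - 0 `^ q).
        have w0 : 0 <= modc (cderiv g z) * wgt m z / (1 + modc z).
          by rewrite divr_ge0 ?(ltW (modc1_gt0 z)) //; exact: mulr_ge0 (modc_ge0 _) (wgt_ge0 _ _).
        apply: rlim0_powR => //.
        + by move=> n; rewrite mulr_ge0 // modc_ge0.
        + by apply: rlim0_le (rlim0M (modc (cderiv g z) * wgt m z / (1 + modc z)) (cvm z)) => n; rewrite subr0.
      apply: rlim0_le k => n; rewrite powR0 ?gt_eqF // subr0.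
      rewrite ger0_norm; last by rewrite le_min X0 H0.
      rewrite ger0_norm ?powR_ge0 // ge_min; apply/orP; left.
      by rewrite /X dwE modcM !mulrA.
  exists N => n Nn; have [Y [mY Y0 iY hY]] := hH (x n) (ix n) (hM2 n).
  apply: le_trans (hC _ (entire_vol_arg hg (ex n))) _.
  have m1 : pmeas (fun z => e1 * Y z) by apply: pmeasM => //; exact: pmeas_cst.
  have m2 : pmeas (fun z => Num.min (X n z) (H z)) by exact: pmeas_min.
  have n1 z : 0 <= e1 * Y z by rewrite mulr_ge0 // ltW.
  have n2 z : 0 <= Num.min (X n z) (H z) by rewrite le_min X0 H0.
  have : (pint (X n) <= e1%:E * pint Y + pint (fun z => Num.min (X n z) (H z)))%E.
    rewrite -pintZ ?(ltW e10) // -pintD //; apply: le_pint => //.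
    - exact: pmeasD.
    - move=> z; have := hY z; rewrite -/(X n z) => k.
      have [h|h] := leP (X n z) (H z); first by rewrite lerDr.
      exact: k.
  move=> k; apply: le_trans (lee_wpmul2l _ k) _; first by rewrite lee_fin ltW.
  have k2 : (e1%:E * pint Y + pint (fun z => Num.min (X n z) (H z)) <= (e1 * K + e1)%:E)%E.
    rewrite EFinD; apply: leeD; last exact: hN.
    by rewrite (EFinM e1 K); apply: lee_wpmul2l => //; rewrite lee_fin ltW.
  apply: le_trans (lee_wpmul2l _ k2) _; first by rewrite lee_fin ltW.
  rewrite -EFinM lee_fin le_eqVlt; apply/orP; left; apply/eqP.
  by rewrite /e1; field; rewrite !gt_eqF // ltr_wpDl.
apply/cvgrPdist_le => e e0; have ep0 : 0 < e `^ q by rewrite powR_gt0.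
have [N hN] := main _ ep0; exists N => // n /= Nn.
rewrite sub0r normrN ger0_norm ?fnorm_ge0 //.
rewrite -(volterraB hg (eu (phi n)) ev).
by rewrite (fnorm_leP q0 (hin _ (ix n)) (ltW e0)); exact: hN.
Qed.

(** Here the integrand is (|a|/(1 + |w|))^q times [fw m q f]. Off a large square the factor is at
    most [d]; on the square [fw] is uniformly bounded, so [H] can be a multiple of an indicator. *)
Lemma linear_compact m p q g a b : 0 < p -> p <= q -> entire g -> (forall z, g z = a * z + b) ->
  compact_op m p q (volterra g).
Proof.
move=> p0 pq hg E; have q0 : 0 < q := lt_le_trans p0 pq; apply: compact_criterion => //.
have dE := cderiv_linear E.
have [L L0 hL] := @fock_embed R m p q p0 pq.
have [C C0 hC] := @fock_ptw R m q q0.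
move=> M M0; pose K := L * (M `^ p^-1) `^ q.
have K0 : 0 <= K by rewrite mulr_ge0 ?(ltW L0) // powR_ge0.
exists K => // d d0.
have a0 := modc_ge0 a; pose D := modc a `^ q * (C * K).
have D0 : 0 <= D by rewrite mulr_ge0 ?powR_ge0 // mulr_ge0 // ltW.
(* The half-side at which (|a|/rho)^q = d when a is nonzero. *)
pose rho := modc a / d `^ q^-1.
have dq : 0 < d `^ q^-1 by rewrite powR_gt0.
have rho0 : 0 <= rho by rewrite divr_ge0 // ltW.
exists (fun z => D * indsq rho z); split.
- by apply: pmeasM; [exact: pmeas_cst|exact: pmeas_indsq].
- by move=> z; rewrite mulr_ge0 // indsq_ge0.
- by rewrite (pintZ (pmeas_indsq rho) (indsq_ge0 rho) D0) pint_indsq // -EFinM ltry.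
move=> f hf fM; have [ef _] := hf.
have fK : (fock_int m q f <= K%:E)%E.
  apply: le_trans (hL f hf) _; rewrite lee_fin /K; apply: (ler_wpM2l (ltW L0)).
  by apply: ler_pow; [exact: ltW|exact: fnorm_ge0|exact: fock_fnorm].
exists (fw m q f); split=> //.
- exact: pmeas_fw.
- by move=> z; exact: fw_ge0.
move=> w; have w1 := modc1_gt0 w.
have fp : fw m q f w <= C * K.
  by have := le_trans (hC f w ef) (lee_wpmul2l _ fK); rewrite lee_fin ltW // -EFinM lee_fin; exact.
have -> : dw m q (fun w => f w * cderiv g w) w = (modc a / (1 + modc w)) `^ q * fw m q f w.
  have r0 : 0 <= modc a / (1 + modc w) by rewrite divr_ge0 // ltW.
  rewrite dwE fwE -(powRM _ r0) ?dE; last exact: mulr_ge0 (modc_ge0 _) (wgt_ge0 _ _).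
  by congr (_ `^ _); rewrite modcM; ring.
have f0 := fw_ge0 m q f w.
have [iw|iw] := eqVneq (indsq rho w) 0.
  rewrite iw mulr0 addr0 ler_wpM2r //.
  have rw : rho <= modc w.
    rewrite leNgt; apply/negP => h; move: iw; rewrite /indsq.
    have -> : `|complex.Re w| <= rho by apply: le_trans (Re_le_modc _) (ltW h).
    have -> : `|complex.Im w| <= rho by apply: le_trans (Im_le_modc _) (ltW h).
    by move/eqP; rewrite oner_eq0.
  rewrite -[leRHS](@powVK R d q) ?(ltW d0) ?gt_eqF //; apply: ler_pow; first exact: ltW.
    by rewrite divr_ge0 // ltW.
  rewrite ler_pdivrMr // mulrC -ler_pdivrMr // -/rho; lra.
have -> : indsq rho w = 1.
  by move: iw; rewrite /indsq; case: (_ && _); rewrite ?eqxx.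
rewrite mulr1; apply: le_trans (_ : D <= _); last by rewrite lerDr mulr_ge0 // ltW.
apply: ler_pM => //; first exact: powR_ge0.
apply: ler_pow; [exact: ltW|by rewrite divr_ge0 // ltW|].
by rewrite ler_pdivrMr // ler_peMr // lerDl modc_ge0.
Qed.

Lemma constant_compact m p q g c : 0 < p -> 0 < q -> entire g -> (forall z, g z = c) ->
  compact_op m p q (volterra g).
Proof.
move=> p0 q0 hg E; apply: compact_criterion => // M M0; exists 0 => // d d0.
have dE z : cderiv g z = 0 by apply: (@cderiv_linear R g 0 c) => w; rewrite mul0r add0r.
have i0 : pint (fun _ : R[i] => 0 : R) = 0%E by rewrite /pint integral0.
exists (fun=> 0); split=> //; first exact: pmeas_cst.
  by rewrite i0 ltry.
move=> f hf fM; exists (fun=> 0); split=> //; [exact: pmeas_cst|by rewrite i0|].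
by move=> w; rewrite dwE dE mulr0 modc0 !mul0r powR0 ?addr0 ?mulr0 // gt_eqF.
Qed.

End CompactSufficiency.

(** * Sufficiency for q < p *)

Section SmallerExponent.
Local Open Scope classical_set_scope.
Local Open Scope ring_scope.
Context {R : realType}.
Implicit Types (d e s t x y M p q r A : R) (a b c z w : R[i]) (f g h v : R[i] -> R[i]) (m n k : nat).
Local Notation mu := (@lebesgue_measure R).
Opaque expR powR ln cauchy_bd wgt fw l1 ker tfun volterra.

Lemma powR_cvg0y s : 0 < s -> (1 + x) `^ (- s) @[x --> +oo] --> (0 : R).
Proof.
move=> s0; apply/cvgrPdist_le => e e0.
near=> x.
have x0 : 0 <= x by near: x; apply: nbhs_pinfty_ge; rewrite num_real.
have xe : e `^ (- s^-1) <= x by near: x; apply: nbhs_pinfty_ge; rewrite num_real.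
rewrite sub0r normrN ger0_norm ?powR_ge0 // powRN.
have ep : 0 < e `^ (- s^-1) by exact: powR_gt0.
rewrite invf_ple ?posrE ?powR_gt0 //; last by lra.
have -> : e^-1 = (e `^ (- s^-1)) `^ s.
  by rewrite -powRrM mulNr mulVf ?gt_eqF // powR_inv1 // ltW.
apply: ler_pow; [exact: ltW|exact: ltW|lra].
Unshelve. all: end_near. Qed.

Lemma is_derive_add1 x : is_derive x 1 (fun y : R => 1 + y) 1.
Proof. by have := is_deriveD (is_derive_cst (1 : R) x 1) (is_derive_id x 1); rewrite add0r. Qed.

Lemma is_derive_pow1 s x : s != 0 -> 0 <= x ->
  is_derive x 1 (fun x : R => (1 + x) `^ (- s) / (- s)) ((1 + x) `^ (- s - 1)).
Proof.
move=> s0 x0; have x1 : 0 < 1 + x by lra.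
have d1 := is_derive_add1 x.
have d2 := @is_derive1_comp R (@powR R ^~ (- s)) (fun x : R => 1 + x) x _ _ (is_derive1_powR (- s) x1) d1.
have d3 := @is_deriveZ R _ _ _ ((- s)^-1) _ _ _ d2.
have -> : (fun x : R => (1 + x) `^ (- s) / (- s)) = ((- s)^-1 \*: (@powR R ^~ (- s) \o (fun x : R => 1 + x))).
  by apply/funext => y /=; rewrite mulrC.
have -> // : (1 + x) `^ (- s - 1) = (- s)^-1 *: (- s * (1 + x) `^ (- s - 1) * 1).
by rewrite mulr1 [RHS]/GRing.scale /= mulrA mulVf ?mul1r // oppr_eq0.
Qed.

Lemma integral_pow s : 1 < s -> exists2 K, 0 <= K &
  (\int[mu]_(x in `[0%R, +oo[) ((1 + x) `^ (- s))%:E <= K%:E)%E.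
Proof.
move=> s1; have t0 : 0 < s - 1 by lra.
have tn : s - 1 != 0 by rewrite gt_eqF.
exists (s - 1)^-1; first by rewrite invr_ge0 ltW.
have dF x : 0 <= x -> is_derive x 1 (fun x : R => (1 + x) `^ (- (s - 1)) / (- (s - 1))) ((1 + x) `^ (- s)).
  by move=> x0; have := is_derive_pow1 tn x0; have -> : - (s - 1) - 1 = - s by ring.
have cont (F : R -> R) x d : is_derive x 1 F d -> {for x, continuous F}.
  by move=> h; apply: differentiable_continuous; apply/derivable1_diffP; case: h.
rewrite (@ge0_continuous_FTC2y R (fun x => (1 + x) `^ (- s)) (fun x : R => (1 + x) `^ (- (s - 1)) / (- (s - 1))) 0 0).
- rewrite sub0e -EFinN lee_fin addr0 powR1 div1r -invrN opprK; exact: lexx.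
- by move=> x _; exact: powR_ge0.
- apply: derivable_within_continuous => x; rewrite in_itv /= andbT => x0.
  have sn : s - 1 + 1 != 0 by rewrite subrK gt_eqF //; lra.
  have x1 : 0 < 1 + x by lra.
  have d1 := is_derive_add1 x.
  have := @is_derive1_comp R (@powR R ^~ (- s)) (fun x : R => 1 + x) x _ _ (is_derive1_powR (- s) x1) d1.
  by case.
- rewrite -(mul0r (- (s - 1))^-1); apply: cvgM; last exact: cvg_cst.
  exact: powR_cvg0y.
- by move=> x x0; case: (dF x (ltW x0)).
- apply: cvg_at_right_filter; apply: (cont _ _ _ (dF 0 (lexx 0))).
- move=> x; rewrite in_itv /= andbT => x0; rewrite derive1E; by case: (dF x (ltW x0)).
Qed.

Lemma integral_even (G : R -> R) K : measurable_fun setT G -> (forall x, 0 <= G x) ->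
  (\int[mu]_(x in `[0%R, +oo[) (G x)%:E <= K%:E)%E ->
  (\int[mu]_x (G `|x|)%:E <= (K + K)%:E)%E.
Proof.
move=> mG G0 hK; pose P := (fun x => (G x)%:E) \_ `[0, +oo[.
have mGE : measurable_fun setT (fun x => (G x)%:E) by exact/measurable_EFinP.
have mP : measurable_fun setT P.
  by apply/(measurable_restrict _ _ _) => //; exact: measurable_funTS.
have P0 x : (0 <= P x)%E by rewrite /P patchE; case: ifP => // _; rewrite lee_fin.
have IP : (\int[mu]_x P x = \int[mu]_(x in `[0%R, +oo[) (G x)%:E)%E by rewrite [RHS]integral_mkcond.
have mPN : measurable_fun setT (fun x : R => P (- x)) by apply: measurableT_comp.
have IPN : (\int[mu]_x P (- x)%R = \int[mu]_x P x)%E by rewrite ge0_integral_opp.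
apply: (@le_trans _ _ (\int[mu]_x (P x + P (- x)%R))%E).
  apply: ge0_le_integral => //.
  - by move=> x _; rewrite lee_fin.
  - by apply/measurable_EFinP; exact: (measurableT_comp mG (@normr_measurable R setT)).
  - exact: emeasurable_funD.
  - move=> x _; have [x0|x0] := leP 0 x.
      rewrite ger0_norm // -[leLHS]adde0; apply: leeD => //.
      by rewrite /P patchE mem_set //= in_itv /= x0.
    rewrite ltr0_norm // -[leLHS]add0e; apply: leeD => //.
    by rewrite /P patchE mem_set //= in_itv /= oppr_ge0 ltW.
rewrite ge0_integralD // IPN IP EFinD; exact: leeD.
Qed.

(** In place of polar coordinates, (1 + |w|)^(-r) is split into two equal powers, one bounded
    through the real and the other through the imaginary part; each has exponent r/2 > 1. *)
Lemma pint_pow r : 2 < r -> (pint (fun w => (1 + modc w) `^ (- r))%R < +oo)%E.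
Proof.
move=> r2; have s1 : 1 < r / 2 by lra.
have [K K0 hK] := integral_pow s1.
pose G (x : R) := (1 + x) `^ (- (r / 2)).
have G0 x : 0 <= G x by exact: powR_ge0.
have mG : measurable_fun setT G.
  apply: (@measurableT_comp _ _ _ _ _ _ (fun x : R => x `^ (- (r / 2))) _ (fun x : R => 1 + x)); first exact: measurable_powR.
  by apply: measurable_funD => //; exact: measurable_cst.
have hI := integral_even mG G0 hK.
pose N (x : R) := G `|x|; have N0 x : 0 <= N x by exact: G0.
have mN : measurable_fun setT N by exact: (measurableT_comp mG (@normr_measurable R setT)).
have mp : pmeas (fun w : R[i] => N (complex.Re w) * N (complex.Im w)).
  apply: pmeasM; [exact: (measurableT_comp mN (@pmeas_Re R))|exact: (measurableT_comp mN (@pmeas_Im R))].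
apply: (@le_lt_trans _ _ (pint (fun w : R[i] => N (complex.Re w) * N (complex.Im w)))%R).
  apply: le_pint => //.
  - by apply: pmeas_powR; apply: pmeasD; [exact: pmeas_cst|exact: pmeas_modc].
  - by move=> w; exact: powR_ge0.
  - move=> w; have w1 := modc1_gt0 w.
    have -> : (1 + modc w) `^ (- r) = (1 + modc w) `^ (- (r / 2)) * (1 + modc w) `^ (- (r / 2)).
      by rewrite -powDp //; congr (_ `^ _); field.
    have k x : `|x| <= modc w -> (1 + modc w) `^ (- (r / 2)) <= N x.
      move=> xw; have x1 : 0 < 1 + `|x| by rewrite ltr_wpDr.
      rewrite /N /G !powRN lef_pV2 ?posrE ?powR_gt0 //.
      by apply: ler_pow; [lra|exact: ltW|rewrite lerD2l].
    by apply: ler_pM; rewrite ?powR_ge0 //; apply: k; [exact: Re_le_modc|exact: Im_le_modc].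
rewrite pint_prod //.
have I0 : (0 <= \int[mu]_x (N x)%:E)%E by apply: integral_ge0 => x _; rewrite lee_fin.
apply: le_lt_trans (lee_pmul I0 I0 hI hI) _.
by rewrite -EFinM ltry.
Qed.

Lemma linear_compact_lt m p q g a b : 0 < q -> q < p -> (p - q) / p < q / 2 -> entire g ->
  (forall z, g z = a * z + b) -> compact_op m p q (volterra g).
Proof.
move=> q0 qp pq2 hg E; have p0 : 0 < p := lt_trans q0 qp.
apply: compact_criterion => // M M0; exists M => // d d0.
have dE := cderiv_linear E.
have pq0 : 0 < p - q by rewrite subr_gt0.
pose P := p / q; pose Q := p / (p - q); pose r := q * Q.
have P0 : 0 < P by rewrite divr_gt0.
have Q0 : 0 < Q by rewrite divr_gt0.
have P1 : P^-1 <= 1 by rewrite invf_le1 // ler_pdivlMr // mul1r ltW.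
have Q1 : Q^-1 <= 1 by rewrite invf_le1 // ler_pdivlMr // mul1r lerBlDr lerDl ltW.
have PQ : P^-1 + Q^-1 = 1 by rewrite /P /Q !invf_div; field; rewrite gt_eqF.
(* With r = pq/(p - q), this is the hypothesis (p - q)/p < q/2 rewritten. *)
have r2 : 2 < r.
  rewrite /r /Q mulrA ltr_pdivlMr // mulrC.
  by move: pq2; rewrite ltr_pdivrMr //; lra.
pose t := d `^ P^-1; have t0 : 0 < t by rewrite powR_gt0.
have tP : t `^ P = d by rewrite powVK ?(ltW d0) // gt_eqF.
pose D := (modc a `^ q / t) `^ Q; have D0 : 0 <= D by exact: powR_ge0.
have mH : pmeas (fun w : R[i] => (1 + modc w) `^ (- r)).
  by apply: pmeas_powR; apply: pmeasD; [exact: pmeas_cst|exact: pmeas_modc].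
exists (fun w => D * (1 + modc w) `^ (- r)); split.
- by apply: pmeasM => //; exact: pmeas_cst.
- by move=> z; rewrite mulr_ge0 // powR_ge0.
- rewrite pintZ //; last by move=> z; exact: powR_ge0.
  by rewrite lte_mul_pinfty ?lee_fin //; exact: pint_pow.
move=> f hf fM; have [ef _] := hf.
exists (fw m p f); split=> //.
- exact: pmeas_fw.
- by move=> z; exact: fw_ge0.
move=> w; have w1 := modc1_gt0 w; set F := modc (f w) * wgt m w.
have F0 : 0 <= F := mulr_ge0 (modc_ge0 _) (wgt_ge0 _ _).
have a0 := modc_ge0 a.
have -> : dw m q (fun w => f w * cderiv g w) w = (t * F `^ q) * ((modc a `^ q / t) * (1 + modc w) `^ (- q)).
  have -> : t * F `^ q * (modc a `^ q / t * (1 + modc w) `^ (- q)) = F `^ q * (modc a `^ q * (1 + modc w) `^ (- q)).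
    by field; rewrite gt_eqF.
  have i0 : 0 <= (1 + modc w)^-1 by rewrite invr_ge0 ltW.
  have -> : (1 + modc w) `^ (- q) = (1 + modc w)^-1 `^ q.
    by rewrite -(powR_inv1 (ltW w1)) -powRrM mulN1r.
  rewrite dwE -(powRM _ a0 i0) -(powRM _ F0 (mulr_ge0 a0 i0)) modcM dE /F.
  by congr (_ `^ _); ring.
have y0 : 0 <= modc a `^ q / t * (1 + modc w) `^ (- q).
  by rewrite mulr_ge0 ?powR_ge0 // divr_ge0 ?powR_ge0 // ltW.
have x0 : 0 <= t * F `^ q by rewrite mulr_ge0 ?powR_ge0 // ltW.
apply: le_trans (conjugate_powR x0 y0 P0 Q0 PQ) _.
apply: lerD.
  rewrite (powRM _ (ltW t0) (powR_ge0 _ _)) tP -powRrM.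
  have -> : q * P = p by rewrite /P mulrC divfK // gt_eqF.
  rewrite fwE -/F; apply: ler_piMr => //; by rewrite mulr_ge0 ?powR_ge0 // ltW.
have k0 : 0 <= modc a `^ q / t by rewrite divr_ge0 ?powR_ge0 // ltW.
rewrite (powRM _ k0 (powR_ge0 _ _)) -powRrM -/D mulNr -/r.
by apply: ler_piMr => //; rewrite mulr_ge0 // powR_ge0.
Qed.

End SmallerExponent.

(** * Lattice functions and the case q < p *)

Section Lattice.
Local Open Scope classical_set_scope.
Local Open Scope ring_scope.
Context {R : realType}.
Implicit Types (d e s t x y M p q r A B : R) (a b c z w : R[i]) (f g h v : R[i] -> R[i]) (m n k N : nat).
(** A lattice of spacing [s] in one quadrant; the shift by 1 keeps every point at modulus at least
    [s]. *)
Definition pt s (l : nat * nat) : R[i] := Complex (s * (1 + l.1%:R)) (s * l.2%:R).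

Lemma pt_dist s (l k : nat * nat) : 0 <= s ->
  l1 (pt s l - pt s k) = s * (`|l.1%:R - k.1%:R| + `|l.2%:R - k.2%:R|).
Proof.
move=> s0; rewrite /l1 cReB cImB /pt /=.
have -> : s * (1 + l.1%:R) - s * (1 + k.1%:R) = s * (l.1%:R - k.1%:R) by ring.
by rewrite -mulrBr !normrM (ger0_norm s0) mulrDr.
Qed.

Lemma cderiv_volterra g f : entire g -> entire f -> cderiv (volterra g f) = fun w => f w * cderiv g w.
Proof.
move=> hg hf; apply/funext => w; exact: (@cderiv_segint R _ w (entire_vol_arg hg hf)).
Qed.

Lemma nat_dist1 (i j : nat) : i != j -> 1 <= `|i%:R - j%:R : R|.
Proof.
wlog ij : i j / (i < j)%N.
  move=> H ne; have [ij|ij|ij] := ltngtP i j; last by move: ne; rewrite ij eqxx.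
  - exact: H.
  - by rewrite distrC; apply: H => //; rewrite eq_sym.
move=> _; rewrite distrC -natrB ?(ltnW ij) // normr_nat ler1n subn_gt0 //.
Qed.

Opaque expR powR ln cauchy_bd wgt fw l1 ker tfun volterra dw.

(* Bounded, with unit increments dominating [exp (- B * `|t|)]: lattice sums of exponentials telescope. *)
Definition stepf B t : R := if 0 <= t then 2 - expR (- (B * t)) else expR (B * t).

(** Equality for t >= 0. For t + 1 < 0 it is e^B + e^(-B) >= 2; in between, with x and y the two
    exponentials, it follows from (1 - x)(1 - y) >= 0 and x y = e^(-B). *)
Lemma stepf_incr B t : 0 < B -> (1 - expR (- B)) * expR (- (B * `|t|)) <= stepf B (t + 1) - stepf B t.
Proof.
move=> B0; set r := expR (- B); have r0 : 0 < r := expR_gt0 _.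
have r1 : r <= 1 by rewrite /r -[leRHS]expR0 ler_expR; lra.
rewrite /stepf; have [t0|t0] := leP 0 t.
  have -> : 0 <= t + 1 by lra.
  rewrite ger0_norm //; have -> : expR (- (B * (t + 1))) = r * expR (- (B * t)).
    by rewrite /r -expRD; congr expR; ring.
  lra.
rewrite ltr0_norm // mulrN opprK; have [t1|t1] := leP 0 (t + 1).
  set y := expR (B * t); set x := expR (- (B * (t + 1))).
  have y0 : 0 < y := expR_gt0 _; have x0 : 0 < x := expR_gt0 _.
  have xy : r = x * y by rewrite /r /x /y -expRD; congr expR; ring.
  have y1 : y <= 1 by rewrite /y -[leRHS]expR0 ler_expR; have := mulr_ge0 (ltW B0) (ltW (_ : 0 < - t)); rewrite oppr_gt0 => /(_ t0); lra.
  have x1 : x <= 1 by rewrite /x -[leRHS]expR0 ler_expR; have := mulr_ge0 (ltW B0) t1; lra.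
  have h1 : 0 <= (1 - x) * (1 - y) by rewrite mulr_ge0 // subr_ge0.
  have h2 : 0 <= (1 - r) * (1 - y) by rewrite mulr_ge0 // subr_ge0.
  move: h1; rewrite mulrBl mul1r mulrBr mulr1 -xy; lra.
have -> : expR (B * (t + 1)) = expR B * expR (B * t) by rewrite -expRD; congr expR; ring.
have E : 1 <= expR B by rewrite -[leLHS]expR0 ler_expR ltW.
have h0 : 0 < expR (B * t) := expR_gt0 _.
have h1 : 2 - r <= expR B.
  rewrite /r expRN; have e0 : 0 < expR B := expR_gt0 _.
  have : 0 <= (expR B - 1) ^+ 2 / expR B by rewrite divr_ge0 ?sqr_ge0 // ltW.
  have -> : (expR B - 1) ^+ 2 / expR B = expR B - 2 + (expR B)^-1 by field; rewrite gt_eqF.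
  lra.
have := ler_wpM2r (ltW h0) h1; lra.
Qed.

Lemma stepf_bd B t : 0 < B -> 0 <= stepf B t <= 2.
Proof.
move=> B0; rewrite /stepf; have [t0|t0] := leP 0 t.
  have : expR (- (B * t)) <= 1 by rewrite -[leRHS]expR0 ler_expR oppr_le0 mulr_ge0 // ltW.
  have := expR_ge0 (- (B * t)); lra.
have : expR (B * t) <= 1 by rewrite -[leRHS]expR0 ler_expR pmulr_rle0 // ltW.
have := expR_ge0 (B * t); lra.
Qed.

Lemma sum_exp1 B : 0 < B -> exists2 K, 0 <= K & forall N x,
  \sum_(i < N) expR (- (B * `|i%:R - x|)) <= K.
Proof.
move=> B0; have r1 : 0 < 1 - expR (- B).
  by rewrite subr_gt0 -[ltRHS]expR0 ltr_expR; lra.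
exists (2 / (1 - expR (- B))); first by rewrite divr_ge0 // ltW.
move=> N x; rewrite ler_pdivlMr // mulr_suml.
apply: (@le_trans _ _ (\sum_(i < N) (stepf B (i.+1%:R - x) - stepf B (i%:R - x)))).
  apply: ler_sum => i _; rewrite mulrC; apply: le_trans (stepf_incr _ B0) _.
  by have -> : i%:R - x + 1 = i.+1%:R - x by rewrite -natr1; ring.
have -> : \sum_(i < N) (stepf B (i.+1%:R - x) - stepf B (i%:R - x)) = stepf B (N%:R - x) - stepf B (0%:R - x).
  elim: N => [|N IH]; first by rewrite big_ord0 subrr.
  by rewrite big_ord_recr /= IH; ring.
have := stepf_bd (N%:R - x) B0; have := stepf_bd (0%:R - x) B0; lra.
Qed.

(** A dilation by s >= 1 only spreads the points, so the bound for integer points holds uniformly in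
    [s] and [N]. *)
Lemma sum_ker_pt B : 0 < B -> exists2 K, 0 <= K & forall N s w, 1 <= s ->
  \sum_(l : 'I_N * 'I_N) ker B (pt s (val l.1, val l.2)) w <= K.
Proof.
move=> B0; have [K K0 hK] := sum_exp1 B0; exists (K * K); first by rewrite mulr_ge0.
move=> N s w s1; have s0 : 0 < s by lra.
have k (u x : R) : expR (- (B * `|s * u - x|)) <= expR (- (B * `|u - x / s|)).
  rewrite ler_expR lerN2 ler_wpM2l ?(ltW B0) //.
  have -> : s * u - x = s * (u - x / s) by field; rewrite gt_eqF.
  by rewrite normrM (ger0_norm (ltW s0)) ler_peMl.
apply: (@le_trans _ _ (\sum_(l : 'I_N * 'I_N) expR (- (B * `|(val l.1)%:R - (complex.Re w / s - 1)|)) * expR (- (B * `|(val l.2)%:R - complex.Im w / s|)))).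
  apply: ler_sum => l _; rewrite kerE2 cReB cImB /pt /=; apply: ler_pM; rewrite ?expR_ge0 //.
  have -> : (val l.1)%:R - (complex.Re w / s - 1) = (1 + (val l.1)%:R) - complex.Re w / s :> R by ring.
  exact: k.
rewrite -(pair_bigA _ (fun i j : 'I_N => expR (- (B * `|(val i)%:R - (complex.Re w / s - 1)|)) * expR (- (B * `|(val j)%:R - complex.Im w / s|)))) /=.
rewrite -big_distrlr /=.
apply: ler_pM; [apply: sumr_ge0 => i _; exact: expR_ge0|apply: sumr_ge0 => i _; exact: expR_ge0|exact: hK|exact: hK].
Qed.

Definition sz (l : nat * nat) : R := 1 + l.1%:R + l.2%:R.
Definition cw p (l : nat * nat) : R := sz l `^ (- (2 / p)).
Definition lat N p s m w : R[i] :=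
  \sum_(l : 'I_N * 'I_N) (cw p (val l.1, val l.2))%:C%C * tfun m (pt s (val l.1, val l.2)) w.
Definition latsum N : R := \sum_(l : 'I_N * 'I_N) (sz (val l.1, val l.2)) ^- 2.

Lemma sz_ge1 l : 1 <= sz l. Proof. by rewrite /sz -addrA lerDl addr_ge0. Qed.
Lemma sz_gt0 l : 0 < sz l. Proof. exact: lt_le_trans ltr01 (sz_ge1 l). Qed.

Lemma cwX p l : p != 0 -> cw p l `^ p = sz l ^- 2.
Proof.
move=> p0; rewrite /cw -powRrM; have -> : - (2 / p) * p = - (2 : R) by field.
by rewrite powRN -powR_mulrn // ltW // sz_gt0.
Qed.

Lemma cw_ge0 p l : 0 <= cw p l. Proof. exact: powR_ge0. Qed.

Lemma latsum_ge0 N : 0 <= latsum N.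
Proof. by apply: sumr_ge0 => l _; rewrite invr_ge0 exprn_ge0 // ltW // sz_gt0. Qed.

Lemma entire_lat N p s m : entire (lat N p s m).
Proof.
apply: (@entire_sum R _ _ _ (fun (l : 'I_N * 'I_N) w => (cw p (val l.1, val l.2))%:C%C * tfun m (pt s (val l.1, val l.2)) w)) => l.
exact: (@entireZ R _ _ (@entire_tfun R m _)).
Qed.

Lemma kerD A B z w : ker A z w * ker B z w = ker (A + B) z w.
Proof. by rewrite !kerE -expRD mulrDl opprD. Qed.

Lemma ker_pow A p z w : ker A z w `^ p = ker (A * p) z w.
Proof. by rewrite !kerE -expRM; congr expR; ring. Qed.

Lemma lat_upper m p : 0 < p -> exists2 C, 0 < C & forall N s, 1 <= s ->
  (fock_int m p (lat N p s m) <= (C * latsum N)%:E)%E.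
Proof.
move=> p0; have pn : p != 0 by rewrite gt_eqF.
have ip : 0 < p^-1 by rewrite invr_gt0.
have A0 : 0 <= p^-1 + p^-1 by rewrite addr_ge0 // ltW.
have [D D0 hD] := @tfun_bound R m _ A0.
have [K K0 hK] := sum_ker_pt ip.
have [L L0 hL] := pint_ker (@ltr01 R).
pose C := (D * K) `^ p; have C0 : 0 <= C := powR_ge0 _ _.
exists (C * L + 1); first by rewrite ltr_wpDl // mulr_ge0.
move=> N s s1.
pose T w : R := \sum_(l : 'I_N * 'I_N) sz (val l.1, val l.2) ^- 2 * ker 1 (pt s (val l.1, val l.2)) w.
have c0 l : 0 <= sz l ^- 2 by rewrite invr_ge0 exprn_ge0 // ltW // sz_gt0.
have mT1 (l : 'I_N * 'I_N) : pmeas (fun w => sz (val l.1, val l.2) ^- 2 * ker 1 (pt s (val l.1, val l.2)) w).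
  by apply: pmeasM; [exact: pmeas_cst|exact: pmeas_ker].
have T10 (l : 'I_N * 'I_N) w : 0 <= sz (val l.1, val l.2) ^- 2 * ker 1 (pt s (val l.1, val l.2)) w.
  by rewrite mulr_ge0 // ker_ge0.
have mT : pmeas T by exact: pmeas_sum.
have T0 w : 0 <= T w by exact: sumr_ge0.
have ptw w : fw m p (lat N p s m) w <= C * T w.
  have DK : 0 <= D * K by rewrite mulr_ge0 // ltW.
  rewrite fwE -[T w](@powVK R _ p) // -(powRM _ DK (powR_ge0 _ _)).
  apply: ler_pow; [exact: ltW|exact: mulr_ge0 (modc_ge0 _) (wgt_ge0 _ _)|].
  apply: (@le_trans _ _ (\sum_(l : 'I_N * 'I_N) D * T w `^ p^-1 * ker p^-1 (pt s (val l.1, val l.2)) w)).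
    apply: le_trans (ler_wpM2r (wgt_ge0 m w) (modc_sum _ _ _)) _.
    rewrite mulr_suml; apply: ler_sum => l _.
    rewrite modcM modc_real (ger0_norm (cw_ge0 _ _)) -(mulrA (cw _ _)).
    apply: le_trans (ler_wpM2l (cw_ge0 _ _) (hD _ _)) _.
    rewrite -kerD mulrCA -[leRHS]mulrA ler_wpM2l ?(ltW D0) // mulrA.
    rewrite ler_wpM2r ?ker_ge0 //.
    rewrite -[leLHS](@powKV R _ p) //; last by rewrite mulr_ge0 ?ker_ge0 // cw_ge0.
    apply: ler_pow; [exact: ltW|exact: powR_ge0|].
    rewrite powRM ?ker_ge0 ?cw_ge0 // cwX // ker_pow mulVf //.
    rewrite /T (bigD1 l) // lerDl; apply: sumr_ge0 => k _; exact: T10.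
  rewrite -mulr_sumr -mulrA [T w `^ _ * _]mulrC mulrA ler_wpM2r ?powR_ge0 //.
  by rewrite ler_wpM2l ?(ltW D0) //; exact: hK.
have ic : (pint T <= (latsum N * L)%:E)%E.
  rewrite /T pint_sum // /latsum mulr_suml -sumEFin.
  apply: lee_sum => l _; rewrite pintZ //; [|exact: pmeas_ker|by move=> w; exact: ker_ge0].
  by rewrite EFinM; apply: lee_wpmul2l; [rewrite lee_fin|exact: hL].
rewrite fock_intE; apply: (@le_trans _ _ (C%:E * pint T)%E).
  rewrite -pintZ //; apply: le_pint => //.
  - by apply: pmeas_fw; exact: entire_lat.
  - by apply: pmeasM => //; exact: pmeas_cst.
  - by move=> w; exact: fw_ge0.
apply: le_trans (lee_wpmul2l _ ic) _; first by rewrite lee_fin.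
rewrite -EFinM lee_fin mulrDl mul1r [latsum N * L]mulrC mulrA lerDl; exact: latsum_ge0.
Qed.

(** Between lattice points the coefficients change at most exponentially at rate 2/p, which a
    sufficiently sparse lattice beats. *)
Lemma cw_slow p (l k : nat * nat) : 0 < p ->
  cw p k <= cw p l * expR (2 / p * (`|l.1%:R - k.1%:R| + `|l.2%:R - k.2%:R|)).
Proof.
move=> p0; set d := `|_| + _; have d0 : 0 <= d by rewrite addr_ge0.
have h : sz l <= sz k * expR d.
  have e := expR_ge1Dx d; have k1 := sz_ge1 k.
  have : sz l <= sz k + d.
    rewrite /sz /d; have := ler_norm (l.1%:R - k.1%:R : R); have := ler_norm (l.2%:R - k.2%:R : R); lra.
  move=> h; apply: le_trans h _.
  apply: le_trans (ler_wpM2l (ltW (sz_gt0 k)) e).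
  have : 0 <= (sz k - 1) * d by rewrite mulr_ge0 // subr_ge0.
  lra.
rewrite (mulrC (2 / p)) expRM /cw !powRN.
have q0 : 0 <= 2 / p by rewrite divr_ge0 // ltW.
have hk := powR_gt0 (2 / p) (sz_gt0 k); have hl := powR_gt0 (2 / p) (sz_gt0 l).
rewrite [leRHS]mulrC ler_pdivlMr // mulrC ler_pdivrMr //.
rewrite [leRHS]mulrC -(powRM _ (ltW (sz_gt0 k)) (expR_ge0 _)).
by apply: ler_pow => //; exact: ltW (sz_gt0 l).
Qed.

Lemma lat_lower m p : 0 < p -> exists2 s0, 1 <= s0 & forall N s (l : 'I_N * 'I_N), s0 <= s ->
  cw p (val l.1, val l.2) / 2 <= modc (lat N p s m (pt s (val l.1, val l.2))) * wgt m (pt s (val l.1, val l.2)).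
Proof.
move=> p0; have [D D0 hD] := @tfun_bound R m 1 ler01.
have [K K0 hK] := sum_ker_pt (@ltr01 R).
(* [2 / p] pays for the variation of the coefficients, 1 leaves a summable kernel, and [2 * D * K]
   makes the sum of all off-diagonal terms at most half of the diagonal one; the last 1 is slack. *)
pose s0 := 2 / p + 1 + 2 * D * K + 1.
have p20 : 0 <= 2 / p by rewrite divr_ge0 // ltW.
have DK0 : 0 <= 2 * D * K by rewrite !mulr_ge0 // ltW.
exists s0; first by rewrite /s0; lra.
move=> N s l ss; set z := pt s (val l.1, val l.2); set c := cw p (val l.1, val l.2).
have c0 : 0 <= c := cw_ge0 _ _.
have s1 : 1 <= s by apply: le_trans ss; rewrite /s0; lra.
have diag : modc (c%:C%C * tfun m z z) * wgt m z = c.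
  by rewrite modcM modc_real (ger0_norm c0) -mulrA tfun_diag mulr1.
pose r := expR (- (2 * D * K)) * D.
have off (k : 'I_N * 'I_N) : k != l ->
  modc ((cw p (val k.1, val k.2))%:C%C * tfun m (pt s (val k.1, val k.2)) z) * wgt m z <=
  c * r * ker 1 (pt 1 (val k.1, val k.2)) (pt 1 (val l.1, val l.2)).
  move=> kl; rewrite modcM modc_real (ger0_norm (cw_ge0 _ _)) -mulrA.
  apply: le_trans (ler_wpM2l (cw_ge0 _ _) (hD _ _)) _.
  have e0 : 0 <= D * ker 1 (pt s (val k.1, val k.2)) z by rewrite mulr_ge0 ?ker_ge0 // ltW.
  apply: le_trans (ler_wpM2r e0 (@cw_slow p (val l.1, val l.2) (val k.1, val k.2) p0)) _.
  rewrite /r !kerE !pt_dist //=; last by lra.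
  set d := `|_| + `|_|; set d' := `|_| + `|_|.
  have dd : d' = d by rewrite /d /d' distrC; congr (_ + _); rewrite distrC.
  rewrite dd !mul1r -/c.
  have -> : c * expR (2 / p * d) * (D * expR (- (s * d))) = c * D * expR (2 / p * d - s * d).
    by rewrite expRD; ring.
  have -> : c * (expR (- (2 * D * K)) * D) * expR (- d) = c * D * expR (- (2 * D * K) - d).
    by rewrite expRD; ring.
  rewrite ler_wpM2l ?mulr_ge0 ?(ltW D0) // ler_expR.
  have d1 : 1 <= d.
    rewrite -dd /d'; have [e1|n1] := eqVneq (val k.1) (val l.1).
      have n2 : val k.2 != val l.2.
        apply: contra_neq kl => e2.
        by rewrite (surjective_pairing k) (surjective_pairing l) (val_inj e1) (val_inj e2).
      by apply: le_trans (nat_dist1 n2) _; rewrite lerDr.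
    by apply: le_trans (nat_dist1 n1) _; rewrite lerDl.
  have : (2 / p + 1 + 2 * D * K) * d <= s * d by rewrite ler_wpM2r //; [lra|move: ss; rewrite /s0; lra].
  have : 2 * D * K * 1 <= 2 * D * K * d by rewrite ler_wpM2l.
  lra.
have rK : r * K <= 1 / 2.
  rewrite /r expRN.
  have e := expR_ge1Dx (2 * D * K); have e0 := expR_gt0 (2 * D * K).
  have -> : (expR (2 * D * K))^-1 * D * K = (2 * D * K) / (2 * expR (2 * D * K)) by field; rewrite gt_eqF.
  by rewrite ler_pdivrMr ?mulr_gt0 //; lra.
have off_sum : modc (\sum_(k | k != l) (cw p (val k.1, val k.2))%:C%C * tfun m (pt s (val k.1, val k.2)) z) * wgt m z <= c / 2.
  apply: le_trans (ler_wpM2r (wgt_ge0 m z) (modc_sum _ _ _)) _.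
  rewrite mulr_suml; apply: le_trans (ler_sum _ off) _.
  rewrite -mulr_sumr; have cr : 0 <= c * r by rewrite mulr_ge0 // mulr_ge0 ?expR_ge0 // ltW.
  apply: (@le_trans _ _ (c * r * K)).
    rewrite ler_wpM2l //; apply: le_trans (hK N 1 (pt 1 (val l.1, val l.2)) (lexx 1)).
    by rewrite [leRHS](bigD1 l) //= lerDr ker_ge0.
  by rewrite -mulrA; have := ler_wpM2l c0 rK; lra.
rewrite /lat (bigD1 l) //= -/z -/c.
set S := \sum_(_ | _) _ in off_sum *.
have h1 : modc (c%:C%C * tfun m z z) <= modc (c%:C%C * tfun m z z + S) + modc S.
  by have := modcB (c%:C%C * tfun m z z + S) S; rewrite addrK.
have := ler_wpM2r (wgt_ge0 m z) h1; rewrite diag mulrDl; lra.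
Qed.

Lemma harmonic_unbounded M : exists N, M < \sum_(i < N) i.+1%:R^-1.
Proof.
apply: contrapT => H; apply: (@dvg_harmonic R); apply: nondecreasing_is_cvgn.
  by apply: nondecreasing_series => n _ _; rewrite invr_ge0.
exists M => _ [N _ <-]; rewrite /series /= big_mkord leNgt; apply/negP => k; apply: H; by exists N.
Qed.

(** Row [i] contains i + 1 terms that are at least (2(i + 1))^(-2), so it contributes at least
    1/(4(i + 1)), and the harmonic series diverges. *)
Lemma latsum_unbounded M : exists N, M < latsum N.
Proof.
apply: contrapT => H; have hM N : latsum N <= M by rewrite leNgt; apply/negP => k; apply: H; exists N.
have key N : \sum_(i < N) (4 * i.+1%:R)^-1 <= latsum N.
  rewrite /latsum -(pair_bigA _ (fun i j : 'I_N => sz (val i, val j) ^- 2)) /=.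
  apply: ler_sum => i _.
  have F0 j : 0 <= sz (val i, j) ^- 2 by rewrite invr_ge0 exprn_ge0 // ltW // sz_gt0.
  apply: (@le_trans _ _ (\sum_(j < N | (j < i.+1)%N) sz (val i, val j) ^- 2)); last first.
    by rewrite [leRHS](bigID (fun j : 'I_N => (j < i.+1)%N)) /= lerDl sumr_ge0.
  rewrite -(big_ord_widen N (fun j => sz (val i, j) ^- 2)) //.
  have i1 : 0 < (i.+1)%:R :> R by rewrite ltr0n.
  have -> : (4 * i.+1%:R)^-1 = \sum_(j < i.+1) (2 * i.+1%:R) ^- 2 :> R.
    by rewrite sumr_const card_ord -mulr_natl; field; rewrite gt_eqF.
  apply: ler_sum => j _; rewrite lef_pV2 ?posrE ?exprn_gt0 ?sz_gt0 ?mulr_gt0 //.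
  rewrite lerXn2r ?nnegrE ?(ltW (sz_gt0 _)) ?mulr_ge0 //.
  rewrite /sz /= -natr1; have : (j%:R : R) <= i%:R by rewrite ler_nat -ltnS.
  lra.
have [N] := harmonic_unbounded (4 * M); rewrite ltNge => /negP; apply.
have := le_trans (key N) (hM N).
have -> : \sum_(i < N) (4 * i.+1%:R)^-1 = 4^-1 * \sum_(i < N) i.+1%:R^-1 :> R.
  by rewrite mulr_sumr; apply: eq_bigr => i _; rewrite invfM.
lra.
Qed.

(** The lower bound on g' is left as a hypothesis because the contradiction is used twice, for
    quadratic and for linear symbols. It may hold only for large spacings, so [s] is chosen after
    both thresholds. *)
Lemma lattice_contra m p q g : 0 < q -> q < p -> entire g -> bounded_op m p q (volterra g) ->
  (exists s0, forall s, s0 <= s -> 1 <= s -> exists2 kap, 0 < kap & forall l : nat * nat,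
    kap * sz l ^- 2 <= (cw p l * (modc (cderiv g (pt s l)) / (1 + modc (pt s l)))) `^ q) -> False.
Proof.
move=> q0 qp hg [hin [c hc]] [s0 hs0]; have p0 : 0 < p := lt_trans q0 qp.
have pn : p != 0 by rewrite gt_eqF. have qn : q != 0 by rewrite gt_eqF.
have [C1 C10 hC1] := @lat_upper m p p0.
have [s1 s11 hs1] := @lat_lower m p p0.
have [C2 C20 hC2] := @local_deriv_bound R m q 1 q0 ler01.
have [K K0 hK] := sum_ker_pt (@ltr01 R).
pose s := Num.max s0 s1.
have ss0 : s0 <= s by rewrite /s le_max lexx.
have ss1 : s1 <= s by rewrite /s le_max lexx orbT.
have s1' : 1 <= s := le_trans s11 ss1.
have [kap kap0 hkap] := hs0 s ss0 s1'.
pose C3 := C2 * K * (`|c| * C1 `^ p^-1) `^ q.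
have C30 : 0 <= C3 by rewrite mulr_ge0 ?powR_ge0 // mulr_ge0 // ltW.
have main N : kap / 2 `^ q * latsum N <= C3 * latsum N `^ (q / p).
  have eL := @entire_lat N p s m; set F := lat N p s m in eL.
  have L0 := latsum_ge0 N.
  have fF := hC1 N s s1'; rewrite -/F in fF.
  have iF : in_fock m p F by split=> //; apply: le_lt_trans fF _; exact: ltry.
  have CL : 0 <= C1 * latsum N by rewrite mulr_ge0 // ltW.
  have nF : fnorm m p F <= (C1 * latsum N) `^ p^-1 by exact: fock_fnorm.
  pose G := volterra g F; have iG : in_fock m q G := hin F iF.
  have eG : entire G by case: iG.
  have nG : fnorm m q G <= `|c| * (C1 * latsum N) `^ p^-1.
    apply: le_trans (hc F iF) _.
    apply: le_trans (ler_wpM2r (fnorm_ge0 _ _ _) (ler_norm c)) _.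
    by rewrite ler_wpM2l.
  have cL0 : 0 <= `|c| * (C1 * latsum N) `^ p^-1 by rewrite mulr_ge0 // powR_ge0.
  rewrite (fnorm_leP q0 iG cL0) in nG.
  have dG : cderiv G = fun w => F w * cderiv g w := cderiv_volterra hg eL.
  have mG := pmeas_fw m q eG.
  have g0 w := fw_ge0 m q G w.
  (* The local derivative bounds at the lattice points add up to a single integral, since the
     kernels at these points sum to at most [K]. *)
  have sumle : ((\sum_(l : 'I_N * 'I_N) dw m q (fun w => F w * cderiv g w)%R (pt s (val l.1, val l.2)))%:E <=
    (C2 * K)%:E * fock_int m q G)%E.
    have mk (l : 'I_N * 'I_N) : pmeas (fun w => fw m q G w * ker 1 (pt s (val l.1, val l.2)) w).
      by apply: pmeasM => //; exact: pmeas_ker.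
    have k0 (l : 'I_N * 'I_N) w : 0 <= fw m q G w * ker 1 (pt s (val l.1, val l.2)) w by rewrite mulr_ge0 // ker_ge0.
    apply: (@le_trans _ _ (\sum_(l : 'I_N * 'I_N) C2%:E * pint (fun w => fw m q G w * ker 1 (pt s (val l.1, val l.2)) w)%R)%E).
      rewrite -sumEFin; apply: lee_sum => l _.
      have := hC2 G (pt s (val l.1, val l.2)) eG; rewrite dG => k.
      by apply: le_trans k; rewrite dwE.
    rewrite -ge0_sume_distrr; last by move=> l _; apply: pint_ge0 => w; exact: k0.
    rewrite EFinM -muleA; apply: lee_wpmul2l; first by rewrite lee_fin ltW.
    rewrite -pint_sum // fock_intE -pintZ //; apply: le_pint.
    - exact: pmeas_sum.
    - by apply: pmeasM => //; exact: pmeas_cst.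
    - by move=> w; apply: sumr_ge0.
    - by move=> w; rewrite -mulr_sumr mulrC ler_wpM2r //; exact: hK.
  have := le_trans sumle (lee_wpmul2l _ nG); rewrite lee_fin mulr_ge0 ?(ltW C20) // -EFinM lee_fin => /(_ isT) tot.
  apply: (@le_trans _ _ (\sum_(l : 'I_N * 'I_N) dw m q (fun w => F w * cderiv g w) (pt s (val l.1, val l.2)))).
    rewrite /latsum mulr_sumr; apply: ler_sum => l _.
    set L := (val l.1, val l.2).
    rewrite mulrAC ler_pdivrMr ?powR_gt0 //; apply: le_trans (hkap L) _.
    have z1 := modc1_gt0 (pt s L).
    have d0 : 0 <= modc (cderiv g (pt s L)) / (1 + modc (pt s L)) by rewrite divr_ge0 ?modc_ge0 // ltW.
    have e0 : 0 <= modc (F (pt s L)) * wgt m (pt s L) := mulr_ge0 (modc_ge0 _) (wgt_ge0 _ _).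
    have -> : dw m q (fun w => F w * cderiv g w) (pt s L) * 2 `^ q =
      (modc (F (pt s L)) * wgt m (pt s L) * 2 * (modc (cderiv g (pt s L)) / (1 + modc (pt s L)))) `^ q.
      rewrite dwE -powRM //; last by rewrite divr_ge0 ?(ltW z1) //; exact: mulr_ge0 (modc_ge0 _) (wgt_ge0 _ _).
      by congr (_ `^ _); rewrite modcM; ring.
    apply: ler_pow; [exact: ltW|by rewrite mulr_ge0 // cw_ge0|].
    rewrite ler_wpM2r // -ler_pdivrMr //; exact: hs1.
  apply: le_trans tot _; rewrite /C3 -mulrA ler_wpM2l ?mulr_ge0 ?(ltW C20) //.
  have E : `|c| * (C1 * latsum N) `^ p^-1 = (`|c| * C1 `^ p^-1) * latsum N `^ p^-1.
    by rewrite (powRM _ (ltW C10) L0) mulrA.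
  rewrite E (powRM _ _ (powR_ge0 _ _)); last by rewrite mulr_ge0 // powR_ge0.
  by rewrite -powRrM [p^-1 * q]mulrC.
have e0 : 0 < 1 - q / p by rewrite subr_gt0 ltr_pdivrMr // mul1r.
pose kk := kap / 2 `^ q; have kk0 : 0 < kk by rewrite divr_gt0 // powR_gt0.
have bdd N : latsum N <= (C3 / kk) `^ (1 - q / p)^-1 + 1.
  have L0 := latsum_ge0 N.
  have [->|Ln] := eqVneq (latsum N) 0; first by rewrite addr_ge0 // powR_ge0.
  have LP : 0 < latsum N by rewrite lt0r Ln.
  apply: le_trans (_ : (C3 / kk) `^ (1 - q / p)^-1 <= _); last by rewrite lerDl.
  rewrite -[leLHS](@powKV R _ (1 - q / p)) ?gt_eqF //.
  apply: ler_pow; [by rewrite invr_ge0 ltW|exact: powR_ge0|].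
  rewrite ler_pdivlMr // mulrC powDp // powRr1 // powRN.
  have := main N; rewrite -/kk => k.
  by rewrite mulrA ler_pdivrMr ?powR_gt0.
have [N] := latsum_unbounded ((C3 / kk) `^ (1 - q / p)^-1 + 1).
by rewrite ltNge bdd.
Qed.

End Lattice.

(** * The symbols for p <= q and for q < p *)

Section Characterizations.
Local Open Scope classical_set_scope.
Local Open Scope ring_scope.
Context {R : realType}.
Implicit Types (d e s t x y p q r A B : R) (a b c z w : R[i]) (f g h v : R[i] -> R[i]) (m n k N : nat).
Opaque expR powR ln cauchy_bd wgt fw l1 ker tfun volterra dw.

Lemma modc_pt_ge s (l : nat * nat) : 0 <= s -> s <= modc (pt s l).
Proof.
move=> s0; apply: le_trans (Re_le_modc _); rewrite /pt /= ger0_norm; last by rewrite mulr_ge0 ?addr_ge0.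
by rewrite ler_peMr // lerDl.
Qed.

Lemma modc_pt_le s (l : nat * nat) : 0 <= s -> modc (pt s l) <= s * sz l.
Proof.
move=> s0; apply: le_trans (modc_le_ReIm _) _; rewrite /pt /sz /= !ger0_norm ?mulr_ge0 ?addr_ge0 //.
by rewrite -mulrDr.
Qed.

Lemma sz_pow_ge (l : nat * nat) t : t <= 2 -> sz l ^- 2 <= sz l `^ (- t) :> R.
Proof.
move=> t2; have s0 := ltW (sz_gt0 (R := R) l).
have -> : sz l ^- 2 = sz l `^ (- 2) :> R by rewrite powRN powR_mulrn.
by apply: ler_powR; rewrite ?lerN2 //; exact: sz_ge1.
Qed.

(** If the leading coefficient is nonzero, |g'|/(1 + |z|) is bounded below far out, so a lattice
    point contributes a multiple of sz^(-2q/p), and 2q/p <= 2. *)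
Lemma bounded_lt_linear m p q g : 0 < q -> q < p -> entire g -> bounded_op m p q (volterra g) ->
  exists a b, forall z, g z = a * z + b.
Proof.
move=> q0 qp hg hb; have p0 : 0 < p := lt_trans q0 qp.
have [C C0 hC] := bounded_growth p0 q0 hg hb.
have [a [b [c E]]] := growth_quadratic hg hC.
have [a0|a0] := eqVneq a 0; first by exists b, c => z; rewrite E a0 mul0r add0r.
have aP : 0 < modc a by rewrite modc_gt0.
have dE := cderiv_quadratic E; exfalso.
apply: (lattice_contra q0 qp hg hb); exists ((modc a + modc b) / modc a) => s hs s1.
have s0 : 0 <= s by lra.
exists (modc a `^ q); first exact: powR_gt0.
move=> l; set z := pt s l; have z1 := modc1_gt0 z.
have k1 : modc a + modc b <= modc a * modc z.
  rewrite mulrC -ler_pdivrMr //; apply: le_trans hs _; exact: modc_pt_ge.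
have k2 : modc a <= modc (cderiv g z) / (1 + modc z).
  rewrite ler_pdivlMr // dE.
  have h1 : modc (2 * a * z) <= modc (2 * a * z + b) + modc b.
    by have := modcB (2 * a * z + b) b; rewrite addrK.
  move: h1; rewrite !modcM.
  have -> : modc (2 : R[i]) = 2.
    by rewrite -[2 : R[i]](rmorph_nat (real_complex R) 2) modc_real ger0_norm.
  lra.
have c0 := cw_ge0 p l.
apply: (@le_trans _ _ ((cw p l * modc a) `^ q)); last first.
  by apply: ler_pow; [exact: ltW|rewrite mulr_ge0 // ltW|rewrite ler_wpM2l].
rewrite (powRM _ c0 (ltW aP)) mulrC ler_wpM2r ?powR_ge0 // /cw -powRrM mulNr.
apply: sz_pow_ge; rewrite mulrAC ler_pdivrMr // ler_wpM2l //; exact: ltW.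
Qed.

(** For a linear symbol a lattice point contributes a multiple of sz^(-(2q/p + q)); the exponent is
    at most 2 exactly when q/2 <= 1 - q/p. *)
Lemma bounded_lt_constant m p q g a b : 0 < q -> q < p -> q / 2 <= (p - q) / p -> entire g ->
  bounded_op m p q (volterra g) -> (forall z, g z = a * z + b) -> a = 0.
Proof.
move=> q0 qp pq2 hg hb E; have p0 : 0 < p := lt_trans q0 qp.
apply/eqP; apply: contrapT => /negP a0.
have aP : 0 < modc a by rewrite modc_gt0.
have dE := cderiv_linear E.
apply: (lattice_contra q0 qp hg hb); exists 0 => s _ s1.
have s0 : 0 < s by lra.
have kp : 0 < modc a / (2 * s) by rewrite divr_gt0 // mulr_gt0.
exists ((modc a / (2 * s)) `^ q); first exact: powR_gt0.
move=> l; set z := pt s l; have z1 := modc1_gt0 z; have S1 := sz_ge1 (R := R) l.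
have SP := sz_gt0 (R := R) l; have c0 := cw_ge0 p l.
have k2 : modc a / (2 * s) / sz l <= modc (cderiv g z) / (1 + modc z).
  rewrite dE -mulrA ler_wpM2l ?(ltW aP) // -invfM lef_pV2 ?posrE ?mulr_gt0 //.
  have := modc_pt_le l (ltW s0); rewrite -/z.
  have : 1 * 1 <= s * sz l by apply: ler_pM.
  lra.
apply: (@le_trans _ _ ((cw p l * (modc a / (2 * s) / sz l)) `^ q)); last first.
  have k0 : 0 <= modc a / (2 * s) / sz l by rewrite divr_ge0 // ltW.
  by apply: ler_pow; [exact: ltW|rewrite mulr_ge0|rewrite ler_wpM2l].
have -> : cw p l * (modc a / (2 * s) / sz l) = modc a / (2 * s) * (sz l `^ (- (2 / p) - 1)).
  by rewrite powDp // powR_inv1 ?(ltW SP) // /cw; ring.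
rewrite (powRM _ (ltW kp) (powR_ge0 _ _)) ler_wpM2l ?powR_ge0 // -powRrM.
have -> : (- (2 / p) - 1) * q = - (2 * (q / p) + q) by ring.
apply: sz_pow_ge; move: pq2.
have -> : (p - q) / p = 1 - q / p by field; rewrite gt_eqF.
lra.
Qed.

Lemma characterization_le m p q g : 0 < p -> p <= q -> entire g ->
  (bounded_op m p q (volterra g) <-> exists a b c, forall z, g z = a * z ^+ 2 + b * z + c) /\
  (compact_op m p q (volterra g) <-> exists a b, forall z, g z = a * z + b).
Proof.
move=> p0 pq hg; have q0 : 0 < q := lt_le_trans p0 pq; split; split.
- by move=> hb; have [C C0 hC] := bounded_growth p0 q0 hg hb; exact: growth_quadratic hg hC.
- by move=> [a [b [c E]]]; have [C C0 hC] := quadratic_growth E; exact: growth_bounded p0 pq hg (ltW C0) hC.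
- exact: compact_linear.
- by move=> [a [b E]]; exact: linear_compact p0 pq hg E.
Qed.

Lemma characterization_lt m p q g : 0 < q -> q < p -> entire g ->
  (bounded_op m p q (volterra g) <-> compact_op m p q (volterra g)) /\
  ((p - q) / p < q / 2 ->
     (compact_op m p q (volterra g) <-> exists a b, forall z, g z = a * z + b)) /\
  (q / 2 <= (p - q) / p ->
     (compact_op m p q (volterra g) <-> exists c, forall z, g z = c)).
Proof.
move=> q0 qp hg; have p0 : 0 < p := lt_trans q0 qp.
have cb := compact_op_bounded p0 q0 hg.
have bc : q / 2 <= (p - q) / p -> bounded_op m p q (volterra g) -> exists c, forall z, g z = c.
  move=> pq2 hb; have [a [b E]] := bounded_lt_linear q0 qp hg hb; exists b => z.
  by rewrite E (bounded_lt_constant q0 qp pq2 hg hb E) mul0r add0r.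
split; [split=> [hb|hc]|split=> pq2; split=> [hc|]].
- have [pq2|pq2] := leP (q / 2) ((p - q) / p).
    by have [c E] := bc pq2 hb; exact: constant_compact p0 q0 hg E.
  by have [a [b E]] := bounded_lt_linear q0 qp hg hb; exact: linear_compact_lt q0 qp pq2 hg E.
- exact: cb.
- exact: (bounded_lt_linear q0 qp hg (cb m hc)).
- by move=> [a [b E]]; exact: linear_compact_lt q0 qp pq2 hg E.
- exact: bc pq2 (cb m hc).
- by move=> [c E]; exact: constant_compact p0 q0 hg E.
Qed.

End Characterizations.

(** * Orthogonality of monomials *)

Section Rotation.
Local Open Scope classical_set_scope.
Local Open Scope ring_scope.
Context {R : realType}.
Implicit Types (d e s t x y p q r A B : R) (a b c z w : R[i]) (f g h : R[i] -> R[i]) (m n k N : nat) (phi : R[i] -> R).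
Local Notation mu := (@lebesgue_measure R).

Definition shearH t z : R[i] := Complex (complex.Re z + t * complex.Im z) (complex.Im z).
Definition shearV t z : R[i] := Complex (complex.Re z) (complex.Im z + t * complex.Re z).

Lemma pmeas_shearH t phi : pmeas phi -> pmeas (fun z => phi (shearH t z)).
Proof.
move=> m; have mm : measurable_fun setT (fun xy : R * R => (xy.1 + t * xy.2, xy.2) : R * R).
  apply/measurable_fun_pairP; split; last exact: measurable_snd.
  by apply: measurable_funD; [exact: measurable_fst|apply: measurable_funM; [exact: measurable_cst|exact: measurable_snd]].
exact: (measurableT_comp m mm).
Qed.

Lemma pmeas_shearV t phi : pmeas phi -> pmeas (fun z => phi (shearV t z)).
Proof.
move=> m; have mm : measurable_fun setT (fun xy : R * R => (xy.1, xy.2 + t * xy.1) : R * R).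
  apply/measurable_fun_pairP; split; first exact: measurable_fst.
  by apply: measurable_funD; [exact: measurable_snd|apply: measurable_funM; [exact: measurable_cst|exact: measurable_fst]].
exact: (measurableT_comp m mm).
Qed.

Lemma pint_shearH t phi : pmeas phi -> (forall z, 0 <= phi z) -> pint (fun z => phi (shearH t z)) = pint phi.
Proof.
move=> m p0; rewrite (pint_yx (pmeas_shearH t m) (fun z => p0 _)) (pint_yx m p0).
apply: eq_integral => y _.
rewrite -(@ge0_integral_shift R (t * y) (fun x => (phi (Complex x y))%:E)) //.
- by apply/measurable_EFinP; exact: pmeas_H.
- by move=> x; rewrite lee_fin.
Qed.

Lemma pint_shearV t phi : pmeas phi -> (forall z, 0 <= phi z) -> pint (fun z => phi (shearV t z)) = pint phi.
Proof.
move=> m p0; rewrite (pint_xy (pmeas_shearV t m) (fun z => p0 _)) (pint_xy m p0).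
apply: eq_integral => x _.
rewrite -(@ge0_integral_shift R (t * x) (fun y => (phi (Complex x y))%:E)) //.
- by apply/measurable_EFinP; exact: pmeas_V.
- by move=> y; rewrite lee_fin.
Qed.

(** A single rotation of infinite order stands in for the circle group. The tangent of its
    half-angle is 1/2, so its three shears have the rational coefficients -1/2, 4/5, -1/2. *)
Definition rot : R[i] := Complex (3 / 5) (4 / 5).

Lemma modc_rot : modc rot = 1.
Proof.
rewrite /modc /rot /=; have -> : (3 / 5) ^+ 2 + (4 / 5) ^+ 2 = 1 :> R by field.
exact: sqrtr1.
Qed.

(* A rotation is a product of three shears, each of which preserves the area. *)
Lemma pint_rot phi : pmeas phi -> (forall z, 0 <= phi z) -> pint (fun z => phi (rot * z)) = pint phi.
Proof.
move=> m p0.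
pose phi1 z := phi (shearH (- (1 / 2)) z); pose phi2 z := phi1 (shearV (4 / 5) z).
have m1 : pmeas phi1 := pmeas_shearH _ m.
have m2 : pmeas phi2 := pmeas_shearV _ m1.
rewrite -(pint_shearH (- (1 / 2)) m p0) -/phi1 -(pint_shearV (4 / 5) m1 (fun z => p0 _)) -/phi2.
rewrite -(pint_shearH (- (1 / 2)) m2 (fun z => p0 _)); apply: eq_pint => z.
rewrite /phi2 /phi1; congr phi; apply: complex_ext; rewrite ?cReM ?cImM /rot /shearH /shearV /=; by field.
Qed.

(** In the Gaussian integers (3 + 4i)^2 = -7 + 24i is congruent to 3 + 4i modulo 5, hence so is
    every positive power, and its imaginary part is never 0. *)
Lemma rot_aperiodic k : rot ^+ k.+1 != 1.
Proof.
have H : exists x y : int, (Complex (3 : R) 4) ^+ k.+1 = Complex (5 * x%:~R + 3) (5 * y%:~R + 4).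
  elim: k => [|k [x [y IH]]].
    by exists 0, 0; rewrite expr1; congr Complex; rewrite mulr0 add0r.
  exists (3 * x - 4 * y - 2), (4 * x + 3 * y + 4); rewrite exprS IH.
  by apply: complex_ext; rewrite ?cReM ?cImM /= !(rmorphD, rmorphB, rmorphM, rmorphN) /=; ring.
have [x [y E]] := H.
have E5 : rot = (5 : R)^-1%:C%C * Complex (3 : R) 4.
  by apply: complex_ext; rewrite ?cReM ?cImM /rot /=; field.
apply/eqP => K; have : complex.Im (rot ^+ k.+1) = 0 by rewrite K.
rewrite E5 exprMn -rmorphXn E cImM /= mul0r addr0 => /eqP; rewrite mulf_eq0 expf_eq0 /= invr_eq0.
rewrite (pnatr_eq0 R 5) /= => /eqP yy.
have : (5 * y + 4 = 0)%R.
  by apply: (@intr_inj R); rewrite rmorphD rmorphM /=.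
lia.
Qed.

End Rotation.

Section Orthogonality.
Local Open Scope classical_set_scope.
Local Open Scope ring_scope.
Context {R : realType} (om : R[i] -> R) (mom : pmeas om) (om0 : forall z, 0 <= om z)
  (omr : forall z w, modc z = modc w -> om z = om w).
Implicit Types (a b c z w : R[i]) (u v : R[i] -> R[i]) (n k N : nat).

(** The weight is an arbitrary radial one because the argument is run both for the Fock weight and
    for its compactly supported truncations. *)
Definition wI u : \bar R := pint (fun z => modc (u z) ^+ 2 * om z).
Definition wfin u := entire u /\ (wI u < +oo)%E.
Definition wJ u : R := fine (wI u).

Lemma wI_ge0 u : (0 <= wI u)%E.
Proof. by apply: pint_ge0 => z; rewrite mulr_ge0 ?sqr_ge0. Qed.

Lemma wJE u : wfin u -> wI u = (wJ u)%:E.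
Proof. by move=> [_ h]; rewrite /wJ fineK // ge0_fin_numE // wI_ge0. Qed.

Lemma wJ_ge0 u : 0 <= wJ u.
Proof. by rewrite fine_ge0 // wI_ge0. Qed.

Lemma pmeas_wI u : entire u -> pmeas (fun z => modc (u z) ^+ 2 * om z).
Proof. by move=> hu; apply: pmeasM => //; apply: pmeasX; exact: pmeas_entire. Qed.

Lemma wI_int0 u z : 0 <= modc (u z) ^+ 2 * om z.
Proof. by rewrite mulr_ge0 ?sqr_ge0. Qed.

Lemma parallelogram a b : modc (a + b) ^+ 2 + modc (a - b) ^+ 2 = 2 * modc a ^+ 2 + 2 * modc b ^+ 2.
Proof. by rewrite !modc_sqr cReD cImD cReB cImB; ring. Qed.

Lemma wIZ c u : entire u -> wI (fun z => c * u z) = ((modc c ^+ 2)%:E * wI u)%E.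
Proof.
move=> hu; rewrite /wI -pintZ ?sqr_ge0 //; [|exact: pmeas_wI|by move=> z; exact: wI_int0].
by apply: eq_pint => z; rewrite modcM exprMn mulrA.
Qed.

Lemma wI_parallelogram u v : entire u -> entire v ->
  (wI (fun z => u z + v z)%R + wI (fun z => u z - v z)%R = 2%:E * wI u + 2%:E * wI v)%E.
Proof.
move=> hu hv; have mu := pmeas_wI hu; have mv := pmeas_wI hv.
have m1 := pmeas_wI (entireD hu hv); have m2 := pmeas_wI (entireB hu hv).
have m3 : pmeas (fun z => 2 * (modc (u z) ^+ 2 * om z)) by apply: pmeasM => //; exact: pmeas_cst.
have m4 : pmeas (fun z => 2 * (modc (v z) ^+ 2 * om z)) by apply: pmeasM => //; exact: pmeas_cst.
have n1 z := wI_int0 u z; have n2 z := wI_int0 v z.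
have n3 z : 0 <= 2 * (modc (u z) ^+ 2 * om z) by rewrite mulr_ge0.
have n4 z : 0 <= 2 * (modc (v z) ^+ 2 * om z) by rewrite mulr_ge0.
rewrite /wI -!pintZ // -!pintD //; try by (move=> z; rewrite mulr_ge0 ?sqr_ge0).
by apply: eq_pint => z; rewrite -mulrDl parallelogram; ring.
Qed.

Lemma wfinDB u v : wfin u -> wfin v -> wfin (fun z => u z + v z) /\ wfin (fun z => u z - v z).
Proof.
move=> hu hv; have [eu _] := hu; have [ev _] := hv.
have := wI_parallelogram eu ev; rewrite (wJE hu) (wJE hv) -!EFinM -EFinD => E.
have F : (wI (fun z => u z + v z)%R + wI (fun z => u z - v z)%R < +oo)%E by rewrite E ltry.
split; split; [exact: entireD| |exact: entireB|]; apply: le_lt_trans F.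
- by rewrite leeDl // wI_ge0.
- by rewrite leeDr // wI_ge0.
Qed.

Lemma wfinZ c u : wfin u -> wfin (fun z => c * u z).
Proof.
move=> hu; have [eu _] := hu; split; first exact: entireZ.
by rewrite wIZ // (wJE hu) -EFinM ltry.
Qed.

Lemma wJ_parallelogram u v : wfin u -> wfin v ->
  wJ (fun z => u z + v z) + wJ (fun z => u z - v z) = 2 * wJ u + 2 * wJ v.
Proof.
move=> hu hv; have [h1 h2] := wfinDB hu hv; have [eu _] := hu; have [ev _] := hv.
apply: EFin_inj; rewrite !EFinD !EFinM -(wJE hu) -(wJE hv) -(wJE h1) -(wJE h2); exact: wI_parallelogram.
Qed.

Lemma wJZ c u : wfin u -> wJ (fun z => c * u z) = modc c ^+ 2 * wJ u.
Proof.
move=> hu; have [eu _] := hu; apply: EFin_inj; rewrite EFinM -(wJE hu) -(wJE (wfinZ c hu)); exact: wIZ.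
Qed.

(* Twice the real part of the inner product, by polarization; no signed integral is needed. *)
Definition wB u v : R := wJ (fun z => u z + v z) - wJ (fun z => u z - v z).

Lemma eq_wJ u v : (forall z, u z = v z) -> wJ u = wJ v.
Proof. by move=> E; congr wJ; apply/funext. Qed.

Lemma wBC u v : wfin u -> wfin v -> wB u v = wB v u.
Proof.
move=> hu hv; rewrite /wB; congr (_ - _); first by apply: eq_wJ => z; rewrite addrC.
have [_ h] := wfinDB hv hu.
rewrite (@eq_wJ _ (fun z => -1 * (v z - u z))); last by move=> z; ring.
by rewrite wJZ // modcN modc1 expr1n mul1r.
Qed.

Lemma wJD u v : wfin u -> wfin v -> wJ (fun z => u z + v z) = wJ u + wJ v + wB u v / 2.
Proof. by move=> hu hv; have := wJ_parallelogram hu hv; rewrite /wB; lra. Qed.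

Lemma lin4 (X A C Y P Q P' Q' V V' : R) : X + A = 2 * P + 2 * V' -> C + Y = 2 * Q + 2 * V' ->
  X + C = 2 * P' + 2 * V -> A + Y = 2 * Q' + 2 * V -> X - Y = P - Q + (P' - Q').
Proof. lra. Qed.

(** Additivity of the polarized form from four instances of the parallelogram law, as in the theorem
    of Jordan and von Neumann. *)
Lemma wBD u v v' : wfin u -> wfin v -> wfin v' -> wB u (fun z => v z + v' z) = wB u v + wB u v'.
Proof.
move=> hu hv hv'.
have [p1 m1] := wfinDB hu hv; have [p2 m2] := wfinDB hu hv'.
have [vv wv] := wfinDB hv hv'; have [p3 m3] := wfinDB hu vv.
have e1 := wJ_parallelogram p1 hv'.
have e2 := wJ_parallelogram m1 hv'.
have e3 := wJ_parallelogram p2 hv.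
have e4 := wJ_parallelogram m2 hv.
rewrite /wB.
have E1 : wJ (fun z => u z + v z + v' z) = wJ (fun z => u z + (v z + v' z)) by apply: eq_wJ => z; rewrite addrA.
have E2 : wJ (fun z => u z - v z - v' z) = wJ (fun z => u z - (v z + v' z)) by apply: eq_wJ => z; ring.
have E3 : wJ (fun z => u z + v' z + v z) = wJ (fun z => u z + (v z + v' z)) by apply: eq_wJ => z; ring.
have E4 : wJ (fun z => u z - v' z - v z) = wJ (fun z => u z - (v z + v' z)) by apply: eq_wJ => z; ring.
have E5 : wJ (fun z => u z + v' z - v z) = wJ (fun z => u z - v z + v' z) by apply: eq_wJ => z; ring.
have E6 : wJ (fun z => u z - v' z + v z) = wJ (fun z => u z + v z - v' z) by apply: eq_wJ => z; ring.
rewrite E1 in e1; rewrite E2 in e2; rewrite E3 E5 in e3; rewrite E4 E6 in e4.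
exact: lin4 e1 e2 e3 e4.
Qed.

Lemma wJ_rot u : entire u -> wJ (fun z => u (rot * z)) = wJ u.
Proof.
move=> hu; rewrite /wJ /wI; congr fine.
rewrite -(pint_rot (pmeas_wI hu) (fun z => wI_int0 u z)).
by apply: eq_pint => z; congr (_ * _); apply: omr; rewrite modcM modc_rot mul1r.
Qed.

Context (fmon : forall k, wfin (fun z => z ^+ k)).

Lemma wfin_mon b k : wfin (fun z => b * z ^+ k).
Proof. exact: wfinZ. Qed.

Lemma modc_rotX k : modc (rot ^+ k : R[i]) = 1.
Proof. by rewrite modcX modc_rot expr1n. Qed.

Lemma wB_rot a b k n : wB (fun z => a * z ^+ k) (fun z => rot ^+ n * b * z ^+ (k + n)) =
  wB (fun z => a * z ^+ k) (fun z => b * z ^+ (k + n)).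
Proof.
have [p1 m1] := wfinDB (wfin_mon a k) (wfin_mon b (k + n)).
have [p2 m2] := wfinDB (wfin_mon a k) (wfin_mon (rot ^+ n * b) (k + n)).
have [e1 _] := p1; have [e2 _] := m1.
rewrite /wB; congr (_ - _).
  rewrite -[RHS](wJ_rot e1) (@eq_wJ (fun z => a * (rot * z) ^+ k + b * (rot * z) ^+ (k + n)) (fun z => rot ^+ k * (a * z ^+ k + rot ^+ n * b * z ^+ (k + n)))).
    by rewrite wJZ // modc_rotX expr1n mul1r.
  by move=> z; rewrite !exprMn exprD; ring.
rewrite -[RHS](wJ_rot e2) (@eq_wJ (fun z => a * (rot * z) ^+ k - b * (rot * z) ^+ (k + n)) (fun z => rot ^+ k * (a * z ^+ k - rot ^+ n * b * z ^+ (k + n)))).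
  by rewrite wJZ // modc_rotX expr1n mul1r.
by move=> z; rewrite !exprMn exprD; ring.
Qed.

Lemma wB_mon_lt a b k n : (k < n)%N -> wB (fun z => a * z ^+ k) (fun z => b * z ^+ n) = 0.
Proof.
move=> kn; have [d nE] : exists d, n = (k + d.+1)%N by exists (n - k).-1; lia.
rewrite nE; have r1 := rot_aperiodic (R := R) d.
(* Invariance under rotation equates the form at c and at rot^(d+1) c = c + b; additivity then makes
   the form at [b] vanish. *)
pose c := b / (rot ^+ d.+1 - 1).
have E : rot ^+ d.+1 * c = c + b.
  by rewrite /c; field; rewrite subr_eq0.
have := wB_rot a c k d.+1.
have -> : (fun z => rot ^+ d.+1 * c * z ^+ (k + d.+1)) = (fun z => c * z ^+ (k + d.+1) + b * z ^+ (k + d.+1)).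
  by apply/funext => z; rewrite E mulrDl.
rewrite (wBD (wfin_mon a k) (wfin_mon c _) (wfin_mon b _)); lra.
Qed.

Lemma wB_mon a b k n : k != n -> wB (fun z => a * z ^+ k) (fun z => b * z ^+ n) = 0.
Proof.
move=> kn; have [h|h|h] := ltngtP k n; first exact: wB_mon_lt.
  by rewrite (wBC (wfin_mon a k) (wfin_mon b n)); exact: wB_mon_lt.
by move: kn; rewrite h eqxx.
Qed.

Lemma wfin0 : wfin (fun=> 0).
Proof.
have := wfin_mon 0 0; congr wfin; apply/funext => z; exact: mul0r.
Qed.

Lemma wfin_poly (b : nat -> R[i]) N M : wfin (fun z => \sum_(N <= k < M) b k * z ^+ k).
Proof.
have [MN|NM] := leqP M N.
  by have := wfin0; congr wfin; apply/funext => z; rewrite big_geq.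
have -> : M = (N + (M - N))%N by lia.
elim: (M - N)%N => [|n IH].
  by have := wfin0; congr wfin; apply/funext => z; rewrite addn0 big_geq.
have [h _] := wfinDB IH (wfin_mon (b (N + n)%N) (N + n)); move: h; congr wfin; apply/funext => z.
by rewrite addnS big_nat_recr ?leq_addr.
Qed.

Lemma wJ0 : wJ (fun=> 0) = 0.
Proof.
rewrite /wJ /wI (_ : pint _ = 0%E) //.
transitivity (pint (fun _ : R[i] => 0 : R)); last by rewrite /pint integral0.
by apply: eq_pint => z; rewrite modc0 expr0n mul0r.
Qed.

Lemma wB_poly (b : nat -> R[i]) c N n k : (N + n <= k)%N ->
  wB (fun z => \sum_(N <= j < N + n) b j * z ^+ j) (fun z => c * z ^+ k) = 0.
Proof.
elim: n => [|n IH] nk.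
  rewrite /wB addn0 -[RHS](subrr (wJ (fun z => c * z ^+ k))); congr (_ - _).
    by apply: eq_wJ => z; rewrite big_geq // add0r.
  rewrite (@eq_wJ _ (fun z => -1 * (c * z ^+ k))); last by move=> z; rewrite big_geq // sub0r mulN1r.
  by rewrite (wJZ (-1) (wfin_mon c k)) modcN modc1 expr1n mul1r.
rewrite (wBC (wfin_poly b N (N + n.+1)) (wfin_mon c k)).
have -> : (fun z => \sum_(N <= j < N + n.+1) b j * z ^+ j) =
  (fun z => \sum_(N <= j < N + n) b j * z ^+ j + b (N + n)%N * z ^+ (N + n)).
  by apply/funext => z; rewrite addnS big_nat_recr ?leq_addr.
rewrite (wBD (wfin_mon c k) (wfin_poly b _ _) (wfin_mon _ _)).
rewrite (wBC (wfin_mon c k) (wfin_poly b _ _)) IH; last by lia.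
by rewrite wB_mon ?addr0 //; lia.
Qed.

Lemma wJ_poly (b : nat -> R[i]) N M : wJ (fun z => \sum_(N <= k < M) b k * z ^+ k) =
  \sum_(N <= k < M) modc (b k) ^+ 2 * wJ (fun z => z ^+ k).
Proof.
have [MN|NM] := leqP M N.
  by rewrite big_geq // -[RHS]wJ0; apply: eq_wJ => z; rewrite big_geq.
have -> : M = (N + (M - N))%N by lia.
elim: (M - N)%N => [|n IH].
  by rewrite addn0 big_geq // -[RHS]wJ0; apply: eq_wJ => z; rewrite big_geq.
rewrite addnS [RHS]big_nat_recr ?leq_addr //= -IH -(wJZ _ (fmon _)).
rewrite (@eq_wJ _ (fun z => \sum_(N <= j < N + n) b j * z ^+ j + b (N + n)%N * z ^+ (N + n))); last first.
  by move=> z; rewrite big_nat_recr ?leq_addr.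
by rewrite (wJD (wfin_poly b _ _) (wfin_mon _ _)) wB_poly // mul0r addr0.
Qed.

End Orthogonality.

(** * Norms of monomials *)

Section Monomials.
Local Open Scope classical_set_scope.
Local Open Scope ring_scope.
Context {R : realType} (m : nat).
Implicit Types (d e s t x y p q r A B : R) (a b c z w : R[i]) (f g h u v : R[i] -> R[i]) (n k N : nat).
Opaque expR powR ln cauchy_bd.

Definition fweight z : R := wgt m z ^+ 2.

Lemma pmeas_W2 : pmeas fweight. Proof. by apply: pmeasX; exact: pmeas_wgt. Qed.
Lemma W2_ge0 z : 0 <= fweight z. Proof. exact: sqr_ge0. Qed.
Lemma W2_gt0 z : 0 < fweight z. Proof. by rewrite exprn_gt0 // wgt_gt0. Qed.
Lemma W2_radial z w : modc z = modc w -> fweight z = fweight w.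
Proof. by move=> E; rewrite /fweight !wgtE E. Qed.

Lemma fw2E f z : fw m 2 f z = modc (f z) ^+ 2 * fweight z.
Proof. by rewrite fwE powR_mulrn ?exprMn // mulr_ge0 ?modc_ge0 ?wgt_ge0. Qed.

Lemma dw2E f z : dw m 2 f z = modc (f z) ^+ 2 * fweight z / (1 + modc z) ^+ 2.
Proof.
rewrite dwE powR_mulrn; first by rewrite !exprMn exprVn.
by rewrite divr_ge0 ?(ltW (modc1_gt0 z)) // mulr_ge0 ?modc_ge0 ?wgt_ge0.
Qed.

Lemma fock2E f : fock_int m 2 f = wI fweight f.
Proof. by rewrite fock_intE; apply: eq_pint => z; rewrite fw2E. Qed.
Lemma tfunE z w : tfun m z w = ((1 + modc z) ^- m)%:C%C * cexp (cj z * w + (- (modc z ^+ 2 / 2))%:C%C).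
Proof. by []. Qed.
Opaque fweight wgt fw l1 ker tfun volterra dw.

Lemma in_fock_wfin f : in_fock m 2 f <-> wfin fweight f.
Proof. by rewrite /in_fock /wfin fock2E. Qed.

Lemma cdiffX k z : cdiff (fun w => w ^+ k.+1) z (k.+1%:R * z ^+ k).
Proof.
elim: k => [|k IH].
  by rewrite expr0 mulr1; apply: cdiff_ext (@cdiff_id R z) => w; rewrite expr1.
have := cdiffM (@cdiff_id R z) IH.
have -> : 1 * z ^+ k.+1 + id z * (k.+1%:R * z ^+ k) = k.+2%:R * z ^+ k.+1.
  by rewrite /= exprS -[k.+2%:R]natr1; ring.
by apply: cdiff_ext => w; rewrite [RHS]exprS.
Qed.

Lemma natc_neq0 k : (k.+1%:R : R[i]) != 0. Proof. by rewrite pnatr_eq0. Qed.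

Lemma modc_nat k : modc (k%:R : R[i]) = k%:R.
Proof. by rewrite -(rmorph_nat (real_complex R) k) modc_real ger0_norm. Qed.

Lemma segint_mon k z : segint (fun w => w ^+ k) z = k.+1%:R^-1 * z ^+ k.+1.
Proof.
have e1 : entire (segint (fun w : R[i] => w ^+ k)) := entire_segint (@entireX R k).
have e2 : entire (fun w : R[i] => k.+1%:R^-1 * w ^+ k.+1) := @entireZ R _ _ (@entireX R k.+1).
rewrite (@eq_of_cderiv R _ _ e1 e2).
  by rewrite segintE mul0r expr0n mulr0 subrr addr0.
move=> w; rewrite cderiv_segint; last exact: entireX.
apply/esym; apply: cdiff_cderiv; have := cdiffZ (k.+1%:R^-1) (cdiffX k w).
by rewrite mulrA mulVf ?mul1r // natc_neq0.
Qed.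

Lemma dw_le_fw q h z : 0 <= q -> dw m q h z <= fw m q h z.
Proof.
move=> q0; have z0 := modc_ge0 z; rewrite dwE fwE.
have w0 : 0 <= modc (h z) * wgt m z := mulr_ge0 (modc_ge0 _) (wgt_ge0 _ _).
apply: ler_pow => //; first by rewrite divr_ge0 // addr_ge0.
by rewrite ler_pdivrMr ?modc1_gt0 // ler_peMr // lerDl.
Qed.

(** The constant 1 is the test function centred at 0, and z^(k+1) is k + 1 times the ray primitive
    of z^k, so finiteness propagates by the norm comparison. *)
Lemma in_fock_mon k : in_fock m 2 (fun z => z ^+ k).
Proof.
split; first exact: entireX.
elim: k => [|k IH].
  have [K K0 hK] := @in_fock_tfun R m 2 (ltr0n R 2); have [_ h] := hK 0.
  apply: le_lt_trans (ltry K); apply: le_trans h.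
  rewrite (@eq_fock_int R m 2 _ (tfun m 0)) // => z.
  rewrite tfunE.
  rewrite modc0 addr0 expr1n invr1 expr0n /= mul0r oppr0 addr0.
  have -> : cj (0 : R[i]) = 0 by apply: complex_ext; rewrite /= ?oppr0.
  by rewrite mul0r cexp0 mulr1.
have [C C0 hC] := @fock_segint R m 2 (ltr0n R 2).
have E z : z ^+ k.+1 = k.+1%:R * segint (fun w => w ^+ k) z.
  by rewrite segint_mon mulrA mulfV ?mul1r // natc_neq0.
have es : entire (segint (fun w : R[i] => w ^+ k)) := entire_segint (@entireX R k).
rewrite (eq_fock_int _ _ E) fock_intZ //.
have fs : (fock_int m 2 (segint (fun w => w ^+ k)%R) < +oo)%E.
  apply: le_lt_trans (hC _ (@entireX R k)) _.
  have c0 : (0 <= C%:E)%E by rewrite lee_fin ltW.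
  apply: lte_mul_pinfty; [exact: c0|by []|apply: le_lt_trans IH].
  rewrite fock_intE; apply: le_pint.
  - exact: pmeas_dw (@entireX R k).
  - exact: pmeas_fw (@entireX R k).
  - by move=> z; exact: dw_ge0.
  - by move=> z; apply: dw_le_fw.
have is_ : in_fock m 2 (segint (fun w => w ^+ k)) by split.
by rewrite (fock_fineK is_) -EFinM ltry.
Qed.

Lemma wfin_monW k : wfin fweight (fun z => z ^+ k).
Proof. exact/in_fock_wfin/in_fock_mon. Qed.

Definition Nm k : R := wJ fweight (fun z => z ^+ k).

Lemma NmE k : wI fweight (fun z => z ^+ k) = (Nm k)%:E.
Proof. exact: (wJE W2_ge0 (wfin_monW k)). Qed.

Lemma Nm_gt0 k : 0 < Nm k.
Proof.
have [C C0 hC] := @fock_ptw R m 2 (ltr0n R 2).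
have := hC _ 1 (@entireX R k); rewrite fock2E NmE -EFinM lee_fin fw2E expr1n modc1 expr1n mul1r => h.
have w0 := W2_gt0 1.
by rewrite -(pmulr_rgt0 _ C0); exact: lt_le_trans h.
Qed.

Lemma amgm_opt (X A B : R) : 0 < X -> 0 < A -> (forall t, 0 < t -> 2 * X <= t * A + t^-1 * B) -> X ^+ 2 <= A * B.
Proof.
move=> X0 A0 H; have := H (X / A) (divr_gt0 X0 A0); rewrite divfK ?gt_eqF // invf_div => h.
have : X <= A / X * B by lra.
by move=> k; rewrite expr2 -ler_pdivlMr // mulrAC.
Qed.

Lemma mon_W2_meas k : pmeas (fun z => modc (z ^+ k) ^+ 2 * fweight z).
Proof. apply: pmeasM; last exact: pmeas_W2.
by apply: pmeasX; apply: pmeas_entire; exact: (@entireX R k). Qed.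

(** Cauchy-Schwarz, obtained by integrating 2 r^2 <= t + r^4/t against |z^k|^2 and then choosing the
    best [t]. *)
Lemma Nm_logconvex k : Nm k.+1 ^+ 2 <= Nm k * Nm k.+2.
Proof.
apply: amgm_opt; [exact: Nm_gt0|exact: Nm_gt0|move=> t t0].
have i0 : 0 <= t^-1 by rewrite invr_ge0 ltW.
have n0 j z := wI_int0 W2_ge0 (fun z => z ^+ j) z.
rewrite -lee_fin EFinD !EFinM -!NmE /wI -!pintZ ?(ltW t0) //; try exact: mon_W2_meas.
have mm j (c : R) : pmeas (fun z => c * (modc (z ^+ j) ^+ 2 * fweight z)).
  by apply: pmeasM; [exact: pmeas_cst|exact: mon_W2_meas].
have nn j (c : R) z : 0 <= c -> 0 <= c * (modc (z ^+ j) ^+ 2 * fweight z) by move=> c0; rewrite mulr_ge0.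
rewrite -pintD //; first last.
- by move=> z; apply: nn.
- by move=> z; apply: nn; exact: ltW.
apply: le_pint => //.
- exact: pmeasD.
- by move=> z; exact: nn.
move=> z; have E j : modc (z ^+ j) ^+ 2 = modc z ^+ (j * 2) by rewrite modcX exprM.
rewrite !E; set r := modc z; have r0 : 0 <= r := modc_ge0 z.
have -> : (k.+1 * 2 = k * 2 + 2)%N by lia.
have -> : (k.+2 * 2 = k * 2 + 4)%N by lia.
rewrite !exprD.
have rk : 0 <= r ^+ (k * 2) by rewrite exprn_ge0.
have : 0 <= r ^+ (k * 2) * (t * (1 - t^-1 * r ^+ 2) ^+ 2).
  by rewrite mulr_ge0 // mulr_ge0 ?sqr_ge0 // ltW.
have -> : t * (1 - t^-1 * r ^+ 2) ^+ 2 = t - 2 * r ^+ 2 + t^-1 * r ^+ 4 by field; rewrite gt_eqF.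
move=> key; have := mulr_ge0 key (W2_ge0 z).
move: (fweight z) (r ^+ (k * 2)) (r ^+ 2) (r ^+ 4) => w x y v; lra.
Qed.

Lemma wJ_segint_mon k : fock_int m 2 (segint (fun w => w ^+ k)) = (k.+1%:R ^- 2 * Nm k.+1)%:E.
Proof.
have E z : segint (fun w => w ^+ k) z = k.+1%:R^-1 * z ^+ k.+1 by exact: segint_mon.
rewrite (eq_fock_int _ _ E) fock2E (wIZ pmeas_W2 W2_ge0 _ (@entireX R k.+1)) NmE -EFinM.
by rewrite modcV modc_nat exprVn.
Qed.

(** The norm comparison is applied to z^(k+1), whose modulus divided by 1 + |z| is at most |z|^k; it
    therefore relates norms two degrees apart. *)
Lemma Nm_upper2 : exists2 C, 0 < C & forall k, Nm k.+2 <= C * k.+2%:R ^+ 2 * Nm k.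
Proof.
have [C C0 hC] := @fock_segint R m 2 (ltr0n R 2); exists C => // k.
have := hC _ (@entireX R k.+1); rewrite wJ_segint_mon => h.
have k2 : (pint (dw m 2 (fun w => w ^+ k.+1)%R) <= (Nm k)%:E)%E.
  rewrite -NmE; apply: le_pint.
  - exact: pmeas_dw (@entireX R k.+1).
  - exact: mon_W2_meas.
  - by move=> z; exact: dw_ge0.
  - move=> z; have z1 := modc1_gt0 z; have z0 := modc_ge0 z.
    rewrite dw2E ler_pdivrMr ?exprn_gt0 // [leRHS]mulrAC ler_wpM2r ?W2_ge0 //.
    rewrite -exprMn lerXn2r ?nnegrE ?mulr_ge0 ?modc_ge0 ?(ltW z1) //.
    by rewrite exprSr modcM ler_wpM2l ?modc_ge0 // lerDr.
have := le_trans h (lee_wpmul2l _ k2); rewrite lee_fin (ltW C0) -EFinM lee_fin => /(_ isT).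
have n0 : 0 < k.+2%:R ^+ 2 :> R by rewrite exprn_gt0.
by rewrite mulrC ler_pdivrMr // => l; rewrite mulrAC.
Qed.

(** Log-convexity places the intermediate norm below the geometric mean, which halves the two-degree
    step; the factor 2 turns k + 2 into k + 1. *)
Lemma Nm_upper : exists2 C, 0 < C & forall k, Nm k.+1 <= C * k.+1%:R * Nm k.
Proof.
have [C C0 hC] := Nm_upper2; pose D := Num.sqrt C; have D0 : 0 < D by rewrite sqrtr_gt0.
exists (2 * D); first by rewrite mulr_gt0.
move=> k; have N0 := Nm_gt0 k; have N1 := Nm_gt0 k.+1.
have h : Nm k.+1 ^+ 2 <= (D * k.+2%:R * Nm k) ^+ 2.
  apply: le_trans (Nm_logconvex k) _; apply: le_trans (ler_wpM2l (ltW N0) (hC k)) _.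
  by rewrite !exprMn sqr_sqrtr ?(ltW C0) // le_eqVlt; apply/orP; left; apply/eqP; ring.
have : Nm k.+1 <= D * k.+2%:R * Nm k.
  by rewrite -(@ler_pXn2r _ 2) ?nnegrE ?mulr_ge0 ?(ltW N0) ?(ltW N1) ?(ltW D0).
move=> l; apply: le_trans l _; rewrite ler_wpM2r ?(ltW N0) // [2 * D]mulrC -mulrA ler_wpM2l ?(ltW D0) //.
rewrite -natrM ler_nat; lia.
Qed.

Lemma Nm_ratio k : Nm 1 * Nm k <= Nm 0 * Nm k.+1.
Proof.
elim: k => [|k IH]; first by rewrite mulrC.
rewrite -(ler_pM2r (Nm_gt0 k)).
apply: (@le_trans _ _ (Nm 0 * Nm k.+1 * Nm k.+1)).
  by rewrite mulrAC ler_wpM2r // ltW // Nm_gt0.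
rewrite -mulrA -expr2 -mulrA ler_wpM2l ?(ltW (Nm_gt0 0)) // [leRHS]mulrC; exact: Nm_logconvex.
Qed.

(** Cauchy-Schwarz with |z^k|^2 split as |z^k|/(1 + |z|) times |z^k| (1 + |z|). The first factor is
    controlled by the derivative of z^(k+1) and gains (k+1)^(-2); the second costs at most a
    multiple of [Nm k.+1]. *)
Lemma Nm_lower : exists2 C, 0 < C & forall k, k.+1%:R * Nm k <= C * Nm k.+1.
Proof.
have [C C0 hC] := @dw_cderiv R m 2 (ltr0n R 2).
(* From (1 + r)^2 <= 2 + 2 r^2, with [Nm k] bounded by [Nm k.+1] through [Nm_ratio]. *)
pose A := 2 * (Nm 0 / Nm 1) + 2.
have r0 : 0 < Nm 0 / Nm 1 by rewrite divr_gt0 // Nm_gt0.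
have A0 : 0 < A by rewrite /A; lra.
have CA : 0 < C * A by rewrite mulr_gt0.
exists (Num.sqrt (C * A)); first by rewrite sqrtr_gt0.
move=> k; have N0 := Nm_gt0 k; have N1 := Nm_gt0 k.+1.
have n0 : 0 < k.+1%:R :> R by rewrite ltr0n.
pose D := k.+1%:R ^- 2 * (C * Nm k.+1).
have D0 : 0 < D by rewrite mulr_gt0 ?invr_gt0 ?exprn_gt0 // mulr_gt0.
have hD : (pint (dw m 2 (fun w => w ^+ k)%R) <= D%:E)%E.
  have dE : cderiv (fun w : R[i] => w ^+ k.+1) = fun w => k.+1%:R * w ^+ k.
    by apply/funext => w; apply: cdiff_cderiv; exact: cdiffX.
  have := hC _ (@entireX R k.+1); rewrite fock2E NmE dE => h.
  have E : pint (dw m 2 (fun w => k.+1%:R * w ^+ k)) = ((k.+1%:R ^+ 2)%:E * pint (dw m 2 (fun w => (w ^+ k)%R)))%E.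
    rewrite -pintZ ?sqr_ge0 //; [|exact: pmeas_dw (@entireX R k)|by move=> z; exact: dw_ge0].
    by apply: eq_pint => z; rewrite !dw2E modcM modc_nat exprMn !mulrA.
  rewrite E in h; rewrite /D EFinM (EFinM C).
  have k2 : (0 <= (k.+1%:R ^- 2 : R)%:E)%E by rewrite lee_fin invr_ge0 sqr_ge0.
  have := lee_wpmul2l k2 h; rewrite muleA -(EFinM (k.+1%:R ^- 2)) mulVf ?mul1e ?gt_eqF ?exprn_gt0 //.
have hX : Nm k ^+ 2 <= D * (A * Nm k.+1).
  apply: amgm_opt => // t t0; have i0 : 0 <= t^-1 by rewrite invr_ge0 ltW.
  have n1 j z := wI_int0 W2_ge0 (fun z => z ^+ j) z.
  have mm j (c : R) : pmeas (fun z => c * (modc (z ^+ j) ^+ 2 * fweight z)).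
    by apply: pmeasM; [exact: pmeas_cst|exact: mon_W2_meas].
  have nn j (c : R) z : 0 <= c -> 0 <= c * (modc (z ^+ j) ^+ 2 * fweight z) by move=> c0; rewrite mulr_ge0.
  have md := pmeas_dw m 2 (@entireX R k).
  have d0 z : 0 <= dw m 2 (fun w => w ^+ k) z := dw_ge0 _ _ _ _.
  have le1 : ((2 * Nm k)%:E <= t%:E * pint (dw m 2 (fun w => (w ^+ k)%R)) + ((t^-1 * 2)%:E * wI fweight (fun z => (z ^+ k)%R) + (t^-1 * 2)%:E * wI fweight (fun z => (z ^+ k.+1)%R)))%E.
    have c0 : 0 <= t^-1 * 2 by rewrite mulr_ge0.
    rewrite EFinM -NmE /wI -!pintZ ?(ltW t0) //; try exact: mon_W2_meas.
    have m1 : pmeas (fun z => t * dw m 2 (fun w => w ^+ k) z) by apply: pmeasM => //; exact: pmeas_cst.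
    have p1 z : 0 <= t * dw m 2 (fun w => w ^+ k) z by rewrite mulr_ge0 // ltW.
    have p2 j z : 0 <= t^-1 * 2 * (modc (z ^+ j) ^+ 2 * fweight z) by exact: nn.
    rewrite -!pintD //; [|exact: pmeasD|by move=> z; rewrite addr_ge0].
    apply: le_pint => //.
    - by apply: pmeasD => //; exact: pmeasD.
    - by move=> z; exact: nn.
    move=> z; set Y := modc (z ^+ k) ^+ 2 * fweight z; have Y0 : 0 <= Y := n1 k z.
    have z0 := modc_ge0 z; have z1 := modc1_gt0 z; set r := modc z in z0 z1.
    rewrite dw2E -/Y (exprS z k) modcM -/r exprMn -mulrA -/Y -/r.
    have sq : (1 + r) ^+ 2 <= 2 + 2 * r ^+ 2 by have := sqr_ge0 (1 - r); rewrite !expr2; lra.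
    have : 0 <= t^-1 * Y * (2 + 2 * r ^+ 2 - (1 + r) ^+ 2).
      by rewrite mulr_ge0 ?subr_ge0 // mulr_ge0.
    have : 0 <= Y * (t * ((1 + r)^-1 - t^-1 * (1 + r)) ^+ 2).
      by rewrite mulr_ge0 // mulr_ge0 ?sqr_ge0 // ltW.
    have -> : t * ((1 + r)^-1 - t^-1 * (1 + r)) ^+ 2 = t / (1 + r) ^+ 2 - 2 + t^-1 * (1 + r) ^+ 2.
      by field; rewrite !gt_eqF.
    rewrite /Y; lra.
  rewrite !NmE in le1.
  have te0 : (0 <= t%:E)%E by rewrite lee_fin ltW.
  have le2 := lee_wpmul2l te0 hD.
  have := le_trans le1 (leeD le2 (lexx _)); rewrite -!EFinM -!EFinD lee_fin => l; apply: le_trans l _.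
  rewrite lerD2l -mulrDr -mulrA ler_wpM2l //.
  have := Nm_ratio k; rewrite mulrC -ler_pdivlMr ?Nm_gt0 // => l.
  have -> : A * Nm k.+1 = 2 * (Nm 0 * Nm k.+1 / Nm 1) + 2 * Nm k.+1 by rewrite /A; ring.
  lra.
rewrite -(@ler_pXn2r _ 2) ?nnegrE ?mulr_ge0 ?(ltW N0) ?(ltW N1) ?sqrtr_ge0 //.
rewrite !exprMn sqr_sqrtr ?(ltW CA) //.
rewrite -ler_pdivlMl ?exprn_gt0 //; apply: le_trans hX _.
by rewrite /D le_eqVlt; apply/orP; left; apply/eqP; ring.
Qed.

End Monomials.

(** * Bessel's inequality for Taylor coefficients *)

Section Bessel.
Local Open Scope classical_set_scope.
Local Open Scope ring_scope.
Context {R : realType} (m : nat).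
Implicit Types (d e s t x y p q r A B : R) (a b c z w : R[i]) (f g h u v : R[i] -> R[i]) (j n k N M : nat).
Local Notation W2 := (@fweight R m).
Local Notation Nm := (@Nm R m).
Opaque expR powR ln cauchy_bd psi wgt fw l1 ker tfun volterra dw fweight.

Definition tsum f M z : R[i] := \sum_(0 <= k < M) tcoef f k * z ^+ k.

Lemma entire_tsum f M : entire (tsum f M).
Proof.
by apply: (@entire_sum R _ _ _ (fun k w => tcoef f k * w ^+ k)) => k; exact: (@entireZ R _ _ (@entireX R k)).
Qed.

(** The Taylor estimate on the square of half-side 2r has ratio at most 1/2 on the disc of radius
    [r]. *)
Lemma tsum_cvg f r : entire f -> 0 < r -> exists2 B, 0 < B & forall M z, modc z <= r ->
  modc (f z - tsum f M z) <= B * 2 ^- M /\ modc (f z) <= B.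
Proof.
move=> hf r0; have cb := cauchy_bd_gt0 (R := R).
have [B B0 hB] := entire_bounded (4 * r) hf.
pose D := cauchy_bd * B; have D0 : 0 < D := mulr_gt0 cb B0.
exists (D + B); first exact: addr_gt0.
move=> M z zr; have z0 := modc_ge0 z; split; last first.
  apply: (@le_trans _ _ B); last by rewrite lerDr ltW.
  by apply: hB; lra.
have s0 : 0 < 2 * r by rewrite mulr_gt0.
have zs : modc z <= 2 * r / 2 by lra.
have Bq w : onsq (2 * r) w -> modc (f w) <= B.
  by move=> /(onsq_modc_le s0) h; apply: hB; lra.
have := @taylor R f M (2 * r) B z hf s0 zs Bq; rewrite -/D => h.
rewrite /tsum big_mkord; apply: le_trans h _.
have i0 : 0 <= (2 : R) ^- M by rewrite invr_ge0 exprn_ge0.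
apply: (@le_trans _ _ (D * 2 ^- M)); last by rewrite ler_wpM2r // lerDl ltW.
rewrite ler_wpM2l ?(ltW D0) // -exprVn lerXn2r ?nnegrE ?invr_ge0 ?divr_ge0 ?(ltW s0) //.
by rewrite ler_pdivrMr // mulrA mulVf // mul1r.
Qed.

Lemma exp2V_small e : 0 < e -> exists N : nat, forall M, (N <= M)%N -> (2 : R) ^- M <= e.
Proof.
move=> e0; exists (Num.bound e^-1) => M NM.
have M0 : 0 < e^-1 by rewrite invr_gt0.
have h : e^-1 <= 2 ^+ M.
  apply: le_trans (ltW (archi_boundP (ltW M0))) _.
  apply: (@le_trans _ _ M%:R); first by rewrite ler_nat.
  by rewrite -natrX ler_nat ltnW // ltn_expl.
by rewrite -[leRHS]invrK lef_pV2 ?posrE ?exprn_gt0.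
Qed.

(** A radial cutoff that vanishes for |z| >= j + 1 and tends to 1 pointwise: Taylor sums converge
    uniformly on its support, and radiality preserves the orthogonality of monomials. *)
Definition cut j z : R := 1 - Num.min 1 (modc z * j.+1%:R^-1).

Lemma cut_ge0 j z : 0 <= cut j z. Proof. by rewrite subr_ge0 ge_min lexx. Qed.
Lemma cut_le1 j z : cut j z <= 1.
Proof. by rewrite gerBl le_min ler01 mulr_ge0 ?modc_ge0 // invr_ge0. Qed.
Lemma cut_eq0 j z : j.+1%:R < modc z -> cut j z = 0.
Proof.
move=> h; rewrite /cut min_l ?subrr // ler_pdivlMr ?mul1r ?ltr0n //; exact: ltW.
Qed.
Lemma pmeas_cut j : pmeas (cut j).
Proof.
apply: pmeasB; first exact: pmeas_cst.
apply: pmeas_min; first exact: pmeas_cst.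
by apply: pmeasM; [exact: pmeas_modc|exact: pmeas_cst].
Qed.

Definition omc j z : R := W2 z * cut j z.

Lemma pmeas_omc j : pmeas (omc j).
Proof. by apply: pmeasM; [exact: pmeas_W2|exact: pmeas_cut]. Qed.
Lemma omc_ge0 j z : 0 <= omc j z.
Proof. by rewrite mulr_ge0 ?W2_ge0 // cut_ge0. Qed.
Lemma omc_radial j z w : modc z = modc w -> omc j z = omc j w.
Proof. by move=> E; rewrite /omc (W2_radial m E) /cut E. Qed.
Lemma omc_le j z : omc j z <= W2 z.
Proof. by rewrite -[leRHS]mulr1 ler_wpM2l ?W2_ge0 // cut_le1. Qed.

Lemma wI_omc_le j f : entire f -> (wI (omc j) f <= wI W2 f)%E.
Proof.
move=> hf; apply: le_pint.
- exact: (pmeas_wI (pmeas_omc j) hf).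
- exact: (pmeas_wI (pmeas_W2 m) hf).
- by move=> z; rewrite mulr_ge0 ?sqr_ge0 // omc_ge0.
- by move=> z; rewrite ler_wpM2l ?sqr_ge0 // omc_le.
Qed.

Lemma wfin_omc j f : wfin W2 f -> wfin (omc j) f.
Proof. by move=> [hf h]; split=> //; apply: le_lt_trans (wI_omc_le j hf) h. Qed.

Lemma wfin_mon_omc j k : wfin (omc j) (fun z => z ^+ k).
Proof. exact: wfin_omc (wfin_monW m k). Qed.

Lemma wJ_tsum_mono j f M N : (M <= N)%N -> wJ (omc j) (tsum f M) <= wJ (omc j) (tsum f N).
Proof.
move=> MN.
rewrite !(wJ_poly (pmeas_omc j) (omc_ge0 j) (omc_radial j) (wfin_mon_omc j) (tcoef f)).
rewrite [leRHS](big_cat_nat (n := M)) //= lerDl; apply: sumr_ge0 => k _.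
by rewrite mulr_ge0 ?sqr_ge0 // (wJ_ge0 (omc_ge0 j)).
Qed.

(** By orthogonality the truncated norms of the Taylor sums increase with the degree, and by uniform
    convergence they tend to that of [f]. *)
Lemma wJ_tsum_le_omc j f M : wfin W2 f -> wJ (omc j) (tsum f M) <= wJ (omc j) f.
Proof.
move=> hf; have [ef _] := hf; have r0 : 0 < j.+1%:R :> R by rewrite ltr0n.
have [B B0 hB] := tsum_cvg ef r0.
have fo := wfin_omc j hf.
have one := wfin_mon_omc j 0; have J1 := wJ_ge0 (omc_ge0 j) (fun z => z ^+ 0).
set I0 := wJ (omc j) _ in J1.
(* With |f| <= B on the support and q = 2^(-N) <= 1, (|f| + B q)^2 exceeds |f|^2 by at most 3 B^2
   q. *)
have key N : (M <= N)%N -> wJ (omc j) (tsum f M) <= wJ (omc j) f + 3 * B ^+ 2 * 2 ^- N * I0.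
  move=> MN; apply: le_trans (wJ_tsum_mono j f MN) _.
  have fN : wfin (omc j) (tsum f N) := wfin_poly (pmeas_omc j) (omc_ge0 j) (wfin_mon_omc j) (tcoef f) 0 N.
  have c0 : 0 <= 3 * B ^+ 2 * 2 ^- N by rewrite mulr_ge0 ?invr_ge0 ?exprn_ge0 // mulr_ge0 // sqr_ge0.
  rewrite -lee_fin EFinD EFinM -(wJE (omc_ge0 j) fN) -(wJE (omc_ge0 j) fo) -(wJE (omc_ge0 j) one).
  have m0 := pmeas_wI (pmeas_omc j) (@entireX R 0).
  have n0 z := wI_int0 (omc_ge0 j) (fun z => z ^+ 0) z.
  rewrite /wI -pintZ // -pintD //; first last.
  - by move=> z; rewrite mulr_ge0.
  - by move=> z; exact: (wI_int0 (omc_ge0 j)).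
  - by apply: pmeasM => //; exact: pmeas_cst.
  - exact: (pmeas_wI (pmeas_omc j) ef).
  apply: le_pint.
  - exact: (pmeas_wI (pmeas_omc j) (@entire_tsum f N)).
  - apply: pmeasD; first exact: (pmeas_wI (pmeas_omc j) ef).
    by apply: pmeasM => //; exact: pmeas_cst.
  - by move=> z; exact: (wI_int0 (omc_ge0 j)).
  move=> z; rewrite expr0 modc1 expr1n mul1r -mulrDl.
  have [zr|zr] := leP (modc z) j.+1%:R; last by rewrite /omc (cut_eq0 zr) mulr0 !mulr0.
  rewrite ler_wpM2r ?omc_ge0 //; have [h1 h2] := hB N z zr.
  set q := (2 : R) ^- N in h1 *; have q0 : 0 <= q by rewrite /q invr_ge0 exprn_ge0.
  have q1 : q <= 1 by rewrite /q -exprVn exprn_ile1 // invf_le1 // ler1n.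
  set F := modc (f z) in h2 *; have F0 : 0 <= F := modc_ge0 _.
  have SF : modc (tsum f N z) <= F + B * q.
    by have := modcB (f z) (f z - tsum f N z); rewrite subKr -/F; lra.
  have sq : modc (tsum f N z) ^+ 2 <= (F + B * q) ^+ 2.
    by rewrite lerXn2r ?nnegrE ?modc_ge0 // addr_ge0 // mulr_ge0 // ltW.
  apply: le_trans sq _.
  have -> : (F + B * q) ^+ 2 = F ^+ 2 + 2 * (B * q) * F + B ^+ 2 * q * q by ring.
  have Bq : 0 <= B * q by rewrite mulr_ge0 // ltW.
  have k1 := ler_wpM2l Bq h2.
  have BBq : 0 <= B ^+ 2 * q by rewrite mulr_ge0 // sqr_ge0.
  have k2 := ler_wpM2l BBq q1.
  have -> : 3 * B ^+ 2 * q = 2 * (B * q * B) + B ^+ 2 * q by ring.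
  lra.
apply/ler_addgt0Pr => e e0.
have d0 : 0 < e / (3 * B ^+ 2 * (I0 + 1)).
  by rewrite divr_gt0 // mulr_gt0 ?ltr_wpDl // mulr_gt0 // exprn_gt0.
have [N hN] := exp2V_small d0.
apply: le_trans (key (maxn M N) (leq_maxl _ _)) _; rewrite lerD2l.
have := hN _ (leq_maxr M N); set q := 2 ^- _ => h.
have b0 : 0 < 3 * B ^+ 2 by rewrite mulr_gt0 // exprn_gt0.
have q0 : 0 <= q by rewrite /q invr_ge0 exprn_ge0.
rewrite ler_pdivlMr ?mulr_gt0 ?ltr_wpDl // in h.
apply: le_trans h; rewrite mulrAC [leLHS]mulrC ler_wpM2l // ler_wpM2l ?(ltW b0) // lerDl //.
Qed.

Lemma rlim0_cut z : rlim0 (fun j => cut j z - 1).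
Proof.
move=> e e0; exists (Num.bound (modc z / e)) => j hj.
have z0 := modc_ge0 z; have j0 : 0 < j.+1%:R :> R by rewrite ltr0n.
rewrite /cut addrC addKr normrN ger0_norm; last by rewrite le_min ler01 mulr_ge0 // invr_ge0 ltW.
rewrite ge_min; apply/orP; right; rewrite ler_pdivrMr // mulrC -ler_pdivrMr //.
have ze : 0 <= modc z / e by rewrite divr_ge0 // ltW.
apply: le_trans (ltW (archi_boundP ze)) _; rewrite ler_nat; exact: leq_trans hj (leqnSn j).
Qed.

(** The inequality holds for each cutoff weight, and Fatou's lemma removes the cutoff from the left
    side, which is a fixed polynomial norm. *)
Lemma bessel f M : in_fock m 2 f ->
  \sum_(0 <= k < M) modc (tcoef f k) ^+ 2 * Nm k <= fine (fock_int m 2 f).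
Proof.
move=> /in_fock_wfin hf; have [ef _] := hf; rewrite fock2E -/(wJ W2 f).
rewrite -(wJ_poly (pmeas_W2 m) (W2_ge0 m) (@W2_radial R m) (wfin_monW m) (tcoef f)).
have fM : wfin W2 (tsum f M) := wfin_poly (pmeas_W2 m) (W2_ge0 m) (wfin_monW m) (tcoef f) 0 M.
rewrite -lee_fin -(wJE (W2_ge0 m) hf) -(wJE (W2_ge0 m) fM).
apply: (@pint_fatou R (fun j z => modc (tsum f M z) ^+ 2 * omc j z)).
- by move=> j; exact: (pmeas_wI (pmeas_omc j) (@entire_tsum f M)).
- by move=> j z; exact: (wI_int0 (omc_ge0 j)).
- move=> z; apply: rlim0_le (rlim0M (modc (tsum f M z) ^+ 2 * W2 z) (rlim0_cut z)) => j.
  by rewrite /omc [X in _ <= `|X|](_ : _ = modc (tsum f M z) ^+ 2 * (W2 z * cut j z) - modc (tsum f M z) ^+ 2 * W2 z) //; ring.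
- move=> j; apply: (@le_trans _ _ (wI (omc j) f)); last exact: wI_omc_le.
  have fo := wfin_omc j hf.
  have fN : wfin (omc j) (tsum f M) := wfin_poly (pmeas_omc j) (omc_ge0 j) (wfin_mon_omc j) (tcoef f) 0 M.
  rewrite -/(wI (omc j) (tsum f M)) (wJE (omc_ge0 j) fN) (wJE (omc_ge0 j) fo) lee_fin.
  exact: wJ_tsum_le_omc.
Qed.

End Bessel.

(** * Singular values *)

Section SingularValues.
Local Open Scope classical_set_scope.
Local Open Scope ring_scope.
Context {R : realType} (m : nat).
Implicit Types (d e s t x y p q r A B : R) (a b c z w : R[i]) (f g h u v : R[i] -> R[i]) (j n k N M : nat).
Local Notation W2 := (@fweight R m).
Local Notation Nm := (@Nm R m).
Opaque expR powR ln cauchy_bd psi wgt fw l1 ker tfun dw fweight.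

Lemma crect_tcoef f k : entire f -> crect (fun w => f w / w ^+ k) (- 1) 1 (- 1) 1.
Proof.
move=> hf; apply: hol_crect; try lra.
by move=> w ow; apply: hol_tcoef => //; exact: (onsq_neq0 ltr01 ow).
Qed.

Lemma tcoef_lin f h a b k : entire f -> entire h ->
  tcoef (fun z => a * f z + b * h z) k = a * tcoef f k + b * tcoef h k.
Proof.
move=> hf hh; rewrite /tcoef /sqint.
have cf := crect_tcoef k.+1 hf; have ch := crect_tcoef k.+1 hh.
have -> : (fun w => (a * f w + b * h w) / w ^+ k.+1) =
  (fun w => a * (f w / w ^+ k.+1) + b * (h w / w ^+ k.+1)).
  by apply/funext => w; rewrite mulrDl !mulrA.
rewrite rectintD ?rectintZ //; try exact: crectZ.
ring.
Qed.

Lemma segint_tsum f M z : segint (tsum f M) z = \sum_(0 <= k < M) tcoef f k / k.+1%:R * z ^+ k.+1.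
Proof.
elim: M => [|M IH].
  rewrite big_geq // (@segint_ext R _ (fun w => 0 * w)); last by move=> w; rewrite /tsum big_geq // mul0r.
  by rewrite (segintZ 0 z (@entire_id R)) mul0r.
rewrite big_nat_recr //= -IH.
rewrite (@segint_ext R _ (fun w => tsum f M w + tcoef f M * w ^+ M)); last by move=> w; rewrite /tsum big_nat_recr.
rewrite (segintD z (@entire_tsum R f M) (@entireZ R _ _ (@entireX R M))).
by rewrite (segintZ _ z (@entireX R M)) segint_mon mulrA.
Qed.

Lemma volterra_linear g a b f : (forall z, g z = a * z + b) -> entire f ->
  volterra g f = fun z => a * segint f z.
Proof.
move=> E hf; apply/funext => z; rewrite /volterra -segintZ //.
by congr (segint _ z); apply/funext => w; rewrite (cderiv_linear E) mulrC.
Qed.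
Opaque volterra.

(** The image of the first [n] Taylor terms under V_g for a symbol with derivative [a]; the index
    shift is that of the primitive. *)
Definition trunc a n f z : R[i] := \sum_(k < n) (a * tcoef f k / k.+1%:R) * z ^+ k.+1.

Lemma rank_trunc a n : rank_le m n (trunc a n).
Proof.
exists (fun k f => a * tcoef f k / k.+1%:R), (fun k z => z ^+ k.+1); split; [|split=> //].
- move=> k f h b c [hf _] [hh _]; rewrite tcoef_lin //; ring.
- by move=> k; exact: in_fock_mon.
Qed.

Lemma segint_tsum_cvg f z : entire f -> exists2 B, 0 <= B & forall M,
  modc (segint f z - segint (tsum f M) z) <= B * 2 ^- M.
Proof.
move=> hf; have z0 := modc_ge0 z; have r0 := modc1_gt0 z.
have [B B0 hB] := tsum_cvg hf r0.
exists (modc z * (2 * B)); first by rewrite mulr_ge0 // mulr_ge0 // ltW.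
move=> M; have et := @entire_tsum R f M.
have cf : ccont_on 0 1 (fun t : R => f (t%:C%C * z)) by apply: ccont_path => w; exact: entire_contin.
have ct : ccont_on 0 1 (fun t : R => tsum f M (t%:C%C * z)) by apply: ccont_path => w; exact: entire_contin.
rewrite !segintE -mulrBr -(cintB cf ct) modcM -mulrA ler_wpM2l //.
have := @cint_bound R 0 1 _ (B * 2 ^- M) ler01 (ccont_onB cf ct).
rewrite subr0 mulr1 mulrA; apply => t /andP[t0 t1]; apply: (hB M _ _).1.
rewrite modcM modc_real (ger0_norm t0); have := ler_wpM2r z0 t1; lra.
Qed.

(** The left side is the squared norm of the primitive of z^k, so this measures how V_g shrinks the
    monomials left after removing rank [n]. *)
Lemma ratio_upper : exists2 C, 0 < C & forall k n, (n <= k)%N ->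
  Nm k.+1 / k.+1%:R ^+ 2 <= C / n.+1%:R * Nm k.
Proof.
have [C C0 hC] := @Nm_upper R m; exists C => // k n nk.
have k0 : 0 < k.+1%:R :> R by rewrite ltr0n.
have n0 : 0 < n.+1%:R :> R by rewrite ltr0n.
have N0 := @Nm_gt0 R m k.
rewrite ler_pdivrMr ?exprn_gt0 //; apply: le_trans (hC k) _.
have h : 1 <= k.+1%:R / n.+1%:R :> R by rewrite ler_pdivlMr // mul1r ler_nat.
have p0 : 0 <= C * k.+1%:R * Nm k by rewrite !mulr_ge0 // ltW.
have := ler_wpM2l p0 h; rewrite mulr1 => l; apply: le_trans l _.
by rewrite le_eqVlt; apply/orP; left; apply/eqP; field; rewrite gt_eqF.
Qed.

(** The difference has only degrees above [n]. Its partial sums are estimated monomial by monomial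
    with orthogonality and Bessel's inequality, and Fatou passes to the limit. *)
Lemma trunc_bound : exists2 C, 0 < C & forall g a b n f, (forall z, g z = a * z + b) -> in_fock m 2 f ->
  (fock_int m 2 (fun z => volterra g f z - trunc a n f z)%R <=
   (modc a ^+ 2 * (C / n.+1%:R) * fine (fock_int m 2 f))%:E)%E.
Proof.
have [C C0 hC] := ratio_upper; exists C => // g a b n f E hf; have [ef _] := hf.
have n0 : 0 < n.+1%:R :> R by rewrite ltr0n.
have a20 := sqr_ge0 (modc a).
(* Coefficient of z^k in V_g f; it is used for k >= 1 only, so the predecessor is genuine and the
   divisor nonzero. *)
pose bb k := a * tcoef f k.-1 / k%:R.
pose P M z := \sum_(n.+1 <= k < M.+1) bb k * z ^+ k.
have fP M : wfin W2 (P M) := wfin_poly (pmeas_W2 m) (W2_ge0 m) (wfin_monW m) bb n.+1 M.+1.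
have eP M : entire (P M) by case: (fP M).
have JP M : wJ W2 (P M) <= modc a ^+ 2 * (C / n.+1%:R) * fine (fock_int m 2 f).
  rewrite (wJ_poly (pmeas_W2 m) (W2_ge0 m) (@W2_radial R m) (wfin_monW m)) big_add1 /=.
  apply: (@le_trans _ _ (\sum_(n <= k < M) modc a ^+ 2 * (C / n.+1%:R) * (modc (tcoef f k) ^+ 2 * Nm k))).
    apply: ler_sum_nat => k /andP[nk _].
    have k0 : 0 < k.+1%:R :> R by rewrite ltr0n.
    have -> : modc (bb k.+1) ^+ 2 * wJ W2 (fun z => z ^+ k.+1) =
      modc a ^+ 2 * modc (tcoef f k) ^+ 2 * (Nm k.+1 / k.+1%:R ^+ 2).
      rewrite /bb /= modcf_div modcM modc_nat -/(Nm k.+1); field; by rewrite gt_eqF.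
    have -> : modc a ^+ 2 * (C / n.+1%:R) * (modc (tcoef f k) ^+ 2 * Nm k) =
      modc a ^+ 2 * modc (tcoef f k) ^+ 2 * (C / n.+1%:R * Nm k) by ring.
    by apply: ler_wpM2l; [rewrite mulr_ge0 ?sqr_ge0|exact: hC].
  rewrite -mulr_sumr ler_wpM2l //; first by rewrite mulr_ge0 // divr_ge0 // ltW.
  apply: le_trans (bessel M hf).
  have [MN|NM] := leqP M n.
    rewrite big_geq //; apply: sumr_ge0 => k _; rewrite mulr_ge0 ?sqr_ge0 // ltW //; exact: Nm_gt0.
  rewrite [leRHS](big_cat_nat (n := n)) //=; last exact: ltnW.
  by rewrite lerDr; apply: sumr_ge0 => k _; rewrite mulr_ge0 ?sqr_ge0 // ltW //; exact: Nm_gt0.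
set G := fun z => _; have GE z : G z = a * segint f z - trunc a n f z by rewrite /G (volterra_linear E ef).
have cvP z : rlim0 (fun M => modc (P M z - G z)).
  have [B B0 hB] := segint_tsum_cvg z ef.
  move=> e e0; have aB0 : 0 <= modc a * B by rewrite mulr_ge0 // modc_ge0.
  have [N hN] := @exp2V_small R (e / (modc a * B + 1)) (divr_gt0 e0 (ltr_wpDl aB0 ltr01)).
  exists (maxn n N) => M; rewrite geq_max => /andP[nM NM]; rewrite ger0_norm ?modc_ge0 //.
  have -> : P M z - G z = - (a * (segint f z - segint (tsum f M) z)).
    rewrite GE segint_tsum (big_cat_nat (n := n)) //= /P big_add1 /= /trunc big_mkord.
    have -> : \sum_(n <= k < M) bb k.+1 * z ^+ k.+1 = a * \sum_(n <= k < M) tcoef f k / k.+1%:R * z ^+ k.+1.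
      by rewrite mulr_sumr; apply: eq_bigr => k _; rewrite /bb /= !mulrA.
    have -> : \sum_(k < n) a * tcoef f k / k.+1%:R * z ^+ k.+1 = a * \sum_(k < n) tcoef f k / k.+1%:R * z ^+ k.+1.
      by rewrite mulr_sumr; apply: eq_bigr => k _; rewrite !mulrA.
    ring.
  rewrite modcN modcM; have := hN M NM; rewrite ler_pdivlMr ?ltr_wpDl // => h.
  apply: le_trans (ler_wpM2l (modc_ge0 a) (hB M)) _; apply: le_trans h.
  rewrite mulrA mulrC ler_wpM2l ?lerDl // invr_ge0 exprn_ge0 //.
rewrite fock2E; apply: (@pint_fatou R (fun M z => modc (P M z) ^+ 2 * W2 z)).
- by move=> M; exact: (pmeas_wI (pmeas_W2 m) (eP M)).
- by move=> M z; exact: (wI_int0 (W2_ge0 m)).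
- move=> z.
  have k : rlim0 (fun M => modc (P M z) `^ 2 - modc (G z) `^ 2).
    apply: rlim0_powR => //; try (by move=> *; exact: modc_ge0); try exact: modc_ge0.
    apply: rlim0_le (cvP z) => M; rewrite (ger0_norm (modc_ge0 _)); exact: modc_lip.
  apply: rlim0_le (rlim0M (W2 z) k) => M.
  by rewrite !powR_mulrn ?modc_ge0 // mulrBl.
- by move=> M; rewrite -/(wI W2 (P M)) (wJE (W2_ge0 m) (fP M)) lee_fin.
Qed.

Lemma lin_functional_sum (phi : (R[i] -> R[i]) -> R[i]) (bb : nat -> R[i]) N : lin_functional m phi ->
  phi (fun z => \sum_(0 <= k < N) bb k * z ^+ k) = \sum_(0 <= k < N) bb k * phi (fun z => z ^+ k).
Proof.
move=> lin; elim: N => [|N IH].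
  have i0 := @in_fock_mon R m 0; rewrite big_geq //.
  have := lin _ _ 0 0 i0 i0; rewrite !mul0r addr0 => E; rewrite -[RHS]E; congr phi.
  by apply/funext => z; rewrite big_geq // !mul0r addr0.
rewrite big_nat_recr //= -IH.
have iS : in_fock m 2 (fun z => \sum_(0 <= k < N) bb k * z ^+ k).
  by apply/in_fock_wfin; exact: (wfin_poly (pmeas_W2 m) (W2_ge0 m) (wfin_monW m) bb 0 N).
have := lin _ _ 1 (bb N) iS (@in_fock_mon R m N); rewrite mul1r => <-; congr phi.
by apply/funext => z; rewrite big_nat_recr //= mul1r.
Qed.

(** The n + 1 rows of length [n] are linearly dependent. The coefficients are extended to all
    naturals through [inord], to fit sums indexed by [nat]. *)
Lemma kernel_vector n (A : 'M[R[i]]_(n.+1, n)) : exists bb : nat -> R[i],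
  (exists2 k, (k < n.+1)%N & bb k != 0) /\ forall j : 'I_n, \sum_(k < n.+1) bb k * A k j = 0.
Proof.
have nz : nz_row (kermx A) != 0.
  rewrite nz_row_eq0 kermx_eq0; apply/negP => /eqP h.
  by have := rank_leq_col A; rewrite h ltnn.
have kz : nz_row (kermx A) *m A = 0 by apply/sub_kermxP; exact: nz_row_sub.
set v := nz_row _ in nz kz.
exists (fun k => v 0 (inord k)); split.
  have [k vk] : exists k : 'I_n.+1, v 0 k != 0.
    apply: contrapT => H; move/eqP: nz; apply; apply/rowP => k; rewrite mxE.
    by apply/eqP; apply: contrapT => /negP vk; apply: H; exists k.
  by exists k => //; rewrite inord_val.
move=> j; have := congr1 (fun M : 'rV_n => M 0 j) kz; rewrite !mxE => E.
by rewrite -[RHS]E; apply: eq_bigr => k _; rewrite inord_val.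
Qed.

Lemma ratio_lower : exists2 C, 0 < C & forall k n, (k <= n)%N ->
  C / n.+1%:R * Nm k <= Nm k.+1 / k.+1%:R ^+ 2.
Proof.
have [C C0 hC] := @Nm_lower R m; exists C^-1; first by rewrite invr_gt0.
move=> k n kn; have k0 : 0 < k.+1%:R :> R by rewrite ltr0n.
have n0 : 0 < n.+1%:R :> R by rewrite ltr0n.
have N0 := @Nm_gt0 R m k.
rewrite ler_pdivlMr ?exprn_gt0 //; have := hC k; rewrite -ler_pdivrMl // => l; apply: le_trans l.
have h : k.+1%:R / n.+1%:R <= 1 :> R by rewrite ler_pdivrMr // mul1r ler_nat.
have p0 : 0 <= C^-1 * (k.+1%:R * Nm k) by rewrite mulr_ge0 ?invr_ge0 ?(ltW C0) // mulr_ge0 // ltW.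
have := ler_wpM2l p0 h; rewrite mulr1 => l2; apply: le_trans l2.
by rewrite le_eqVlt; apply/orP; left; apply/eqP; field; rewrite !gt_eqF.
Qed.

(** Among polynomials of degree at most [n] one is annihilated by all [n] functionals of [K]; on it
    [K] vanishes, and V_g shrinks the squared norm of each of its monomials by no more than a factor
    of order 1/(n + 1). *)
Lemma rank_lower : exists2 C, 0 < C & forall g a b n K, (forall z, g z = a * z + b) -> rank_le m n K ->
  exists f, [/\ in_fock m 2 f, fnorm m 2 f <= 1 &
   ((modc a ^+ 2 * (C / n.+1%:R))%:E <= fock_int m 2 (fun z => volterra g f z - K f z)%R)%E].
Proof.
have [C C0 hC] := ratio_lower; exists C => // g a b n K E [phis [hs [lin [fh KE]]]].
have [bb [[k0 k0n bk0] hb]] := kernel_vector (\matrix_(k < n.+1, j < n) phis j (fun z => z ^+ k)).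
pose f0 z := \sum_(0 <= k < n.+1) bb k * z ^+ k.
have w0 : wfin W2 f0 := wfin_poly (pmeas_W2 m) (W2_ge0 m) (wfin_monW m) bb 0 n.+1.
have i0 : in_fock m 2 f0 by apply/in_fock_wfin.
have e0 : entire f0 by case: i0.
have J0 : wJ W2 f0 = \sum_(0 <= k < n.+1) modc (bb k) ^+ 2 * Nm k.
  exact: (wJ_poly (pmeas_W2 m) (W2_ge0 m) (@W2_radial R m) (wfin_monW m)).
have Jpos : 0 < wJ W2 f0.
  rewrite J0 big_mkord (bigD1 (Ordinal k0n)) //=; apply: ltr_pwDl.
    by rewrite mulr_gt0 ?exprn_gt0 ?modc_gt0 //; exact: Nm_gt0.
  by apply: sumr_ge0 => k _; rewrite mulr_ge0 ?sqr_ge0 // ltW //; exact: Nm_gt0.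
have phi0 (j : 'I_n) : phis j f0 = 0.
  rewrite (lin_functional_sum bb n.+1 (lin j)) big_mkord -[RHS](hb j).
  by apply: eq_bigr => k _; rewrite mxE.
pose c := Num.sqrt (wJ W2 f0); have c0 : 0 < c by rewrite sqrtr_gt0.
pose f z := (c^-1)%:C%C * f0 z.
have mc : modc (c^-1)%:C%C = c^-1 by rewrite modc_real ger0_norm // invr_ge0 ltW.
have If : in_fock m 2 f := @in_fockZ R m 2 _ _ (ler0n R 2) i0.
have ef : entire f by case: If.
have c2 : c ^+ 2 = wJ W2 f0 by rewrite sqr_sqrtr // ltW.
have phif (j : 'I_n) : phis j f = 0.
  have := lin j f0 f0 (c^-1)%:C%C 0 i0 i0; rewrite phi0 !mulr0 addr0 => <-; congr (phis j _).
  by apply/funext => z; rewrite mul0r addr0.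
exists f; split=> //.
  rewrite fnorm_leP // powR1 fock2E (wIZ (pmeas_W2 m) (W2_ge0 m) _ e0) (wJE (W2_ge0 m) w0) -EFinM lee_fin.
  by rewrite mc exprVn c2 mulVf // gt_eqF.
pose F0 z := \sum_(1 <= k < n.+2) (bb k.-1 / k%:R) * z ^+ k.
have wF : wfin W2 F0 := wfin_poly (pmeas_W2 m) (W2_ge0 m) (wfin_monW m) (fun k => bb k.-1 / k%:R) 1 n.+2.
have eF : entire F0 by case: wF.
have VE z : volterra g f z - K f z = (a * (c^-1)%:C%C) * F0 z.
  rewrite (KE f If) big1 ?subr0; last by move=> j _; rewrite phif mul0r.
  rewrite (volterra_linear E ef) -mulrA; congr (_ * _).
  rewrite (segintZ _ z e0); congr (_ * _); rewrite /F0 big_add1 /=.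
  rewrite /f0; elim: n.+1 => [|N IH].
    rewrite big_geq // (@segint_ext R _ (fun w => 0 * w)); last by move=> w; rewrite big_geq // mul0r.
    by rewrite (segintZ 0 z (@entire_id R)) mul0r.
  rewrite big_nat_recr //= -IH.
  rewrite (@segint_ext R _ (fun w => \sum_(0 <= k < N) bb k * w ^+ k + bb N * w ^+ N)); last by move=> w; rewrite big_nat_recr.
  have es : entire (fun w : R[i] => \sum_(0 <= k < N) bb k * w ^+ k).
    by apply: (@entire_sum R _ _ _ (fun k w => bb k * w ^+ k)) => k; exact: (@entireZ R _ _ (@entireX R k)).
  rewrite (segintD z es (@entireZ R _ _ (@entireX R N))).
  by rewrite (segintZ _ z (@entireX R N)) segint_mon mulrA.
rewrite (eq_fock_int _ _ VE) fock2E (wIZ (pmeas_W2 m) (W2_ge0 m) _ eF) (wJE (W2_ge0 m) wF) -EFinM lee_fin.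
have -> : modc (a * (c^-1)%:C%C) ^+ 2 * wJ W2 F0 = modc a ^+ 2 * ((wJ W2 f0)^-1 * wJ W2 F0).
  by rewrite modcM mc exprMn exprVn c2 mulrA.
apply: ler_wpM2l; first exact: sqr_ge0.
rewrite ler_pdivlMl // mulrC J0.
rewrite (wJ_poly (pmeas_W2 m) (W2_ge0 m) (@W2_radial R m) (wfin_monW m)) big_add1 /= mulr_sumr.
apply: ler_sum_nat => k /andP[_ kn].
have -> : modc (bb k / k.+1%:R) ^+ 2 * wJ W2 (fun z => z ^+ k.+1) = modc (bb k) ^+ 2 * (Nm k.+1 / k.+1%:R ^+ 2).
  rewrite modcf_div modc_nat -/(Nm k.+1); field; by rewrite gt_eqF // ltr0n.
by rewrite mulrCA ler_wpM2l ?sqr_ge0 //; exact: hC.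
Qed.

(** The squared singular value before [fine]. As [fine] sends [+oo] to 0, finiteness, supplied by
    the upper bound, is required before a lower bound can be transferred. *)
Definition approx_inf (T : (R[i] -> R[i]) -> R[i] -> R[i]) n : \bar R :=
  ereal_inf [set (ereal_sup [set fock_int m 2 (fun z => T f z - K f z) |
                     f in [set f | in_fock m 2 f /\ fnorm m 2 f <= 1]])
    | K in [set K | rank_le m n K]].

Lemma sing_val_upper : exists2 C, 0 < C & forall g a b n, (forall z, g z = a * z + b) ->
  0 <= sq_sing_val m (volterra g) n <= modc a ^+ 2 * (C / n.+1%:R) /\
  (approx_inf (volterra g) n <= (modc a ^+ 2 * (C / n.+1%:R))%:E)%E.
Proof.
have [C C0 hC] := trunc_bound; exists C => // g a b n E.
rewrite -[sq_sing_val _ _ _]/(fine (approx_inf (volterra g) n)); set I := approx_inf _ _.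
have D0 : 0 <= modc a ^+ 2 * (C / n.+1%:R) by rewrite mulr_ge0 ?sqr_ge0 // divr_ge0 // ltW.
have Iup : (I <= (modc a ^+ 2 * (C / n.+1%:R))%:E)%E.
  apply: le_trans (ereal_inf_lbound _) _; first by exists (trunc a n) => //; exact: rank_trunc.
  apply: ub_ereal_sup => _ [f [hf nf] <-]; apply: le_trans (hC g a b n f E hf) _.
  rewrite lee_fin -[leRHS]mulr1 ler_wpM2l //.
  have := nf; rewrite fnorm_leP // powR1 (fock_fineK hf) lee_fin //.
have I0 : (0 <= I)%E.
  apply: le_ereal_inf_tmp => _ [K hK <-].
  apply: (@le_trans _ _ (fock_int m 2 (fun z => volterra g (fun=> 0) z - K (fun=> 0) z)%R)); first exact: fock_ge0.
  apply: ereal_sup_ubound; exists (fun=> 0) => //; split; first exact: in_fock0.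
  by rewrite fnorm_leP ?fock_int0 // ?lee_fin ?powR_ge0 //; exact: in_fock0.
split=> //; rewrite fine_ge0 //= -lee_fin fineK //.
by rewrite ge0_fin_numE //; apply: le_lt_trans Iup _; exact: ltry.
Qed.

Lemma sing_val_lower : exists2 C, 0 < C & forall g a b n, (forall z, g z = a * z + b) ->
  modc a ^+ 2 * (C / n.+1%:R) <= sq_sing_val m (volterra g) n.
Proof.
have [D D0 hD] := sing_val_upper; have [C C0 hC] := rank_lower; exists C => // g a b n E.
have [_] := hD g a b n E.
rewrite -[sq_sing_val _ _ _]/(fine (approx_inf (volterra g) n)); set I := approx_inf _ _ => Iup.
have Ilow : ((modc a ^+ 2 * (C / n.+1%:R))%:E <= I)%E.
  apply: le_ereal_inf_tmp => _ [K hK <-].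
  have [f [hf nf hl]] := hC g a b n K E hK; apply: le_trans hl _.
  by apply: ereal_sup_ubound; exists f.
have c0 : 0 <= modc a ^+ 2 * (C / n.+1%:R) by rewrite mulr_ge0 ?sqr_ge0 // divr_ge0 // ltW.
rewrite -lee_fin fineK // ge0_fin_numE; first by apply: le_lt_trans Iup _; exact: ltry.
by apply: le_trans Ilow; rewrite lee_fin.
Qed.

(** By the mean value theorem each term after the first is at most an increment of the primitive [F]
    of (1 + x)^(-s), and the increments telescope. *)
Lemma sum_powN s N : 1 < s -> \sum_(n < N) n.+1%:R `^ (- s) <= 1 + (s - 1)^-1 :> R.
Proof.
move=> s1; have t0 : 0 < s - 1 by lra.
have tn : s - 1 != 0 by rewrite gt_eqF.
pose F x : R := (1 + x) `^ (- (s - 1)) / (- (s - 1)).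
have dF x : 0 <= x -> is_derive x 1 F ((1 + x) `^ (- s)).
  by move=> x0; have := is_derive_pow1 tn x0; have -> : - (s - 1) - 1 = - s by ring.
have step k : k.+2%:R `^ (- s) <= F k.+1%:R - F k%:R.
  have kk : (k%:R : R) < k.+1%:R by rewrite ltr_nat.
  have dk x : x \in `]k%:R, k.+1%:R[ -> is_derive x 1 F ((1 + x) `^ (- s)).
    by rewrite in_itv /= => /andP[h _]; apply: dF; apply: le_trans (ltW h).
  have ck : {within `[k%:R, k.+1%:R], continuous F}.
    apply: derivable_within_continuous => x; rewrite in_itv /= => /andP[h _].
    by have [] := dF x (le_trans (ler0n R k) h).
  have [x] := MVT kk dk ck; rewrite in_itv /= => /andP[x1 x2] ->.
  have -> : k.+1%:R - k%:R = 1 :> R by rewrite -natr1; ring.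
  have x0 : 0 <= x by apply: le_trans (ltW x1).
  rewrite mulr1 !powRN lef_pV2 ?posrE ?powR_gt0 ?ltr0n //; last by lra.
  by apply: ler_pow; [lra|lra|rewrite -[k.+2%:R]natr1; lra].
have tel k : \sum_(n < k) n.+2%:R `^ (- s) <= F k%:R - F 0.
  elim: k => [|k IH]; first by rewrite big_ord0 subrr.
  by rewrite big_ord_recr /=; have := step k; lra.
case: N => [|N]; first by rewrite big_ord0 addr_ge0 // invr_ge0 ltW.
rewrite big_ord_recl /= powR1 lerD2l; apply: le_trans (tel N) _.
have -> : F 0 = - (s - 1)^-1 by rewrite /F addr0 powR1 mul1r invrN.
have : F N%:R <= 0 by rewrite /F mulr_ge0_le0 ?powR_ge0 // invr_le0; lra.
lra.
Qed.

Lemma nneseries_bounded (x : nat -> R) B : (forall n, 0 <= x n) ->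
  (forall N, \sum_(n < N) x n <= B) -> (\sum_(0 <= n <oo) (x n)%:E < +oo)%E.
Proof.
move=> x0 H; apply: (@le_lt_trans _ _ B%:E); last exact: ltry.
apply: lime_le; first by apply: is_cvg_nneseries => n _ _; rewrite lee_fin.
by apply: nearW => N; rewrite big_mkord sumEFin lee_fin.
Qed.

Lemma schatten_gt2 p g a b : entire g -> (forall z, g z = a * z + b) -> 2 < p ->
  schatten m p (volterra g).
Proof.
move=> hg E p2; split; first exact: (linear_compact m (ltr0n R 2) (lexx 2) hg E).
have [C C0 hC] := sing_val_upper; have s1 : 1 < p / 2 by lra.
pose D := modc a ^+ 2 * C; have D0 : 0 <= D by rewrite mulr_ge0 ?sqr_ge0 // ltW.
apply: (@nneseries_bounded _ (D `^ (p / 2) * (1 + (p / 2 - 1)^-1))).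
  by move=> n; exact: powR_ge0.
move=> N; apply: (@le_trans _ _ (\sum_(n < N) D `^ (p / 2) * n.+1%:R `^ (- (p / 2)))).
  apply: ler_sum => n _; have [/andP[h1 h2] _] := hC g a b n E.
  have i0 : 0 <= n.+1%:R^-1 :> R by rewrite invr_ge0.
  have -> : n.+1%:R `^ (- (p / 2)) = n.+1%:R^-1 `^ (p / 2) :> R.
    by rewrite -(@powR_inv1 R n.+1%:R (ler0n R _)) -powRrM mulN1r.
  rewrite -(powRM _ D0 i0); apply: ler_pow => //; first by lra.
  by rewrite /D -mulrA.
by rewrite -mulr_sumr ler_wpM2l ?powR_ge0 //; exact: sum_powN.
Qed.

(** Membership includes compactness, so [g] is linear; a nonzero slope would make the terms at least
    a multiple of (n + 1)^(-p/2), hence of 1/(n + 1). *)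
Lemma schatten_lt2 p g : entire g -> 0 < p -> p < 2 ->
  (schatten m p (volterra g) <-> exists c, forall z, g z = c).
Proof.
move=> hg p0 p2; have two : 0 < (2 : R) := ltr0n R 2; split=> [[hc hs]|[c E]]; last first.
  split; first exact: (constant_compact m two two hg E).
  have [C C0 hC] := sing_val_upper.
  (* A constant symbol is the slope-zero case of the upper bound, so every singular value is 0. *)
  have E' z : g z = 0 * z + c by rewrite mul0r add0r.
  apply: (@nneseries_bounded _ 0) => [n|N]; first exact: powR_ge0.
  rewrite big1 // => n _; have [/andP[h1 h2] _] := hC g 0 c n E'.
  rewrite modc0 expr0n mul0r in h2.
  have -> : sq_sing_val m (volterra g) n = 0 by apply/eqP; rewrite eq_le h1 h2.
  by rewrite powR0 // gt_eqF // divr_gt0.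
have [a [b E]] := compact_linear two two hg hc.
have [a0|a0] := eqVneq a 0; first by exists b => z; rewrite E a0 mul0r add0r.
have aP : 0 < modc a by rewrite modc_gt0.
have [C C0 hC] := sing_val_lower.
pose D := modc a ^+ 2 * C; have D0 : 0 < D by rewrite mulr_gt0 // exprn_gt0.
exfalso; set S := (\sum_(0 <= n <oo) _)%E in hs.
have part N : \sum_(n < N) n.+1%:R^-1 <= fine S / D `^ (p / 2).
  have Dp : 0 < D `^ (p / 2) by rewrite powR_gt0.
  rewrite ler_pdivlMr // mulr_suml -lee_fin fineK; last first.
    rewrite ge0_fin_numE //; apply: nneseries_ge0 => n _ _; rewrite lee_fin; exact: powR_ge0.
  apply: (@le_trans _ _ (\sum_(0 <= n < N) ((sq_sing_val m (volterra g) n) `^ (p / 2))%:E)%E); last first.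
    by apply: nneseries_lim_ge => n _ _; rewrite lee_fin powR_ge0.
  rewrite big_mkord sumEFin lee_fin; apply: ler_sum => n _.
  have n0 : 0 < n.+1%:R :> R by rewrite ltr0n.
  have i0 : 0 <= n.+1%:R^-1 :> R by rewrite invr_ge0.
  have h := hC g a b n E.
  apply: (@le_trans _ _ ((D * n.+1%:R^-1) `^ (p / 2))); last first.
    apply: ler_pow; first by rewrite divr_ge0 // ltW.
      by rewrite mulr_ge0 // ltW.
    by rewrite /D -mulrA.
  rewrite (powRM _ (ltW D0) i0) mulrC ler_wpM2l ?powR_ge0 //.
  have i1 : n.+1%:R^-1 <= 1 :> R by rewrite invf_le1 // ler1n.
  have ip : 0 < (n.+1%:R^-1 : R) by rewrite invr_gt0.
  (* The base 1/(n + 1) is at most 1 and the exponent [p / 2] is below 1, so the power is at least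
     1/(n + 1) itself. *)
  rewrite -[leLHS](powRr1 i0); apply: (@ger_powR R n.+1%:R^-1); first by rewrite ip.
  lra.
have [N] := harmonic_unbounded (fine S / D `^ (p / 2)).
by rewrite ltNge part.
Qed.

End SingularValues.

Theorem theorem1 (R : realType) (m : nat) (g : R[i] -> R[i]) (Hg : entire g) :
  (* (1) 0 < p <= q < oo *)
  (forall p q : R, 0 < p -> p <= q ->
     (bounded_op m p q (volterra g) <->
        exists a b c : R[i], forall z, g z = a * z ^+ 2 + b * z + c) /\
     (compact_op m p q (volterra g) <->
        exists a b : R[i], forall z, g z = a * z + b)) /\
  (* (2) 0 < q < p < oo *)
  (forall p q : R, 0 < q -> q < p ->
     (bounded_op m p q (volterra g) <-> compact_op m p q (volterra g)) /\
     ((p - q) / p < q / 2 ->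
        (compact_op m p q (volterra g) <->
           exists a b : R[i], forall z, g z = a * z + b)) /\
     (q / 2 <= (p - q) / p ->
        (compact_op m p q (volterra g) <->
           exists c : R[i], forall z, g z = c))) /\
  (* (3) Schatten classes on F^2 *)
  (compact_op m 2 2 (volterra g) ->
     forall p : R, 2 < p -> schatten m p (volterra g)) /\
  (forall p : R, 0 < p -> p < 2 ->
     (schatten m p (volterra g) <-> exists c : R[i], forall z, g z = c)).
Proof.
have two : 0 < (2 : R) := ltr0n R 2.
split; first by move=> p q p0 pq; exact: characterization_le.
split; first by move=> p q q0 qp; exact: characterization_lt.
split.
- move=> hc p p2; have [a [b E]] := compact_linear two two Hg hc; exact: (@schatten_gt2 R m p g a b Hg E p2).
- by move=> p p0 p2; exact: schatten_lt2.
Qed.
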